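(* Let $n\ge 1$, $d\ge 1$ be integers, let $r>0$, and let $M\subset\mathbb{R}^d$ be a closed connected smooth $n$-dimensional submanifold contained in a closed ball of radius $r$ in $\mathbb{R}^d$. Suppose that all normal curvatures of $M$ are at most $\tfrac{2}{\sqrt{3}}\cdot\tfrac{1}{r}$. If $M$ is not homeomorphic to a sphere, then, up to rescaling, $M$ is congruent to the image of a Veronese embedding into $\mathbb{R}^d$ of one of the projective planes $\mathbb{R}\mathrm{P}^2$, $\mathbb{C}\mathrm{P}^2$, $\mathbb{H}\mathrm{P}^2$, or $\mathbb{O}\mathrm{P}^2$.
   Context: A closed submanifold means a compact embedded submanifold without boundary, with the Riemannian metric induced from $\mathbb{R}^d$. The normal curvatures of $M$ are the numbers $|\mathrm{II}_p(u,u)|$, where $p\in M$, $u\in T_pM$ is a unit vector, and $\mathrm{II}$ is the second fundamental form of $M\subset\mathbb{R}^d$ (with values in the normal space). Equivalently, they are the curvatures, as curves in $\mathbb{R}^d$, of unit-speed geodesics of $M$. Veronese embeddings of projective planes. Let $\mathbb{F}$ be $\mathbb{R}$, $\mathbb{C}$, $\mathbb{H}$ or $\mathbb{O}$ (reals, complex numbers, quaternions, octonions), and let $k=\dim_{\mathbb{R}}\mathbb{F}\in\{1,2,4,8\}$. The projective plane $\mathbb{F}\mathrm{P}^2$ carries its canonical metric, normalized so that its closed geodesics have length $\pi$. The Veronese embedding is a smooth isometric embedding $\mathbb{F}\mathrm{P}^2\hookrightarrow\mathbb{R}^d$, $d\ge 2+3k$ (that is, $d\ge 5,8,14,26$ respectively),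 that maps each geodesic to a round circle; all normal curvatures of its image equal $2$, and its image lies on a sphere of radius $1/\sqrt{3}$. Explicitly, it can be described as follows. Let $\mathcal{H}_3(\mathbb{F})$ be the real vector space of $3\times 3$ Hermitian matrices over $\mathbb{F}$ with the Euclidean norm $|A|^2=\tfrac12\operatorname{tr}(A^2)=\tfrac12\sum_{i,j}|a_{ij}|^2$. Identify $\mathbb{F}\mathrm{P}^2$ with $\{P\in\mathcal{H}_3(\mathbb{F}) : P^2=P,\ \operatorname{tr}P=1\}$ (for $\mathbb{F}=\mathbb{R},\mathbb{C},\mathbb{H}$, a line in $\mathbb{F}^3$ corresponds to the orthogonal projection onto it; for $\mathbb{F}=\mathbb{O}$ this set is the octonionic projective plane). The Veronese embedding is the inclusion of this set into the affine subspace $\{A\in\mathcal{H}_3(\mathbb{F}):\operatorname{tr}A=1\}$, which is isometric to $\mathbb{R}^{2+3k}$, followed by an isometric affine embedding $\mathbb{R}^{2+3k}\hookrightarrow\mathbb{R}^d$. ''Congruent up to rescaling'' means that some similarity of $\mathbb{R}^d$ (composition of a homothety and an isometry) maps $M$ onto the image of the embedding; in particular the conclusion includes that $d\ge 2+3k$ for the corresponding $\mathbb{F}$. *)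

(* Defs.v *)
From HB Require Import structures.
From mathcomp Require Import all_boot all_order all_algebra.
From mathcomp Require Import complex.
From mathcomp Require Import all_classical all_reals all_analysis.
Import Order.TTheory GRing.Theory Num.Theory.
Import numFieldNormedType.Exports.

Set Implicit Arguments.
Unset Strict Implicit.
Unset Printing Implicit Defensive.

Local Open Scope classical_set_scope.
Local Open Scope ring_scope.

(* The library norm on 'rV[R]_d is the sup norm.  It induces the usual topology
   and the usual notion of derivative, but all metric quantities below use the
   Euclidean norm enorm. *)
Definition dotp (R : realType) (d : nat) (u v : 'rV[R]_d) : R :=
  \sum_(i < d) u 0 i * v 0 i.

Definition enorm (R : realType) (d : nat) (u : 'rV[R]_d) : R :=
  Num.sqrt (dotp u u).

Definition sphere (R : realType) (n : nat) : set 'rV[R]_n.+1 :=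
  [set x | enorm x = 1].
Arguments sphere : clear implicits.

Definition homeomorphism_on (T S : topologicalType) (A : set T) (B : set S)
    (f : T -> S) : Prop :=
  [/\ set_bij A B f, {within A, continuous f} &
      exists2 g : S -> T, {within B, continuous g}
                        & forall x, A x -> g (f x) = x].

Definition homeomorphic (T S : topologicalType) (A : set T) (B : set S) : Prop :=
  exists f : T -> S, homeomorphism_on A B f.

(* C^infinity on an open set U: every iterated directional derivative is
   differentiable (hence continuous) at every point of U. *)
Definition smooth_on (R : realType) (n d : nat) (U : set 'rV[R]_n)
    (f : 'rV[R]_n -> 'rV[R]_d) : Prop :=
  forall (vs : seq 'rV[R]_n) (x : 'rV[R]_n), U x ->
    differentiable (foldr (fun v g => 'D_v g) f vs) x.

(* phi : U -> M `&` W is a smooth parametrization of the part of M lying in the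
   open set W; the values of phi outside U are irrelevant. *)
Definition local_parametrization (R : realType) (n d : nat) (M : set 'rV[R]_d)
    (W : set 'rV[R]_d) (U : set 'rV[R]_n) (phi : 'rV[R]_n -> 'rV[R]_d) : Prop :=
  [/\ open W, open U, smooth_on U phi,
      forall x, U x -> injective ('d phi x) &
      homeomorphism_on U (M `&` W) phi].

Definition embedded_submanifold (R : realType) (n d : nat)
    (M : set 'rV[R]_d) : Prop :=
  forall p, M p -> exists W (U : set 'rV[R]_n) phi,
    local_parametrization M W U phi /\ W p.

Definition closed_submanifold (R : realType) (n d : nat)
    (M : set 'rV[R]_d) : Prop :=
  embedded_submanifold n M /\ compact M.

Definition tangent_space (R : realType) (n d : nat) (M : set 'rV[R]_d)
    (p : 'rV[R]_d) : set 'rV[R]_d :=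
  [set u | exists W (U : set 'rV[R]_n) phi x a,
     [/\ local_parametrization M W U phi, U x, phi x = p & u = 'd phi x a]].

(* w is the component of a orthogonal to the linear subspace T. *)
Definition normal_component (R : realType) (d : nat) (T : set 'rV[R]_d)
    (a w : 'rV[R]_d) : Prop :=
  T (a - w) /\ forall t, T t -> dotp w t = 0.

(* The relation II_p(u, v) = w: in a local parametrization phi at p, with
   u = dphi(a) and v = dphi(b), the vector b is extended to the constant
   coordinate field, so that y |-> 'D_b phi y is a tangent field along M
   extending v, and II_p(u, v) is the normal component of its derivative in the
   direction u.  The result does not depend on the parametrization. *)
Definition second_fundamental_form (R : realType) (n d : nat)
    (M : set 'rV[R]_d) (p u v w : 'rV[R]_d) : Prop :=
  exists W (U : set 'rV[R]_n) phi x a b,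
    [/\ local_parametrization M W U phi, U x /\ phi x = p,
        'd phi x a = u, 'd phi x b = v &
        normal_component (tangent_space n M p) ('D_a ('D_b phi) x) w].

Definition normal_curvatures (R : realType) (n d : nat)
    (M : set 'rV[R]_d) : set R :=
  [set k | exists p u w, [/\ M p, tangent_space n M p u, enorm u = 1,
     second_fundamental_form n M p u u w & k = enorm w]].

(* A real algebra with conjugation and real part; only the data are recorded,
   since the multiplication of the octonions is not even associative. *)
Record conj_algebra (R : realType) := ConjAlgebra {
  carrier :> lmodType R;
  cone : carrier;
  cmul : carrier -> carrier -> carrier;
  cconj : carrier -> carrier;
  cre : carrier -> R }.

Definition cayley_dickson (R : realType) (F : conj_algebra R) : conj_algebra R :=
  @ConjAlgebra R (F * F)%type
    (cone F, 0)
    (fun x y => (cmul x.1 y.1 - cmul (cconj y.2) x.2,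
                 cmul y.2 x.1 + cmul x.2 (cconj y.1)))
    (fun x => (cconj x.1, - x.2))
    (fun x => cre x.1).

Definition real_algebra (R : realType) : conj_algebra R :=
  @ConjAlgebra R R^o 1 *%R id id.

(* Rcomplex R is R[i] with its structure of module over R. *)
Definition complex_algebra (R : realType) : conj_algebra R :=
  @ConjAlgebra R (Rcomplex R) 1 *%R (@conjc R) (@complex.Re R).

Definition quaternion_algebra (R : realType) : conj_algebra R :=
  cayley_dickson (complex_algebra R).

Definition octonion_algebra (R : realType) : conj_algebra R :=
  cayley_dickson (quaternion_algebra R).

Definition abs2 (R : realType) (F : conj_algebra R) (x : F) : R :=
  cre (cmul (cconj x) x).

Definition hermitian3 (R : realType) (F : conj_algebra R) : set 'M[F]_3 :=
  [set A | forall i j, A i j = cconj (A j i)].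

Definition ctrace (R : realType) (F : conj_algebra R) (A : 'M[F]_3) : F :=
  \sum_i A i i.

Definition cmulmx (R : realType) (F : conj_algebra R) (A B : 'M[F]_3) :
    'M[F]_3 :=
  \matrix_(i, j) \sum_k cmul (A i k) (B k j).

Definition hnorm (R : realType) (F : conj_algebra R) (A : 'M[F]_3) : R :=
  Num.sqrt (2^-1 * \sum_i \sum_j abs2 (A i j)).

Definition trace_one (R : realType) (F : conj_algebra R) : set 'M[F]_3 :=
  [set A | hermitian3 A /\ ctrace A = cone F].

Definition projective_plane (R : realType) (F : conj_algebra R) : set 'M[F]_3 :=
  [set P | [/\ hermitian3 P, cmulmx P P = P & ctrace P = cone F]].
Arguments projective_plane {R} F _.

(* f restricts to an isometric affine embedding of the affine space trace_one F
   into R^d; its values elsewhere are irrelevant. *)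
Definition isometric_affine (R : realType) (F : conj_algebra R) (d : nat)
    (f : 'M[F]_3 -> 'rV[R]_d) : Prop :=
  (forall A B (t : R), trace_one A -> trace_one B ->
     f (\matrix_(i, j) ((1 - t) *: A i j + t *: B i j))
       = (1 - t) *: f A + t *: f B) /\
  (forall A B, trace_one A -> trace_one B -> enorm (f A - f B) = hnorm (A - B)).

Definition veronese_image (R : realType) (F : conj_algebra R) (d : nat)
    (V : set 'rV[R]_d) : Prop :=
  exists2 f : 'M[F]_3 -> 'rV[R]_d,
    isometric_affine f & V = f @` projective_plane F.

Definition isometry (R : realType) (d : nat) (g : 'rV[R]_d -> 'rV[R]_d) : Prop :=
  forall x y, enorm (g x - g y) = enorm (x - y).

Definition homothety (R : realType) (d : nat) (a : 'rV[R]_d) (c : R)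
    (x : 'rV[R]_d) : 'rV[R]_d := a + c *: (x - a).

Definition similarity (R : realType) (d : nat)
    (s : 'rV[R]_d -> 'rV[R]_d) : Prop :=
  exists a c g, [/\ 0 < c, isometry g & s = g \o homothety a c].

Definition congruent_to_veronese (R : realType) (F : conj_algebra R) (d : nat)
    (M : set 'rV[R]_d) : Prop :=
  exists s V, [/\ similarity s, veronese_image F V & s @` M = V].

(* Main.v *)
(* After a similarity, M lies in the ball of radius 1/sqrt 3 around 0 and has normal curvatures
   at most 2.  For x, p in M put s = |x - p| and let T and nu be the tangential and normal parts
   of x - p at x.  The derivative of |nu|^2 in the direction T is -2 <nu, II(T, T)>, so
   |nu| - l s^2 is monotone along T for every l > 1.  A continuity argument starting at the
   diagonal shows T <> 0 and |nu| <= s^2 on the component of the diagonal in {s < 1} (x <> p).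
   Hence the slices Om p of this component can be pushed into coordinate balls, and if two of
   them cover M, then M is a union of two cells, so it is a sphere by Brown's argument.  In
   dimension one the same conclusion always holds, by merging arcs.

   If M is not a sphere, every p has a contact point q: a limit of points of Om p at distance 1
   from p.  The ball condition then forces -p - q in M and |p|^2 = 1/3, and the case of equality
   in the monotonicity gives |nu| = s^2.  It follows that
   Om x = {x + (w + B(w, w)) / (1 + |w|^2) : w in T_x}, where 2 B is the second fundamental form
   and |B(w, w)| = |w|^2, and that Om x is dense in M.  For a contact pair x, q and s = -x - q,
   the tangent space T_x is the orthogonal sum of {u : B(u, u) = |u|^2 (q - x)} and
   {u : B(u, u) = |u|^2 (s - x)}, on whose product 2 B is a composition of quadratic forms.  By
   Hurwitz' theorem it is the multiplication of R, C, H or O, and the parametrization of M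
   becomes psi |-> psi psi^*. *)
Require Import Defs.
From HB Require Import structures.
From mathcomp Require Import all_boot all_order all_algebra complex.
From mathcomp Require Import all_classical all_reals all_analysis.
From mathcomp Require Import ring lra.
Import Order.TTheory GRing.Theory Num.Theory.
Import numFieldNormedType.Exports.
Set Implicit Arguments.
Unset Strict Implicit.
Unset Printing Implicit Defensive.
Local Open Scope classical_set_scope.
Local Open Scope ring_scope.

(** * Euclidean geometry *)

(** The constants come from one picture. Curvature at most 2 is compared with circles of radius 1/2,
    whose diameter 1 is the side of the equilateral triangle inscribed in a circle of radius 1/sqrt
    3. So 1 is exactly the distance at which |nu| <= s^2 stops excluding T = 0, and three points of
    the ball at mutual distances at least 1 must be such a triangle centred at 0. The comparison is
    global in nature: two points may be close in space without being joined to the diagonal by close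
    pairs, and for such pairs nothing can be said. Hence slices are defined by connectedness of
    close pairs. The third vertex of a triangle is found indirectly: if no point of M were far from
    both p and a contact point q, two slices would cover M. Integration along curves is replaced by
    extremal arguments, in which a first-order move in a chart would improve an extremum on a
    compact set, and isotopies by finite compositions of explicit homeomorphisms supported in
    charts. The factor l > 1 that appears throughout only serves to make these moves strict and is
    finally sent to 1. *)

Section Dot.
Context {R : realType} {d : nat}.
Implicit Types (u v w : 'rV[R]_d) (a : R).

Lemma dotpE u v : dotp u v = (u *m v^T) 0 0.
Proof. by rewrite /dotp !mxE; apply: eq_bigr => i _; rewrite !mxE. Qed.

Lemma dotpC u v : dotp u v = dotp v u.
Proof. by apply: eq_bigr => i _; rewrite mulrC. Qed.

Lemma dotpDl u v w : dotp (u + v) w = dotp u w + dotp v w.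
Proof. by rewrite !dotpE mulmxDl mxE. Qed.

Lemma dotpDr u v w : dotp w (u + v) = dotp w u + dotp w v.
Proof. by rewrite !(dotpC w) dotpDl. Qed.

Lemma dotpZl a u v : dotp (a *: u) v = a * dotp u v.
Proof. by rewrite !dotpE -scalemxAl mxE. Qed.

Lemma dotpZr a u v : dotp u (a *: v) = a * dotp u v.
Proof. by rewrite !(dotpC u) dotpZl. Qed.

Lemma dotpNl u v : dotp (- u) v = - dotp u v.
Proof. by rewrite -scaleN1r dotpZl mulN1r. Qed.

Lemma dotpNr u v : dotp u (- v) = - dotp u v.
Proof. by rewrite !(dotpC u) dotpNl. Qed.

Lemma dotpBl u v w : dotp (u - v) w = dotp u w - dotp v w.
Proof. by rewrite dotpDl dotpNl. Qed.

Lemma dotpBr u v w : dotp w (u - v) = dotp w u - dotp w v.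
Proof. by rewrite dotpDr dotpNr. Qed.

Lemma dotp0l u : dotp 0 u = 0.
Proof. by rewrite dotpE mul0mx mxE. Qed.

Lemma dotp0r u : dotp u 0 = 0.
Proof. by rewrite dotpC dotp0l. Qed.

Lemma dotp_ge0 u : 0 <= dotp u u.
Proof. by apply: sumr_ge0 => i _; rewrite -expr2 sqr_ge0. Qed.

Lemma dotp_eq0 u : (dotp u u == 0) = (u == 0).
Proof.
apply/eqP/eqP => [u0|->]; last exact: dotp0l.
apply/rowP => i; rewrite mxE.
move/eqP: u0; rewrite psumr_eq0 => [/allP /(_ i)|j _]; last by rewrite -expr2 sqr_ge0.
by rewrite mem_index_enum => /(_ isT) /=; rewrite -expr2 sqrf_eq0 => /eqP.
Qed.

Lemma dotp_gt0 u : (0 < dotp u u) = (u != 0).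
Proof. by rewrite lt_def dotp_eq0 dotp_ge0 andbT. Qed.

Lemma dotp_inj u v : (forall w, dotp u w = dotp v w) -> u = v.
Proof.
move=> h; apply/eqP; rewrite -subr_eq0 -dotp_eq0 dotpBl.
by rewrite h subrr.
Qed.

Lemma enorm_sqr u : enorm u ^+ 2 = dotp u u.
Proof. by rewrite sqr_sqrtr // dotp_ge0. Qed.

Lemma enorm_ge0 u : 0 <= enorm u. Proof. exact: sqrtr_ge0. Qed.

Lemma enorm_eq0 u : (enorm u == 0) = (u == 0).
Proof. by rewrite -sqrf_eq0 enorm_sqr dotp_eq0. Qed.

Lemma enorm_gt0 u : (0 < enorm u) = (u != 0).
Proof. by rewrite lt_def enorm_eq0 enorm_ge0 andbT. Qed.

Lemma enorm0 : enorm (0 : 'rV[R]_d) = 0.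
Proof. by apply/eqP; rewrite enorm_eq0. Qed.

Lemma enormZ a u : enorm (a *: u) = `|a| * enorm u.
Proof.
by rewrite /enorm dotpZl dotpZr mulrA -expr2 sqrtrM ?sqr_ge0 // sqrtr_sqr.
Qed.

Lemma enormN u : enorm (- u) = enorm u.
Proof. by rewrite /enorm dotpNl dotpNr opprK. Qed.

Lemma enormB u v : enorm (u - v) = enorm (v - u).
Proof. by rewrite -enormN opprB. Qed.

Lemma enorm_le a u : 0 <= a -> (enorm u <= a) = (dotp u u <= a ^+ 2).
Proof. by move=> a0; rewrite -enorm_sqr ler_sqr ?nnegrE ?enorm_ge0. Qed.

Lemma enorm_lt a u : 0 <= a -> (enorm u < a) = (dotp u u < a ^+ 2).
Proof. by move=> a0; rewrite -enorm_sqr ltr_sqr ?nnegrE ?enorm_ge0. Qed.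

Lemma cauchy_sqr u v : dotp u v ^+ 2 <= dotp u u * dotp v v.
Proof.
have [->|v0] := eqVneq v 0; first by rewrite !dotp0r mulr0 expr0n.
have vv : 0 < dotp v v by rewrite dotp_gt0.
have := dotp_ge0 (dotp v v *: u - dotp u v *: v).
rewrite dotpBl !dotpBr !dotpZl !dotpZr (dotpC v u) => h.
rewrite -subr_ge0 -(pmulr_rge0 _ vv); move: h; congr (0 <= _); ring.
Qed.

Lemma cauchy u v : `|dotp u v| <= enorm u * enorm v.
Proof.
rewrite -ler_sqr ?nnegrE ?mulr_ge0 ?enorm_ge0 // exprMn !enorm_sqr.
by rewrite real_normK ?num_real // cauchy_sqr.
Qed.

Lemma cauchy_le u v : dotp u v <= enorm u * enorm v.
Proof. exact: le_trans (ler_norm _) (cauchy _ _). Qed.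

Lemma enormD u v : enorm (u + v) <= enorm u + enorm v.
Proof.
rewrite enorm_le ?addr_ge0 ?enorm_ge0 //.
rewrite dotpDl !dotpDr (dotpC v u) sqrrD !enorm_sqr.
have := cauchy_le u v; lra.
Qed.

Lemma enormBD u v w : enorm (u - w) <= enorm (u - v) + enorm (v - w).
Proof. by rewrite (le_trans _ (enormD _ _)) // addrA subrK. Qed.

(** The two bounds make |u - v|^2 nonpositive. This equality case of Cauchy-Schwarz turns sharp
    scalar estimates into vector identities, as in [acc_rigid] and [VVP]. *)
Lemma cauchy_eq u v : dotp u u <= dotp v v -> dotp v v <= dotp u v -> u = v.
Proof.
move=> uv vu; apply/eqP; rewrite -subr_eq0 -dotp_eq0; apply/eqP/le_anti.
rewrite dotp_ge0 andbT dotpBl !dotpBr (dotpC v u); lra.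
Qed.

Lemma mx_norm_coord u i : `|u 0 i| <= `|u|.
Proof.
rewrite /Num.norm /= mx_normrE; apply: le_trans (le_bigmax _ _ (0, i)) => //=.
Qed.

Lemma enorm_coord u i : `|u 0 i| <= enorm u.
Proof.
rewrite -ler_sqr ?nnegrE ?enorm_ge0 // enorm_sqr real_normK ?num_real //.
rewrite /dotp (bigD1 i) //= -expr2 lerDl; apply: sumr_ge0 => j _.
by rewrite -expr2 sqr_ge0.
Qed.

Lemma le_norm_enorm u : `|u| <= enorm u.
Proof.
rewrite /Num.norm /= mx_normrE; apply/bigmax_leP; split=> [|[i j] _ /=].
  exact: enorm_ge0.
by rewrite ord1; exact: enorm_coord.
Qed.

Lemma le_enorm_norm u : enorm u <= d%:R * `|u|.
Proof.
rewrite enorm_le ?mulr_ge0 //.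
rewrite exprMn -natrX; apply: (@le_trans _ _ (\sum_(i < d) `|u| ^+ 2)).
  apply: ler_sum => i _; rewrite -expr2 -real_normK ?num_real //.
  by rewrite ler_sqr ?nnegrE // mx_norm_coord.
rewrite sumr_const card_ord -[leLHS]mulr_natl; apply: ler_wpM2r; rewrite ?sqr_ge0 // ler_nat.
by rewrite expnS expn1; case: (d) => // k; rewrite leq_pmulr.
Qed.

Lemma enorm_lipschitz : exists2 C : R, 0 < C & forall u, enorm u <= C * `|u|.
Proof.
exists (d%:R + 1); first by rewrite ltr_wpDl.
by move=> u; rewrite (le_trans (le_enorm_norm u)) // ler_wpM2r // lerDl.
Qed.

End Dot.

(** * Continuity and connectedness *)

(** If [P K] fails, the sets whose complement in K satisfies P form a proper filter containing K,
    and a cluster point in K contradicts the local hypothesis. It replaces the handling of finite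
    subcovers. *)
Lemma compact_ind (T : topologicalType) (K : set T) (P : set T -> Prop) :
    compact K -> P set0 -> (forall A B, P A -> P B -> P (A `|` B)) ->
    (forall A B, A `<=` B -> P B -> P A) ->
    (forall x, K x -> exists2 U, nbhs x U & P (K `&` U)) ->
  P K.
Proof.
move=> cK P0 PU PS Ploc; apply: contrapT => nP.
pose F : set_system T := [set A | P (K `\` A)].
have FF : ProperFilter F.
  apply: Build_ProperFilter_ex => [A FA|].
    apply: contrapT => nA; apply: nP; apply: PS FA => x Kx; split=> // Ax.
    by apply: nA; exists x.
  split=> [|A B FA FB|A B AB FA]; rewrite /F /=.
  - by rewrite setDT.
  - by rewrite setDIr; apply: PU.
  - by apply: PS FA => x [Kx nB]; split=> // /AB.
have FK : F K by rewrite /F /= setDv.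
have [x [Kx clx]] := cK F FF FK.
have [U xU PKU] := Ploc x Kx.
have [|y [nUy Uy]] := clx (~` U) U _ xU; last by [].
by apply: PS PKU => y [Ky nnU]; split=> //; apply: contrapT.
Qed.

Section EpsilonDelta.
Context {R : realType}.
Implicit Types V W : normedModType R.

(** Equivalent to [{within A, continuous f}] by [cont_onP]. Both compared points lie in A, so
    charts, their inverses and maps of M are treated alike. *)
Definition cont_on V W (A : set V) (f : V -> W) : Prop :=
  forall x, A x -> forall e, 0 < e ->
    exists2 r, 0 < r & forall y, A y -> `|x - y| < r -> `|f x - f y| < e.

Lemma nbhsP V (x : V) (U : set V) :
  nbhs x U <-> exists2 r : R, 0 < r & forall y, `|x - y| < r -> U y.
Proof.
split=> [/nbhs_ballP[r /= r0 xr]|[r r0 xr]].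
  by exists r => // y xy; apply: xr; rewrite -ball_normE.
by apply/nbhs_ballP; exists r => //= y; rewrite -ball_normE; apply: xr.
Qed.

Lemma openE V (U : set V) :
  open U <-> forall x, U x -> exists2 r : R, 0 < r & forall y, `|x - y| < r -> U y.
Proof.
rewrite openE; split=> [h x Ux|h x Ux]; first exact/nbhsP/h.
exact/nbhsP/h.
Qed.

Lemma closureP V (A : set V) (x : V) :
  closure A x <-> forall e : R, 0 < e -> exists2 y, A y & `|x - y| < e.
Proof.
split=> [clx e e0|h U /nbhsP[r r0 xr]].
  have [|y [Ay xy]] := clx [set y | `|x - y| < e]; last by exists y.
  by apply/nbhsP; exists e.
by have [y Ay xy] := h _ r0; exists y; split=> //; exact: xr.
Qed.

Lemma closedP V (A : set V) : closed A <->
  forall x, (forall e : R, 0 < e -> exists2 y, A y & `|x - y| < e) -> A x.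
Proof.
split=> [cA x h|h x /closureP]; first exact/cA/closureP.
exact: h.
Qed.

Lemma not_closed_dist V (A : set V) (x : V) : closed A -> ~ A x ->
  exists2 r : R, 0 < r & forall y, A y -> r <= `|x - y|.
Proof.
move=> /closedP cA nAx; apply: contrapT => h; apply: nAx; apply: cA => e e0.
apply: contrapT => h'; apply: h; exists e => // y Ay; rewrite leNgt.
by apply/negP => xy; apply: h'; exists y.
Qed.

Lemma cont_onP V W (A : set V) (f : V -> W) :
  cont_on A f <-> {within A, continuous f}.
Proof.
rewrite subspace_continuousP; split=> h x Ax.
  apply/cvgrPdist_lt => e e0; have [r r0 xr] := h x Ax e e0.
  by apply/nbhsP; exists r => // y xy Ay; apply: xr.
move=> e e0; move: (h x Ax) => /cvgrPdist_lt /(_ e e0) /nbhsP[r r0 xr].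
by exists r => // y Ay xy; apply: xr.
Qed.

Lemma continuous_cont_on V W (A : set V) (f : V -> W) :
  continuous f -> cont_on A f.
Proof. by move=> cf; apply/cont_onP; apply: continuous_subspaceT. Qed.

Lemma cont_onS V W (A B : set V) (f : V -> W) :
  B `<=` A -> cont_on A f -> cont_on B f.
Proof.
move=> BA cf x Bx e e0; have [r r0 xr] := cf x (BA x Bx) e e0.
by exists r => // y By xy; apply: xr => //; apply: BA.
Qed.

Lemma cont_on_ext V W (A : set V) (f g : V -> W) :
  (forall x, A x -> f x = g x) -> cont_on A f -> cont_on A g.
Proof.
move=> fg cf x Ax e e0; have [r r0 xr] := cf x Ax e e0.
by exists r => // y Ay xy; rewrite -!fg //; apply: xr.
Qed.

Lemma cont_on_comp V W (Z : normedModType R) (A : set V) (B : set W)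
    (f : V -> W) (g : W -> Z) :
  (forall x, A x -> B (f x)) -> cont_on A f -> cont_on B g -> cont_on A (g \o f).
Proof.
move=> AB cf cg x Ax e e0; have [r r0 fr] := cg _ (AB x Ax) e e0.
have [q q0 xq] := cf x Ax r r0; exists q => // y Ay xy.
by apply: fr; [exact: AB|exact: xq].
Qed.

Lemma cont_onD V W (A : set V) (f g : V -> W) :
  cont_on A f -> cont_on A g -> cont_on A (fun x => f x + g x).
Proof.
move=> /cont_onP cf /cont_onP cg; apply/cont_onP => x.
by apply: continuousD; [exact: cf|exact: cg].
Qed.

Lemma cont_onN V W (A : set V) (f : V -> W) :
  cont_on A f -> cont_on A (fun x => - f x).
Proof. by move=> /cont_onP cf; apply/cont_onP => x; apply: continuousN; exact: cf. Qed.

Lemma cont_onB V W (A : set V) (f g : V -> W) :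
  cont_on A f -> cont_on A g -> cont_on A (fun x => f x - g x).
Proof. by move=> cf cg; apply: cont_onD => //; apply: cont_onN. Qed.

Lemma cont_onZ V W (A : set V) (k : V -> R) (f : V -> W) :
  cont_on A k -> cont_on A f -> cont_on A (fun x => k x *: f x).
Proof.
move=> /cont_onP ck /cont_onP cf; apply/cont_onP => x.
by apply: continuousZ; [exact: ck|exact: cf].
Qed.

Lemma cont_onM V (A : set V) (k f : V -> R) :
  cont_on A k -> cont_on A f -> cont_on A (fun x => k x * f x).
Proof.
move=> /cont_onP ck /cont_onP cf; apply/cont_onP => x.
by apply: continuousM; [exact: ck|exact: cf].
Qed.

Lemma cont_onV V (A : set V) (k : V -> R) :
  (forall x, A x -> k x != 0) -> cont_on A k -> cont_on A (fun x => (k x)^-1).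
Proof.
move=> k0 ck; apply/cont_onP/subspace_continuousP => x Ax.
apply: cvgV; first exact: k0.
by move/cont_onP/subspace_continuousP: ck => /(_ x Ax).
Qed.

Lemma cont_on_cst V W (A : set V) (w : W) : cont_on A (fun=> w).
Proof. by move=> x _ e e0; exists 1 => // y _ _; rewrite subrr normr0. Qed.

Lemma cont_on_id V (A : set V) : cont_on A id.
Proof. by move=> x _ e e0; exists e. Qed.

Lemma cont_on_norm V W (A : set V) (f : V -> W) :
  cont_on A f -> cont_on A (fun x => `|f x|).
Proof.
move=> cf x Ax e e0; have [r r0 xr] := cf x Ax e e0.
by exists r => // y Ay xy; apply: le_lt_trans (ler_dist_dist _ _) _; exact: xr.
Qed.

Lemma cont_on_min V (A : set V) (f g : V -> R) :
  cont_on A f -> cont_on A g -> cont_on A (fun x => Num.min (f x) (g x)).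
Proof.
move=> /cont_onP cf /cont_onP cg; apply/cont_onP => x.
by apply: continuous_min; [exact: cf|exact: cg].
Qed.

Lemma cont_on_max V (A : set V) (f g : V -> R) :
  cont_on A f -> cont_on A g -> cont_on A (fun x => Num.max (f x) (g x)).
Proof.
move=> /cont_onP cf /cont_onP cg; apply/cont_onP => x.
by apply: continuous_max; [exact: cf|exact: cg].
Qed.

Lemma cont_on_pair V W (Z : normedModType R) (A : set V) (f : V -> W) (g : V -> Z) :
  cont_on A f -> cont_on A g -> cont_on A (fun x => (f x, g x)).
Proof.
move=> cf cg x Ax e e0; have [r r0 xr] := cf x Ax e e0.
have [q q0 xq] := cg x Ax e e0; exists (Num.min r q); first by rewrite lt_min r0.
by move=> y Ay; rewrite lt_min prod_normE /= gt_max => /andP[? ?]; rewrite xr ?xq.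
Qed.

Lemma cont_on_fst V W (A : set (V * W)%type) : cont_on A fst.
Proof.
move=> x _ e e0; exists e => // y _.
by rewrite prod_normE /= gt_max => /andP[].
Qed.

Lemma cont_on_snd V W (A : set (V * W)%type) : cont_on A snd.
Proof.
move=> x _ e e0; exists e => // y _.
by rewrite prod_normE /= gt_max => /andP[].
Qed.

Lemma compact_max V (A : set V) (f : V -> R) : compact A -> A !=set0 -> cont_on A f ->
  exists2 x, A x & forall y, A y -> f y <= f x.
Proof.
move=> cA A0 /cont_onP cf; have [x xA xmax] := compact_EVT_max A0 cA cf.
by exists x; [rewrite inE in xA|move=> y Ay; apply: xmax; rewrite inE].
Qed.

Lemma compact_min V (A : set V) (f : V -> R) : compact A -> A !=set0 -> cont_on A f ->
  exists2 x, A x & forall y, A y -> f x <= f y.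
Proof.
move=> cA A0 cf; have [x Ax h] := compact_max cA A0 (cont_onN cf).
by exists x => // y /h; rewrite lerN2.
Qed.

Lemma compact_image V W (A : set V) (f : V -> W) :
  compact A -> cont_on A f -> compact (f @` A).
Proof. by move=> cA /cont_onP cf; apply: continuous_compact. Qed.

Lemma connected_image V W (A : set V) (f : V -> W) :
  connected A -> cont_on A f -> connected (f @` A).
Proof. by move=> cA /cont_onP cf; apply: connected_continuous_connected. Qed.

Lemma compact_isclosed V (A : set V) : compact A -> closed A.
Proof. exact: compact_closed (@norm_hausdorff _ _). Qed.

Lemma closed_preimage V W (A : set V) (B : set W) (f : V -> W) :
  closed A -> closed B -> cont_on A f -> closed [set x | A x /\ B (f x)].
Proof.
move=> /closedP cA /closedP cB cf; apply/closedP => x h.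
have Ax : A x by apply: cA => e /h[y [Ay _] xy]; exists y.
split=> //; apply: cB => e e0; have [r r0 xr] := cf x Ax e e0.
by have [y [Ay By] xy] := h r r0; exists (f y) => //; apply: xr.
Qed.

Lemma closed_ge V (A : set V) (f : V -> R) c : closed A -> cont_on A f ->
  closed [set x | A x /\ c <= f x].
Proof.
move=> cA cf; have cC : closed [set t : R | c <= t] by exact: closed_ge.
exact: (closed_preimage cA cC cf).
Qed.

Lemma closed_le V (A : set V) (f : V -> R) c : closed A -> cont_on A f ->
  closed [set x | A x /\ f x <= c].
Proof.
move=> cA cf; have cC : closed [set t : R | t <= c] by exact: closed_le.
exact: (closed_preimage cA cC cf).
Qed.

Lemma compact_sub V (A B : set V) : compact A -> closed B -> B `<=` A -> compact B.
Proof. by move=> cA cB BA; apply: subclosed_compact cA BA. Qed.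

(** The points of A at distance at least e from x form a compact set; its image is closed and misses
    [f x], hence stays at a positive distance from it. *)
Lemma cont_on_inv V W (A : set V) (f : V -> W) (g : W -> V) :
  compact A -> cont_on A f -> (forall x, A x -> g (f x) = x) ->
  cont_on (f @` A) g.
Proof.
move=> cA cf fK _ [x Ax <-] e e0; rewrite fK //.
pose B := [set y | A y /\ e <= `|x - y|].
have cB : compact B.
  apply: (compact_sub cA) => [|y []//]; apply: closed_ge; first exact: compact_isclosed.
  by apply: cont_on_norm; apply: cont_onB; [exact: cont_on_cst|exact: cont_on_id].
have cfB : closed (f @` B).
  have cBf : cont_on B f by apply: (cont_onS _ cf) => y [].
  exact: compact_isclosed (compact_image cB cBf).
have [|r r0 xr] := not_closed_dist (x := f x) cfB.
  by move=> [y [Ay xy] fxy]; rewrite -(fK x Ax) -fxy fK // subrr normr0 leNgt e0 in xy.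
exists r => // _ [y Ay <-] fxy; rewrite fK // ltNge; apply/negP => xy.
by have := xr (f y) (imageP _ (conj Ay xy)); rewrite leNgt fxy.
Qed.

(** The clopen argument, with O and its complement tested only at points of K, so that O may be any
    subset of the ambient space. Most global statements below are obtained in this way. *)
Lemma connected_all V (K O : set V) : connected K -> (exists2 x, K x & O x) ->
    (forall x, K x -> O x -> exists2 r : R, 0 < r & forall y, K y -> `|x - y| < r -> O y) ->
    (forall x, K x -> ~ O x ->
       exists2 r : R, 0 < r & forall y, K y -> `|x - y| < r -> ~ O y) ->
  K `<=` O.
Proof.
move=> cK [x0 Kx0 Ox0] hO hN; apply: contrapT => nKO.
have [y Ky nOy] : exists2 y, K y & ~ O y.
  apply: contrapT => h; apply: nKO => y Ky; apply: contrapT => nOy.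
  by apply: h; exists y.
apply/connectedPn: cK; exists (fun b => if b then K `&` O else K `\` O); split.
- by case; [exists x0|exists y].
- rewrite setDE -setIUr setUC setUCr; by rewrite setIT.
- split; apply/seteqP; split=> // z [].
  + move=> /closureP clz [Kz Oz]; have [r r0 zr] := hO z Kz Oz.
    by have [w [Kw nOw] zw] := clz r r0; apply: nOw; exact: zr.
  + move=> [Kz nOz] /closureP clz; have [r r0 zr] := hN z Kz nOz.
    by have [w [Kw Ow] zw] := clz r r0; apply: (zr w).
Qed.

Lemma connected_segment V (x y : V) :
  connected [set x + t *: (y - x) | t in `[0 : R, 1]].
Proof.
apply: connected_image; first exact/connected_intervalP/interval_is_interval.
apply: cont_onD; first exact: cont_on_cst.
by apply: cont_onZ; [exact: cont_on_id|exact: cont_on_cst].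
Qed.

Lemma compact_segment V (x y : V) :
  compact [set x + t *: (y - x) | t in `[0 : R, 1]].
Proof.
apply: compact_image; first exact: segment_compact.
apply: cont_onD; first exact: cont_on_cst.
by apply: cont_onZ; [exact: cont_on_id|exact: cont_on_cst].
Qed.

(** Compact connected sets play the role of paths: they pass through unions and continuous images,
    and compactness leaves room in strict inequalities, as in [O_lt]. *)
Definition linked V (S : set V) (x y : V) : Prop :=
  exists K, [/\ compact K, connected K, K `<=` S, K x & K y].

Lemma linked_refl V (S : set V) x : S x -> linked S x x.
Proof.
move=> Sx; exists [set x]; split=> //; [exact: compact_set1|exact: connected1|].
by move=> _ ->.
Qed.

Lemma linked_sym V (S : set V) x y : linked S x y -> linked S y x.
Proof. by move=> [K [? ? ? ? ?]]; exists K. Qed.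

Lemma linked_trans V (S : set V) x y z : linked S x y -> linked S y z -> linked S x z.
Proof.
move=> [K [cK nK KS Kx Ky]] [L [cL nL LS Ly Lz]]; exists (K `|` L); split.
- exact: compactU.
- by apply: connectedU => //; exists y.
- by move=> w [/KS|/LS].
- by left.
- by right.
Qed.

Lemma linkedS V (S T : set V) x y : S `<=` T -> linked S x y -> linked T x y.
Proof. by move=> ST [K [cK nK KS Kx Ky]]; exists K; split=> // z /KS /ST. Qed.

Lemma linked_segment V W (S : set W) (A : set V) (f : V -> W) x y :
    cont_on A f ->
    (forall t : R, 0 <= t <= 1 -> A (x + t *: (y - x)) /\ S (f (x + t *: (y - x)))) ->
  linked S (f x) (f y).
Proof.
move=> cf h; pose I := [set x + t *: (y - x) | t in `[0 : R, 1]].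
have IA : I `<=` A by move=> _ [t + <-]; rewrite /= in_itv /= => /h[].
have cI : cont_on I f by apply: (cont_onS IA cf).
exists (f @` I); split.
- by apply: compact_image => //; exact: compact_segment.
- by apply: connected_image => //; exact: connected_segment.
- by move=> _ [_ [t + <-] <-]; rewrite /= in_itv /= => /h[_].
- exists x => //; exists 0; last by rewrite scale0r addr0.
  by rewrite /= in_itv /= lexx ler01.
- exists y => //; exists 1; last by rewrite scale1r addrC subrK.
  by rewrite /= in_itv /= lexx ler01.
Qed.

End EpsilonDelta.

(** * Differentiability *)

Section Calculus.
Context {R : realType}.
Implicit Types V W : normedModType R.

Lemma norm_rV_le {d : nat} (u : 'rV[R]_d) c :
  0 <= c -> (forall j, `|u 0 j| <= c) -> `|u| <= c.
Proof.
move=> c0 h; rewrite /Num.norm /= mx_normrE; apply/bigmax_leP; split=> // [[i j] _ /=].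
by rewrite ord1.
Qed.

Lemma mulmx_lipschitz {n d : nat} (B : 'M[R]_(n, d)) :
  exists2 C, 0 < C & forall u : 'rV[R]_n, `|u *m B| <= C * `|u|.
Proof.
exists (1 + \sum_i \sum_j `|B i j|).
  by rewrite ltr_wpDr // sumr_ge0 // => i _; rewrite sumr_ge0.
move=> u; apply: norm_rV_le => [|j].
  by rewrite mulr_ge0 // addr_ge0 // sumr_ge0 // => i _; rewrite sumr_ge0.
rewrite mxE (le_trans (ler_norm_sum _ _ _)) // (@le_trans _ _ (\sum_i `|u| * `|B i j|)) //.
  by apply: ler_sum => i _; rewrite normrM ler_wpM2r // mx_norm_coord.
rewrite -mulr_sumr mulrC ler_wpM2r // ler_wpDl // ler_sum // => i _.
by rewrite (bigD1 j) //= lerDl sumr_ge0.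
Qed.

Lemma is_derive_line V (f : V -> R) (a h : V) (t : R) :
  differentiable f (a + t *: h) ->
  is_derive t 1 (fun s : R => f (a + s *: h)) ('d f (a + t *: h) h).
Proof.
move=> df; pose l := fun s : R => a + s *: h.
have dl : is_diff t l (fun s : R => s *: h).
  have -> : l = cst a + (fun s : R => s *: h) by [].
  by have := is_diffD (is_diff_cst a t) (is_diff_scalel t h); rewrite add0r.
have dc : is_diff t (f \o l) ('d f (l t) \o (fun s : R => s *: h)).
  by apply: is_diff_comp; apply: differentiableP.
have df1 : differentiable (f \o l) t by exact: ex_diff.
apply: DeriveDef; first exact: (diff_derivable (f := f \o l)).
by rewrite -[LHS]/('D_1 (f \o l) t) deriveE // diff_val /= scale1r.
Qed.

Lemma differentiable_cvg V (f : V -> R) a (e : R) : differentiable f a -> 0 < e ->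
  exists2 r, 0 < r & forall b, `|a - b| < r -> `|f a - f b| < e.
Proof.
move=> /differentiable_continuous cf e0.
by move/cvgrPdist_lt/(_ e e0)/nbhsP: cf.
Qed.

Lemma differentiable_bigsum V (I : Type) (r : seq I) (P : pred I) (f : I -> V -> R) a :
  (forall i, P i -> differentiable (f i) a) ->
  differentiable (fun x => \sum_(i <- r | P i) f i x) a.
Proof.
move=> h; have -> : (fun x => \sum_(i <- r | P i) f i x) = \sum_(i <- r | P i) f i.
  apply/funext => x; elim: r => [|i r IH]; first by rewrite !big_nil.
  by rewrite !big_cons; case: ifP => _ //; rewrite IH.
elim/big_rec : _ => [|i g Pi dg]; first exact: differentiable_cst.
by apply: differentiableD => //; exact: h.
Qed.

Lemma differentiable_bigprod V (I : Type) (r : seq I) (P : pred I) (f : I -> V -> R) a :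
  (forall i, P i -> differentiable (f i) a) ->
  differentiable (fun x => \prod_(i <- r | P i) f i x) a.
Proof.
move=> h; elim: r => [|i r IH].
  rewrite (_ : (fun _ => _) = cst 1); first exact: differentiable_cst.
  by apply/funext => x; rewrite big_nil.
rewrite (_ : (fun _ => _) = (fun x => (if P i then f i x else 1) *
   \prod_(i <- r | P i) f i x)).
  apply: differentiableM => //; case Pi: (P i); first exact: h.
  exact: differentiable_cst.
by apply/funext => x; rewrite big_cons; case: ifP; rewrite ?mul1r.
Qed.

(** Entrywise, so that determinants, adjugates and tangent projections become rational expressions
    in scalar differentiable functions. *)
Definition mxdiff V {m n} (A : V -> 'M[R]_(m, n)) (a : V) : Prop :=
  forall i j, differentiable (fun x => A x i j) a.

Lemma mxdiff_cst V m n (B : 'M[R]_(m, n)) (a : V) : mxdiff (fun=> B) a.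
Proof. by move=> i j; exact: differentiable_cst. Qed.

Lemma mxdiffM V m n p (A : V -> 'M[R]_(m, n)) (B : V -> 'M[R]_(n, p)) a :
  mxdiff A a -> mxdiff B a -> mxdiff (fun x => A x *m B x) a.
Proof.
move=> dA dB i j; rewrite (_ : (fun _ => _) = fun x => \sum_k A x i k * B x k j).
  by apply: differentiable_bigsum => k _; apply: differentiableM.
by apply/funext => x; rewrite mxE.
Qed.

Lemma mxdiffT V m n (A : V -> 'M[R]_(m, n)) a :
  mxdiff A a -> mxdiff (fun x => (A x)^T) a.
Proof.
move=> dA i j; rewrite (_ : (fun _ => _) = fun x => A x j i) //.
by apply/funext => x; rewrite mxE.
Qed.

Lemma mxdiffB V m n (A B : V -> 'M[R]_(m, n)) a :
  mxdiff A a -> mxdiff B a -> mxdiff (fun x => A x - B x) a.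
Proof.
move=> dA dB i j; rewrite (_ : (fun _ => _) = fun x => A x i j - B x i j).
  exact: differentiableB.
by apply/funext => x; rewrite !mxE.
Qed.

Lemma mxdiffZ V m n (k : V -> R) (A : V -> 'M[R]_(m, n)) a :
  differentiable k a -> mxdiff A a -> mxdiff (fun x => k x *: A x) a.
Proof.
move=> dk dA i j; rewrite (_ : (fun _ => _) = fun x => k x * A x i j).
  exact: differentiableM.
by apply/funext => x; rewrite !mxE.
Qed.

Lemma differentiable_det V n (A : V -> 'M[R]_n) a :
  mxdiff A a -> differentiable (fun x => \det (A x)) a.
Proof.
move=> dA; apply: differentiable_bigsum => s _; apply: differentiableM.
  exact: differentiable_cst.
by apply: differentiable_bigprod.
Qed.

Lemma mxdiff_adj V n (A : V -> 'M[R]_n) a :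
  mxdiff A a -> mxdiff (fun x => \adj (A x)) a.
Proof.
move=> dA i j.
rewrite (_ : (fun _ => _) = fun x => (-1) ^+ (j + i) * \det (row' j (col' i (A x)))).
  apply: differentiableM; first exact: differentiable_cst.
  apply: (differentiable_det (A := fun x => row' j (col' i (A x)))) => k l.
  rewrite (_ : (fun _ => _) = fun x => A x (lift j k) (lift i l)) //.
  by apply/funext => x; rewrite !mxE.
by apply/funext => x; rewrite mxE.
Qed.

(* The total function B |-> (\det B)^-1 *: \adj B is used instead of invmx, with
   which it agrees on invertible matrices. *)
Lemma mxdiff_inv V n (A : V -> 'M[R]_n) a : A a \in unitmx ->
  mxdiff A a -> mxdiff (fun x => (\det (A x))^-1 *: \adj (A x)) a.
Proof.
move=> uA dA; apply: mxdiffZ; last exact: mxdiff_adj.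
apply: differentiableV; first exact: differentiable_det.
by move: uA; rewrite unitmxE unitfE.
Qed.

(** [U - h] has a local minimum at 0, so its derivative vanishes there. A derivative can thus be
    read off from a simpler function that touches from one side. *)
Lemma touching_derive (h U : R -> R) (dh dU : R) (e : R) : 0 < e ->
  is_derive (0 : R) 1 h dh -> is_derive (0 : R) 1 U dU -> h 0 = U 0 ->
  (forall t, `|t| < e -> h t <= U t) -> dh = dU.
Proof.
move=> e0 ih iU hU hle.
have iD : is_derive (0 : R) 1 (U - h) (dU - dh) by exact: is_deriveB.
apply/eqP; rewrite eq_sym -subr_eq0; apply/eqP.
have cvgD : (fun t => t^-1 *: ((U - h) (t *: (1 : R) + 0) - (U - h) 0)) @ (0 : R)^' --> dU - dh.
  by rewrite -(derive_val (is_derive := iD)); exact: (ex_derive (is_derive := iD)).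
have [//|nz] := eqVneq (dU - dh) 0.
have := cvgD => /cvgrPdist_lt /(_ `|dU - dh|).
rewrite normr_gt0 nz => /(_ isT) /nbhs_ballP[r /= r0 hr].
pose q := Num.min r e / 2.
have q0 : 0 < q by rewrite divr_gt0 // lt_min r0.
have qr : q < r /\ q < e.
  have : q < Num.min r e by rewrite /q ltr_pdivrMr // ltr_pMr ?ltr1n // lt_min r0.
  by rewrite lt_min => /andP[].
have Dq t : `|t| = q -> 0 <= (U - h) (t *: (1 : R) + 0) - (U - h) 0.
  move=> tq; rewrite scaler1 addr0 /= !fctE hU subrr subr0 subr_ge0.
  by apply: hle; rewrite tq; case: qr.
have key t : `|t| = q -> `|dU - dh - t^-1 *: ((U - h) (t *: (1 : R) + 0) - (U - h) 0)| < `|dU - dh|.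
  move=> tq; apply: hr; first by rewrite /ball /= sub0r normrN tq; case: qr.
  by rewrite -normr_eq0 tq gt_eqF.
have qn : `|q| = q by rewrite gtr0_norm.
have k1 := key q qn; have d1 := Dq q qn.
have k2 := key (- q) _; rewrite normrN qn in k2; have {}k2 := k2 erefl.
have d2 := Dq (- q) _; rewrite normrN qn in d2; have {}d2 := d2 erefl.
set x := (U - h) (q *: (1 : R) + 0) - _ in k1 d1.
set y := (U - h) (- q *: (1 : R) + 0) - _ in k2 d2.
have qi : 0 < q^-1 by rewrite invr_gt0.
have x0 : 0 <= q^-1 *: x by rewrite mulr_ge0 // ltW.
have y0 : (- q)^-1 *: y <= 0 by rewrite invrN scaleNr oppr_le0 mulr_ge0 // ltW.
by move: k1 k2; case: (ltrP 0 (dU - dh)) => s; [rewrite (gtr0_norm s)|rewrite (ler0_norm s)];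
  rewrite !ltr_norml => /andP[? ?] /andP[? ?]; lra.
Qed.

End Calculus.

(** * Charts and tangent projections *)

Section Charts.
Context {R : realType} {n d : nat}.
Implicit Types (M W : set 'rV[R]_d) (U : set 'rV[R]_n) (a b h : 'rV[R]_n).

(** [J a] is the matrix of ['d phi a] on row vectors, so its rows span the tangent space; its
    differentiability is what gives access to second derivatives of phi. *)
Definition chart M W U (phi : 'rV[R]_n -> 'rV[R]_d) (g : 'rV[R]_d -> 'rV[R]_n)
    (J : 'rV[R]_n -> 'M[R]_(n, d)) : Prop :=
  [/\ open W, open U,
     forall a, U a -> [/\ M (phi a), W (phi a) & g (phi a) = a],
     (forall x, M x -> W x -> U (g x) /\ phi (g x) = x) /\ cont_on (M `&` W) g &
     forall a, U a -> [/\ differentiable phi a, forall b, 'd phi a b = b *m J a,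
                          row_free (J a) & mxdiff J a]].

Lemma diff_coord (V : normedModType R) m p (f : V -> 'M[R]_(m, p)) (a h : V) (i : 'I_m) (j : 'I_p) :
  differentiable f a -> differentiable (fun x => f x i j : R) a /\
  'd (fun x => f x i j : R) a h = ('d f a h) i j.
Proof.
move=> df; have @c : {linear 'M[R]_(m, p) -> R}.
  by exists (fun N : 'M[R]_(_, _) => N i j); do 2![eexists]; do ?[constructor];
     rewrite ?mxE// => ? *; rewrite ?mxE//; move=> ?; rewrite !mxE.
have cc : continuous c by exact: coord_continuous.
have dc : differentiable c (f a) by exact: linear_differentiable.
split; first exact: (differentiable_comp df dc).
rewrite -[LHS]/('d (c \o f) a h) diff_comp // diff_lin //.
Qed.

Lemma chart_jac_close M W U phi g J a0 (e : R) : chart M W U phi g J -> U a0 -> 0 < e ->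
  exists2 r, 0 < r & forall a, `|a0 - a| < r ->
    U a /\ forall h, `|h *m (J a - J a0)| <= e * `|h|.
Proof.
move=> [_ /openE oU _ _ dphi] Ua0 e0.
have [r1 r10 r1U] := oU _ Ua0.
pose e' := e / (n%:R + 1).
have e'0 : 0 < e' by rewrite divr_gt0 // ltr_wpDl.
pose S a := \sum_i \sum_j (J a i j - J a0 i j) * (J a i j - J a0 i j).
have dS : differentiable S a0.
  apply: differentiable_bigsum => i _; apply: differentiable_bigsum => j _.
  have dJ : differentiable (fun a => J a i j - J a0 i j) a0.
    apply: differentiableB; last exact: differentiable_cst.
    by have [_ _ _] := dphi _ Ua0; exact.
  exact: differentiableM.
have [r2 r20 r2S] := differentiable_cvg dS (exprn_gt0 2 e'0).
have S0 : S a0 = 0.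
  by rewrite /S big1 // => i _; rewrite big1 // => j _; rewrite subrr mul0r.
exists (Num.min r1 r2); first by rewrite lt_min r10.
move=> a; rewrite lt_min => /andP[/r1U Ua /r2S]; rewrite S0 sub0r normrN => h2.
split=> // h.
have le i j : `|J a i j - J a0 i j| <= e'.
  rewrite -ler_sqr ?nnegrE ?(ltW e'0) // real_normK ?num_real //.
  apply: le_trans (ltW h2); apply: le_trans (ler_norm _).
  rewrite /S (bigD1 i) //= (bigD1 j) //= -addrA -expr2 lerDl addr_ge0 //.
    by apply: sumr_ge0 => k _; rewrite -expr2 sqr_ge0.
  by apply: sumr_ge0 => k _; apply: sumr_ge0 => l _; rewrite -expr2 sqr_ge0.
apply: norm_rV_le => [|j]; first by rewrite mulr_ge0 // ltW.
rewrite mxE (le_trans (ler_norm_sum _ _ _)) //.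
apply: (@le_trans _ _ (\sum_(i < n) `|h| * e')).
  apply: ler_sum => i _; rewrite normrM ler_pM // ?mx_norm_coord //.
  by rewrite !mxE; exact: le.
rewrite sumr_const card_ord -mulrnAr mulrC ler_wpM2r //.
rewrite /e' -[leLHS]mulr_natl mulrA ler_pdivrMr ?ltr_wpDl // mulrC.
by rewrite ler_wpM2l ?lerDl // ltW.
Qed.

Lemma ball_convex (V : normedModType R) (a0 a b : V) (r t : R) :
  `|a0 - a| < r -> `|a0 - b| < r -> 0 <= t <= 1 -> `|a0 - (b + t *: (a - b))| < r.
Proof.
move=> ha hb /andP[t0 t1].
have -> : a0 - (b + t *: (a - b)) = t *: (a0 - a) + (1 - t) *: (a0 - b).
  have -> : a - b = (a0 - b) - (a0 - a) by rewrite opprB [RHS]addrC addrA subrK.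
  rewrite opprD addrA; move: (a0 - a) (a0 - b) => u w.
  by rewrite scalerBr opprB scalerBl scale1r addrCA.
rewrite (le_lt_trans (ler_normD _ _)) // !normrZ (ger0_norm t0) (@ger0_norm _ (1 - t)) ?subr_ge0 //.
have [->|tn] := eqVneq t 0; first by rewrite mul0r add0r subr0 mul1r.
have tp : 0 < t by rewrite lt_def tn.
have h1 : t * `|a0 - a| < t * r by rewrite ltr_pM2l.
have h2 : (1 - t) * `|a0 - b| <= (1 - t) * r by rewrite ler_wpM2l ?subr_ge0 // ltW.
lra.
Qed.

(** Mean value theorem for each coordinate along the segment from b to a, with the variation of J
    bounded by [chart_jac_close]. The bound is uniform in both end points, as needed to compare two
    moving points. *)
Lemma chart_strict_diff M W U phi g J a0 (e : R) : chart M W U phi g J -> U a0 -> 0 < e ->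
  exists2 r, 0 < r & forall a b, `|a0 - a| < r -> `|a0 - b| < r ->
    U a /\ `|phi a - phi b - (a - b) *m J a0| <= e * `|a - b|.
Proof.
move=> C Ua0 e0; have [r r0 hr] := chart_jac_close C Ua0 e0.
have [_ _ _ _ dphi] := C; exists r => // a b ha hb; split; first exact: (hr a ha).1.
apply: norm_rV_le => [|j]; first by rewrite mulr_ge0 // ltW.
pose k (t : R) : R := phi (b + t *: (a - b)) 0 j.
have dk (t : R) : 0 <= t <= 1 -> is_derive t 1 k (((a - b) *m J (b + t *: (a - b))) 0 j).
  move=> t01; have Ut := (hr _ (ball_convex ha hb t01)).1.
  have [df dE _ _] := dphi _ Ut.
  rewrite -dE; have [dc' <-] := diff_coord (a - b) ord0 j df.
  exact: (is_derive_line (f := fun x => phi x 0 j)).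
have [||c c01] := @MVT_segment R k (fun t => ((a - b) *m J (b + t *: (a - b))) 0 j) 0 1 ler01.
- by move=> t; rewrite in_itv /= => /andP[t0 t1]; apply: dk; rewrite !ltW.
- apply: derivable_within_continuous => t; rewrite in_itv /= => /dk h.
  exact: (ex_derive (is_derive := h)).
rewrite subr0 mulr1 /k scale1r scale0r addr0 => kE.
have -> : (phi a - phi b - (a - b) *m J a0) 0 j =
   ((a - b) *m (J (b + c *: (a - b)) - J a0)) 0 j.
  rewrite mulmxBr mxE [in RHS]mxE [X in _ = _ + X]mxE -kE mxE [(- phi b) 0 j]mxE.
  rewrite addrC -[in RHS]addrC; congr (_ + _); first by rewrite mxE.
  by congr (phi _ 0 j - _); rewrite addrC subrK.
apply: le_trans (mx_norm_coord _ _) _; apply: (hr _ _).2; by apply: ball_convex.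
Qed.

Lemma chart_cont M W U phi g J : chart M W U phi g J -> cont_on U phi.
Proof.
move=> [_ _ _ _ dphi] x Ux e e0; have [/differentiable_continuous df _ _ _] := dphi _ Ux.
move: df => /cvgrPdist_lt /(_ e e0) /nbhsP[r r0 xr].
by exists r => // y _ xy; apply: xr.
Qed.

End Charts.

(** * Orthogonal projection onto a row space *)

Section Projection.
Context {R : realType}.

Lemma dotp_mulmx {m p} (u : 'rV[R]_m) (A : 'M[R]_(m, p)) (v : 'rV[R]_p) :
  dotp (u *m A) v = dotp u (v *m A^T).
Proof. by rewrite !dotpE trmx_mul trmxK mulmxA. Qed.

Lemma dotp_norm_le {d} (v : 'rV[R]_d) : exists2 K, 0 < K & forall w, `|dotp v w| <= K * `|w|.
Proof.
exists (enorm v * d%:R + 1).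
  by rewrite ltr_wpDl // mulr_ge0 ?enorm_ge0.
move=> w; apply: le_trans (cauchy v w) _; rewrite mulrDl mul1r -mulrA.
by rewrite -[leLHS]addr0 lerD // ler_wpM2l ?enorm_ge0 // le_enorm_norm.
Qed.

Context {n d : nat}.
Implicit Types J : 'M[R]_(n, d).

(** J^T (J J^T)^-1 J, acting on row vectors from the right. Being rational in J, it varies
    differentiably along a chart. *)
Definition proj J : 'M[R]_d :=
  J^T *m ((\det (J *m J^T))^-1 *: \adj (J *m J^T)) *m J.

Lemma gram_unit J : row_free J -> J *m J^T \in unitmx.
Proof.
move=> fJ; rewrite -row_free_unit; apply: inj_row_free => v vJ0.
have : dotp (v *m J) (v *m J) = 0.
  by rewrite dotp_mulmx -mulmxA vJ0 dotp0r.
move/eqP; rewrite dotp_eq0 => /eqP vJ; apply: (row_free_inj fJ).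
by rewrite vJ mul0mx.
Qed.

Lemma proj_rowfree J : row_free J -> J *m proj J = J.
Proof.
move=> fJ; rewrite /proj !mulmxA -scalemxAr -scalemxAl mul_mx_adj mul_scalar_mx.
by rewrite scalerA mulVf ?scale1r //; move: (gram_unit fJ); rewrite unitmxE unitfE.
Qed.

Lemma proj_sym J : (proj J)^T = proj J.
Proof.
by rewrite /proj !trmx_mul trmxK linearZ /= trmx_adj trmx_mul trmxK mulmxA.
Qed.

Lemma proj_idem J : row_free J -> proj J *m proj J = proj J.
Proof. by move=> fJ; rewrite {1}/proj -!mulmxA proj_rowfree // /proj !mulmxA. Qed.

Lemma proj_range J (u : 'rV[R]_d) : exists c, u *m proj J = c *m J.
Proof. by eexists; rewrite /proj mulmxA. Qed.

Lemma proj_id J c : row_free J -> c *m J *m proj J = c *m J :> 'rV[R]_d.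
Proof. by move=> fJ; rewrite -mulmxA proj_rowfree. Qed.

Lemma dotp_proj J (u v : 'rV[R]_d) : dotp (u *m proj J) v = dotp u (v *m proj J).
Proof. by rewrite dotp_mulmx proj_sym. Qed.

Lemma normalP J (v : 'rV[R]_d) : row_free J ->
  (forall c, dotp v (c *m J) = 0) <-> v *m proj J = 0.
Proof.
move=> fJ; split=> [h|v0 c]; last by rewrite -(proj_id c fJ) -dotp_proj v0 dotp0l.
apply/eqP; rewrite -dotp_eq0 dotp_proj -mulmxA proj_idem //.
by have [c ->] := proj_range J v; rewrite h.
Qed.

End Projection.

(** Equal row spaces give P Q = P and Q P = Q; transposing one identity and using symmetry gives P =
    Q. *)
Lemma proj_uniq {R : realType} {n d : nat} (J J' : 'M[R]_(n, d)) :
  row_free J -> row_free J' ->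
  (forall c : 'rV_n, exists c' : 'rV_n, c *m J = c' *m J') ->
  (forall c : 'rV_n, exists c' : 'rV_n, c *m J' = c' *m J) ->
  proj J = proj J'.
Proof.
move=> fJ fJ' h h'.
have aux (A B : 'M[R]_(n, d)) : row_free B -> (forall c : 'rV_n, exists c' : 'rV_n, c *m A = c' *m B) ->
    proj A *m proj B = proj A.
  move=> fB AB; apply/row_matrixP => i; rewrite row_mul.
  have [c] := proj_range A (delta_mx 0 i); rewrite -rowE => ->.
  by have [c' ->] := AB c; rewrite proj_id.
have e1 := aux _ _ fJ' h; have e2 := aux _ _ fJ h'.
by have := congr1 trmx e1; rewrite trmx_mul !proj_sym e2.
Qed.

Section DiffMul.
Context {R : realType}.

Lemma diff_mulmxr (V : normedModType R) {m p : nat} (f : V -> 'rV[R]_m) (a h : V) (B : 'M[R]_(m, p)) :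
  differentiable f a -> differentiable (fun x => f x *m B) a /\
  'd (fun x => f x *m B) a h = 'd f a h *m B.
Proof.
move=> df; have cB : continuous (mulmxr B : 'rV[R]_m -> 'rV[R]_p).
  suff : cont_on setT (mulmxr B : 'rV[R]_m -> 'rV[R]_p).
    by move=> hc; apply/(@continuous_subspace_setT 'rV[R]_m 'rV[R]_p)/cont_onP.
  move=> x _ e e0; have [C C0 hC] := mulmx_lipschitz B.
  exists (e / C); first by rewrite divr_gt0.
  move=> y _ xy; rewrite /= -mulmxBl (le_lt_trans (hC _)) //.
  by rewrite mulrC -ltr_pdivlMr.
have dB : differentiable (mulmxr B : 'rV[R]_m -> 'rV[R]_p) (f a).
  exact: linear_differentiable.
split; first exact: (differentiable_comp df dB).
by rewrite -[LHS]/('d (mulmxr B \o f) a h) diff_comp // diff_lin.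
Qed.

Lemma diff_dotp (V : normedModType R) {m : nat} (f : V -> 'rV[R]_m) (a h : V) (v : 'rV[R]_m) :
  differentiable f a -> differentiable (fun x => dotp v (f x)) a /\
  'd (fun x => dotp v (f x)) a h = dotp v ('d f a h).
Proof.
move=> df; have [dg dgE] := diff_mulmxr h v^T df.
have -> : (fun x => dotp v (f x)) = (fun x => (f x *m v^T) 0 0).
  by apply/funext => x; rewrite dotpC dotpE.
have [dh ->] := diff_coord h 0 0 dg.
by rewrite dgE (dotpC v) dotpE.
Qed.

End DiffMul.

(** * Independence of the tangent space from the chart *)

Section Tangent.
Context {R : realType} {n d : nat}.

(** The change of charts is only known to be continuous, so displacements are compared instead. If v
    = c J1 had a nonzero part nu normal to the second tangent space, moving by t c in the first
    chart would give a displacement D with <nu, D> close to t |nu|^2, whereas strict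
    differentiability of the second chart makes <nu, D> negligible against |D|. *)
Lemma chart_tangent (M W1 W2 : set 'rV[R]_d) (U1 U2 : set 'rV[R]_n) f1 f2 g1 g2 J1 J2 a1 a2 :
  chart M W1 U1 f1 g1 J1 -> chart M W2 U2 f2 g2 J2 -> U1 a1 -> U2 a2 ->
  f1 a1 = f2 a2 -> forall c : 'rV_n, exists c' : 'rV_n, c *m J1 a1 = c' *m J2 a2.
Proof.
move=> C1 C2 Ua1 Ua2 f12 c; have [oW1 oU1 h1 _ D1] := C1.
have [oW2 oU2 h2 [k2 cg2] D2] := C2.
have fJ2 : row_free (J2 a2) by have [] := D2 _ Ua2.
pose v := c *m J1 a1; pose nu := v - v *m proj (J2 a2).
suff nu0 : nu = 0.
  have [c' E] := proj_range (J2 a2) v; exists c'; rewrite -E.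
  by apply/eqP; rewrite -subr_eq0 -/v -/nu nu0.
have nuT b : dotp nu (b *m J2 a2) = 0.
  move: b; apply/normalP => //; rewrite /nu mulmxBl -(mulmxA v) proj_idem //.
  by rewrite subrr.
have nuv : dotp nu v = dotp nu nu.
  have [c' E] := proj_range (J2 a2) v.
  by rewrite -[RHS]/(dotp nu (v - v *m proj (J2 a2))) dotpBr E nuT subr0.
apply/eqP; rewrite -dotp_eq0; apply: contrapT => /negP; rewrite dotp_eq0 -dotp_gt0.
set m := dotp nu nu => m0.
have [K K0 hK] := dotp_norm_le nu.
have [C C0 hC] := mulmx_lipschitz (pinvmx (J2 a2)).
(* L collects the constants of both error estimates: the proof ends with m <= e (L - m), which e L
   <= m / 2 contradicts. *)
pose L := K * `|c| + 2 * K * C * (`|v| + `|c|) + m.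
have L0 : 0 < L by rewrite ltr_wpDl // addr_ge0 // ?mulr_ge0 // ?addr_ge0 // ltW.
pose e := Num.min (Num.min (1 / (2 * C)) 1) (m / (2 * L)).
have e0 : 0 < e by rewrite !lt_min ltr01 !divr_gt0 ?mulr_gt0.
have [e1 e2 e3] : [/\ e * C <= 1 / 2, e <= 1 & e * L <= m / 2].
  split.
  - rewrite -ler_pdivlMr // (le_trans (_ : _ <= 1 / (2 * C))) ?ge_min ?lexx //.
    by rewrite invfM mulrA.
  - by rewrite !ge_min lexx orbT.
  - rewrite -ler_pdivlMr // (le_trans (_ : _ <= m / (2 * L))) ?ge_min ?lexx ?orbT //.
    by rewrite invfM mulrA.
have [r1 r10 s1] := chart_strict_diff C1 Ua1 e0.
have [r2 r20 s2] := chart_strict_diff C2 Ua2 e0.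
have [M1 Wf1 _] := h1 _ Ua1; have [M2 Wf2 gf2] := h2 _ Ua2.
have [q q0 hq] := cg2 (f2 a2) (conj M2 Wf2) r2 r20.
have [w w0 hw] : exists2 w : R, 0 < w & forall y, `|f2 a2 - y| < w -> W2 y.
  by move/openE: oW2; exact.
pose Y := `|v| + `|c| + 1.
have Y0 : 0 < Y by rewrite ltr_wpDl // addr_ge0.
pose t := Num.min (r1 / (2 * Y)) (Num.min q w / (2 * Y)).
have qw : 0 < Num.min q w by rewrite lt_min q0.
have t0 : 0 < t by rewrite lt_min !divr_gt0 // mulr_gt0.
have tY z : 0 < z -> t <= z / (2 * Y) -> t * Y < z.
  move=> z0; rewrite -(ler_pM2r Y0) => /le_lt_trans -> //.
  rewrite invfM mulrA divfK ?gt_eqF // ltr_pdivrMr // ltr_pMr // ltr1n //.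
have tY1 : t * Y < r1 by apply: tY; rewrite // ge_min lexx.
have tY2 : t * Y < Num.min q w by apply: tY; rewrite // ge_min lexx orbT.
have tc : `|a1 - (a1 + t *: c)| < r1.
  rewrite opprD addNKr normrN normrZ gtr0_norm // (le_lt_trans _ tY1) // ler_pM2l //.
  by rewrite /Y; have := normr_ge0 v; lra.
have ta : `|a1 - a1| < r1 by rewrite subrr normr0.
have [Ut s1t] := s1 _ _ tc ta.
have e1' : a1 + t *: c - a1 = t *: c by rewrite [a1 + _]addrC addrK.
rewrite e1' -scalemxAl -/v normrZ gtr0_norm // in s1t.
pose D := f1 (a1 + t *: c) - f1 a1.
have Dn : `|D| <= t * (`|v| + e * `|c|).
  rewrite -(subrK (t *: v) D) (le_trans (ler_normD _ _)) // normrZ gtr0_norm //.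
  rewrite -lerBrDr (le_trans s1t) //; rewrite le_eqVlt; apply/orP; left; apply/eqP; ring.
have DY : `|D| < Num.min q w.
  rewrite (le_lt_trans Dn) // (le_lt_trans _ tY2) // ler_pM2l // /Y.
  have : e * `|c| <= `|c| by rewrite ler_piMl.
  lra.
have [Mt Wt _] := h1 _ Ut.
have W2t : W2 (f1 (a1 + t *: c)).
  by apply: hw; rewrite -f12 distrC; apply: lt_le_trans DY _; rewrite ge_min lexx orbT.
have [U2t fgt] := k2 _ Mt W2t.
pose b := g2 (f1 (a1 + t *: c)).
have bq : `|a2 - b| < r2.
  rewrite -gf2; apply: hq; first by split.
  by rewrite -f12 distrC; apply: lt_le_trans DY _; rewrite ge_min lexx.
have aa : `|a2 - a2| < r2 by rewrite subrr normr0.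
have [_ s2t] := s2 _ _ bq aa.
rewrite /b fgt -/b -f12 -/D in s2t.
pose x := `|b - a2|.
(* A one-sided inverse of J2 bounds the coordinate displacement by the ambient one, with e C <= 1/2
   absorbing the error term. *)
have xD : x <= 2 * C * `|D|.
  have : x <= C * `|(b - a2) *m J2 a2|.
    by rewrite /x -{1}[b - a2]mulmx1 -(mulmxVp fJ2) mulmxA hC.
  have : `|(b - a2) *m J2 a2| <= `|D| + e * x.
    rewrite (_ : (b - a2) *m J2 a2 = D - (D - (b - a2) *m J2 a2)); last first.
      by rewrite opprB [RHS]addrC subrK.
    by rewrite (le_trans (ler_normB _ _)) // lerD2l.
  move=> h3 h4; have : C * `|(b - a2) *m J2 a2| <= C * (`|D| + e * x) by rewrite ler_pM2l.
  have : e * C * x <= 1 / 2 * x by rewrite ler_wpM2r // /x.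
  nra.
have low : t * m - K * (e * (t * `|c|)) <= dotp nu D.
  have := le_trans (hK (D - t *: v)) (ler_wpM2l (ltW K0) s1t).
  by rewrite dotpBr dotpZr nuv -/m ler_norml => /andP[h3 _]; lra.
have up : dotp nu D <= K * (e * x).
  have := le_trans (hK _) (ler_wpM2l (ltW K0) s2t).
  by rewrite dotpBr nuT subr0; apply: le_trans; exact: ler_norm.
have h1' : K * (e * x) <= K * (e * (2 * C * (t * (`|v| + `|c|)))).
  rewrite !ler_pM2l //; apply: le_trans xD _; rewrite ler_pM2l ?mulr_gt0 //.
  apply: le_trans Dn _; rewrite ler_pM2l // lerD2l ler_piMl //.
have : t * m <= t * (e * (L - m)).
  rewrite /L; move: low up h1'; lra.
rewrite ler_pM2l // mulrBr => h3.
have : 0 < e * m by rewrite mulr_gt0.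
lra.
Qed.

Lemma chart_proj (M W1 W2 : set 'rV[R]_d) (U1 U2 : set 'rV[R]_n) f1 f2 g1 g2 J1 J2 a1 a2 :
  chart M W1 U1 f1 g1 J1 -> chart M W2 U2 f2 g2 J2 -> U1 a1 -> U2 a2 ->
  f1 a1 = f2 a2 -> proj (J1 a1) = proj (J2 a2).
Proof.
move=> C1 C2 Ua1 Ua2 f12; apply: proj_uniq.
- by case: C1 => _ _ _ _ /(_ _ Ua1)[].
- by case: C2 => _ _ _ _ /(_ _ Ua2)[].
- exact: (chart_tangent C1 C2).
- exact: (chart_tangent C2 C1).
Qed.

End Tangent.

(** * Charts from local parametrizations, and the curvature bound in a chart *)

Section FromParametrization.
Context {R : realType} {n d : nat}.
Implicit Types (M W : set 'rV[R]_d) (U : set 'rV[R]_n) (phi : 'rV[R]_n -> 'rV[R]_d).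

Definition jac phi (a : 'rV[R]_n) : 'M[R]_(n, d) :=
  \matrix_(i, j) ('D_(delta_mx 0 i) phi a) 0 j.

(** The bound |<II(u, u), v>| <= k |u|^2 |v| for u = b J and v normal. Since v is a fixed vector,
    only a scalar function is differentiated and u need not be a unit vector. *)
Definition curved U (J : 'rV[R]_n -> 'M[R]_(n, d)) (k : R) : Prop :=
  forall a (b : 'rV_n) (v : 'rV_d), U a -> (forall c, dotp v (c *m J a) = 0) ->
  `|'D_b (fun a' => dotp v (b *m J a')) a| <= k * dotp (b *m J a) (b *m J a) * enorm v.

Lemma jacE phi a b : differentiable phi a -> 'd phi a b = b *m jac phi a.
Proof.
move=> df; rewrite [b in LHS]row_sum_delta linear_sum mulmx_sum_row.
apply: eq_bigr => i _; rewrite linearZ /=; congr (_ *: _).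
by apply/rowP => j; rewrite !mxE deriveE.
Qed.

Lemma param_chart M W U phi : local_parametrization M W U phi ->
  exists g, chart M W U phi g (jac phi).
Proof.
move=> [oW oU sm injd [[hU hinj hsurj] cphi [g cg gK]]]; exists g; split=> //.
- by move=> a Ua; have [? ?] := hU _ Ua; split=> //; apply: gK.
- split; last exact/cont_onP.
  move=> x Mx Wx; have [a Ua <-] := hsurj x (conj Mx Wx); by rewrite gK.
move=> a Ua; have df := sm [::] a Ua; split=> //.
- by move=> b; exact: jacE.
- apply: inj_row_free => v; rewrite -jacE // => v0.
  by apply: (injd a Ua); rewrite v0 linear0.
move=> i j; rewrite (_ : (fun _ => _) = fun x => 'D_(delta_mx 0 i) phi x 0 j).
  by have [] := diff_coord 0 0 j (sm [:: delta_mx 0 i] a Ua).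
by apply/funext => x; rewrite mxE.
Qed.

Lemma param_tangent M W U phi a u : local_parametrization M W U phi -> U a ->
  tangent_space n M (phi a) u <-> exists c : 'rV_n, u = c *m jac phi a.
Proof.
move=> P Ua; have [g C] := param_chart P; split; last first.
  move=> [c ->]; exists W, U, phi, a, c; split=> //; rewrite jacE //.
  by have [_ _ sm _ _] := P; exact: (sm [::]).
move=> [W' [U' [phi' [a' [b [P' Ua' pp ->]]]]]].
have [g' C'] := param_chart P'; rewrite jacE; last first.
  by have [_ _ sm _ _] := P'; exact: (sm [::]).
exact: (chart_tangent C' C Ua' Ua pp).
Qed.

(** Pairing with a normal v sees only the normal part w of the second derivative along b. Once b is
    divided by |u|, this w is the second fundamental form on a unit vector, and Cauchy-Schwarz
    concludes. *)
Lemma param_curved M W U phi k : local_parametrization M W U phi ->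
  (forall l, normal_curvatures n M l -> l <= k) -> curved U (jac phi) k.
Proof.
move=> P hk a b v Ua vT; have [g C] := param_chart P.
have [oW oU sm injd _] := P; have [_ _ hM _ dC] := C.
have df := sm [::] a Ua; have dDb := sm [:: b] a Ua.
pose q := 'D_b ('D_b phi) a.
have -> : 'D_b (fun a' => dotp v (b *m jac phi a')) a = dotp v q.
  have [dd dE] := diff_dotp b v (dDb : differentiable ('D_b phi) a).
  rewrite /q (deriveE b (dDb : differentiable ('D_b phi) a)) -dE -(deriveE b dd).
  apply: near_eq_derive.
  have [r r0 hr] := (openE U).1 oU a Ua; apply/nbhsP; exists r => // a' /hr Ua'.
  have da' : differentiable phi a' := sm [::] a' Ua'.
  have e : b *m jac phi a' = 'D_b phi a'.
    exact: etrans (esym (jacE b da')) (esym (deriveE b da')).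
  exact: (congr1 (dotp v) e).
have [_ _ fJ _] := dC _ Ua; set u := b *m jac phi a.
(* For u = 0 injectivity of the differential gives b = 0 and both sides vanish; otherwise u is
   scaled to unit length. *)
have [u0|u0] := eqVneq u 0.
  have b0 : b = 0 by apply: (row_free_inj fJ); rewrite -/u u0 mul0mx.
  by rewrite u0 dotp0l mulr0 mul0r /q b0 derive0 dotp0r normr0.
have un : 0 < enorm u by rewrite enorm_gt0.
pose s := (enorm u)^-1; pose w := q - q *m proj (jac phi a).
have vq : dotp v q = dotp v w.
  rewrite /w dotpBr; have [c ->] := proj_range (jac phi a) q; by rewrite vT subr0.
have : s ^+ 2 * enorm w <= k.
  apply: hk; exists (phi a), (s *: u), (s ^+ 2 *: w); split.
  - by have [] := hM _ Ua.
  - apply/(param_tangent _ P Ua); exists (s *: b); by rewrite scalemxAl.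
  - by rewrite enormZ ger0_norm ?invr_ge0 ?enorm_ge0 // mulVf // gt_eqF.
  - exists W, U, phi, a, (s *: b), (s *: b); split=> //.
    + by rewrite jacE // -scalemxAl.
    + by rewrite jacE // -scalemxAl.
    + have -> : 'D_(s *: b) ('D_(s *: b) phi) a = s ^+ 2 *: q.
        have -> : 'D_(s *: b) ('D_(s *: b) phi) a = 'D_(s *: b) (s *: 'D_b phi) a.
          apply: near_eq_derive; have [r r0 hr] := (openE U).1 oU a Ua.
          apply/nbhsP; exists r => // a' /hr Ua'.
          have da' : differentiable phi a' := sm [::] a' Ua'.
          have e1 : 'D_(s *: b) phi a' = 'd phi a' (s *: b) := deriveE _ da'.
          have e2 : 'D_b phi a' = 'd phi a' b := deriveE _ da'.
          exact: etrans e1 (etrans (linearZ _ _) (congr1 ( *:%R s) (esym e2))).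
        have dD : differentiable ('D_b phi) a := dDb.
        rewrite (deriveE _ (differentiableZ s dD)) (diffZ s dD) linearZ /= scalerA.
        by rewrite -expr2 /q (deriveE _ dD).
      split.
        apply/(param_tangent _ P Ua); rewrite -scalerBr /w opprB addrC subrK.
        by have [c ->] := proj_range (jac phi a) q; exists (s ^+ 2 *: c); rewrite scalemxAl.
      move=> t /(param_tangent _ P Ua)[c ->]; rewrite dotpZl.
      move: c; suff h : w *m proj (jac phi a) = 0.
        by move=> c; have /(normalP _ fJ) -> := h; rewrite mulr0.
      by rewrite /w mulmxBl -mulmxA proj_idem // subrr.
  - by rewrite enormZ ger0_norm // sqr_ge0.
rewrite vq => h; apply: le_trans (cauchy _ _) _.
rewrite mulrC ler_wpM2r ?enorm_ge0 // -enorm_sqr.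
rewrite -ler_pdivrMr ?exprn_gt0 // mulrC; move: h; rewrite /s exprVn mulrC.
by rewrite mulrC.
Qed.

End FromParametrization.

Section Rescale.
Context {R : realType} {n d : nat}.

(* The image of M under x |-> k (x - c). *)
Definition rescaled (M : set 'rV[R]_d) (c : 'rV[R]_d) (k : R) : set 'rV[R]_d :=
  [set x | M (c + k^-1 *: x)].

Lemma diff_affine (V V' : normedModType R) (f : V -> V') (a : V) (c : V') (k : R) (b : V) :
  differentiable f a -> differentiable (fun x => k *: (f x - c)) a /\
  'd (fun x => k *: (f x - c)) a b = k *: 'd f a b.
Proof.
move=> df; have i1 := is_diffB (differentiableP df) (is_diff_cst c a).
have i2 := is_diffZ k i1.
split; first exact: (@ex_diff _ _ _ _ _ _ _ i2).
rewrite (@diff_val _ _ _ _ _ _ _ i2).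
by rewrite -[LHS]/(k *: ('d f a b - 0)) subr0.
Qed.

Lemma chart_rescale (M W : set 'rV[R]_d) (U : set 'rV[R]_n) phi g J c k : 0 < k ->
  chart M W U phi g J ->
  chart (rescaled M c k) (rescaled W c k) U (fun a => k *: (phi a - c))
    (fun x => g (c + k^-1 *: x)) (fun a => k *: J a).
Proof.
move=> k0 [oW oU hU [hM cg] D]; have kn : k != 0 by rewrite gt_eqF.
have kk y : c + k^-1 *: (k *: (y - c)) = y.
  by rewrite scalerA mulVf // scale1r addrC subrK.
split=> //.
- apply/openE => x; rewrite /rescaled /= => Wx; move/openE: oW => /(_ _ Wx)[r r0 hr].
  exists (k * r); first by rewrite mulr_gt0.
  move=> y xy; apply: hr; rewrite opprD addrACA subrr add0r -scalerBr normrZ.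
  by rewrite gtr0_norm ?invr_gt0 // mulrC ltr_pdivrMr // mulrC.
- by move=> a Ua; rewrite /rescaled /= kk; exact: hU.
- split.
    move=> x Mx Wx; have [? ->] := hM _ Mx Wx; split=> //.
    by rewrite addrAC subrr add0r scalerA mulfV // scale1r.
  apply: (cont_on_comp (B := M `&` W) (f := fun x => c + k^-1 *: x)) => //.
  apply: cont_onD; first exact: cont_on_cst.
  by apply: cont_onZ; [exact: cont_on_cst|exact: cont_on_id].
move=> a Ua; have [df dE fJ dJ] := D _ Ua.
split.
- exact: (diff_affine c k 0 df).1.
- move=> b; have e2 := (diff_affine c k b df).2.
  exact: etrans e2 (etrans (congr1 ( *:%R k) (dE b)) (scalemxAr _ _ _)).
- by rewrite /row_free eqmx_scale.
- exact: mxdiffZ.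
Qed.

Lemma curved_rescale (U : set 'rV[R]_n) (J : 'rV[R]_n -> 'M[R]_(n, d)) k l : 0 < k ->
  (forall a, U a -> mxdiff J a) ->
  curved U J l -> curved U (fun a => k *: J a) (l / k).
Proof.
move=> k0 dJ h a b v Ua vT; have kn : k != 0 by rewrite gt_eqF.
have E : (fun a' => dotp v (b *m (k *: J a'))) = k *: (fun a' => dotp v (b *m J a')).
  by apply/funext => x; rewrite -scalemxAr dotpZr.
have dd : differentiable (fun a' => dotp v (b *m J a')) a.
  apply: differentiable_bigsum => i _; apply: differentiableM.
    exact: differentiable_cst.
  by have := mxdiffM (mxdiff_cst b a) (dJ _ Ua) 0 i.
rewrite E deriveZ; last exact: diff_derivable.
rewrite normrM gtr0_norm // -scalemxAr dotpZl dotpZr.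
have := h a b v Ua _; rewrite -(ler_pM2l k0) => /(_ _)/le_trans -> //.
  move=> c'; have := vT c'; rewrite -scalemxAr dotpZr => /eqP.
  by rewrite mulf_eq0 (negbTE kn) => /eqP.
rewrite le_eqVlt; apply/orP; left; apply/eqP; field.
exact: kn.
Qed.

End Rescale.

(** * Tangential and normal parts of chords *)

Section DerivativeSign.
Context {R : realType}.

Lemma derive_lt0_sign (k : R -> R) (dk : R) : is_derive (0 : R) 1 k dk -> dk < 0 ->
  exists2 r, 0 < r & forall t, 0 < t < r -> k t < k 0 /\ k 0 < k (- t).
Proof.
move=> ik dk0.
have cvgD : (fun t => t^-1 *: (k (t *: (1 : R) + 0) - k 0)) @ (0 : R)^' --> dk.
  by rewrite -(derive_val (is_derive := ik)); exact: (ex_derive (is_derive := ik)).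
move/cvgrPdist_lt: cvgD => /(_ (- dk)); rewrite oppr_gt0 => /(_ dk0).
move=> /nbhs_ballP[r /= r0 hr]; exists r => // t /andP[t0 tr].
have key u : `|u| < r -> u != 0 -> u^-1 * (k u - k 0) < 0.
  move=> ur u0; have := hr u; rewrite /ball /= sub0r normrN => /(_ ur u0).
  by rewrite scaler1 addr0 ltr_norml => /andP[h _]; rewrite -[_ * _]/(u^-1 *: _); lra.
split.
  have := key t; rewrite gtr0_norm // => /(_ tr).
  by rewrite gt_eqF // => /(_ isT); rewrite pmulr_rlt0 ?invr_gt0 // subr_lt0.
have := key (- t); rewrite normrN gtr0_norm // => /(_ tr).
rewrite oppr_eq0 gt_eqF // => /(_ isT); rewrite invrN mulNr oppr_lt0.
by rewrite pmulr_rgt0 ?invr_gt0 // subr_gt0.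
Qed.

Lemma derive_gt0_sign (k : R -> R) (dk : R) : is_derive (0 : R) 1 k dk -> 0 < dk ->
  exists2 r, 0 < r & forall t, 0 < t < r -> k 0 < k t /\ k (- t) < k 0.
Proof.
move=> ik dk0; have iN : is_derive (0 : R) 1 (- k) (- dk) by exact: is_deriveN.
have := derive_lt0_sign iN; rewrite oppr_lt0 => /(_ dk0)[r r0 hr].
by exists r => // t /hr; rewrite /GRing.opp /= !ltrN2 => -[].
Qed.

Lemma diff_add (V : normedModType R) (f g : V -> R) a h :
  differentiable f a -> differentiable g a ->
  'd (fun x => f x + g x) a h = 'd f a h + 'd g a h.
Proof.
move=> df dg; have i := is_diffD (differentiableP df) (differentiableP dg).
exact: (congr1 (fun k => k h) (@diff_val _ _ _ _ _ _ _ i)).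
Qed.

Lemma diff_sub (V : normedModType R) (f g : V -> R) a h :
  differentiable f a -> differentiable g a ->
  'd (fun x => f x - g x) a h = 'd f a h - 'd g a h.
Proof.
move=> df dg; have i := is_diffB (differentiableP df) (differentiableP dg).
exact: (congr1 (fun k => k h) (@diff_val _ _ _ _ _ _ _ i)).
Qed.

Lemma diff_mul (V : normedModType R) (f g : V -> R) a h :
  differentiable f a -> differentiable g a ->
  'd (fun x => f x * g x) a h = f a * 'd g a h + g a * 'd f a h.
Proof.
move=> df dg; have i := is_diffM (differentiableP df) (differentiableP dg).
exact: (congr1 (fun k => k h) (@diff_val _ _ _ _ _ _ _ i)).
Qed.

Lemma diff_const (V : normedModType R) (c : R) (a h : V) : 'd (fun=> c) a h = 0.
Proof. exact: (congr1 (fun k => k h) (@diff_val _ _ _ _ _ _ _ (is_diff_cst c a))). Qed.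

Lemma diff_bigsum (V : normedModType R) (I : Type) (r : seq I) (f : I -> V -> R) a h :
  (forall i, differentiable (f i) a) ->
  'd (fun x => \sum_(i <- r) f i x) a h = \sum_(i <- r) 'd (f i) a h.
Proof.
move=> df; elim: r => [|i r IH].
  rewrite big_nil (_ : (fun _ => _) = (fun=> 0)); first exact: diff_const.
  by apply/funext => x; rewrite big_nil.
rewrite big_cons -IH (_ : (fun _ => _) = (fun x => f i x + \sum_(i <- r) f i x)).
  by apply: diff_add; [exact: df|exact: differentiable_bigsum].
by apply/funext => x; rewrite big_cons.
Qed.

Lemma diff_dotp_coord (V : normedModType R) {m} (F G : V -> 'rV[R]_m) (a h : V) :
  mxdiff F a -> mxdiff G a ->
  differentiable (fun x => dotp (F x) (G x)) a /\
  'd (fun x => dotp (F x) (G x)) a h =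
    dotp (\row_j 'd (fun x => F x 0 j) a h) (G a) + dotp (F a) (\row_j 'd (fun x => G x 0 j) a h).
Proof.
move=> dF dG; have dFG j : differentiable (fun x => F x 0 j * G x 0 j) a.
  by apply: differentiableM.
split; first exact: differentiable_bigsum.
have e1 := @diff_bigsum V _ (index_enum 'I_m) (fun j x => F x 0 j * G x 0 j) a h dFG.
transitivity (\sum_j 'd (fun x => F x 0 j * G x 0 j) a h); first exact: e1.
rewrite /dotp -big_split /=; apply: eq_bigr => j _; rewrite !mxE.
rewrite (diff_mul h (dF 0 j) (dG 0 j)) addrC; congr (_ + _); exact: mulrC.
Qed.

Lemma is_derive_sqr (f : R -> R) (df : R) : is_derive (0 : R) 1 f df ->
  is_derive (0 : R) 1 (fun t => f t ^+ 2) (2 * f 0 * df).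
Proof.
move=> h; have h2 := is_deriveM h h.
apply: is_derive_eq h2 _; rewrite /GRing.scale /=; ring.
Qed.

Lemma is_derive_affine (c0 c : R) : is_derive (0 : R) 1 (fun t : R => c0 + c * t) c.
Proof.
have h1 := is_deriveM (is_derive_cst c (0 : R) (1 : R)) (is_derive_id (0 : R) (1 : R)).
have h := is_deriveD (is_derive_cst c0 (0 : R) (1 : R)) h1.
by apply: is_derive_eq h _; rewrite /GRing.scale /=; ring.
Qed.

Lemma is_derive_mulc (l : R) (f : R -> R) (df : R) : is_derive (0 : R) 1 f df ->
  is_derive (0 : R) 1 (fun t => l * f t) (l * df).
Proof. by move=> h; exact: (is_deriveZ l h). Qed.

End DerivativeSign.

(** * Derivatives of the distance and of the normal part of a chord *)

Section Ambient.
Context {R : realType} {n d : nat}.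

Definition nu (P : 'M[R]_d) (z : 'rV[R]_d) := z - z *m P.

Definition oproj (P : 'M[R]_d) := P^T = P /\ P *m P = P.

Lemma oproj_dotp P z w : oproj P -> dotp (z *m P) w = dotp z (w *m P).
Proof. by move=> [sP _]; rewrite dotp_mulmx sP. Qed.

Lemma nu_tan P z w : oproj P -> dotp (nu P z) (w *m P) = 0.
Proof.
by move=> oP; rewrite /nu dotpBl (oproj_dotp z _ oP) -mulmxA oP.2 subrr.
Qed.

Lemma nu_proj P z : oproj P -> nu P z *m P = 0.
Proof. by move=> oP; rewrite /nu mulmxBl -mulmxA oP.2 subrr. Qed.

Lemma pythagoras P z : oproj P -> dotp z z = dotp (z *m P) (z *m P) + dotp (nu P z) (nu P z).
Proof.
move=> oP; have h := nu_tan z z oP.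
have E : z = nu P z + z *m P by rewrite /nu subrK.
rewrite [LHS](_ : _ = dotp (nu P z + z *m P) (nu P z + z *m P)); last by rewrite -E.
move: h {E}; move: (nu P z) (z *m P) => v t h.
rewrite dotpDl !dotpDr (dotpC t v) h; lra.
Qed.

Lemma nuB P z w : nu P (z - w) = nu P z - nu P w.
Proof.
rewrite /nu mulmxBl; move: (z *m P) (w *m P) => a b.
by apply/rowP => i; rewrite !mxE; ring.
Qed.

Lemma nu_le P z : oproj P -> dotp (nu P z) (nu P z) <= dotp z z.
Proof. by move=> oP; rewrite (pythagoras z oP) lerDr dotp_ge0. Qed.

Lemma nu_self P z : oproj P -> dotp (nu P z) z = dotp (nu P z) (nu P z).
Proof. by move=> oP; rewrite [X in _ = dotp _ X]/nu dotpBr nu_tan // subr0. Qed.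

Variables (M W : set 'rV[R]_d) (U : set 'rV[R]_n) (phi : 'rV[R]_n -> 'rV[R]_d)
  (g : 'rV[R]_d -> 'rV[R]_n) (J : 'rV[R]_n -> 'M[R]_(n, d)).
Hypotheses (C : chart M W U phi g J) (cJ : curved U J 2).

Lemma chart_oproj a : U a -> oproj (proj (J a)).
Proof.
by case: C => _ _ _ _ D Ua; have [_ _ fJ _] := D _ Ua; split; [exact: proj_sym|exact: proj_idem].
Qed.

(** The acceleration at a of the curve phi (a + t b). *)
Definition acc b a : 'rV[R]_d := \row_j 'd (fun a' => (b *m J a') 0 j) a b.

Lemma acc_derive a b v : U a -> 'D_b (fun a' => dotp v (b *m J a')) a = dotp v (acc b a).
Proof.
case: C => _ _ _ _ D Ua; have [_ _ fJ dJ] := D _ Ua.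
have dbJ := mxdiffM (mxdiff_cst b a) dJ.
have [df dfE] := diff_dotp_coord b (mxdiff_cst v a) dbJ.
rewrite (deriveE _ df) dfE /acc.
have -> : \row_j 'd (fun=> v 0 j) a b = 0 by apply/rowP => j; rewrite !mxE diff_const.
by rewrite dotp0l add0r.
Qed.

Lemma acc_bound a b v : U a -> v *m proj (J a) = 0 ->
  `|dotp v (acc b a)| <= 2 * dotp (b *m J a) (b *m J a) * enorm v.
Proof.
move=> Ua v0; rewrite -acc_derive //; apply: cJ => //.
apply/normalP => //; by case: C => _ _ _ _ D; have [] := D _ Ua.
Qed.

Lemma phi_mxdiff a : U a -> mxdiff phi a.
Proof.
case: C => _ _ _ _ D Ua i j; have [df _ _ _] := D _ Ua; rewrite ord1.
by have [] := diff_coord 0 0 j df.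
Qed.

Lemma proj_mxdiff a : U a -> mxdiff (fun a' => proj (J a')) a.
Proof.
case: C => _ _ _ _ D Ua; have [_ _ fJ dJ] := D _ Ua.
have dT : mxdiff (fun x => (J x)^T) a by exact: mxdiffT.
have dG : mxdiff (fun x => J x *m (J x)^T) a by exact: (mxdiffM (A := J) (B := fun x => (J x)^T)).
have dI := mxdiff_inv (A := fun x => J x *m (J x)^T) (gram_unit fJ) dG.
have dK := mxdiffM (A := fun x => (J x)^T) dT dI.
exact: (mxdiffM (A := fun x => (J x)^T *m ((\det (J x *m (J x)^T))^-1 *: \adj (J x *m (J x)^T))) (B := J) dK dJ).
Qed.

Definition sqdist (p : 'rV[R]_d) (a : 'rV[R]_n) := dotp (phi a - p) (phi a - p).
Definition sqnu (p : 'rV[R]_d) (a : 'rV[R]_n) :=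
  dotp (nu (proj (J a)) (phi a - p)) (nu (proj (J a)) (phi a - p)).

Lemma phiB_diff p a b : U a -> mxdiff (fun a' => phi a' - p) a /\
  (\row_j 'd (fun a' => (phi a' - p) 0 j) a b) = b *m J a.
Proof.
move=> Ua; split; first exact: mxdiffB (phi_mxdiff Ua) (mxdiff_cst _ _).
case: C => _ _ _ _ D; have [df dE _ _] := D _ Ua.
apply/rowP => j; rewrite mxE.
have -> : (fun a' => (phi a' - p) 0 j) = (fun a' => phi a' 0 j - p 0 j).
  by apply/funext => x; rewrite !mxE.
have [h1 h2] := diff_coord b 0 j df.
have e1 := diff_sub b h1 (differentiable_cst (p 0 j) a).
have e2 := diff_const (p 0 j) a b.
apply: (etrans e1); apply: (etrans (congr1 (fun t => _ - t) e2)).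
by apply: (etrans (subr0 _)); apply: (etrans h2); rewrite dE.
Qed.

Lemma sqdist_diff p a b : U a -> differentiable (sqdist p) a /\
  'd (sqdist p) a b = 2 * dotp (phi a - p) (b *m J a).
Proof.
move=> Ua; have [d1 dE] := phiB_diff p b Ua.
have [h1 h2] := diff_dotp_coord b d1 d1; split=> //.
by rewrite /sqdist h2 dE (dotpC (b *m J a)); ring.
Qed.

Lemma sqnu_diff p a : U a -> differentiable (sqnu p) a.
Proof.
move=> Ua; have [d1 _] := phiB_diff p 0 Ua.
have d2 : mxdiff (fun a' => nu (proj (J a')) (phi a' - p)) a.
  by apply: (mxdiffB d1); apply: mxdiffM d1 (proj_mxdiff Ua).
exact: (diff_dotp_coord 0 d2 d2).1.
Qed.

Lemma line_in a b : U a -> exists2 r : R, 0 < r & forall t, `|t| < r -> U (a + t *: b).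
Proof.
move=> Ua; case: C => _ oU _ _ _; have [r r0 hr] := (openE U).1 oU a Ua.
exists (r / (`|b| + 1)); first by rewrite divr_gt0 // ltr_wpDl.
move=> t tr; apply: hr; rewrite opprD addNKr normrN normrZ.
have b1 : 0 < `|b| + 1 by rewrite ltr_wpDl.
move: tr; rewrite ltr_pdivlMr // => /(le_lt_trans _); apply.
by rewrite ler_wpM2l // lerDl.
Qed.

Lemma is_derive_chart (F : 'rV[R]_n -> R) a b : differentiable F a ->
  is_derive (0 : R) 1 (fun t : R => F (a + t *: b)) ('d F a b).
Proof.
move=> dF; have a0 : a + (0 : R) *: b = a by rewrite scale0r addr0.
have h : differentiable F (a + (0 : R) *: b) by rewrite a0.
exact: is_derive_eq (is_derive_line h) (congr1 (fun x => 'd F x b) a0).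
Qed.

(* Along the tangential part b J of phi - p, the normal part of phi - p is the
   smallest vector phi - p - w with w tangent, and the choice w = b J gives an upper
   bound touching at the base point. *)
Lemma sqnu_derive p a b : U a -> (phi a - p) *m proj (J a) = b *m J a ->
  'd (sqnu p) a b = - 2 * dotp (nu (proj (J a)) (phi a - p)) (acc b a).
Proof.
move=> Ua bT; set v := nu _ _.
have vE : v = phi a - p - b *m J a by rewrite /v /nu bT.
case: (C) => _ _ _ _ D; have [_ _ fJ dJ] := D _ Ua.
have dbJ := mxdiffM (mxdiff_cst b a) dJ.
have [d1 dE] := phiB_diff p b Ua.
have dF : mxdiff (fun a' => phi a' - p - b *m J a') a by exact: mxdiffB d1 dbJ.
have FE : \row_j 'd (fun a' => (phi a' - p - b *m J a') 0 j) a b = b *m J a - acc b a.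
  rewrite -dE /acc; apply/rowP => j; rewrite !mxE.
  rewrite (_ : (fun a' => (phi a' - p - b *m J a') 0 j) =
     (fun a' => (phi a' - p) 0 j - (b *m J a') 0 j)); last first.
    by apply/funext => x; move: (phi x - p) (b *m J x) => u w; rewrite !mxE.
  exact: (diff_sub b (d1 0 j) (dbJ 0 j)).
have [dU UE] := diff_dotp_coord b dF dF.
rewrite FE -vE in UE.
have vJ : dotp v (b *m J a) = 0.
  by rewrite -(proj_id b fJ) /v; apply: nu_tan; exact: chart_oproj.
have [r r0 hr] := line_in b Ua.
have aux (u x y : 'rV[R]_d) : dotp u x = 0 ->
    dotp (x - y) u + dotp u (x - y) = - 2 * dotp u y.
  by move=> ux; rewrite dotpBl dotpBr (dotpC x) (dotpC y) ux; ring.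
have key := touching_derive r0 (is_derive_chart b (sqnu_diff p Ua)) (is_derive_chart b dU).
apply: etrans (key _ _) (etrans UE (aux _ _ _ vJ)).
- by rewrite scale0r addr0 -vE.
move=> t /hr Ut; rewrite /sqnu; have oP := chart_oproj Ut.
have E : nu (proj (J (a + t *: b))) (phi (a + t *: b) - p) =
    nu (proj (J (a + t *: b))) (phi (a + t *: b) - p - b *m J (a + t *: b)).
  rewrite [in RHS]nuB [X in _ = _ - X]/nu proj_id ?subrr ?subr0 //.
  by have [_ _ ? _] := D _ Ut.
by rewrite E; exact: nu_le.
Qed.

End Ambient.

Section ContVec.
Context {R : realType} {V : normedModType R}.
Implicit Types A : set V.

Lemma cont_on_bigsum A (I : Type) (r : seq I) (f : I -> V -> R) :
  (forall i, cont_on A (f i)) -> cont_on A (fun x => \sum_(i <- r) f i x).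
Proof.
move=> cf; elim: r => [|i r IH].
  apply: (cont_on_ext (f := fun=> 0)) => [x _|]; [by rewrite big_nil|exact: cont_on_cst].
apply: (cont_on_ext (f := fun x => f i x + \sum_(i <- r) f i x)) => [x _|].
  by rewrite big_cons.
by apply: cont_onD.
Qed.

Lemma cont_on_coord A {m p} (F : V -> 'M[R]_(m, p)) i j :
  cont_on A F -> cont_on A (fun x => F x i j).
Proof.
move=> cF x Ax e e0; have [r r0 hr] := cF x Ax e e0; exists r => // y Ay /(hr y Ay).
apply: le_lt_trans; rewrite [leRHS]/Num.norm /= mx_normrE.
apply: le_trans (le_bigmax _ _ (i, j)) => //=; by rewrite !mxE.
Qed.

Lemma cont_on_dotp A {m} (F G : V -> 'rV[R]_m) :
  (forall j, cont_on A (fun x => F x 0 j)) -> (forall j, cont_on A (fun x => G x 0 j)) ->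
  cont_on A (fun x => dotp (F x) (G x)).
Proof. by move=> cF cG; apply: cont_on_bigsum => j; exact: cont_onM. Qed.

End ContVec.

(** * Chords of a set covered by charts *)

Section Charted.
Context {R : realType} {n d : nat}.

Definition good_chart (M W : set 'rV[R]_d) (U : set 'rV[R]_n) phi g J :=
  chart M W U phi g J /\ curved U J 2.

Definition charted (M : set 'rV[R]_d) : Prop := forall p, M p ->
  exists W (U : set 'rV[R]_n) phi g J, good_chart M W U phi g J /\ W p.

Variable M : set 'rV[R]_d.
Hypothesis hC : charted M.

(** Projection onto the tangent space at x, read in an arbitrary chart around x; by [PiE] every
    chart gives the same matrix. *)
Definition Pi (x : 'rV[R]_d) : 'M[R]_d :=
  get [set P | exists W (U : set 'rV[R]_n) phi g J,
    [/\ good_chart M W U phi g J, W x & P = proj (J (g x))]].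

Lemma PiE W (U : set 'rV[R]_n) phi g J x : chart M W U phi g J -> M x -> W x ->
  Pi x = proj (J (g x)).
Proof.
move=> C Mx Wx; have [W' [U' [phi' [g' [J' [gc' Wx']]]]]] := hC Mx.
rewrite /Pi; case: xgetP => [P -> {P}|/(_ (proj (J' (g' x)))) []]; last first.
  by exists W', U', phi', g', J'.
move=> [W2 [U2 [f2 [g2 [J2 [[C2 _] W2x ->]]]]]].
have [_ _ _ [h1 _] _] := C; have [_ _ _ [h2 _] _] := C2.
have [Ux fx] := h1 _ Mx Wx; have [U2x f2x] := h2 _ Mx W2x.
by apply: (chart_proj C2 C) => //; rewrite fx f2x.
Qed.

Lemma chart_at x : M x -> exists W (U : set 'rV[R]_n) phi g J,
  [/\ good_chart M W U phi g J, W x, U (g x), phi (g x) = x & Pi x = proj (J (g x))].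
Proof.
move=> Mx; have [W [U [phi [g [J [gc Wx]]]]]] := hC Mx.
exists W, U, phi, g, J; have [C _] := gc; have [_ _ _ [h1 _] _] := C.
by have [? ?] := h1 _ Mx Wx; split=> //; exact: (PiE C).
Qed.

Lemma Pi_oproj x : M x -> oproj (Pi x).
Proof.
move=> /chart_at[W [U [phi [g [J [[C _] Wx Ux fx ->]]]]]].
exact: (chart_oproj C).
Qed.

Definition dist2 (x p : 'rV[R]_d) := dotp (x - p) (x - p).
Definition norm2 (x p : 'rV[R]_d) := dotp (nu (Pi x) (x - p)) (nu (Pi x) (x - p)).
Definition tang (x p : 'rV[R]_d) := (x - p) *m Pi x.

Lemma dist2_ge0 x p : 0 <= dist2 x p. Proof. exact: dotp_ge0. Qed.

Lemma dist2C x p : dist2 x p = dist2 p x.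
Proof. by rewrite /dist2 -opprB dotpNl dotpNr opprK. Qed.

Lemma dist2_eq0 x p : (dist2 x p == 0) = (x == p).
Proof. by rewrite /dist2 dotp_eq0 subr_eq0. Qed.

Lemma dist2xx x : dist2 x x = 0. Proof. by apply/eqP; rewrite dist2_eq0. Qed.

Lemma norm2_ge0 x p : 0 <= norm2 x p. Proof. exact: dotp_ge0. Qed.

Lemma tang_sqr x p : M x -> dotp (tang x p) (tang x p) = dist2 x p - norm2 x p.
Proof.
move=> Mx; have := pythagoras (x - p) (Pi_oproj Mx).
rewrite -/(dist2 x p) -/(norm2 x p) -/(tang x p); lra.
Qed.

Lemma norm2_le x p : M x -> norm2 x p <= dist2 x p.
Proof. by move=> Mx; rewrite -subr_ge0 -tang_sqr // dotp_ge0. Qed.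

Lemma tang_gt0 x p : M x -> norm2 x p != dist2 x p -> 0 < dotp (tang x p) (tang x p).
Proof. by move=> Mx h; rewrite tang_sqr // subr_gt0 lt_neqAle h norm2_le. Qed.

Lemma norm2xx x : norm2 x x = 0.
Proof. by rewrite /norm2 subrr /nu mul0mx subrr dotp0l. Qed.

Lemma cont_dist2 : cont_on setT (fun q : 'rV[R]_d * 'rV[R]_d => dist2 q.1 q.2).
Proof.
have c : cont_on setT (fun q : 'rV[R]_d * 'rV[R]_d => q.1 - q.2).
  by apply: cont_onB; [exact: cont_on_fst|exact: cont_on_snd].
by apply: cont_on_dotp => j; exact: cont_on_coord.
Qed.

Lemma cont_Pi i j : cont_on M (fun x => Pi x i j).
Proof.
move=> x Mx e e0; have [W [U [phi [g [J [[C _] Wx Ux fx PE]]]]]] := chart_at Mx.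
have [q q0 hq] := differentiable_cvg (proj_mxdiff C Ux i j) e0.
have [oW _ _ [_ cg] _] := C.
have [r r0 hr] := cg x (conj Mx Wx) q q0.
have [w w0 hw] := (openE W).1 oW x Wx.
exists (Num.min r w); first by rewrite lt_min r0.
move=> y My; rewrite lt_min => /andP[xr /hw Wy].
by rewrite PE (PiE C My Wy); apply: hq; apply: hr.
Qed.

Lemma cont_norm2 : cont_on (M `*` setT) (fun q : 'rV[R]_d * 'rV[R]_d => norm2 q.1 q.2).
Proof.
have c : cont_on (M `*` setT) (fun q : 'rV[R]_d * 'rV[R]_d => q.1 - q.2).
  by apply: cont_onB; [exact: cont_on_fst|exact: cont_on_snd].
have cn j : cont_on (M `*` setT)
    (fun q : 'rV[R]_d * 'rV[R]_d => nu (Pi q.1) (q.1 - q.2) 0 j).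
  apply: (cont_on_ext (f := fun q : 'rV[R]_d * 'rV[R]_d =>
     (q.1 - q.2) 0 j - \sum_k (q.1 - q.2) 0 k * Pi q.1 k j)).
    by move=> q _; rewrite /nu; move: (q.1 - q.2) => z; rewrite !mxE.
  apply: cont_onB; first exact: cont_on_coord.
  apply: cont_on_bigsum => k; apply: cont_onM; first exact: cont_on_coord.
  have cf : cont_on (M `*` setT) (fst : 'rV[R]_d * 'rV[R]_d -> 'rV[R]_d) by exact: cont_on_fst.
  have MM : forall q, (M `*` [set: 'rV[R]_d]) q -> M q.1 by move=> q [].
  exact: (cont_on_comp MM cf (cont_Pi k j)).
exact: cont_on_dotp.
Qed.

(** With h = g x - g p, both the chord x - p and the tangent vector h J(g x) equal h J(a0) up to an
    error small against |h|. If the tangential part of the chord vanished they would be orthogonal,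
    against |h| <= B |h J(a0)|. *)
Lemma noncrit_near_diag x0 : M x0 -> exists2 e, 0 < e & forall x p, M x -> M p ->
  `|x0 - x| < e -> `|x0 - p| < e -> x <> p -> norm2 x p <> dist2 x p.
Proof.
move=> Mx0; have [W [U [phi [g [J [[C _] Wx Ux fx PE]]]]]] := chart_at Mx0.
set a0 := g x0 in Ux fx PE; have [oW _ hM [hg cg] D] := C.
have [_ _ fJ _] := D _ Ux.
have [B B0 hB] := mulmx_lipschitz (pinvmx (J a0)).
have [A A0 hA] := mulmx_lipschitz (J a0).
have [K K0 hK] := @enorm_lipschitz R d.
pose L := K ^+ 2 * (2 * A + 1) * B ^+ 2 + 1.
have L0 : 0 < L.
  rewrite ltr_wpDl // !mulr_ge0 ?sqr_ge0 //; have := ltW A0; lra.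
pose e := Num.min 1 (1 / (2 * L)).
have e0 : 0 < e by rewrite lt_min ltr01 divr_gt0 // mulr_gt0.
have [e1 eL] : e <= 1 /\ e * L <= 1 / 2.
  split; first by rewrite ge_min lexx.
  rewrite -ler_pdivlMr // (le_trans (_ : _ <= 1 / (2 * L))) ?ge_min ?lexx ?orbT //.
  by rewrite invfM mulrA.
have [r1 r10 s1] := chart_strict_diff C Ux e0.
have [r2 r20 s2] := chart_jac_close C Ux e0.
have r120 : 0 < Num.min r1 r2 by rewrite lt_min r10.
have [q q0 hq] := cg x0 (conj Mx0 Wx) _ r120.
have [w w0 hw] := (openE W).1 oW x0 Wx.
exists (Num.min q w); first by rewrite lt_min q0.
move=> x p Mx Mp; rewrite !lt_min => /andP[xq /hw Wx'] /andP[pq /hw Wp] xp crit.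
have := hq _ (conj Mx Wx') xq; rewrite lt_min => /andP[ar1 ar2].
have := hq _ (conj Mp Wp) pq; rewrite lt_min => /andP[br1 br2].
have [Ua fa] := hg _ Mx Wx'; have [Ub fb] := hg _ Mp Wp.
pose h := g x - g p.
have hn : 0 < `|h|.
  rewrite normr_gt0 subr_eq0; apply/eqP => E; apply: xp.
  by rewrite -fa -fb E.
have [_ E1] := s1 _ _ ar1 br1; rewrite fa fb -/h in E1.
have [_ E2] := s2 _ ar2; have {}E2 := E2 h.
have T0 : tang x p = 0.
  by apply/eqP; rewrite -dotp_eq0 tang_sqr // crit subrr.
have orth : dotp (x - p) (h *m J (g x)) = 0.
  have [_ _ fJx _] := D _ Ua.
  rewrite -(proj_id h fJx) -dotp_proj -(PiE C Mx Wx') -/(tang x p) T0.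
  by rewrite dotp0l.
pose u := h *m J a0; pose v1 := x - p - u; pose v2 := h *m (J (g x) - J a0).
have ex : x - p = u + v1 by rewrite /v1 [RHS]addrC subrK.
have ej : h *m J (g x) = u + v2 by rewrite /v2 mulmxBr [RHS]addrC subrK.
have ulow : `|h| <= B * `|u|.
  by rewrite -{1}[h]mulmx1 -(mulmxVp fJ) mulmxA hB.
have uup : `|u| <= A * `|h| by exact: hA.
have dl (y z : 'rV[R]_d) Y Z : `|y| <= Y -> `|z| <= Z -> - (K ^+ 2 * (Y * Z)) <= dotp y z.
  move=> yY zZ; have := cauchy y z; rewrite ler_norml => /andP[+ _].
  apply: le_trans; rewrite lerN2.
  have y0 := normr_ge0 y; have z0 := normr_ge0 z.
  apply: le_trans (ler_pM (enorm_ge0 y) (enorm_ge0 z) (hK y) (hK z)) _.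
  rewrite mulrACA -expr2; apply: ler_wpM2l; first by rewrite sqr_ge0.
  by apply: ler_pM.
have uu : `|u| ^+ 2 <= dotp u u.
  by rewrite -enorm_sqr ler_sqr ?nnegrE ?enorm_ge0 // le_norm_enorm.
have d1 := dl u v2 _ _ uup E2; have d2 := dl v1 u _ _ E1 uup; have d3 := dl v1 v2 _ _ E1 E2.
move: orth; rewrite ex ej dotpDl !dotpDr => orth.
have hB2 : `|h| ^+ 2 <= B ^+ 2 * `|u| ^+ 2.
  have Bu : 0 <= B * `|u| by rewrite mulr_ge0 // ltW.
  by rewrite -exprMn ler_sqr ?nnegrE.
have : `|h| ^+ 2 <= B ^+ 2 * (K ^+ 2 * (`|h| ^+ 2 * e * (2 * A + e))).
  apply: le_trans hB2 _; rewrite ler_pM2l ?exprn_gt0 //.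
  apply: le_trans uu _; rewrite -subr_ge0; move: d1 d2 d3 orth; lra.
have : B ^+ 2 * (K ^+ 2 * (`|h| ^+ 2 * e * (2 * A + e))) <= `|h| ^+ 2 * (e * (L - 1)).
  rewrite /L addrK.
  have -> : B ^+ 2 * (K ^+ 2 * (`|h| ^+ 2 * e * (2 * A + e))) =
     `|h| ^+ 2 * (e * (K ^+ 2 * (2 * A + e) * B ^+ 2)) by ring.
  apply: ler_wpM2l; first by rewrite sqr_ge0.
  apply: ler_wpM2l; first exact: ltW.
  apply: ler_wpM2r; first by rewrite sqr_ge0.
  by apply: ler_wpM2l; [rewrite sqr_ge0|rewrite lerD2l].
have h2 : 0 < `|h| ^+ 2 by rewrite exprn_gt0.
have : e * (L - 1) <= 1 / 2 by rewrite mulrBr mulr1; lra.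
rewrite -(ler_pM2l h2); lra.
Qed.

Lemma line_near W (U : set 'rV[R]_n) phi g J a b (e : R) : chart M W U phi g J -> U a -> 0 < e ->
  exists2 r : R, 0 < r & forall t, `|t| < r ->
    [/\ U (a + t *: b), M (phi (a + t *: b)), W (phi (a + t *: b)),
        g (phi (a + t *: b)) = a + t *: b & `|phi a - phi (a + t *: b)| < e].
Proof.
move=> C Ua e0; have [r r0 hr] := line_in C b Ua.
have [q q0 hq] := chart_cont C Ua e0; have [_ _ hM _ _] := C.
have b1 : 0 < `|b| + 1 by rewrite ltr_wpDl.
exists (Num.min r (q / (`|b| + 1))); first by rewrite lt_min r0 divr_gt0.
move=> t; rewrite lt_min => /andP[/hr Ut tq]; have [? ? ?] := hM _ Ut; split=> //.
apply: hq => //; rewrite opprD addNKr normrN normrZ.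
move: tq; rewrite ltr_pdivlMr // => /(le_lt_trans _); apply.
by rewrite ler_wpM2l // lerDl.
Qed.

Lemma sqnu_norm2 W (U : set 'rV[R]_n) phi g J a p : chart M W U phi g J -> U a ->
  sqnu phi J p a = norm2 (phi a) p.
Proof.
move=> C Ua; have [_ _ hM _ _] := C; have [Ma Wa ga] := hM _ Ua.
by rewrite /norm2 (PiE C Ma Wa) ga.
Qed.

Lemma tang_lift W (U : set 'rV[R]_n) phi g J x p : chart M W U phi g J -> M x -> W x ->
  exists b, [/\ b *m J (g x) = tang x p, (x - p) *m proj (J (g x)) = b *m J (g x) &
   dotp (x - p) (b *m J (g x)) = dotp (tang x p) (tang x p)].
Proof.
move=> C Mx Wx; have [b E] := proj_range (J (g x)) (x - p); exists b.
have bT : b *m J (g x) = tang x p by rewrite -E /tang (PiE C Mx Wx).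
split=> //; rewrite bT /tang (oproj_dotp _ _ (Pi_oproj Mx)) -mulmxA.
by rewrite (Pi_oproj Mx).2.
Qed.

(* Moving towards p along the tangential part T of p - x decreases |nu| at rate at most
   2 |T|^2, which is the rate of decrease of s^2. *)
Lemma descend x p l e : M x -> norm2 x p != dist2 x p -> 0 < norm2 x p -> 1 < l -> 0 < e ->
  exists y, [/\ M y, `|x - y| < e, dist2 y p < dist2 x p &
    Num.sqrt (norm2 x p) - l * dist2 x p < Num.sqrt (norm2 y p) - l * dist2 y p].
Proof.
move=> Mx nc n0 l1 e0.
(* The intermediate l' makes both derivatives below strict. |nu|^2 is compared with the square of
   the affine function [lam], of slope 2 l' |T|^2, so that no square root is differentiated, and s^2
   with an affine function of slope 2 (l'/l) |T|^2. Since b lifts the tangential part of x - p, the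
   point moves along -b. *)
have [l' [l'1 l'l]] : exists l', 1 < l' /\ l' < l by exists ((1 + l) / 2); lra.
have sc1 (X s T : R) : X <= 4 * T * s -> 0 < s * T * (l' - 1) -> X - 2 * s * (2 * l' * T) < 0.
  lra.
have sc2 (T r : R) : 0 < (1 - r) * T -> 0 < 2 * T - 2 * r * T by lra.
have l0 : 0 < l by lra.
have l'0 : 0 < l' by lra.
have sc3 (s T t : R) : t * (2 * l' * T) < s -> 0 < s + 2 * l' * T * - t by lra.
have sc5 (A B X : R) : 0 < X -> A - (- X) < B -> A < B by lra.
have sc6 (s q A B X Y : R) : s - Y < q -> l * X = Y -> l * (A - - X) < l * B ->
    s - l * B < q - l * A by lra.
have sc7 (Y X s : R) : `|X| <= 2 * Y * s -> - 2 * X <= 4 * Y * s.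
  by rewrite ler_norml => /andP[? _]; lra.
 have [W [U [phi [g [J [[C cJ] Wx Ux fx PE]]]]]] := chart_at Mx.
have [b [bT bP bd]] := tang_lift p C Mx Wx.
have T0 := tang_gt0 Mx nc; set T2 := dotp _ _ in T0 bd.
set a := g x in Ux fx PE bT bP bd.
pose s0 := Num.sqrt (norm2 x p); have s00 : 0 < s0 by rewrite sqrtr_gt0.
have s02 : s0 ^+ 2 = norm2 x p by rewrite sqr_sqrtr // ltW.
have [dD DE] := sqdist_diff C p b Ux.
have dN := sqnu_diff C p Ux.
rewrite fx bd in DE.
have NE : 'd (sqnu phi J p) a b <= 4 * T2 * s0.
  rewrite (sqnu_derive C) ?fx //.
  have v0 : nu (proj (J a)) (x - p) *m proj (J a) = 0 by apply: nu_proj; rewrite -PE; exact: Pi_oproj.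
  have := acc_bound C cJ b Ux v0; rewrite bT -/T2 -PE /enorm -/(norm2 x p) -/s0.
  exact: sc7.
pose lam t := s0 + 2 * l' * T2 * t.
have i1 : is_derive (0 : R) 1 (fun t => sqnu phi J p (a + t *: b) - lam t ^+ 2)
    ('d (sqnu phi J p) a b - 2 * s0 * (2 * l' * T2)).
  have h1 := is_derive_chart b dN.
  have h2 := is_derive_sqr (is_derive_affine s0 (2 * l' * T2)).
  rewrite mulr0 addr0 in h2.
  exact: is_deriveB.
have i1n : 'd (sqnu phi J p) a b - 2 * s0 * (2 * l' * T2) < 0.
  by apply: (sc1 _ _ _ NE); rewrite !mulr_gt0 // subr_gt0.
have i2 : is_derive (0 : R) 1 (fun t => sqdist phi p (a + t *: b) - 2 * (l' / l) * T2 * t)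
    (2 * T2 - 2 * (l' / l) * T2).
  have h1 := is_derive_chart b dD; rewrite DE in h1.
  have h3 : is_derive (0 : R) 1 (fun t => 2 * (l' / l) * T2 * t) (2 * (l' / l) * T2).
    have := is_derive_affine 0 (2 * (l' / l) * T2).
    by rewrite (_ : (fun t => _) = (fun t => 2 * (l' / l) * T2 * t)) //; apply/funext => t; rewrite add0r.
  exact: is_deriveB.
have lr : l' / l < 1 by rewrite ltr_pdivrMr // mul1r.
have lr0 : 0 < l' / l by rewrite divr_gt0.
have i2p : 0 < 2 * T2 - 2 * (l' / l) * T2.
  by apply: sc2; rewrite mulr_gt0 // subr_gt0.
have [r1 r10 h1] := derive_lt0_sign i1 i1n.
have [r2 r20 h2] := derive_gt0_sign i2 i2p.
have [r3 r30 h3] := line_near b C Ux e0.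
pose t := Num.min (Num.min r1 r2) (Num.min r3 (s0 / (2 * l' * T2))) / 2.
have lT : 0 < 2 * l' * T2 by rewrite !mulr_gt0.
have m0 : 0 < Num.min (Num.min r1 r2) (Num.min r3 (s0 / (2 * l' * T2))).
  by rewrite !lt_min r10 r20 r30 divr_gt0.
have t0 : 0 < t by rewrite /t divr_gt0.
have tm : t < Num.min (Num.min r1 r2) (Num.min r3 (s0 / (2 * l' * T2))).
  by rewrite /t ltr_pdivrMr // ltr_pMr // ltr1n.
move: tm; rewrite !lt_min => /andP[/andP[tr1 tr2] /andP[tr3 tr4]].
have := h3 (- t); rewrite normrN gtr0_norm // => /(_ tr3)[Ut Mt Wt gt ft].
exists (phi (a + - t *: b)).
have [_] := h1 t (introT andP (conj t0 tr1)).
rewrite /lam scale0r addr0 mulr0 addr0 (sqnu_norm2 _ C Ux) (sqnu_norm2 _ C Ut) fx s02 subrr.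
rewrite subr_gt0 => hN.
have [_] := h2 t (introT andP (conj t0 tr2)).
rewrite scale0r addr0 mulr0 subr0 /sqdist fx -/(dist2 _ _) -/(dist2 _ _) => hD.
have lamp : 0 < s0 + 2 * l' * T2 * - t.
  by apply: sc3; rewrite -ltr_pdivlMr.
have sN : s0 + 2 * l' * T2 * - t < Num.sqrt (norm2 (phi (a + - t *: b)) p).
  by rewrite -(ger0_norm (ltW lamp)) -sqrtr_sqr ltr_sqrt // (le_lt_trans _ hN) // sqr_ge0.
have rT : 0 < 2 * (l' / l) * T2 * t by rewrite mulr_gt0 // mulr_gt0 // mulr_gt0.
split=> //; first by rewrite -fx.
- by rewrite mulrN in hD; apply: (sc5 _ _ _ rT).
have lE : l * (2 * (l' / l) * T2 * t) = 2 * l' * T2 * t by field; rewrite gt_eqF.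
rewrite mulrN in hD; rewrite mulrN in sN.
by apply: (sc6 _ _ _ _ _ _ sN lE); rewrite ltr_pM2l.
Qed.

(** Where |nu| <= s^2, moving away from p along T raises |nu|^2 at rate at most 4 |T|^2 s^2, which
    is the rate of s^4. With l > 1 the difference strictly decreases, so it has no minimum at such a
    point. *)
Lemma ascend x p l e : M x -> norm2 x p != dist2 x p -> norm2 x p <= dist2 x p ^+ 2 ->
  1 < l -> 0 < e ->
  exists y, [/\ M y, `|x - y| < e &
    norm2 y p - l * dist2 y p ^+ 2 < norm2 x p - l * dist2 x p ^+ 2].
Proof.
move=> Mx nc nle l1 e0.
have sc7 (Y X s s' : R) : `|X| <= 2 * Y * s -> 2 * Y * s <= 2 * Y * s' -> - 2 * X <= 4 * Y * s'.
  by rewrite ler_norml => /andP[? _] ?; lra.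
have sc8 (X T D : R) : X <= 4 * T * D -> 0 < D * T * (l - 1) -> X - l * (2 * D * (2 * T)) < 0.
  lra.
 have [W [U [phi [g [J [[C cJ] Wx Ux fx PE]]]]]] := chart_at Mx.
have [b [bT bP bd]] := tang_lift p C Mx Wx.
have T0 := tang_gt0 Mx nc; set T2 := dotp _ _ in T0 bd.
set a := g x in Ux fx PE bT bP bd.
have [dD DE] := sqdist_diff C p b Ux.
have dN := sqnu_diff C p Ux.
rewrite fx bd in DE.
have d0 : 0 < dist2 x p.
  rewrite lt_def dist2_ge0 andbT; apply: contra nc => /eqP d0.
  by apply/eqP/le_anti; rewrite norm2_le // d0 norm2_ge0.
have sle : Num.sqrt (norm2 x p) <= dist2 x p.
  by rewrite -[leRHS](ger0_norm (ltW d0)) -sqrtr_sqr ler_sqrt // sqr_ge0.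
have NE : 'd (sqnu phi J p) a b <= 4 * T2 * dist2 x p.
  rewrite (sqnu_derive C) ?fx //.
  have v0 : nu (proj (J a)) (x - p) *m proj (J a) = 0 by apply: nu_proj; rewrite -PE; exact: Pi_oproj.
  have := acc_bound C cJ b Ux v0; rewrite bT -/T2 -PE /enorm -/(norm2 x p).
  by move=> h; apply: (sc7 _ _ _ _ h); rewrite ler_pM2l // mulr_gt0.
pose F t := sqnu phi J p (a + t *: b) - l * sqdist phi p (a + t *: b) ^+ 2.
have i1 : is_derive (0 : R) 1 F
    ('d (sqnu phi J p) a b - l * (2 * dist2 x p * (2 * T2))).
  have h1 := is_derive_chart b dN.
  have h2 := is_derive_chart b dD; rewrite DE in h2.
  have h4 := is_derive_mulc l (is_derive_sqr h2).
  rewrite scale0r addr0 {2}/sqdist fx -/(dist2 x p) in h4.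
  exact: is_deriveB.
have i1n : 'd (sqnu phi J p) a b - l * (2 * dist2 x p * (2 * T2)) < 0.
  by apply: (sc8 _ _ _ NE); rewrite !mulr_gt0 // subr_gt0.
have [r1 r10 h1] := derive_lt0_sign i1 i1n.
have [r3 r30 h3] := line_near b C Ux e0.
pose t := Num.min r1 r3 / 2.
have m0 : 0 < Num.min r1 r3 by rewrite !lt_min r10 r30.
have t0 : 0 < t by rewrite /t divr_gt0.
have tm : t < Num.min r1 r3 by rewrite /t ltr_pdivrMr // ltr_pMr // ltr1n.
move: tm; rewrite !lt_min => /andP[tr1 tr3].
have := h3 t; rewrite gtr0_norm // => /(_ tr3)[Ut Mt Wt gt ft].
exists (phi (a + t *: b)); split=> //; first by rewrite -fx.
have [+ _] := h1 t (introT andP (conj t0 tr1)).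
by rewrite /F scale0r addr0 (sqnu_norm2 _ C Ux) (sqnu_norm2 _ C Ut) /sqdist fx.
Qed.

(** Differentiating |nu|^2 = s^4 along T gives <nu, II(T, T)> = -2 s^2 |T|^2, while |nu| = s^2 and
    |II(T, T)| <= 2 |T|^2. Equality in Cauchy-Schwarz makes II(T, T) antiparallel to nu. *)
Lemma acc_rigid W (U : set 'rV[R]_n) phi g J x p b (e : R) : good_chart M W U phi g J ->
  M x -> W x -> 0 < e ->
  (forall y, M y -> `|x - y| < e -> norm2 y p = dist2 y p ^+ 2) ->
  norm2 x p != dist2 x p -> b *m J (g x) = tang x p ->
  dist2 x p *: nu (Pi x) (acc J b (g x)) =
    - (2 * dotp (tang x p) (tang x p)) *: nu (Pi x) (x - p).
Proof.
move=> [C cJ] Mx Wx e0 heq nc bT.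
have [_ _ _ [hg _] _] := C; have [Ux fx] := hg _ Mx Wx.
have PE := PiE C Mx Wx; have oP := Pi_oproj Mx.
have bP : (x - p) *m proj (J (g x)) = b *m J (g x) by rewrite bT /tang PE.
have bd : dotp (x - p) (b *m J (g x)) = dotp (tang x p) (tang x p).
  by rewrite bT /tang (oproj_dotp _ _ oP) -mulmxA oP.2.
have T0 := tang_gt0 Mx nc; set T2 := dotp _ _ in T0 bd *.
set a := g x in Ux fx PE bT bP bd *.
have [dD DE] := sqdist_diff C p b Ux.
have dN := sqnu_diff C p Ux.
rewrite fx bd in DE.
have Nx : norm2 x p = dist2 x p ^+ 2 by apply: heq => //; rewrite subrr normr0.
have i1 := is_derive_chart b dN.
have i2 := is_derive_sqr (is_derive_chart b dD).
rewrite DE scale0r addr0 {2}/sqdist fx -/(dist2 x p) in i2.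
have [r3 r30 h3] := line_near b C Ux e0.
have key : 'd (sqnu phi J p) a b = 2 * dist2 x p * (2 * T2).
  rewrite (touching_derive r30 i1 i2).
  - by [].
  - by rewrite /= scale0r addr0 (sqnu_norm2 _ C Ux) /sqdist fx Nx.
  move=> t /h3[Ut Mt Wt gt ft]; rewrite (sqnu_norm2 _ C Ut) heq //.
  by rewrite -fx.
move: key; rewrite (sqnu_derive C) ?fx // -PE.
set v := nu (Pi x) (x - p); set q := acc J b a => key.
have vv : dotp v v = dist2 x p ^+ 2 by exact: Nx.
have vq : dotp v (nu (Pi x) q) = dotp v q.
  by rewrite [X in dotp _ X]/nu dotpBr nu_tan // subr0.
have w0 : nu (Pi x) q *m proj (J a) = 0 by rewrite -PE; exact: nu_proj.
have := acc_bound C cJ b Ux w0; rewrite -/q (nu_self q oP) bT -/T2.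
rewrite (ger0_norm (dotp_ge0 _)) -enorm_sqr expr2.
set w := nu (Pi x) q => hw.
have wle : enorm w <= 2 * T2.
  have [->|wn] := eqVneq w 0; first by rewrite enorm0 mulr_ge0 // ltW.
  by rewrite -(ler_pM2r (x := enorm w)) // enorm_gt0.
have ww : dotp w w <= (2 * T2) ^+ 2 by rewrite -enorm_le // mulr_ge0 // ltW.
rewrite -vq in key; apply: cauchy_eq.
  rewrite !dotpZl !dotpZr vv.
  have : dist2 x p ^+ 2 * dotp w w <= dist2 x p ^+ 2 * (2 * T2) ^+ 2.
    by rewrite ler_wpM2l // sqr_ge0.
  lra.
rewrite !dotpZl !dotpZr vv (dotpC w).
have -> : dotp v w = - (dist2 x p * (2 * T2)) by move: key; lra.
lra.
Qed.

End Charted.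

(** * The component of the diagonal *)

Lemma disjoint_compact_dist {R : realType} (V : normedModType R) (A B : set V) :
  compact A -> closed B -> (forall x, A x -> ~ B x) ->
  exists2 r : R, 0 < r & forall x y, A x -> B y -> r <= `|x - y|.
Proof.
move=> cA cB AB.
pose P (S : set V) := exists2 r : R, 0 < r & forall x y, S x -> B y -> r <= `|x - y|.
apply: (@compact_ind V A P) => //.
- by exists 1.
- move=> S S' [r r0 hr] [q q0 hq]; exists (Num.min r q); first by rewrite lt_min r0.
  by move=> x y [Sx|Sx] By; rewrite ge_min; [rewrite hr|rewrite hq ?orbT].
- by move=> S S' SS' [r r0 hr]; exists r => // x y /SS'; exact: hr.
move=> x Ax; have [r r0 hr] := not_closed_dist cB (AB x Ax).
exists [set y | `|x - y| < r / 2]; first by apply/nbhsP; exists (r / 2); rewrite ?divr_gt0.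
exists (r / 2); first by rewrite divr_gt0.
move=> z y [_ /= xz] By; have := hr y By; have := ler_distD z x y; lra.
Qed.

(** * Sublevel sets of the distance on pairs of points *)

Section Sublevel.
Context {R : realType} {n d : nat}.
Variable M : set 'rV[R]_d.
Hypotheses (cM : compact M) (hC : charted (n := n) M).
Local Notation vec := 'rV[R]_d.
Local Notation pvec := (vec * vec)%type.
Local Notation norm2 := (norm2 (n := n) M).

Lemma chart_ball W (U : set 'rV[R]_n) phi g J x0 (r : R) : chart M W U phi g J ->
  M x0 -> W x0 -> 0 < r -> exists2 rho, 0 < rho &
    (forall a, `|g x0 - a| < rho -> U a /\ `|x0 - phi a| < r) /\
    exists2 e, 0 < e & forall x, M x -> `|x0 - x| < e -> W x /\ `|g x0 - g x| < rho.
Proof.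
move=> C Mx Wx r0; have [oW oU hM [hg cg] _] := C; have [Ux fx] := hg _ Mx Wx.
have [q q0 hq] := chart_cont C Ux r0.
have [u u0 hu] := (openE U).1 oU _ Ux.
exists (Num.min q u); first by rewrite lt_min q0.
split=> [a|].
  by rewrite lt_min => /andP[aq /hu Ua]; split=> //; rewrite -{1}fx; exact: hq.
have qu : 0 < Num.min q u by rewrite lt_min q0.
have [v v0 hv] := cg x0 (conj Mx Wx) _ qu.
have [w w0 hw] := (openE W).1 oW _ Wx.
exists (Num.min v w); first by rewrite lt_min v0.
by move=> x Mx'; rewrite lt_min => /andP[xv /hw Wx']; split=> //; exact: hv.
Qed.

Lemma chart_J_cont W (U : set 'rV[R]_n) phi g J (b : 'rV_n) j : chart M W U phi g J ->
  cont_on U (fun a => (b *m J a) 0 j).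
Proof.
move=> [_ _ _ _ D] a Ua e e0; have [_ _ _ dJ] := D _ Ua.
have [r r0 hr] := differentiable_cvg (mxdiffM (mxdiff_cst b a) dJ 0 j) e0.
by exists r => // y _; exact: hr.
Qed.

Definition sub (c : R) : set pvec := [set q | [/\ M q.1, M q.2 & dist2 q.1 q.2 < c]].

(** The part of [sub c] joined to the diagonal, where c bounds the squared distance. Working with
    pairs lets both points move and makes the relation symmetric, see [O_sym]. *)
Definition O (c : R) : set pvec :=
  [set q | exists2 x, M x & linked (sub c) (x, x) q].

Lemma subS c c' : c <= c' -> sub c `<=` sub c'.
Proof. by move=> cc q [? ? h]; split=> //; exact: lt_le_trans cc. Qed.

Lemma linked_charts W (U : set 'rV[R]_n) phi g J W' (U' : set 'rV[R]_n) phi' g' J' c a0 b0 a1 b1 :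
  chart M W U phi g J -> chart M W' U' phi' g' J' ->
  (forall t : R, 0 <= t <= 1 -> [/\ U (a0 + t *: (a1 - a0)), U' (b0 + t *: (b1 - b0)) &
      dist2 (phi (a0 + t *: (a1 - a0))) (phi' (b0 + t *: (b1 - b0))) < c]) ->
  linked (sub c) (phi a0, phi' b0) (phi a1, phi' b1).
Proof.
move=> C C' h.
have [_ _ hM _ _] := C; have [_ _ hM' _ _] := C'.
pose F (z : 'rV[R]_n * 'rV[R]_n) := (phi z.1, phi' z.2).
have cF : cont_on (U `*` U') F.
  apply: cont_on_pair.
    apply: (cont_on_comp (B := U) (f := fst)); [by move=> z []|exact: cont_on_fst|].
    exact: chart_cont C.
  apply: (cont_on_comp (B := U') (f := snd)); [by move=> z []|exact: cont_on_snd|].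
  exact: chart_cont C'.
apply: (linked_segment (S := sub c) (x := (a0, b0)) (y := (a1, b1)) cF) => t /h[h1 h2 h3].
split; first by split.
by split=> //=; [have [] := hM _ h1|have [] := hM' _ h2].
Qed.

Lemma dist2_near q0 c : dist2 q0.1 q0.2 < c -> exists2 r : R, 0 < r &
  forall q : pvec, `|q0 - q| < r -> dist2 q.1 q.2 < c.
Proof.
move=> h; have [|r r0 hr] := @cont_dist2 R d q0 I (c - dist2 q0.1 q0.2); first by rewrite subr_gt0.
by exists r => // q /(hr q I); rewrite ltr_norml => /andP[+ _]; lra.
Qed.

Lemma norm_pair_lt (q q' : pvec) (r : R) : `|q - q'| < r <-> `|q.1 - q'.1| < r /\ `|q.2 - q'.2| < r.
Proof. by rewrite prod_normE /= gt_max; split=> [/andP[]|[-> ->]]. Qed.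

Lemma linked_near q0 c : sub c q0 -> exists2 e, 0 < e & forall q, M q.1 -> M q.2 ->
  `|q0 - q| < e -> linked (sub c) q0 q.
Proof.
case: q0 => x0 y0 [/= Mx My /(dist2_near (q0 := (x0, y0)))[r r0 hr]].
have [W [U [phi [g [J [[C _] Wx Ux fx _]]]]]] := chart_at hC Mx.
have [W' [U' [phi' [g' [J' [[C' _] Wy Uy fy _]]]]]] := chart_at hC My.
have [s s0 [hs [e e0 he]]] := chart_ball C Mx Wx r0.
have [s' s'0 [hs' [e' e'0 he']]] := chart_ball C' My Wy r0.
exists (Num.min e e'); first by rewrite lt_min e0.
move=> [x y] /= Mx' My' /norm_pair_lt[/=]; rewrite !lt_min => /andP[xe _] /andP[_ ye].
have [Wx' gx] := he _ Mx' xe; have [Wy' gy] := he' _ My' ye.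
have [_ _ _ [hg _] _] := C; have [_ _ _ [hg' _] _] := C'.
have [_ fx'] := hg _ Mx' Wx'; have [_ fy'] := hg' _ My' Wy'.
rewrite -{1}fx -{1}fy -fx' -fy'; apply: (linked_charts C C') => t t01.
have o : `|g x0 - g x0| < s by rewrite subrr normr0.
have o' : `|g' y0 - g' y0| < s' by rewrite subrr normr0.
have [h1 h2] := hs _ (ball_convex gx o t01); have [h3 h4] := hs' _ (ball_convex gy o' t01).
by split=> //; apply: (hr (phi _, phi' _)); apply/norm_pair_lt.
Qed.

Lemma O_sub c : O c `<=` sub c.
Proof. by move=> q [x Mx [K [_ _ KS _ /KS]]]. Qed.

Lemma O_linked c q q' : O c q -> linked (sub c) q q' -> O c q'.
Proof. by move=> [x Mx h] h'; exists x => //; exact: linked_trans h'. Qed.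

Lemma O_open c q : O c q -> exists2 e, 0 < e & forall q', M q'.1 -> M q'.2 ->
  `|q - q'| < e -> O c q'.
Proof.
move=> Oq; have [e e0 he] := linked_near (O_sub Oq); exists e => // q' M1 M2 qq.
by apply: O_linked Oq _; exact: he.
Qed.

Lemma O_closed c q : sub c q -> (forall e : R, 0 < e -> exists2 q', O c q' & `|q - q'| < e) ->
  O c q.
Proof.
move=> sq h; have [e e0 he] := linked_near sq; have [q' Oq' qq] := h e e0.
apply: (O_linked Oq'); apply: linked_sym; apply: he => //; by have [] := O_sub Oq'.
Qed.

Lemma OS c c' : c <= c' -> O c `<=` O c'.
Proof. by move=> cc q [x Mx h]; exists x => //; apply: linkedS h; exact: subS. Qed.

Lemma O_diag c x : 0 < c -> M x -> O c (x, x).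
Proof. by move=> c0 Mx; exists x => //; apply: linked_refl; split=> //=; rewrite dist2xx. Qed.

(** On the compact connected set joining q to the diagonal the squared distance attains a maximum,
    which is below c. *)
Lemma O_lt c q : O c q -> exists2 c', c' < c & O c' q.
Proof.
move=> [x Mx [K [cK nK KS Kx Kq]]].
have cf : cont_on K (fun q : pvec => dist2 q.1 q.2).
  by apply: cont_onS (@cont_dist2 R d).
have [z Kz hz] := compact_max cK (ex_intro _ _ Kx) cf.
have [M1 M2 zc] := KS _ Kz.
exists ((dist2 z.1 z.2 + c) / 2); first lra.
exists x => //; exists K; split=> // w Kw; have [w1 w2 _] := KS _ Kw; split=> //.
by have := hz _ Kw; lra.
Qed.

(** The tangential part of x0 - y0 lifts to a coordinate vector b. By continuity <phi a - y, b J a>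
    stays positive near the pair, so the one direction -b decreases the distance to every y near
    y0. *)
Lemma descent_dir W (U : set 'rV[R]_n) phi g J x0 y0 : chart M W U phi g J ->
  M x0 -> W x0 -> norm2 x0 y0 != dist2 x0 y0 ->
  exists b r, [/\ 0 < r, forall a, `|g x0 - a| < r -> U a &
    forall a y t, `|g x0 - a| < r -> `|g x0 - (a - t *: b)| < r -> `|y0 - y| < r -> 0 < t ->
      dist2 (phi (a - t *: b)) y < dist2 (phi a) y].
Proof.
move=> C Mx Wx nc; have [_ oU hM [hg _] _] := C; have [Ux fx] := hg _ Mx Wx.
have [b [_ _ bd]] := tang_lift hC y0 C Mx Wx.
have T0 := tang_gt0 hC Mx nc; set T2 := dotp _ _ in T0 bd.
set a0 := g x0 in Ux fx bd *.
pose G (z : 'rV[R]_n * vec) := dotp (phi z.1 - z.2) (b *m J z.1).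
have c1 : cont_on (U `*` setT) (fun z : 'rV[R]_n * vec => phi z.1).
  apply: (cont_on_comp (B := U) (f := fst)); [by move=> z []|exact: cont_on_fst|].
  exact: chart_cont C.
have c2 : cont_on (U `*` setT) (fun z : 'rV[R]_n * vec => phi z.1 - z.2).
  by apply: cont_onB => //; exact: cont_on_snd.
have cG : cont_on (U `*` setT) G.
  apply: cont_on_dotp => j; first exact: cont_on_coord.
  apply: (cont_on_comp (B := U) (f := fst) (g := fun a => (b *m J a) 0 j)).
  - by move=> z [].
  - exact: cont_on_fst.
  - exact: chart_J_cont C.
have [r1 r10 hr1] := cG (a0, y0) (conj Ux I) T2 T0.
have [r2 r20 hr2] := (openE U).1 oU _ Ux.
have [r r0 [rr1 rr2]] : exists2 r : R, 0 < r & r <= r1 /\ r <= r2.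
  by exists (Num.min r1 r2); rewrite ?lt_min ?r10 // !ge_min !lexx orbT.
have Gp a y : `|a0 - a| < r -> `|y0 - y| < r -> U a /\ 0 < G (a, y).
  move=> ar yr; have Ua := hr2 _ (lt_le_trans ar rr2); split=> //.
  have ar1 := lt_le_trans ar rr1; have yr1 := lt_le_trans yr rr1.
  have := hr1 (a, y) (conj Ua I); rewrite prod_normE /= gt_max ar1 yr1 => /(_ isT).
  rewrite {1}/G /= fx bd ltr_norml => /andP[_]; lra.
exists b, r; split=> // [a ha|a y t ha hat hy t0].
  by apply: hr2; exact: lt_le_trans rr2.
have seg s : 0 <= s <= t -> `|a0 - (a + - s *: b)| < r.
  move=> /andP[s0 st]; have h01 : 0 <= s / t <= 1.
    by rewrite divr_ge0 ?(ltW t0) //= ler_pdivrMr // mul1r.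
  have := ball_convex hat ha h01; congr (`|_ - (_ + _)| < _).
  by rewrite addrAC subrr add0r scalerN scalerA divfK ?scaleNr // gt_eqF.
pose k (s : R) : R := dist2 (phi (a + s *: (- b))) y.
have dk (s : R) : 0 <= s <= t -> is_derive s 1 k (2 * - G (a + s *: (- b), y)).
  move=> /seg; rewrite scaleNr -scalerN => hs; have [Us _] := Gp _ _ hs hy.
  have [dD DE] := sqdist_diff C y (- b) Us.
  have := is_derive_line dD; rewrite DE mulNmx dotpNr; exact.
have [||s st E] := @MVT_segment R k (fun s => 2 * - G (a + s *: (- b), y)) 0 t (ltW t0).
- by move=> s; rewrite in_itv /= => /andP[s0 s1]; apply: dk; rewrite !ltW.
- apply: derivable_within_continuous => s; rewrite in_itv /= => /dk h.
  exact: (ex_derive (is_derive := h)).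
have st' : 0 <= s <= t by move: st; rewrite in_itv.
have [_] := Gp _ _ (seg _ st') hy; rewrite scaleNr -scalerN => Gs.
move: E; rewrite /k scale0r addr0 subr0 scalerN => E.
have : 0 < t * G (a + s *: - b, y) by rewrite mulr_gt0.
lra.
Qed.

(** Near a noncritical pair the open sublevel set lies on one side of its boundary and is locally
    connected up to it: both pairs slide along -b to a depth tau at which a whole neighbourhood is
    below the level. As q may lie on the level itself, it is only approximated by w. *)
Lemma half_space x0 y0 : M x0 -> M y0 -> norm2 x0 y0 != dist2 x0 y0 ->
  exists2 e : R, 0 < e & forall q q', M q.1 -> M q.2 -> dist2 q.1 q.2 <= dist2 x0 y0 ->
    sub (dist2 x0 y0) q' -> `|(x0, y0) - q| < e -> `|(x0, y0) - q'| < e ->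
    forall e', 0 < e' -> exists2 w, `|q - w| < e' & linked (sub (dist2 x0 y0)) w q'.
Proof.
move=> Mx My nc; set c0 := dist2 x0 y0.
have [W [U [phi [g [J [[C _] Wx Ux fx _]]]]]] := chart_at hC Mx.
have [W' [U' [phi' [g' [J' [[C' _] Wy Uy fy _]]]]]] := chart_at hC My.
have [_ oU hM [hg _] _] := C; have [_ _ hM' [hg' _] _] := C'.
have [b [r [r0 rU dec]]] := descent_dir C Mx Wx nc.
set a0 := g x0 in Ux fx rU dec; set b0 := g' y0 in Uy fy.
have b1 : 0 < `|b| + 1 by rewrite ltr_wpDl.
pose tau := r / 2 / (`|b| + 1); have tau0 : 0 < tau by rewrite !divr_gt0.
have taub t : 0 <= t <= tau -> `|t *: b| < r / 2.
  move=> /andP[t0 tt]; rewrite normrZ ger0_norm // (@le_lt_trans _ _ (tau * `|b|)) //.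
    by rewrite ler_wpM2r.
  by rewrite /tau mulrAC ltr_pdivrMr // ltr_pM2l ?divr_gt0 // ltrDl.
have a0r : `|a0 - a0| < r by rewrite subrr normr0.
have y0r : `|y0 - y0| < r by rewrite subrr normr0.
have atr t : 0 <= t <= tau -> `|a0 - (a0 - t *: b)| < r.
  move=> /taub h; rewrite opprB addrC subrK; apply: lt_le_trans h _; lra.
have tt : 0 <= tau <= tau by rewrite lexx ltW.
have Ft : dist2 (phi (a0 - tau *: b)) y0 < c0.
  by rewrite /c0 -{1}fx; apply: dec => //; exact: atr.
have [r3 r30 hr3] := dist2_near (q0 := (phi (a0 - tau *: b), y0)) Ft.
have Ut := rU _ (atr _ tt).
have [r4 r40 hr4] := chart_cont C Ut r30.
have [s s0 [sr2 sr3 sr4]] : exists2 s : R, 0 < s & [/\ s <= r / 2, s <= r3 & s <= r4].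
  exists (Num.min (r / 2) (Num.min r3 r4)); first by rewrite !lt_min divr_gt0 //= r30.
  by rewrite !ge_min !lexx !orbT.
have low a y : `|a0 - a| < s -> `|y0 - y| < s -> [/\ `|a0 - a| < r, `|y0 - y| < r,
    forall t, 0 <= t <= tau -> `|a0 - (a - t *: b)| < r & dist2 (phi (a - tau *: b)) y < c0].
  move=> a_s y_s; have ar := lt_le_trans a_s sr2; have yr := lt_le_trans y_s sr2.
  have yr3 := lt_le_trans y_s sr3; have ar4 := lt_le_trans a_s sr4.
  have h t : 0 <= t <= tau -> `|a0 - (a - t *: b)| < r.
    move=> /taub ht; rewrite opprB addrCA addrC (le_lt_trans (ler_normD _ _)) //; lra.
  have r2r : r / 2 < r by rewrite ltr_pdivrMr // ltr_pMr // ltr1n.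
  have yr' := lt_trans yr r2r; split; [exact: lt_trans ar r2r|exact: yr'|exact: h|].
  apply: (hr3 (_, _)); apply/norm_pair_lt; split=> //=; apply: hr4.
    exact: rU (h _ tt).
  by rewrite opprB addrA subrK.
have [u u0 [hu [e1 e10 he1]]] := chart_ball C Mx Wx s0.
have [v v0 [hv [e2 e20 he2]]] := chart_ball C' My Wy s0.
have smin : 0 < Num.min s u by rewrite lt_min s0.
have [u' u'0 hu'] : exists2 e, 0 < e & forall x, M x -> `|x0 - x| < e -> W x /\ `|a0 - g x| < s.
  have [_ oW] := C; case: (C) => oW' _ _ [_ cg] _.
  have [z z0 hz] := cg x0 (conj Mx Wx) s s0; have [w w0 hw] := (openE W).1 oW' _ Wx.
  exists (Num.min z w); first by rewrite lt_min z0.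
  by move=> x Mx'; rewrite lt_min => /andP[xz /hw Wx']; split=> //; exact: hz.
exists (Num.min (Num.min u' e2) s); first by rewrite !lt_min u'0 e20.
move=> [x y] [x' y'] /= Mx1 My1 le1 [/= Mx2 My2 lt2] /norm_pair_lt[/=].
move=> xm ym /norm_pair_lt[/=]; move: xm ym.
rewrite !lt_min => /andP[/andP[xu _] _] /andP[/andP[_ ye] ys].
move=> /andP[/andP[xu' _] _] /andP[/andP[_ ye'] ys'] e' e'0.
have [Wx1 gx] := hu' _ Mx1 xu; have [Wx2 gx'] := hu' _ Mx2 xu'.
have [Wy1 gy] := he2 _ My1 ye; have [Wy2 gy'] := he2 _ My2 ye'.
have [Ux1 fx1] := hg _ Mx1 Wx1; have [Ux2 fx2] := hg _ Mx2 Wx2.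
have [Uy1 fy1] := hg' _ My1 Wy1; have [Uy2 fy2] := hg' _ My2 Wy2.
have [ar yr hr Fl] := low _ _ gx ys; have [ar' yr' hr' Fl'] := low _ _ gx' ys'.
have nb : - b = - b by [].
have [t [t0 tt1 te]] : exists t, [/\ 0 < t, t <= tau & `|x - phi (g x - t *: b)| < e'].
  have [z z0 hz] := line_near (- b) C Ux1 e'0.
  exists (Num.min (z / 2) tau); split; first by rewrite lt_min divr_gt0.
    by rewrite ge_min lexx orbT.
  have := hz (Num.min (z / 2) tau); rewrite gtr0_norm ?lt_min ?divr_gt0 //.
  rewrite scalerN fx1 => h; have [] // := h _; rewrite gt_min; apply/orP; left; lra.
exists (phi (g x - t *: b), y); first by apply/norm_pair_lt => /=; rewrite subrr normr0.
have down z w t1 : `|a0 - g z| < s -> `|y0 - w| < s -> M w -> W' w -> 0 <= t1 <= tau ->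
    (forall t2, t1 <= t2 <= tau -> dist2 (phi (g z - t2 *: b)) w < c0) ->
    linked (sub c0) (phi (g z - t1 *: b), w) (phi (g z - tau *: b), w).
  move=> gz yw Mw Ww /andP[t10 t1t] hd; have [_ fw] := hg' _ Mw Ww.
  have [zr wr hz _] := low _ _ gz yw.
  rewrite -{1 2}fw; apply: (linked_charts C C') => k /andP[k0 k1].
  have E : g z - t1 *: b + k *: (g z - tau *: b - (g z - t1 *: b)) =
      g z - (t1 + k * (tau - t1)) *: b.
    by apply/rowP => i; rewrite !mxE; ring.
  have tk : t1 <= t1 + k * (tau - t1) <= tau.
    have h1 : 0 <= k * (tau - t1) by rewrite mulr_ge0 // subr_ge0.
    have h2 : 0 <= (1 - k) * (tau - t1) by rewrite mulr_ge0 // subr_ge0.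
    by apply/andP; split; lra.
  rewrite E subrr scaler0 addr0 fw.
  have tk' : 0 <= t1 + k * (tau - t1) <= tau.
    by move: tk => /andP[h1 ->]; rewrite (le_trans t10 h1).
  split; last exact: hd.
  - exact: rU (hz _ tk').
  - by have [] := hg' _ Mw Ww.
(* Down from the first pair, across at depth tau, and up to the second pair. *)
have L1 : linked (sub c0) (phi (g x - t *: b), y) (phi (g x - tau *: b), y).
  apply: down => //; first by rewrite (ltW t0).
  move=> t2 /andP[tt2 t2t]; apply: lt_le_trans le1; rewrite -{2}fx1.
  have t20 : 0 < t2 by exact: lt_le_trans tt2.
  by apply: dec => //; apply: hr; rewrite (ltW t20).
have L2 : linked (sub c0) (phi (g x - tau *: b), y) (phi (g x' - tau *: b), y').
  rewrite -{1}fy1 -{1}fy2; apply: (linked_charts C C') => k k01.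
  have E : g x - tau *: b + k *: (g x' - tau *: b - (g x - tau *: b)) =
      (g x + k *: (g x' - g x)) - tau *: b.
    by apply/rowP => i; rewrite !mxE; ring.
  have [h1 h2] := hv _ (ball_convex gy' gy k01).
  have [h3 h4 h5 h6] := low _ _ (ball_convex gx' gx k01) h2.
  rewrite E; split=> //.
  exact: rU (h5 _ tt).
have L3 : linked (sub c0) (x', y') (phi (g x' - tau *: b), y').
  have -> : (x', y') = (phi (g x' - 0 *: b), y') by rewrite scale0r subr0 fx2.
  apply: down => //; first by rewrite lexx ltW.
  move=> t2 /andP[t20 t2t]; have [->|t2n] := eqVneq t2 0; first by rewrite scale0r subr0 fx2.
  apply: lt_trans lt2; rewrite -{2}fx2.
  have t2p : 0 < t2 by rewrite lt_def t2n.
  by apply: dec => //; apply: hr'; rewrite t20.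
exact: linked_trans L1 (linked_trans L2 (linked_sym L3)).
Qed.

End Sublevel.

(** * Continuity argument on the component of the diagonal *)

Section Component.
Context {R : realType} {n d : nat}.
Variable M : set 'rV[R]_d.
Hypotheses (cM : compact M) (hC : charted (n := n) M).
Local Notation vec := 'rV[R]_d.
Local Notation pvec := (vec * vec)%type.
Local Notation norm2 := (norm2 (n := n) M).

Definition crit (q : pvec) := q.1 <> q.2 /\ norm2 q.1 q.2 = dist2 q.1 q.2.

Let good c := forall q, O M c q -> ~ crit q.

Let MM := M `*` M.

Lemma compact_MM : compact MM. Proof. exact: compact_setX. Qed.

Lemma cont_on_norm2 : cont_on MM (fun q : pvec => norm2 q.1 q.2).
Proof. by apply: cont_onS (cont_norm2 hC) => q []. Qed.

Lemma cont_on_dist2 (A : set pvec) : cont_on A (fun q : pvec => dist2 q.1 q.2).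
Proof. by apply: cont_onS (@cont_dist2 R d). Qed.

Lemma noncrit_open q : MM q -> ~ crit q ->
  exists2 r : R, 0 < r & forall q', MM q' -> `|q - q'| < r -> ~ crit q'.
Proof.
case: q => x p [/= Mx Mp] nc; have [xp|xp] := eqVneq x p.
  have [e e0 he] := noncrit_near_diag hC Mx; exists e => // -[y z] [/= My Mz].
  by move=> /norm_pair_lt[/= xy pz] [/= yz]; apply: he => //; rewrite xp.
have ne : norm2 x p - dist2 x p != 0.
  by rewrite subr_eq0; apply/eqP => E; apply: nc; split=> //; apply/eqP.
have c : cont_on MM (fun q : pvec => norm2 q.1 q.2 - dist2 q.1 q.2).
  by apply: cont_onB; [exact: cont_on_norm2|exact: cont_on_dist2].
have [|r r0 hr] := c (x, p) (conj Mx Mp) `|norm2 x p - dist2 x p|; first by rewrite normr_gt0.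
exists r => // -[y z] My xy [/= _ E].
by have := hr _ My xy; rewrite /= E subrr subr0 ltxx.
Qed.

Lemma noncrit_unif (F : set pvec) : compact F -> F `<=` MM -> (forall q, F q -> ~ crit q) ->
  exists2 r : R, 0 < r & forall q q', F q -> MM q' -> `|q - q'| < r -> ~ crit q'.
Proof.
move=> cF FM Fc.
pose P (S : set pvec) := exists2 r : R, 0 < r & forall q q', S q -> MM q' -> `|q - q'| < r -> ~ crit q'.
apply: (@compact_ind pvec F P) => //.
- by exists 1.
- move=> S S' [r r0 hr] [s s0 hs]; exists (Num.min r s); first by rewrite lt_min r0.
  by move=> x y [Sx|Sx] My; rewrite lt_min => /andP[? ?]; [apply: (hr x)|apply: (hs x)].
- by move=> S S' SS' [r r0 hr]; exists r => // x y /SS'; exact: hr.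
move=> q Fq; have [r r0 hr] := noncrit_open (FM _ Fq) (Fc _ Fq).
exists [set y | `|q - y| < r / 2]; first by apply/nbhsP; exists (r / 2); rewrite ?divr_gt0.
exists (r / 2); first by rewrite divr_gt0.
move=> y z [_ /= qy] Mz yz; apply: hr => //.
by have := ler_distD y q z; lra.
Qed.

Lemma good0 : exists2 c : R, 0 < c & good c.
Proof.
pose F := [set (x, x) | x in M].
have cF : compact F.
  by apply: compact_image => //; apply: cont_on_pair; exact: cont_on_id.
have [||r r0 hr] := noncrit_unif cF.
- by move=> _ [x Mx <-].
- by move=> _ [x Mx <-] [].
exists (r ^+ 2); first by rewrite exprn_gt0.
move=> [x y] /O_sub[/= Mx My xy]; apply: (hr (x, x)) => //; first by exists x.
apply/norm_pair_lt; rewrite /= subrr normr0; split=> //.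
by apply: le_lt_trans (le_norm_enorm _) _; rewrite enorm_lt // ltW.
Qed.

(** The quantity that [descend] increases; l tends to 1 in [O_norm2]. *)
Let gl (l : R) (q : pvec) := Num.sqrt (norm2 q.1 q.2) - l * dist2 q.1 q.2.

Lemma cont_on_gl l : cont_on MM (gl l).
Proof.
apply: cont_onB; last by apply: cont_onM; [exact: cont_on_cst|exact: cont_on_dist2].
apply: (cont_on_comp (B := setT) (f := fun q : pvec => norm2 q.1 q.2)) => //.
  exact: cont_on_norm2.
apply: continuous_cont_on; exact: sqrt_continuous.
Qed.

(** A positive value would give a positive maximum over the pairs of [O M c] with squared distance
    at most c', a compact set because c' < c. There neither nu nor T vanishes, so [descend] moves
    the pair closer and increases the value. *)
Lemma good_le c l q : good c -> 1 < l -> O M c q -> gl l q <= 0.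
Proof.
move=> gc l1 Oq; rewrite leNgt; apply/negP => gq.
pose c' := dist2 q.1 q.2.
have c'c : c' < c by have [] := O_sub Oq.
pose A := [set z | O M c z /\ dist2 z.1 z.2 <= c'].
have AM : A `<=` MM by move=> z [/O_sub[]].
have cA : closed A.
  apply/closedP => z h.
  have zM : MM z.
    have /closedP : closed MM by apply: compact_isclosed; exact: compact_MM.
    by apply=> e /h[w [/O_sub[]]]; exists w.
  have zc : dist2 z.1 z.2 <= c'.
    have /closedP : closed [set z | MM z /\ dist2 z.1 z.2 <= c'].
      apply: closed_le; last exact: cont_on_dist2.
      by apply: compact_isclosed; exact: compact_MM.
    move=> /(_ z)[] // e /h[w [/O_sub[? ? _] ?]]; by exists w.
  split=> //; apply: (O_closed hC).
    by case: zM => ? ?; split=> //; exact: le_lt_trans c'c.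
  by move=> e /h[w [Ow _] zw]; exists w.
have cA' : compact A by apply: (compact_sub compact_MM).
have [z [Oz zc] hz] := compact_max cA' (ex_intro _ q (conj Oq (lexx _))) (cont_onS AM (cont_on_gl l)).
have gz : 0 < gl l z by apply: lt_le_trans gq _; exact: (hz q).
have [M1 M2 zlt] := O_sub Oz.
have zd : z.1 <> z.2.
  move=> E; move: gz; rewrite /gl E norm2xx dist2xx sqrtr0; lra.
have nc : norm2 z.1 z.2 != dist2 z.1 z.2 by apply/eqP => E; exact: (gc _ Oz).
have n0 : 0 < norm2 z.1 z.2.
  rewrite lt_def norm2_ge0 andbT; apply/eqP => E; move: gz; rewrite /gl E sqrtr0.
  have := dist2_ge0 z.1 z.2; have : 0 <= l by lra.
  by move=> h1 h2; have := mulr_ge0 h1 h2; lra.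
have [e e0 he] := O_open hC Oz.
have [y [My zy lt1 lt2]] := descend hC M1 nc n0 l1 e0.
have Oy : O M c (y, z.2).
  by apply: he => //; apply/norm_pair_lt; rewrite /= subrr normr0.
have /hz : A (y, z.2) by split=> //=; apply: le_trans zc; exact: ltW.
by rewrite leNgt lt2.
Qed.

(** On the closure of [O M c] the bound |nu| <= l s^2 persists, while a critical pair has |nu| = s
    and hence l s >= 1, against l^2 c < 1. So the closure is noncritical, and [half_space] separates
    it from the other pairs with squared distance at most c. For slightly larger c' a connected set
    starting on the diagonal stays near the closure, where no pair is critical. *)
Lemma good_ext c l : good c -> 0 < c -> 1 < l -> l ^+ 2 * c < 1 ->
  exists2 c', c < c' & good c'.
Proof.
move=> gc c0 l1 lc.
pose Lc := [set z : pvec | MM z /\ dist2 z.1 z.2 <= c].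
have cMM : closed MM by apply: compact_isclosed; exact: compact_MM.
have cL : closed Lc by apply: closed_le => //; exact: cont_on_dist2.
pose F := closure (O M c).
have FL : F `<=` Lc.
  move=> z /closureP h; move/closedP: cL; apply=> e /h[w /O_sub[? ? ?] zw].
  by exists w => //; split=> //; exact: ltW.
have FM : F `<=` MM by move=> z /FL[].
have cF : compact F by apply: (compact_sub compact_MM) => //; exact: closed_closure.
have Fg q : F q -> ~ crit q.
  move=> Fq [qd qE]; have [Mq qc] := FL _ Fq.
  have : gl l q <= 0.
    have /closedP : closed [set z | MM z /\ gl l z <= 0].
      by apply: closed_le => //; exact: cont_on_gl.
    move=> /(_ q)[] // e; move/closureP: Fq => h /h[w Ow qw]; exists w => //.
    by split; [have [] := O_sub Ow|exact: good_le Ow].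
  have dp : 0 < dist2 q.1 q.2 by rewrite lt_def dist2_ge0 andbT dist2_eq0; apply/eqP.
  rewrite /gl qE; set s := Num.sqrt _; have ss : s ^+ 2 = dist2 q.1 q.2 by rewrite sqr_sqrtr // ltW.
  have s0 : 0 < s by rewrite sqrtr_gt0.
  rewrite -ss subr_le0 expr2 mulrA -{1}[s]mul1r ler_pM2r // => ls.
  have : 1 <= (l * s) ^+ 2 by rewrite expr_ge1 // mulr_ge0 ?ltW //; lra.
  rewrite exprMn ss => h; have : l ^+ 2 * dist2 q.1 q.2 <= l ^+ 2 * c by rewrite ler_wpM2l ?sqr_ge0.
  lra.
pose F' := Lc `\` F.
have cF' : closed F'.
  apply/closedP => z h; have Lz : Lc z.
    by move/closedP: cL; apply=> e /h[w [? _]]; exists w.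
  split=> // Fz; have [[Mz1 Mz2] zc] := Lz.
  have clF w : Lc w -> (forall e : R, 0 < e -> exists2 u, O M c u & `|w - u| < e) -> F w.
    by move=> _ hw; apply/closureP.
  have [zd|zd] := pselect (dist2 z.1 z.2 < c).
    have Oz : O M c z.
      apply: (O_closed hC) => //; by move/closureP: Fz.
    have [e e0 he] := O_open hC Oz; have [w [[[Mw1 Mw2] wc] nF] zw] := h e e0.
    by apply: nF; apply: subset_closure; exact: he.
  have zE : dist2 z.1 z.2 = c by apply/le_anti; rewrite zc leNgt; apply/negP.
  have nz : norm2 z.1 z.2 != dist2 z.1 z.2.
    apply/eqP => E; apply: (Fg z Fz); split=> // zz.
    by move: zE; rewrite zz dist2xx => E'; move: c0; rewrite -E' ltxx.
  (* A pair w outside the closure but near z is approximated by pairs linked to a pair of [O M c]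
     near z, so it would lie in the closure. *)
  have [e e0 he] := half_space hC Mz1 Mz2 nz; rewrite zE -surjective_pairing in he.
  move/closureP: (Fz) => /(_ e e0)[u Ou zu].
  have [w [[[Mw1 Mw2] wc] nF] zw] := h e e0.
  apply: nF; apply/closureP => e' e'0.
  have [v wv lv] := he w u Mw1 Mw2 wc (O_sub Ou) zw zu e' e'0.
  by exists v => //; apply: (O_linked Ou); exact: linked_sym.
have [r1 r10 hr1] := disjoint_compact_dist cF cF' (fun x Fx F'x => F'x.2 Fx).
have [r2 r20 hr2] := noncrit_unif cF FM Fg.
have [r r0 [rr1 rr2]] : exists2 r : R, 0 < r & 3 * r <= r1 /\ r <= r2.
  exists (Num.min (r1 / 3) r2); first by rewrite lt_min divr_gt0.
  split; last by rewrite ge_min lexx orbT.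
  have : Num.min (r1 / 3) r2 <= r1 / 3 by rewrite ge_min lexx.
  lra.
pose N (S : set pvec) := [set z | exists2 w, S w & `|z - w| < r].
have Nopen S z : N S z -> exists2 e : R, 0 < e & forall y, `|z - y| < e -> N S y.
  move=> [w Sw zw]; exists (r - `|z - w|); first by rewrite subr_gt0.
  move=> y zy; exists w => //; have := ler_distD z y w; rewrite (distrC y z); lra.
have Ndisj z : N F z -> N F' z -> False.
  move=> [w Fw zw] [w' Fw' zw']; have := hr1 _ _ Fw Fw'.
  have := ler_distD z w w'; rewrite (distrC w z); lra.
pose H := [set z | MM z /\ (forall w, Lc w -> r <= `|z - w|)].
have [c' cc' hc'] : exists2 c', c < c' & forall z, MM z -> dist2 z.1 z.2 < c' -> N F z \/ N F' z.
  have cH : compact H.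
    apply: (compact_sub compact_MM); last by move=> z [].
    apply/closedP => z h; split; first by move/closedP: cMM; apply=> e /h[w [? _]]; exists w.
    move=> w Lw; rewrite leNgt; apply/negP => zw.
    have [|u [Mu hu] zu] := h (r - `|z - w|); first by rewrite subr_gt0.
    by have := hu w Lw; have := ler_distD z u w; rewrite (distrC u z); lra.
  have split_ z : MM z -> ~ H z -> N F z \/ N F' z.
    move=> Mz nH; have [w Lw zw] : exists2 w, Lc w & `|z - w| < r.
      apply: contrapT => hn; apply: nH; split=> // w Lw; rewrite leNgt; apply/negP => zw.
      by apply: hn; exists w.
    by have [Fw|nFw] := pselect (F w); [left|right]; exists w.
  have [[z0 Hz0]|H0] := pselect (H !=set0); last first.
    exists (c + 1); first lra.
    by move=> z Mz _; apply: split_ => // Hz; apply: H0; exists z.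
  have [z [Mz hz] zmin] := compact_min cH (ex_intro _ z0 Hz0) (@cont_on_dist2 H).
  exists (dist2 z.1 z.2).
    rewrite ltNge; apply/negP => zc; have := hz z (conj Mz zc).
    by rewrite subrr normr0; lra.
  by move=> w Mw wz; apply: split_ => // Hw; have := zmin w Hw; rewrite leNgt wz.
exists c' => // q [x Mx [K [cK nK KS Kx Kq]]].
suff : N F q.
  move=> [w Fw qw]; apply: (hr2 w) => //; first by have [] := KS _ Kq.
  by rewrite distrC; exact: lt_le_trans rr2.
apply: (connected_all (O := N F) nK _ _ _ Kq).
- exists (x, x) => //; exists (x, x); last by rewrite subrr normr0.
  by apply: subset_closure; exact: O_diag.
- by move=> z Kz /Nopen[e e0 he]; exists e => // y _; exact: he.
move=> z Kz nz; have [M1 M2 zc'] := KS _ Kz.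
have [//|/Nopen[e e0 he]] := hc' z (conj M1 M2) zc'.
by exists e => // y _ /he Fy /Ndisj; exact.
Qed.

(** The supremum s of the good levels up to c is good, because by [O_lt] a pair of [O M s] already
    occurs at a smaller level; if s < c, [good_ext] would exceed it. *)
Lemma good_lt1 c : c < 1 -> good c.
Proof.
move=> c1; have [c0|c0] := lerP c 0.
  by move=> q /O_sub[_ _]; rewrite ltNge (le_trans c0) // dist2_ge0.
have [l [l1 lc]] : exists l : R, 1 < l /\ l ^+ 2 * c < 1.
  exists (1 + (1 - c) / 4); split; first lra.
  have -> : (1 + (1 - c) / 4) ^+ 2 * c = c + (1 - c) * c / 2 + (1 - c) ^+ 2 * c / 16 by field.
  have h1 : (1 - c) * c < (1 - c) * 1 by rewrite ltr_pM2l // subr_gt0.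
  have h2 : (1 - c) * ((1 - c) * c) <= (1 - c) * 1.
    rewrite ler_pM2l ?subr_gt0 //; lra.
  rewrite expr2; lra.
pose G := [set c' : R | c' <= c /\ good c'].
have [a a0 ga] := good0.
have goodS c1' c2' : c1' <= c2' -> good c2' -> good c1'.
  by move=> cc g q /(OS cc); exact: g.
have Gm : G (Num.min a c).
  by split; [rewrite ge_min lexx orbT|apply: goodS ga; rewrite ge_min lexx].
have hsG : has_sup G by split; [exists (Num.min a c)|exists c => x []].
pose s := sup G.
have s0 : 0 < s.
  apply: (@lt_le_trans _ _ (Num.min a c)); first by rewrite lt_min a0.
  by apply: sup_upper_bound.
have sc : s <= c by apply: ge_sup; [exists (Num.min a c)|move=> x []].
have gs : good s.
  move=> q /O_lt[c' c's Oq].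
  have e0 : 0 < s - c' by rewrite subr_gt0.
  have [x [xc gx] c'x] := sup_adherent e0 hsG.
  by apply: gx; apply: (OS (c := c')) => //; rewrite opprB addrC subrK in c'x; exact: ltW.
have [cs|sc'] := lerP c s; first exact: goodS gs.
have ls : l ^+ 2 * s < 1.
  by apply: le_lt_trans lc; rewrite ler_wpM2l // sqr_ge0.
have [c' sc'' gc'] := good_ext gs s0 l1 ls.
have : Num.min c' c <= s.
  apply: sup_upper_bound => //; split; first by rewrite ge_min lexx orbT.
  by apply: goodS gc'; rewrite ge_min lexx.
by rewrite leNgt lt_min sc'' sc'.
Qed.

Lemma O_noncrit x p : O M 1 (x, p) -> x <> p -> norm2 x p <> dist2 x p.
Proof. by move=> /O_lt[c c1 Oc] xp E; apply: (good_lt1 c1 Oc). Qed.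

Lemma O_norm2 x p : O M 1 (x, p) -> norm2 x p <= dist2 x p ^+ 2.
Proof.
move=> /O_lt[c c1 Oc]; have D0 := dist2_ge0 x p.
suff h : Num.sqrt (norm2 x p) <= dist2 x p.
  have N0 : 0 <= norm2 x p by exact: norm2_ge0.
  by rewrite -(sqr_sqrtr N0) ler_sqr ?nnegrE // sqrtr_ge0.
rewrite leNgt; apply/negP => h; set s := Num.sqrt _ in h.
have D1 : 0 < dist2 x p + 1 by rewrite ltr_wpDl.
pose l := 1 + (s - dist2 x p) / (dist2 x p + 1).
have l1 : 1 < l by rewrite ltrDl divr_gt0 // subr_gt0.
have := good_le (good_lt1 c1) l1 Oc; rewrite /gl /= -/s.
have -> : s - l * dist2 x p = (s - dist2 x p) / (dist2 x p + 1).
  by rewrite /l; field; rewrite gt_eqF.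
by rewrite leNgt divr_gt0 // subr_gt0.
Qed.

End Component.

Lemma O_sym {R : realType} {d : nat} (M : set 'rV[R]_d) c x y : O M c (x, y) -> O M c (y, x).
Proof.
move=> [z Mz [K [cK nK KS Kz Kxy]]]; exists z => //.
pose sw (q : 'rV[R]_d * 'rV[R]_d) := (q.2, q.1).
have cs (A : set ('rV[R]_d * 'rV[R]_d)) : cont_on A sw.
  by apply: cont_on_pair; [exact: cont_on_snd|exact: cont_on_fst].
exists (sw @` K); split.
- exact: compact_image.
- exact: connected_image.
- by move=> _ [q /KS[M1 M2 h] <-]; split=> //=; rewrite dist2C.
- by exists (z, z).
- by exists (x, y).
Qed.

(** * Pushing slices into charts *)

Section Homeo.
Context {R : realType} {d : nat}.
Implicit Types (M : set 'rV[R]_d) (h k : 'rV[R]_d -> 'rV[R]_d).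

Definition homeoM M h k : Prop :=
  [/\ forall x, M x -> M (h x) /\ k (h x) = x, forall x, M x -> M (k x) /\ h (k x) = x,
      cont_on M h & cont_on M k].

Lemma homeoM_id M : homeoM M id id.
Proof. by split=> //; exact: cont_on_id. Qed.

Lemma homeoM_sym M h k : homeoM M h k -> homeoM M k h.
Proof. by case. Qed.

Lemma homeoM_comp M h1 k1 h2 k2 : homeoM M h1 k1 -> homeoM M h2 k2 ->
  homeoM M (h2 \o h1) (k1 \o k2).
Proof.
move=> [a1 b1 c1 d1] [a2 b2 c2 d2]; split.
- move=> x /a1[M1 E1] /=; have [M2 E2] := a2 _ M1; by rewrite E2.
- move=> x /b2[M1 E1] /=; have [M2 E2] := b1 _ M1; by rewrite E2.
- by apply: cont_on_comp c1 c2 => x /a1[].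
- by apply: cont_on_comp d2 d1 => x /b2[].
Qed.

Lemma closed_ball_compact {n} (a0 : 'rV[R]_n) (r : R) : compact [set a | `|a0 - a| <= r].
Proof.
apply: bounded_closed_compact.
  exists (`|a0| + r); split; first exact: num_real.
  move=> e he a /= ar; rewrite (le_trans _ (ltW he)) // -[a](subrK a0).
  by rewrite (le_trans (ler_normD _ _)) // addrC lerD2l distrC.
have /(closed_le (c := r)) : closed [set: 'rV[R]_n] by exact: closedT.
move=> /(_ (fun a => `|a0 - a|)); rewrite (_ : [set x | _] = [set a | `|a0 - a| <= r]).
  by apply; apply: cont_on_norm; apply: cont_onB; [exact: cont_on_cst|exact: cont_on_id].
by apply/seteqP; split=> x //= [].
Qed.

(** The topological content of a chart, stable under homeomorphisms of M; the last clause says that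
    the image is open in M. *)
Definition embed {n} M (U : set 'rV[R]_n) (f : 'rV[R]_n -> 'rV[R]_d) g : Prop :=
  [/\ open U, forall a, U a -> M (f a) /\ g (f a) = a, cont_on U f, cont_on (f @` U) g &
      forall a, U a -> exists2 e : R, 0 < e & forall x, M x -> `|f a - x| < e -> (f @` U) x].

Lemma chart_embed {n} M W (U : set 'rV[R]_n) f g J : chart M W U f g J -> embed M U f g.
Proof.
move=> C; have [oW oU hM [hg cg] _] := C; split=> //.
- by move=> a /hM[].
- exact: chart_cont C.
- by apply: cont_onS cg => _ [a Ua <-]; have [] := hM _ Ua.
move=> a Ua; have [Ma Wa _] := hM _ Ua; have [e e0 he] := (openE W).1 oW _ Wa.
by exists e => // x Mx /he Wx; have [Ux fx] := hg _ Mx Wx; exists (g x).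
Qed.

Lemma embed_homeo {n} M (U : set 'rV[R]_n) f g h k : embed M U f g -> homeoM M h k ->
  embed M U (h \o f) (g \o k).
Proof.
move=> [oU hf cf cg op] [hh hk ch ck]; split=> //.
- by move=> a /hf[Mf gf] /=; have [Mh ->] := hh _ Mf.
- by apply: (cont_on_comp (B := M)) cf ch => a /hf[].
- apply: (cont_on_comp (B := f @` U)) _ _ cg.
    by move=> _ [a Ua <-] /=; exists a => //; rewrite (hh _ (hf _ Ua).1).2.
  by apply: cont_onS ck => _ [a Ua <-] /=; apply: (hh _ _).1; exact: (hf _ Ua).1.
move=> a Ua; have [e e0 he] := op _ Ua; have [Mf _] := hf _ Ua.
have [q q0 hq] := ck _ (hh _ Mf).1 e e0; exists q => // x Mx /(hq _ Mx).
rewrite (hh _ Mf).2 => /(he _ (hk _ Mx).1)[b Ub E]; exists b => //=.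
by rewrite E (hk _ Mx).2.
Qed.

Section Extend.
Context {n : nat}.
Variables (M : set 'rV[R]_d) (U B : set 'rV[R]_n) (f : 'rV[R]_n -> 'rV[R]_d)
  (g : 'rV[R]_d -> 'rV[R]_n).
Hypotheses (E : embed M U f g) (cB : compact B) (BU : B `<=` U).

(** Transport of a coordinate homeomorphism that moves only points of a compact subset B of U.
    Continuity at the edge of the chart holds because the image of B is closed. *)
Definition extend (s : 'rV[R]_n -> 'rV[R]_n) (x : 'rV[R]_d) : 'rV[R]_d :=
  if asbool ((f @` U) x) then f (s (g x)) else x.

Lemma extend_in s a : U a -> extend s (f a) = f (s a).
Proof.
move=> Ua; have [_ hf _ _ _] := E; rewrite /extend asboolT; last exact: imageP.
by rewrite (hf _ Ua).2.
Qed.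

Lemma extend_out s x : ~ (f @` U) x -> extend s x = x.
Proof. by move=> nx; rewrite /extend asboolF. Qed.

Lemma extend_fix s x : (forall a, ~ B a -> s a = a) -> ~ (f @` B) x -> extend s x = x.
Proof.
move=> sB nx; have [[a Ua ax]|nU] := pselect ((f @` U) x); last exact: extend_out.
by rewrite -ax extend_in // sB // => Ba; apply: nx; exists a.
Qed.

Variables (s s' : 'rV[R]_n -> 'rV[R]_n).
Hypotheses (cs : cont_on setT s) (cs' : cont_on setT s') (sK : cancel s s') (s'K : cancel s' s)
  (sB : forall a, ~ B a -> s a = a).

Lemma extend_fix' a : ~ B a -> s' a = a.
Proof. by move=> nB; rewrite -{1}(sB nB) sK. Qed.

Lemma extend_stable (t t' : 'rV[R]_n -> 'rV[R]_n) a : cancel t t' -> (forall a, ~ B a -> t a = a) ->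
  (forall a, ~ B a -> t' a = a) -> U a -> U (t a).
Proof.
move=> tK tB tB' Ua; have [Bta|nB] := pselect (B (t a)); first exact: BU.
by have := tB' _ nB; rewrite tK => <-.
Qed.

Lemma extend_cont (t t' : 'rV[R]_n -> 'rV[R]_n) : cont_on setT t -> cancel t t' ->
  (forall a, ~ B a -> t a = a) -> (forall a, ~ B a -> t' a = a) -> cont_on M (extend t).
Proof.
move=> ct tK tB tB' x Mx e e0; have [_ hf cf cg op] := E.
have [[a Ua ax]|nU] := pselect ((f @` U) x); last first.
  have cfB : closed (f @` B).
    by apply: compact_isclosed; apply: compact_image => //; exact: cont_onS cf.
  have [|r r0 hr] := not_closed_dist (x := x) cfB; first by move=> [a /BU Ua fx]; apply: nU; exists a.
  exists (Num.min e r); first by rewrite lt_min e0.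
  move=> y My; rewrite lt_min => /andP[ye yr]; rewrite extend_out // extend_fix //.
  by move=> By; have := hr _ By; rewrite leNgt yr.
have Uta : U (t a) by exact: extend_stable tK tB tB' Ua.
have [r1 r10 h1] := cf _ Uta e e0.
have [r2 r20 h2] := ct a I r1 r10.
have [r3 r30 h3] := cg _ (imageP f Ua) r2 r20.
have [r4 r40 h4] := op _ Ua.
exists (Num.min r3 r4); first by rewrite lt_min r30.
move=> y My; rewrite -ax lt_min => /andP[y3 /(h4 _ My)[b Ub yb]].
rewrite -yb !extend_in //; apply: h1; first exact: extend_stable tK tB tB' Ub.
apply: h2 => //; have := h3 (f b) (imageP f Ub).
by rewrite (hf _ Ua).2 (hf _ Ub).2 yb; exact.
Qed.

Lemma extend_homeo : homeoM M (extend s) (extend s').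
Proof.
have [_ hf _ _ _] := E; have sB' := extend_fix'.
have aux t t' : cancel t t' -> (forall a, ~ B a -> t a = a) -> (forall a, ~ B a -> t' a = a) ->
    forall x, M x -> M (extend t x) /\ extend t' (extend t x) = x.
  move=> tK tB tB' x Mx; have [[a Ua <-]|nU] := pselect ((f @` U) x); last by rewrite !extend_out.
  have Uta : U (t a) by exact: extend_stable tK tB tB' Ua.
  by rewrite !extend_in // tK; have [] := hf _ Uta.
split; [exact: aux|exact: aux| |].
- exact: extend_cont sK sB sB'.
- exact: extend_cont s'K sB' sB.
Qed.

End Extend.
End Homeo.

(** * An explicit push along a direction, with bounded support *)

Section Boost.
Context {R : realType} {n : nat}.
Implicit Types (a : 'rV[R]_n).

Definition clamp (y : R) : R := Num.max (- 1) (Num.min 1 y).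

Lemma clamp_bound y : -1 <= clamp y <= 1.
Proof.
rewrite /clamp le_max lexx /= ge_max ge_min lexx /=.
by rewrite (le_trans (lerN10 _)).
Qed.

Lemma clamp_id y : -1 <= y <= 1 -> clamp y = y.
Proof. by move=> /andP[y1 y2]; rewrite /clamp min_r // max_r. Qed.

Lemma clamp_out y : 1 <= `|y| -> clamp y ^+ 2 = 1.
Proof.
rewrite ler_normr => /orP[y1|y1]; rewrite /clamp.
  by rewrite min_l // max_r ?expr1n // (le_trans (lerN10 _)).
have y2 : y <= -1 by lra.
by rewrite min_r ?max_l ?sqrrN ?expr1n // (le_trans y2) // (le_trans (lerN10 _)).
Qed.

(* The displacement of the Moebius map t |-> (t - m) / (1 - m t) of [-1, 1]. *)
Definition disp (m t : R) : R := m * (1 - t ^+ 2) / (1 - m * t).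

Lemma disp_den (m t : R) : `|m| < 1 -> -1 <= t <= 1 -> 0 < 1 - m * t.
Proof.
move=> m1 /andP[t1 t2]; have t3 : `|t| <= 1 by rewrite ler_norml t1.
have : `|m * t| < 1 by rewrite normrM (le_lt_trans _ m1) // ler_piMr.
by rewrite ltr_norml; lra.
Qed.

Lemma disp_inv (m t : R) : `|m| < 1 -> -1 <= t <= 1 ->
  -1 <= t - disp m t <= 1 /\ disp (- m) (t - disp m t) = - disp m t.
Proof.
move=> m1 t1; have d0 := disp_den m1 t1; have [ta tb] := andP t1.
have E : t - disp m t = (t - m) / (1 - m * t).
  by rewrite /disp; field; rewrite gt_eqF.
have [m2 m3] : -1 < m /\ m < 1 by move: m1; rewrite ltr_norml => /andP[].
have h1 : 0 <= (1 + t) * (1 - m) by rewrite mulr_ge0; lra.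
have h2 : 0 <= (1 - t) * (1 + m) by rewrite mulr_ge0; lra.
split.
  by rewrite E ler_pdivlMr // ler_pdivrMr //; apply/andP; split; lra.
have d1 : 1 + m * (t - disp m t) = (1 - m ^+ 2) / (1 - m * t).
  by rewrite E; field; rewrite gt_eqF.
have m4 : 0 < 1 - m ^+ 2.
  have -> : 1 - m ^+ 2 = (1 - m) * (1 + m) by ring.
  by rewrite mulr_gt0 //; lra.
have dE u : disp (- m) u = - (m * (1 - u ^+ 2)) / (1 + m * u).
  by rewrite /disp !mulNr opprK.
rewrite dE d1 E /disp; field.
by rewrite !gt_eqF.
Qed.

Variables (a0 b : 'rV[R]_n) (e : R).
Hypotheses (b0 : b != 0) (e0 : 0 < e).

Definition lead a : R := dotp (a - a0) b / dotp b b.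
Definition trans a : 'rV[R]_n := a - a0 - lead a *: b.
Definition strength a : R := Num.max 0 (1 - `|trans a| / e) / 2.
(** On each line parallel to b the segment |lead| <= e undergoes a Moebius map, whose parameter
    decreases to 0 as |trans| reaches e. The support is thus a box around a0, the opposite parameter
    gives the inverse, and for sg = 1 every moved point goes in the direction -b. *)
Definition boost (sg : R) a : 'rV[R]_n :=
  a - (e * disp (sg * strength a) (clamp (lead a / e))) *: b.

Let bb : 0 < dotp b b. Proof. by rewrite dotp_gt0. Qed.

Lemma lead_move a t : lead (a - t *: b) = lead a - t.
Proof.
rewrite /lead (_ : a - t *: b - a0 = a - a0 - t *: b); last by rewrite addrAC.
by rewrite (dotpBl (a - a0)) dotpZl mulrBl mulfK // gt_eqF.
Qed.

Lemma trans_move a t : trans (a - t *: b) = trans a.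
Proof. by rewrite /trans lead_move scalerBl; apply/rowP => i; rewrite !mxE; ring. Qed.

Lemma strength_move a t : strength (a - t *: b) = strength a.
Proof. by rewrite /strength trans_move. Qed.

Lemma strength_bound a : 0 <= strength a < 1.
Proof.
rewrite /strength divr_ge0 ?le_max ?lexx //= ltr_pdivrMr // mul1r gt_max ltr0n /=.
have : 0 <= `|trans a| / e by rewrite divr_ge0 // ltW.
lra.
Qed.

Lemma boostK (sg : R) : sg = 1 \/ sg = -1 -> cancel (boost sg) (boost (- sg)).
Proof.
move=> hsg a; pose m := sg * strength a; pose t := clamp (lead a / e).
have [s0 s1] := andP (strength_bound a).
have m1 : `|m| < 1 by rewrite /m; case: hsg => ->; rewrite ?mul1r ?mulN1r ?normrN ger0_norm.
have t1 := clamp_bound (lead a / e).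
have [t2 dE] := disp_inv m1 t1.
rewrite {1}/boost -/m -/t strength_move mulNr -/m lead_move mulrBl.
have [ly|ly] := lerP `|lead a / e| 1.
  have tE : t = lead a / e by rewrite /t clamp_id // -ler_norml.
  have -> : e * disp m t / e = disp m t by field; rewrite gt_eqF.
  rewrite -tE clamp_id // dE.
  by rewrite /boost -/m -/t mulrN scaleNr opprK subrK.
have d0 : disp m t = 0 by rewrite /disp /t clamp_out ?(ltW ly) // subrr mulr0 mul0r.
rewrite d0 mulr0 mul0r subr0 /boost -/m -/t d0 mulr0 scale0r !subr0.
rewrite /disp clamp_out ?(ltW ly) // subrr mulr0 mul0r mulr0 scale0r subr0 //.
Qed.

Lemma boost_cont (sg : R) : sg = 1 \/ sg = -1 -> cont_on setT (boost sg).
Proof.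
move=> hsg; have cl : cont_on setT lead.
  apply: cont_onM; last exact: cont_on_cst.
  apply: cont_on_dotp => j; apply: cont_on_coord; last exact: cont_on_cst.
  by apply: cont_onB; [exact: cont_on_id|exact: cont_on_cst].
have ct : cont_on setT trans.
  apply: cont_onB; last by apply: cont_onZ => //; exact: cont_on_cst.
  by apply: cont_onB; [exact: cont_on_id|exact: cont_on_cst].
have cst0 : cont_on setT strength.
  apply: cont_onM; last exact: cont_on_cst.
  apply: cont_on_max; first exact: cont_on_cst.
  apply: cont_onB; first exact: cont_on_cst.
  by apply: cont_onM; [exact: cont_on_norm|exact: cont_on_cst].
have cc : cont_on setT (fun a => clamp (lead a / e)).
  apply: cont_on_max; first exact: cont_on_cst.
  apply: cont_on_min; first exact: cont_on_cst.
  by apply: cont_onM => //; exact: cont_on_cst.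
have cm : cont_on setT (fun a => sg * strength a) by apply: cont_onM => //; exact: cont_on_cst.
apply: cont_onB; first exact: cont_on_id.
apply: cont_onZ; last exact: cont_on_cst.
apply: cont_onM; first exact: cont_on_cst.
apply: cont_onM.
  apply: cont_onM => //; apply: cont_onB; first exact: cont_on_cst.
  by apply: cont_onM.
apply: cont_onV.
  move=> a _; rewrite gt_eqF // disp_den ?clamp_bound //.
  have [s0 s1] := andP (strength_bound a).
  by case: hsg => ->; rewrite ?mul1r ?mulN1r ?normrN ger0_norm.
apply: cont_onB; first exact: cont_on_cst.
exact: cont_onM.
Qed.

Lemma boost_supp (sg : R) a : boost sg a != a -> `|lead a| < e /\ `|trans a| < e.
Proof.
move=> ne; split; rewrite ltNge; apply: contra ne => h; apply/eqP; rewrite /boost /disp.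
  rewrite clamp_out; last by rewrite normrM normfV (gtr0_norm e0) ler_pdivlMr // mul1r.
  by rewrite subrr mulr0 mul0r mulr0 scale0r subr0.
have -> : strength a = 0.
  by rewrite /strength max_l ?mul0r // subr_le0 ler_pdivlMr // mul1r.
by rewrite mulr0 !mul0r mulr0 scale0r subr0.
Qed.

Lemma supp_ball a : `|lead a| < e -> `|trans a| < e -> `|a0 - a| <= e * (`|b| + 1).
Proof.
move=> l1 t1; have -> : a0 - a = - (trans a + lead a *: b).
  by rewrite /trans subrK opprB.
rewrite normrN (le_trans (ler_normD _ _)) // normrZ mulrDr mulr1 addrC lerD //; last exact: ltW.
by rewrite ler_wpM2r // ltW.
Qed.

Lemma boost_back a : exists2 t : R, 0 <= t & boost 1 a = a - t *: b.
Proof.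
exists (e * disp (1 * strength a) (clamp (lead a / e))) => //.
have [s0 s1] := andP (strength_bound a); have t1 := clamp_bound (lead a / e).
apply: mulr_ge0; first exact: ltW.
rewrite mul1r /disp; apply: divr_ge0; last by apply/ltW/disp_den => //; rewrite ger0_norm.
apply: mulr_ge0 => //.
by rewrite subr_ge0 -[leLHS]ger0_norm ?sqr_ge0 // normrX expr_le1 // ler_norml.
Qed.

Lemma boost_moves : exists2 r : R, 0 < r & forall a, `|a0 - a| < r -> boost 1 a != a.
Proof.
have cl : cont_on setT lead.
  apply: cont_onM; last exact: cont_on_cst.
  apply: cont_on_dotp => j; apply: cont_on_coord; last exact: cont_on_cst.
  by apply: cont_onB; [exact: cont_on_id|exact: cont_on_cst].
have ct : cont_on setT trans.
  apply: cont_onB; last by apply: cont_onZ => //; exact: cont_on_cst.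
  by apply: cont_onB; [exact: cont_on_id|exact: cont_on_cst].
have l0 : lead a0 = 0 by rewrite /lead subrr dotp0l mul0r.
have t0 : trans a0 = 0 by rewrite /trans l0 subrr scale0r subr0.
have [r1 r10 h1] := cl a0 I e e0; have [r2 r20 h2] := ct a0 I e e0.
exists (Num.min r1 r2); first by rewrite lt_min r10.
move=> a; rewrite lt_min => /andP[/(h1 _ I) + /(h2 _ I)].
rewrite l0 t0 !sub0r !normrN => la ta.
have sp : 0 < strength a.
  by rewrite /strength divr_gt0 // lt_max subr_gt0 ltr_pdivrMr // mul1r ta orbT.
have [s0 s1] := andP (strength_bound a).
have le : `|lead a / e| < 1 by rewrite normrM normfV (gtr0_norm e0) ltr_pdivrMr // mul1r.
have tE : clamp (lead a / e) = lead a / e by rewrite clamp_id // -ler_norml ltW.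
rewrite /boost subr_eq addrC -subr_eq subrr eq_sym scaler_eq0 (negbTE b0) orbF mulf_eq0 gt_eqF //=.
rewrite mul1r tE /disp gt_eqF //; apply: divr_gt0.
  apply: mulr_gt0 => //.
  by rewrite subr_gt0 -[ltLHS]ger0_norm ?sqr_ge0 // normrX expr_lt1.
by apply: disp_den; rewrite ?ger0_norm // -ler_norml ltW.
Qed.

End Boost.

(** * Contraction of a slice towards its centre *)

Section Push.
Context {R : realType} {n d : nat}.
Variable M : set 'rV[R]_d.
Hypotheses (cM : compact M) (hC : charted (n := n) M).
Variable p : 'rV[R]_d.
Hypothesis Mp : M p.

Definition Om : set 'rV[R]_d := [set x | O M 1 (x, p)].

Lemma Om_sub x : Om x -> M x /\ dist2 x p < 1.
Proof. by move=> /O_sub[]. Qed.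

Lemma Om_p : Om p. Proof. exact: O_diag. Qed.

Lemma Om_open x : Om x -> exists2 e, 0 < e & forall z, M z -> `|x - z| < e -> Om z.
Proof.
move=> Ox; have [e e0 he] := O_open hC Ox; exists e => // z Mz xz; apply: he => //.
by apply/norm_pair_lt; rewrite /= subrr normr0.
Qed.

Lemma Om_closed x : M x -> dist2 x p < 1 ->
  (forall e : R, 0 < e -> exists2 z, Om z & `|x - z| < e) -> Om x.
Proof.
move=> Mx xp h; apply: (O_closed hC) => // e /h[z Oz xz]; exists (z, p) => //.
by apply/norm_pair_lt; rewrite /= subrr; have [] := h 1 ltr01; split=> //; rewrite normr0 (le_lt_trans _ xz).
Qed.

Lemma Om_linked x z : Om x ->
  linked [set w | M w /\ dist2 w p < 1] x z -> Om z.
Proof.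
move=> Ox [K [cK nK KS Kx Kz]]; apply: (O_linked Ox).
exists ((fun w => (w, p)) @` K).
have cp : cont_on K (fun w => (w, p)) by apply: cont_on_pair; [exact: cont_on_id|exact: cont_on_cst].
split; [exact: compact_image|exact: connected_image| | |].
- by move=> _ [w /KS[? ?] <-]; split.
- by exists x.
- by exists z.
Qed.

(** The third clause keeps a track from each point to its image inside the slice, between the new
    and the old distance to p; connectedness arguments follow these tracks. *)
Definition push h k : Prop :=
  [/\ homeoM M h k, forall z, M z -> ~ Om z -> h z = z,
      forall z, Om z ->
        linked [set w | [/\ Om w, dist2 (h z) p <= dist2 w p & dist2 w p <= dist2 z p]] z (h z) &
      forall z, M z -> h z = z \/ dist2 (h z) p < dist2 z p].

Lemma push_id : push id id.
Proof.
split=> //; [exact: homeoM_id| |by move=> z _; left].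
by move=> z Oz; apply: linked_refl; split.
Qed.

Lemma push_le h k z : push h k -> Om z -> Om (h z) /\ dist2 (h z) p <= dist2 z p.
Proof. by move=> [_ _ tr _] /tr[K [_ _ KS Kz /KS[]]]. Qed.

Lemma push_comp h1 k1 h2 k2 : push h1 k1 -> push h2 k2 -> push (h2 \o h1) (k1 \o k2).
Proof.
move=> P1 P2; have [H1 f1 t1 m1] := P1; have [H2 f2 t2 m2] := P2; split.
- exact: homeoM_comp.
- by move=> z Mz nO /=; rewrite f1 // f2.
- move=> z Oz /=; have [Oz1 l1] := push_le P1 Oz; have [Oz2 l2] := push_le P2 Oz1.
  apply: linked_trans (linkedS _ (t1 z Oz)) (linkedS _ (t2 _ Oz1)).
    by move=> w [? h ?]; split=> //; exact: le_trans h.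
  by move=> w [? ? h]; split=> //; exact: le_trans l1.
move=> z Mz /=; have [M1 _] := (let: And4 a _ _ _ := H1 in a) _ Mz.
case: (m1 _ Mz) => [->|l1]; first exact: m2.
by right; case: (m2 _ M1) => [->//|l2]; exact: lt_trans l1.
Qed.

Lemma push_inv h k z : push h k -> Om z -> Om (k z).
Proof.
move=> [[_ hk _ _] fx _ _] Oz; have [Mz _] := Om_sub Oz; have [Mk E] := hk _ Mz.
apply: contrapT => nO; have E' := fx _ Mk nO.
by apply: nO; rewrite -E' E.
Qed.

(** [descent_dir] supplies a direction that lowers the distance to p throughout a coordinate box,
    and [boost] along it extends by the identity. *)
Lemma push_local x : Om x -> x <> p -> exists h k, push h k /\
  exists2 e : R, 0 < e & forall z, M z -> `|x - z| < e -> dist2 (h z) p < dist2 z p.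
Proof.
move=> Ox xp; have [Mx xlt] := Om_sub Ox.
have nc : norm2 (n := n) M x p != dist2 x p by apply/eqP; exact: O_noncrit.
have [W [U [phi [g [J [[C _] Wx Ux fx _]]]]]] := chart_at hC Mx.
have [b [r [r0 rU dec]]] := descent_dir hC C Mx Wx nc.
have pr : `|p - p| < r by rewrite subrr normr0.
have b0 : b != 0.
  apply/eqP => b0; have := dec (g x) p 1.
  by rewrite b0 scaler0 subr0 subrr normr0 => /(_ r0 r0 pr ltr01); rewrite ltxx.
have [e1 e10 he1] := Om_open Ox.
have [rho rho0 [hrho _]] := chart_ball C Mx Wx e10.
have b1 : 0 < `|b| + 1 by rewrite ltr_wpDl.
pose r' := Num.min r rho; have r'0 : 0 < r' by rewrite lt_min r0.
pose e := r' / 2 / (`|b| + 1); have e0 : 0 < e by rewrite !divr_gt0.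
have er : e * (`|b| + 1) < r' by rewrite /e divfK ?gt_eqF // ltr_pdivrMr // ltr_pMr // ltr1n.
set a0 := g x in Ux fx rU dec hrho.
pose B := [set a | `|a0 - a| <= e * (`|b| + 1)].
have Br a : B a -> `|a0 - a| < r /\ `|a0 - a| < rho.
  by move=> Ba; have := le_lt_trans Ba er; rewrite lt_min => /andP[].
have BU : B `<=` U by move=> a /Br[/rU].
have cB : compact B by exact: closed_ball_compact.
have E := chart_embed C.
pose s := boost a0 b e 1; pose s' := boost a0 b e (- 1).
have sK : cancel s s' by apply: boostK => //; left.
have s'K : cancel s' s by have := boostK a0 b0 e0 (or_intror (erefl (-1 : R))); rewrite opprK.
have cs : cont_on setT s by apply: boost_cont => //; left.
have cs' : cont_on setT s' by apply: boost_cont => //; right.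
have sB a : ~ B a -> s a = a.
  move=> nB; apply/eqP; apply: contrapT => /negP ne; apply: nB.
  by have [l t] := boost_supp e0 ne; exact: supp_ball.
have sin a : s a != a -> B a /\ B (s a).
  move=> ne; split; first by apply: contrapT => /sB /eqP; rewrite (negbTE ne).
  apply: contrapT => nB; move: ne; rewrite -{2}(sK a).
  by rewrite (extend_fix' sK sB nB) eqxx.
have H := extend_homeo E cB BU cs cs' sK s'K sB.
have back a t1 t2 : B (a - t1 *: b) -> B (a - t2 *: b) -> t1 < t2 ->
    dist2 (phi (a - t2 *: b)) p < dist2 (phi (a - t1 *: b)) p.
  move=> B1 B2 t12; have -> : a - t2 *: b = a - t1 *: b - (t2 - t1) *: b.
    by rewrite scalerBl; apply/rowP => i; rewrite !mxE; ring.
  apply: dec => //; [by have [] := Br _ B1| |by rewrite subr_gt0].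
  rewrite (_ : a - t1 *: b - (t2 - t1) *: b = a - t2 *: b); last first.
    by apply/rowP => i; rewrite !mxE; ring.
  by have [] := Br _ B2.
have move_ a : U a -> s a != a -> dist2 (phi (s a)) p < dist2 (phi a) p.
  move=> Ua ne; have [Ba Bs] := sin _ ne; have [t t0 sE] := boost_back a0 b e0 a.
  have tp : 0 < t.
    rewrite lt_def t0 andbT; apply: contra ne => /eqP tz.
    by rewrite /s sE tz scale0r subr0.
  have := back a 0 t; rewrite scale0r subr0 -sE; exact.
have hE a : U a -> extend U phi g s (phi a) = phi (s a) by move=> Ua; exact: (extend_in E).
exists (extend U phi g s), (extend U phi g s'); split; first split=> //.
- move=> z Mz nO; have [[a Ua az]|nU] := pselect ((phi @` U) z); last exact: extend_out.
  rewrite -az hE //; have [->//|ne] := eqVneq (s a) a.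
  have [Ba _] := sin _ ne; case: nO; rewrite -az; apply: he1; first by rewrite az.
  by have [_ ar] := Br _ Ba; have [] := hrho _ ar.
- move=> z Oz; have [Mz _] := Om_sub Oz.
  have [[a Ua az]|nU] := pselect ((phi @` U) z); last first.
    by rewrite extend_out //; apply: linked_refl; split.
  rewrite -az hE //; have [->//|ne] := eqVneq (s a) a.
    by apply: linked_refl; split=> //; rewrite az.
  have [Ba Bs] := sin _ ne; have [t t0 sE] := boost_back a0 b e0 a.
  rewrite -/s in sE; have cphi : cont_on U phi := chart_cont C.
  apply: (linked_segment cphi) => k k01.
  have Bk : B (a + k *: (s a - a)).
    have := Bs; have := Ba; rewrite /B /= => h1 h2.
    move: k01 => /andP[k0 k1].
    have -> : a0 - (a + k *: (s a - a)) = k *: (a0 - s a) + (1 - k) *: (a0 - a).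
      by apply/rowP => i; rewrite !mxE; ring.
    rewrite (le_trans (ler_normD _ _)) // !normrZ (ger0_norm k0) ger0_norm ?subr_ge0 //.
    have h3 := ler_wpM2l k0 h2; have h4 : (1 - k) * `|a0 - a| <= (1 - k) * (e * (`|b| + 1)).
      by rewrite ler_wpM2l // subr_ge0.
    by apply: le_trans (lerD h3 h4) _; rewrite -mulrDl addrC subrK mul1r.
  have kE : a + k *: (s a - a) = a - (k * t) *: b.
    by rewrite sE addrAC subrr add0r scalerN scalerA.
  have Uk := BU _ Bk; have [_ _ hM _ _] := C; have [Mk _ _] := hM _ Uk.
  split=> //; split.
  + by apply: he1 => //; have [_ ar] := Br _ Bk; have [] := hrho _ ar.
  + rewrite kE sE; have : k * t <= t by case/andP: k01 => *; rewrite ler_piMl.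
    rewrite le_eqVlt => /predU1P[->//|kt].
    by apply/ltW/back => //; rewrite -?kE -?sE.
  + have Ba0 : B (a - 0 *: b) by rewrite scale0r subr0.
    have : 0 <= k * t by case/andP: k01 => *; rewrite mulr_ge0.
    rewrite kE -[X in _ <= dist2 (phi X) p]subr0 -[X in _ <= dist2 (phi (a - X)) p](scale0r b).
    rewrite le_eqVlt => /predU1P[<-//|kt].
    by apply/ltW/back => //; rewrite -kE.
- move=> z Mz; have [[a Ua az]|nU] := pselect ((phi @` U) z); last by left; exact: extend_out.
  rewrite -az hE //; have [->|ne] := eqVneq (s a) a; [by left|right; exact: move_].
have [q q0 hq] := boost_moves a0 b0 e0.
have [_ _ _ [hg cg] _] := C; have [q' q'0 hq'] := cg x (conj Mx Wx) q q0.
have [w w0 hw] : exists2 w : R, 0 < w & forall y, `|x - y| < w -> W y.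
  by case: C => oW _ _ _ _; exact: ((openE W).1 oW).
exists (Num.min q' w); first by rewrite lt_min q'0.
move=> z Mz; rewrite lt_min => /andP[zq /hw Wz].
have [Uz fz] := hg _ Mz Wz; rewrite -fz hE //; apply: move_ => //.
by apply: hq; exact: hq'.
Qed.

Lemma push_compact K : compact K -> K `<=` Om -> (forall x, K x -> x <> p) ->
  exists h k, push h k /\ forall z, K z -> dist2 (h z) p < dist2 z p.
Proof.
move=> cK KO Kp.
pose P (S : set 'rV[R]_d) := exists h k, push h k /\
  forall z, M z -> S z -> dist2 (h z) p < dist2 z p.
have [h [k [hP hS]]] : P K; last first.
  by exists h, k; split=> // z Kz; apply: hS => //; have [] := Om_sub (KO _ Kz).
apply: (@compact_ind _ K P cK).
- by exists id, id; split=> //; exact: push_id.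
- move=> S S' [h1 [k1 [P1 l1]]] [h2 [k2 [P2 l2]]]; exists (h2 \o h1), (k1 \o k2).
  split; first exact: push_comp.
  have [[H1 _ _ _] _ _ m1] := P1; have [_ _ _ m2] := P2.
  move=> z Mz [Sz|Sz] /=.
    by case: (m2 _ (H1 _ Mz).1) => [->|h]; [exact: l1|apply: lt_trans h _; exact: l1].
  case: (m1 _ Mz) => [->|h]; first exact: l2.
  by case: (m2 _ (H1 _ Mz).1) => [->//|h']; exact: lt_trans h.
- by move=> S S' SS' [h [k [hP hS]]]; exists h, k; split=> // z Mz /SS'; exact: hS.
move=> x Kx; have [h [k [hP [e e0 he]]]] := push_local (KO _ Kx) (Kp _ Kx).
exists [set z | `|x - z| < e]; first by apply/nbhsP; exists e.
by exists h, k; split=> // z Mz [_ /=]; exact: he.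
Qed.

Lemma cont_dist2p (A : set 'rV[R]_d) : cont_on A (fun x => dist2 x p).
Proof.
by apply: cont_on_dotp => j; apply: cont_on_coord; apply: cont_onB;
  [exact: cont_on_id|exact: cont_on_cst|exact: cont_on_id|exact: cont_on_cst].
Qed.

(** On the compact shell between r and c one push lowers the squared distance by at least some eta >
    0. As no push raises it, more than c / eta repetitions bring all these points below r. *)
Lemma push_deep c r : c < 1 -> 0 < r ->
  exists h k, push h k /\ forall z, Om z -> dist2 z p <= c -> dist2 (h z) p < r.
Proof.
move=> c1 r0; pose A := [set z | [/\ Om z, r <= dist2 z p & dist2 z p <= c]].
have cA : compact A.
  apply: (compact_sub cM); last by move=> z [/Om_sub[]].
  apply/closedP => z h.
  have Mz : M z.
    have /closedP : closed M by exact: compact_isclosed.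
    by apply=> e /h[w [/Om_sub[? _] _ _] zw]; exists w.
  have c' : closed [set: 'rV[R]_d] by exact: closedT.
  have [_ h1] : setT z /\ r <= dist2 z p.
    have /closedP : closed [set x | setT x /\ r <= dist2 x p].
      by apply: closed_ge => //; exact: cont_dist2p.
    by apply=> e /h[w [_ ? _] zw]; exists w.
  have [_ h2] : setT z /\ dist2 z p <= c.
    have /closedP : closed [set x | setT x /\ dist2 x p <= c].
      by apply: closed_le => //; exact: cont_dist2p.
    by apply=> e /h[w [_ _ ?] zw]; exists w.
  split=> //; apply: Om_closed => //; first exact: le_lt_trans c1.
  by move=> e /h[w [? _ _] zw]; exists w.
have [A0|A0] := pselect (A !=set0); last first.
  exists id, id; split; first exact: push_id.
  by move=> z Oz zc; rewrite ltNge; apply/negP => rz; apply: A0; exists z.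
have AO : A `<=` Om by move=> z [].
have Ap z : A z -> z <> p by move=> [_ rz _] zp; move: rz; rewrite zp dist2xx leNgt r0.
have [h0 [k0 [P0 l0]]] := push_compact cA AO Ap.
have [[H0 _ ch0 _] _ _ _] := P0.
have cd : cont_on A (fun z => dist2 z p - dist2 (h0 z) p).
  apply: cont_onB; first exact: cont_dist2p.
  have ch : cont_on A h0 by apply: cont_onS ch0 => z /AO /Om_sub[].
  have TT : forall z, A z -> [set: 'rV[R]_d] (h0 z) by [].
  exact: (cont_on_comp TT ch (@cont_dist2p setT)).
have [z0 Az0 zmin] := compact_min cA A0 cd.
pose eta := dist2 z0 p - dist2 (h0 z0) p.
have eta0 : 0 < eta by rewrite subr_gt0; exact: l0.
have step N : exists h k, push h k /\ forall z, Om z -> dist2 z p <= c ->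
    dist2 (h z) p < r \/ dist2 (h z) p <= c - N%:R * eta.
  elim: N => [|N [h [k [hP hN]]]].
    by exists id, id; split; [exact: push_id|move=> z _ zc; right; rewrite mul0r subr0].
  exists (h0 \o h), (k \o k0); split; first exact: push_comp.
  move=> z Oz zc /=; have [Oh lh] := push_le hP Oz; have [Oh0 lh0] := push_le P0 Oh.
  have [hr|hr] := ltrP (dist2 (h z) p) r; first by left; exact: le_lt_trans hr.
  right; have Ah : A (h z) by split=> //; exact: le_trans zc.
  case: (hN _ Oz zc) => [h'|h']; first by move: hr; rewrite leNgt h'.
  by have := zmin _ Ah; rewrite -/eta -natr1; lra.
have [N hN] : exists N : nat, c / eta < N%:R.
  exists (Num.bound `|c / eta|); apply: le_lt_trans (ler_norm _) _.
  by apply: Num.Theory.archi_boundP.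
have [h [k [hP hh]]] := step N; exists h, k; split=> // z Oz zc.
case: (hh _ Oz zc) => // h'; move: hN; rewrite ltr_pdivrMr // => hN.
by have := dist2_ge0 (h z) p; lra.
Qed.

End Push.

(** * Covers by two slices *)

Section Punctured.
Context {R : realType} {n : nat}.

Lemma independent_vector (u : 'rV[R]_n) : (1 < n)%N -> u != 0 ->
  exists w : 'rV[R]_n, forall s t : R, s *: u + t *: w = 0 -> s = 0 /\ t = 0.
Proof.
move=> n1 u0; have [i ui] : exists i, u 0 i != 0.
  apply: contrapT => h; move/negP: u0; apply; apply/eqP/rowP => i; rewrite mxE.
  by apply/eqP; apply: contrapT => /negP ui; apply: h; exists i.
have [j ij] : exists j : 'I_n, j != i.
  have [i0|i0] := eqVneq (val i) 0%N.
    by exists (Ordinal n1); rewrite -val_eqE /= i0.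
  by exists (Ordinal (ltnW n1)); rewrite -val_eqE /= eq_sym.
exists (delta_mx 0 j) => s t E.
have s0 : s = 0.
  move/rowP: (E) => /(_ i); rewrite !mxE /= eq_sym (negbTE ij) mulr0 addr0 => /eqP.
  by rewrite mulf_eq0 (negbTE ui) orbF => /eqP.
split=> //; move/rowP: E => /(_ j); rewrite s0 !mxE !eqxx mulr1 mul0r add0r //.
Qed.

(** If the segment from a to b meets a0, the detour passes through a point c off the line through a
    and b; such a point exists because n > 1. *)
Lemma linked_punctured (a0 a b : 'rV[R]_n) (r : R) : (1 < n)%N ->
  `|a0 - a| < r -> `|a0 - b| < r -> a != a0 -> b != a0 ->
  linked [set u | `|a0 - u| < r /\ u <> a0] a b.
Proof.
have id1 (x y z : 'rV[R]_n) (q s : R) :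
    (1 - q) *: (x - y) + q *: (s *: z) = x + q *: (y + s *: z - x) - y.
  by apply/rowP => i; rewrite !mxE; ring.
move=> n1 ar br an bn; set S := [set u | _].
have seg (x y : 'rV[R]_n) : `|a0 - x| < r -> `|a0 - y| < r ->
    (forall t : R, 0 <= t <= 1 -> x + t *: (y - x) <> a0) -> linked S x y.
  move=> xr yr h; apply: (linked_segment (f := id) (A := setT)); first exact: cont_on_id.
  by move=> t t01; split=> //; split; [exact: ball_convex|exact: h].
have [h|h] := pselect (forall t : R, 0 <= t <= 1 -> a + t *: (b - a) <> a0); first exact: seg.
have [t [t01 tE]] : exists t : R, 0 <= t <= 1 /\ a + t *: (b - a) = a0.
  by apply: contrapT => h'; apply: h => t t01 E; apply: h'; exists t.
have u0 : a - a0 != 0 by rewrite subr_eq0.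
have [w wi] := independent_vector n1 u0.
have tE' : (1 - t) *: (a - a0) + t *: (b - a0) = 0.
  by rewrite -[RHS](subrr a0) -{3}tE; apply/rowP => i; rewrite !mxE; ring.
have tn : t != 0.
  by apply/eqP => t0; move: tE' u0; rewrite t0 subr0 scale1r scale0r addr0 => ->; rewrite eqxx.
have bE : b - a0 = (- (1 - t) / t) *: (a - a0).
  have /eqP := tE'; rewrite addrC addr_eq0 => /eqP E.
  apply: (scalerI tn); rewrite E scalerA mulrA [t * _]mulrC mulfK // scaleNr //.
have r0 : 0 < r by exact: le_lt_trans ar.
have w1 : 0 < `|w| + 1 by rewrite ltr_wpDl.
pose s := r / 2 / (`|w| + 1); have s0 : 0 < s by rewrite !divr_gt0.
pose c := a0 + s *: w.
have cr : `|a0 - c| < r.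
  rewrite /c opprD addNKr normrN normrZ gtr0_norm // /s mulrAC ltr_pdivrMr //.
  have : `|w| * r <= `|w| * r by []. 
  have h1 : 0 <= `|w| by []; have := mulr_ge0 h1 (ltW r0); lra.
have avoid (x : 'rV[R]_n) k : x - a0 = k *: (a - a0) -> x != a0 ->
    forall q : R, 0 <= q <= 1 -> x + q *: (c - x) <> a0.
  move=> xE xn q q01 E.
  have E' : ((1 - q) * k) *: (a - a0) + (q * s) *: w = 0.
    have E2 : x + q *: (c - x) - a0 = 0 by rewrite E subrr.
    by rewrite -[(q * s) *: w]scalerA -scalerA -xE; exact: etrans (id1 _ _ _ _ _) E2.
  have [h1 h2] := wi _ _ E'.
  move/eqP: h2; rewrite mulf_eq0 (gt_eqF s0) orbF => /eqP q0.
  move/eqP: h1; rewrite q0 subr0 mul1r => /eqP k0.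
  by move: xn; rewrite -subr_eq0 xE k0 scale0r eqxx.
apply: (@linked_trans _ _ _ _ c) _ (linked_sym _).
  by apply: seg => //; apply: (avoid _ 1) => //; rewrite scale1r.
by apply: seg => //; exact: avoid bE bn.
Qed.

Definition ball_map (a0 : 'rV[R]_n) (r : R) (u : 'rV[R]_n) := a0 + (r / (1 + `|u|)) *: u.
Definition ball_inv (a0 : 'rV[R]_n) (r : R) (a : 'rV[R]_n) :=
  (r - `|a0 - a|)^-1 *: (a - a0).

Lemma ball_map_in a0 r u : 0 < r -> `|a0 - ball_map a0 r u| < r.
Proof.
move=> r0; have u1 : 0 < 1 + `|u| by rewrite ltr_wpDr.
rewrite /ball_map opprD addNKr normrN normrZ ger0_norm ?divr_ge0 ?ltW //.
by rewrite mulrAC ltr_pdivrMr // ltr_pM2l // ltrDr.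
Qed.

Lemma ball_mapK a0 r : 0 < r -> cancel (ball_map a0 r) (ball_inv a0 r).
Proof.
move=> r0 u; have u1 : 0 < 1 + `|u| by rewrite ltr_wpDr.
rewrite /ball_inv /ball_map opprD addNKr normrN normrZ ger0_norm ?divr_ge0 ?ltW //.
rewrite [a0 + _]addrC addrK scalerA -[RHS]scale1r; congr (_ *: _).
by field; rewrite !gt_eqF //=; rewrite (_ : _ - _ = r) //; ring.
Qed.

Lemma ball_invK a0 r a : `|a0 - a| < r -> ball_map a0 r (ball_inv a0 r a) = a.
Proof.
move=> ar; have ra : 0 < r - `|a0 - a| by rewrite subr_gt0.
have r0 : 0 < r by exact: le_lt_trans ar.
rewrite /ball_map /ball_inv normrZ gtr0_norm ?invr_gt0 // (distrC a) scalerA.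
rewrite (_ : _ / _ * _ = 1) ?scale1r; first by rewrite addrC subrK.
field; rewrite !gt_eqF //=; rewrite (_ : _ + _ = r) //; ring.
Qed.

Lemma embed_ball {d} (M : set 'rV[R]_d) (U : set 'rV[R]_n) f g a0 r : embed M U f g -> 0 < r ->
  (forall a, `|a0 - a| < r -> U a) ->
  exists (f' : 'rV[R]_n -> 'rV[R]_d) (g' : 'rV[R]_d -> 'rV[R]_n),
    embed M setT f' g' /\ forall a, `|a0 - a| < r -> range f' (f a).
Proof.
move=> [oU hf cf cg op] r0 rU.
exists (f \o ball_map a0 r), (ball_inv a0 r \o g); split; last first.
  by move=> a ar; exists (ball_inv a0 r a) => //=; rewrite ball_invK.
have inU u : U (ball_map a0 r u) by apply: rU; exact: ball_map_in.
split.
- exact: openT.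
- by move=> u _ /=; have [Mf gf] := hf _ (inU u); rewrite gf ball_mapK.
- apply: cont_on_comp cf; first by move=> u _; exact: inU.
  apply: cont_onD; first exact: cont_on_cst.
  apply: cont_onZ; last exact: cont_on_id.
  apply: cont_onM; first exact: cont_on_cst.
  apply: cont_onV; first by move=> u _; rewrite gt_eqF // ltr_wpDr.
  by apply: cont_onD; [exact: cont_on_cst|apply: cont_on_norm; exact: cont_on_id].
- apply: (cont_on_comp (B := [set a | `|a0 - a| < r]) (f := g)).
  + by move=> _ [u _ <-] /=; rewrite (hf _ (inU u)).2; exact: ball_map_in.
  + by apply: cont_onS cg => _ [u _ <-] /=; exists (ball_map a0 r u).
  have cd : cont_on [set a | `|a0 - a| < r] (fun a => a0 - a).
    by apply: cont_onB; [exact: cont_on_cst|exact: cont_on_id].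
  apply: cont_onZ; last by apply: cont_onB; [exact: cont_on_id|exact: cont_on_cst].
  apply: cont_onV; first by move=> a /= ar; rewrite gt_eqF // subr_gt0.
  by apply: cont_onB; [exact: cont_on_cst|exact: cont_on_norm].
move=> u _ /=; have Uu := inU u; have [e e0 he] := op _ Uu.
have ru : 0 < r - `|a0 - ball_map a0 r u| by rewrite subr_gt0 ball_map_in.
have [q q0 hq] := cg _ (imageP f Uu) _ ru.
exists (Num.min e q); first by rewrite lt_min e0.
move=> x Mx; rewrite lt_min => /andP[/(he _ Mx)[b Ub <-] bq].
have := hq _ (imageP f Ub) bq; rewrite (hf _ Uu).2 (hf _ Ub).2 => h.
exists (ball_inv a0 r b) => //=; rewrite ball_invK //.
by have := ler_distD (ball_map a0 r u) a0 b; lra.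
Qed.

End Punctured.

(** * Annuli in slices, and covers by two slices *)

Section TwoBalls.
Context {R : realType} {n d : nat}.
Variable M : set 'rV[R]_d.
Hypotheses (cM : compact M) (hC : charted (n := n) M) (nM : connected M).
Hypothesis n1 : (1 < n)%N.

Definition Ann (p : 'rV[R]_d) (c : R) : set 'rV[R]_d := [set x | Om M p x /\ c < dist2 x p].

Lemma center_chart p : M p -> exists (U : set 'rV[R]_n) phi g a0 rho r,
  [/\ embed M U phi g /\ (0 < rho /\ 0 < r), phi a0 = p,
      forall a, `|a0 - a| < rho -> U a /\ Om M p (phi a) &
      forall z, M z -> dist2 z p < r -> `|a0 - g z| < rho /\ phi (g z) = z].
Proof.
move=> Mp; have [W [U [phi [g [J [[C _] Wp Up fp _]]]]]] := chart_at hC Mp.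
have [e e0 he] := Om_open hC Mp (Om_p Mp).
have [rho rho0 [h1 [q q0 h2]]] := chart_ball C Mp Wp e0.
have [_ _ hM [hg _] _] := C.
exists U, phi, g, (g p), rho, (q ^+ 2); split=> //.
- by split; [exact: chart_embed C|rewrite exprn_gt0].
- by move=> a /h1[Ua ar]; split=> //; apply: he => //; have [] := hM _ Ua.
move=> z Mz zq; have pz : `|p - z| < q.
  rewrite distrC; apply: le_lt_trans (le_norm_enorm _) _.
  by rewrite enorm_lt // ltW.
have [Wz gz] := h2 _ Mz pz; split=> //.
by have [] := hg _ Mz Wz.
Qed.

Lemma Om_linked_p p x : M p -> Om M p x -> linked (Om M p) x p.
Proof.
move=> Mp Ox; have [Mx x1] := Om_sub Ox.
have [U [phi [g [a0 [rho [r [[E [rho0 r0]] fp hU hr]]]]]]] := center_chart Mp.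
have [h [k [P hd]]] := push_deep cM hC Mp x1 r0.
have [Oh _] := push_le P Ox; have [Mh _] := Om_sub Oh.
have [ga fg] := hr _ Mh (hd _ Ox (lexx _)).
have [_ _ tr _] := P; apply: linked_trans (linkedS _ (tr _ Ox)) _; first by move=> w [].
have [_ _ cphi _ _] := E.
rewrite -fg -[X in linked _ _ X]fp; apply: (linked_segment cphi) => t t01.
have a0r : `|a0 - a0| < rho by rewrite subrr normr0.
exact: hU (ball_convex a0r ga t01).
Qed.

(** A push contracts x and y into a chart at p, where they are joined off the centre; with the
    tracks this gives a compact connected L in the slice without p. The inverse of a deeper push,
    one that compresses the points within c below the distance from p to L, carries L into the
    annulus, and tracks join the new end points to x and y. *)
Lemma Ann_linked p c x y : M p -> c < 1 -> Ann p c x -> Ann p c y -> linked (Ann p c) x y.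
Proof.
move=> Mp c1 [Ox cx] [Oy cy].
have [U [phi [g [a0 [rho [r [[E [rho0 r0]] fp hU hr]]]]]]] := center_chart Mp.
have [_ hE cphi cg _] := E.
have [Mx x1] := Om_sub Ox; have [My y1] := Om_sub Oy.
have [c0|c0] := ltrP c 0.
  apply: (linkedS (S := Om M p)) => [z Oz|]; first by split=> //; exact: lt_le_trans (dist2_ge0 _ _).
  exact: linked_trans (Om_linked_p Mp Ox) (linked_sym (Om_linked_p Mp Oy)).
have m1 : Num.max (dist2 x p) (dist2 y p) < 1 by rewrite gt_max x1.
have [h [k [P hd]]] := push_deep cM hC Mp m1 r0.
have [[Hh _ _ _] _ tr _] := P.
pose S := [set w | Om M p w /\ w <> p].
have hp : h p = p.
  have [_] := push_le P (Om_p Mp); rewrite dist2xx => hle.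
  by apply/eqP; rewrite -dist2_eq0; apply/eqP/le_anti; rewrite hle dist2_ge0.
have cpos z : c < dist2 z p -> z <> p.
  by move=> cz zp; move: cz; rewrite zp dist2xx ltNge c0.
have hnp z : M z -> z <> p -> h z <> p.
  by move=> Mz zp E'; apply: zp; rewrite -(Hh _ Mz).2 E' -{1}hp (Hh _ Mp).2.
have tS z : Om M p z -> z <> p -> linked S z (h z).
  move=> Oz zp; have [Mz _] := Om_sub Oz; apply: linkedS (tr _ Oz) => w [Ow l _]; split=> // wp.
  move: l; rewrite wp dist2xx => l; apply: (hnp _ Mz zp); apply/eqP; rewrite -dist2_eq0.
  by apply/eqP/le_anti; rewrite l dist2_ge0.
have near z : Om M p z -> z <> p -> dist2 z p <= Num.max (dist2 x p) (dist2 y p) ->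
    [/\ `|a0 - g (h z)| < rho, phi (g (h z)) = h z & g (h z) != a0].
  move=> Oz zp zm; have [Oh _] := push_le P Oz; have [Mh _] := Om_sub Oh.
  have [ga fg] := hr _ Mh (hd _ Oz zm); split=> //.
  apply/eqP => gE; have [Mz _] := Om_sub Oz; apply: (hnp _ Mz zp); by rewrite -fg gE fp.
have xp := cpos _ cx; have yp := cpos _ cy.
have [xr fx xn] : [/\ `|a0 - g (h x)| < rho, phi (g (h x)) = h x & g (h x) != a0].
  by apply: near => //; rewrite le_max lexx.
have [yr fy yn] : [/\ `|a0 - g (h y)| < rho, phi (g (h y)) = h y & g (h y) != a0].
  by apply: near => //; rewrite le_max lexx orbT.
have [K [cK nK KS Kx Ky]] := linked_punctured n1 xr yr xn yn.
have hxy : linked S (h x) (h y).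
  have cK' : cont_on K phi by apply: cont_onS cphi => a /KS[/hU[]].
  exists (phi @` K); split; [exact: compact_image|exact: connected_image| | |].
  - move=> _ [a Ka <-]; have [/hU[Ua Oa] an] := KS _ Ka; split=> // fa.
    have Ua0 : U a0 by have := hU a0; rewrite subrr normr0 => /(_ rho0)[].
    by apply: an; rewrite -(hE _ Ua).2 fa -fp (hE _ Ua0).2.
  - by exists (g (h x)).
  - by exists (g (h y)).
have [L [cL nL LS Lx Ly]] : linked S x y.
  exact: linked_trans (tS _ Ox xp) (linked_trans hxy (linked_sym (tS _ Oy yp))).
have [z0 Lz0 zmin] := compact_min cL (ex_intro _ _ Lx) (@cont_dist2p _ _ p L).
have m0 : 0 < dist2 z0 p.
  by rewrite lt_def dist2_ge0 andbT dist2_eq0; have [_ /eqP] := LS _ Lz0.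
have [h' [k' [P' hd']]] := push_deep cM hC Mp c1 m0.
have [[_ Hk' _ ck'] _ tr' _] := P'.
have LO z : L z -> Om M p z by move=> /LS[].
have kA z : L z -> Ann p c (k' z).
  move=> Lz; have Oz := LO _ Lz; have Ok := push_inv P' Oz; split=> //.
  rewrite ltNge; apply/negP => /(hd' _ Ok); have [Mz _] := Om_sub Oz.
  by rewrite (Hk' _ Mz).2 ltNge (zmin z).
have kL z : L z -> c < dist2 z p -> linked (Ann p c) (k' z) z.
  move=> Lz cz; have Oz := LO _ Lz; have Ok := push_inv P' Oz; have [Mz _] := Om_sub Oz.
  have := tr' _ Ok; rewrite (Hk' _ Mz).2; apply: linkedS => w [Ow l _]; split=> //.
  exact: lt_le_trans l.
apply: linked_trans (linked_sym (kL _ Lx cx)) (linked_trans _ (kL _ Ly cy)).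
have cL' : cont_on L k' by apply: cont_onS ck' => z /LO /Om_sub[].
exists (k' @` L); split; [exact: compact_image|exact: connected_image| | |].
- by move=> _ [z Lz <-]; exact: kA.
- by exists x.
- by exists y.
Qed.

(** Points of the annulus around p are within squared distance c of q, so this connected annulus
    lies in the slice of q as soon as it meets it. A limit of slice points outside the slice has
    distance at least 1 from the centre, hence is a limit of annulus points and lies in the other
    slice. The union of the slices is therefore closed as well as open. *)
Lemma two_components p q c : M p -> M q -> c < 1 -> c < dist2 p q ->
  (forall x, M x -> c < dist2 x p -> dist2 x q <= c) ->
  (exists2 z, Ann p c z & Om M q z) -> forall x, M x -> Om M p x \/ Om M q x.
Proof.
move=> Mp Mq c1 cpq hx [z0 Az0 Oz0].
have hx' x : M x -> c < dist2 x q -> dist2 x p <= c.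
  by move=> Mx cx; rewrite leNgt; apply/negP => /(hx _ Mx); rewrite leNgt cx.
have ann p' q' z z' : M p' -> M q' -> (forall x, M x -> c < dist2 x p' -> dist2 x q' <= c) ->
    Ann p' c z -> Om M q' z -> Ann p' c z' -> Om M q' z'.
  move=> Mp' Mq' h Az Oz Az'; apply: (Om_linked Mq' Oz); apply: linkedS (Ann_linked Mp' c1 Az Az').
  move=> w [Ow cw]; have [Mw _] := Om_sub Ow; split=> //.
  exact: le_lt_trans (h _ Mw cw) c1.
have Ap z : Ann p c z -> Om M q z by apply: ann Az0 Oz0.
have lim p' x e : M p' -> M x -> ~ Om M p' x -> (forall e : R, 0 < e -> exists2 z, Om M p' z & `|x - z| < e) ->
    0 < e -> exists2 z, Ann p' c z & `|x - z| < e.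
  move=> Mp' Mx nO h e0.
  have x1 : 1 <= dist2 x p'.
    by rewrite leNgt; apply/negP => x1; apply: nO; exact: (Om_closed hC Mp').
  have d0 : 0 < dist2 x p' - c by rewrite subr_gt0; exact: lt_le_trans x1.
  have [r r0 hr] := @cont_dist2p _ _ p' setT x I _ d0.
  have er : 0 < Num.min e r by rewrite lt_min e0.
  have [z Oz] := h _ er; rewrite lt_min => /andP[ze zr]; exists z => //; split=> //.
  by have := hr z I zr; rewrite ltr_norml => /andP[_]; lra.
have cl p' q' x : M p' -> M q' -> M x -> (forall x, M x -> c < dist2 x p' -> dist2 x q' <= c) ->
    (forall z, Ann p' c z -> Om M q' z) ->
    (forall e : R, 0 < e -> exists2 z, Om M p' z & `|x - z| < e) -> Om M p' x \/ Om M q' x.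
  move=> Mp' Mq' Mx hh A h; have [Ox|nO] := pselect (Om M p' x); [by left|right].
  have x1 : 1 <= dist2 x p'.
    by rewrite leNgt; apply/negP => x1; apply: nO; exact: (Om_closed hC Mp').
  apply: (Om_closed hC Mq') => //.
    by apply: (le_lt_trans (hh _ Mx _) c1); exact: lt_le_trans c1 x1.
  by move=> e e0; have [z Az xz] := lim _ _ _ Mp' Mx nO h e0; exists z => //; exact: A.
(* Were the annulus around q disjoint from the slice of p, the slice of q would be relatively closed
   in the slice of p and contain it. Then p itself, at squared distance more than c from q, would
   lie in both. *)
have Aq : exists2 z, Ann q c z & Om M p z.
  apply: contrapT => no.
  have Opq y : Om M p y -> Om M q y.
    move=> Oy; have Oz0p : Om M p z0 by case: Az0.
    have [K [cK nK KS Kz Ky]] := linked_trans (Om_linked_p Mp Oz0p) (linked_sym (Om_linked_p Mp Oy)).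
    apply: (connected_all (O := Om M q) nK _ _ _ Ky); first by exists z0.
      move=> z Kz' /(Om_open hC Mq)[e e0 he]; exists e => // w Kw; apply: he.
      by have [] := Om_sub (KS _ Kw).
    move=> z Kz' nO; have Oz := KS _ Kz'; have [Mz _] := Om_sub Oz.
    apply: contrapT => h.
    have hz e : 0 < e -> exists2 w, Om M q w & `|z - w| < e.
      move=> e0; apply: contrapT => h'; apply: h; exists e => // w _ zw Ow.
      by apply: h'; exists w.
    have [e e0 he] := Om_open hC Mp Oz.
    have [w Aw zw] := lim _ _ _ Mq Mz nO hz e0.
    by apply: no; exists w => //; apply: he => //; case: Aw => /Om_sub[].
  apply: no; exists p; last exact: Om_p.
  by split=> //; apply: Opq; exact: Om_p.
have Aq' z : Ann q c z -> Om M p z by case: Aq => w Aw Ow; apply: ann Aw Ow.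
have uo z : Om M p z \/ Om M q z -> exists2 e : R, 0 < e &
    forall w, M w -> `|z - w| < e -> Om M p w \/ Om M q w.
  by case=> [/(Om_open hC Mp)|/(Om_open hC Mq)][e e0 he]; exists e => // w Mw zw; [left|right]; exact: he.
move=> x Mx; apply: (connected_all (O := [set x | Om M p x \/ Om M q x]) nM _ _ _ Mx).
- by exists p => //; left; exact: Om_p.
- by move=> z Mz /uo[e e0 he]; exists e.
move=> z Mz nz; apply: contrapT => h.
have both e : 0 < e -> exists2 w, Om M p w \/ Om M q w & `|z - w| < e.
  move=> e0; apply: contrapT => h'; apply: h; exists e => // w _ zw Ow.
  by apply: h'; exists w.
have [hp|hp] := pselect (forall e : R, 0 < e -> exists2 w, Om M p w & `|z - w| < e).
  by apply: nz; exact: (cl p q).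
have [e1 e10 he1] : exists2 e : R, 0 < e & forall w, Om M p w -> `|z - w| < e -> False.
  apply: contrapT => h1; apply: hp => e e0; apply: contrapT => h2; apply: h1.
  by exists e => // w Ow zw; apply: h2; exists w.
have : Om M q z \/ Om M p z.
  apply: (cl q p) => // e e0; have [|w Ow zw] := both (Num.min e e1); first by rewrite lt_min e0.
  move: zw; rewrite lt_min => /andP[ze ze1]; exists w => //.
  by case: Ow => // /he1 /(_ ze1).
by case=> Oz; apply: nz; [right|left].
Qed.

(** The part of M outside the slice of q is compact in the slice of p, so a push moves it into a
    coordinate ball at p. What the pulled-back ball leaves uncovered is compact in the slice of q
    and is treated likewise. *)
Lemma two_balls p q : M p -> M q -> (forall x, M x -> Om M p x \/ Om M q x) ->
  exists f g f' g', [/\ embed M (@setT 'rV[R]_n) f g, embed M (@setT 'rV[R]_n) f' g' &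
    forall x, M x -> range f x \/ range f' x].
Proof.
move=> Mp Mq cov.
have deep p' K : M p' -> compact K -> K `<=` Om M p' -> exists h k (f : 'rV[R]_n -> _) g,
    [/\ homeoM M h k, embed M setT f g & forall z, K z -> range f (h z)].
  move=> Mp' cK KO.
  have [U [phi [g [a0 [rho [r [[E [rho0 r0]] fp hU hr]]]]]]] := center_chart Mp'.
  have [f' [g' [E' hf']]] := embed_ball (a0 := a0) E rho0 (fun a ha => (hU a ha).1).
  have [c c1 hc] : exists2 c : R, c < 1 & forall z, K z -> dist2 z p' <= c.
    have [K0|K0] := pselect (K !=set0); last by exists 0 => // z Kz; case: K0; exists z.
    have [z0 Kz0 zmax] := compact_max cK K0 (@cont_dist2p _ _ p' K).
    by exists (dist2 z0 p') => //; have [] := Om_sub (KO _ Kz0).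
  have [h [k [P hd]]] := push_deep cM hC Mp' c1 r0.
  exists h, k, f', g'; split=> //; first by case: P.
  move=> z Kz; have Oz := KO _ Kz; have [Oh _] := push_le P Oz; have [Mh _] := Om_sub Oh.
  have [ga fg] := hr _ Mh (hd _ Oz (hc _ Kz)); rewrite -fg; exact: hf'.
pose compl (A : set 'rV[R]_d) := [set x | M x /\ ~ A x].
have ccompl A : (forall x, M x -> A x -> exists2 e : R, 0 < e & forall w, M w -> `|x - w| < e -> A w) ->
    compact (compl A).
  move=> oA; apply: (compact_sub cM); last by move=> x [].
  apply/closedP => x h; have Mx : M x.
    have /closedP : closed M by exact: compact_isclosed.
    by apply=> e /h[w [? _] xw]; exists w.
  split=> // Ax; have [e e0 he] := oA _ Mx Ax; have [w [Mw nw] xw] := h e e0.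
  by apply: nw; exact: he.
have cq : compact (compl (Om M q)) by apply: ccompl => x _; exact: (Om_open hC Mq).
have qp : compl (Om M q) `<=` Om M p by move=> x [Mx nO]; case: (cov _ Mx).
have [h1 [k1 [f1 [g1 [H1 E1 in1]]]]] := deep p _ Mp cq qp.
have [Hh1 Hk1 _ ck1] := H1.
pose A := [set x | M x /\ range f1 (h1 x)].
have cA : compact (compl A).
  apply: ccompl => x Mx [_ [a _ ax]]; have [_ _ _ _ op] := E1.
  have [e e0 he] := op a I; have [_ _ ch _] := H1.
  have [r r0 hr] := ch _ Mx e e0; exists r => // w Mw xw; split=> //.
  by apply: he; [exact: (Hh1 _ Mw).1|rewrite ax; exact: hr].
have Aq : compl A `<=` Om M q.
  by move=> x [Mx nA]; apply: contrapT => nO; apply: nA; split=> //; exact: in1.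
have [h2 [k2 [f2 [g2 [H2 E2 in2]]]]] := deep q _ Mq cA Aq.
have [Hh2 Hk2 _ _] := H2.
exists (k1 \o f1), (g1 \o h1), (k2 \o f2), (g2 \o h2); split.
- exact: embed_homeo (homeoM_sym H1).
- exact: embed_homeo (homeoM_sym H2).
move=> x Mx; have [[_ [a _ ax]]|nA] := pselect (A x).
  by left; exists a => //=; rewrite ax (Hh1 _ Mx).2.
right; have [a _ ax] := in2 x (conj Mx nA); exists a => //=.
by rewrite ax (Hh2 _ Mx).2.
Qed.

End TwoBalls.

(** * Unions of two cells *)

Section Squeeze.
Context {R : realType} {n : nat}.
Variables (c : 'rV[R]_n) (rad k : R).
Hypotheses (rad0 : 0 < rad) (k0 : 0 < k).

(** Along a ray, t = |u| / rad < 1 goes to t / (t + l (1 - t)), which divides t / (1 - t) by l.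
    Hence l and 1 / l give inverse maps, and points at distance at least rad are fixed. *)
Definition squeeze_scale (l : R) (u : 'rV[R]_n) : R :=
  let t := Num.min (`|u| / rad) 1 in t + l * (1 - t).

Definition squeeze (l : R) (a : 'rV[R]_n) : 'rV[R]_n :=
  c + (squeeze_scale l (a - c))^-1 *: (a - c).

Lemma squeeze_scale_gt0 l u : 0 < l -> 0 < squeeze_scale l u.
Proof.
move=> l0; rewrite /squeeze_scale; set t := Num.min _ _.
have t0 : 0 <= t by rewrite le_min ler01 divr_ge0 // ltW.
have t1 : t <= 1 by rewrite ge_min lexx orbT.
have [->|tn] := eqVneq t 0; first by rewrite subr0 mulr1 add0r.
have tp : 0 < t by rewrite lt_def tn.
have t1' : 0 <= 1 - t by rewrite subr_ge0.
by rewrite ltr_wpDr // mulr_ge0 // ltW.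
Qed.

Lemma squeeze_out l a : rad <= `|c - a| -> squeeze l a = a.
Proof.
move=> h; rewrite /squeeze /squeeze_scale min_r; last by rewrite ler_pdivlMr // mul1r distrC.
by rewrite subrr mulr0 addr0 invr1 scale1r addrC subrK.
Qed.

Lemma squeeze_center l : squeeze l c = c.
Proof. by rewrite /squeeze subrr scaler0 addr0. Qed.

Lemma squeezeK l : 0 < l -> cancel (squeeze l) (squeeze l^-1).
Proof.
move=> l0 a; have [h|h] := lerP rad `|c - a|; first by rewrite !squeeze_out.
have h' : `|a - c| < rad by rewrite distrC.
have p1 := squeeze_scale_gt0 (a - c) l0.
have tE : squeeze_scale l (a - c) = `|a - c| / rad + l * (1 - `|a - c| / rad).
  by rewrite /squeeze_scale min_l // ler_pdivrMr // mul1r ltW.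
have T1 : `|a - c| / rad < 1 by rewrite ltr_pdivrMr // mul1r.
have T0 : 0 <= `|a - c| / rad by rewrite divr_ge0 // ltW.
rewrite {1}/squeeze (_ : squeeze l a - c = (squeeze_scale l (a - c))^-1 *: (a - c)); last first.
  by rewrite /squeeze addrC addKr.
have nE : `|(squeeze_scale l (a - c))^-1 *: (a - c)| / rad
    = (`|a - c| / rad) / squeeze_scale l (a - c).
  by rewrite normrZ gtr0_norm ?invr_gt0 // -mulrA mulrC.
have sE : squeeze_scale l^-1 ((squeeze_scale l (a - c))^-1 *: (a - c))
    = (squeeze_scale l (a - c))^-1.
  rewrite {1}/squeeze_scale nE; move: p1; rewrite tE; move: (`|a - c| / rad) T1 T0 => t t1 t0 p1.
  rewrite min_l; last first.
    rewrite ler_pdivrMr // mul1r lerDl mulr_ge0 ?subr_ge0 ?ltW //.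
  by field; rewrite !gt_eqF.
by rewrite sE invrK scalerA mulfV ?gt_eqF // scale1r addrC subrK.
Qed.

Lemma squeeze_cont l : 0 < l -> cont_on setT (squeeze l).
Proof.
move=> l0; have ca : cont_on setT (fun a : 'rV[R]_n => a - c).
  by apply: cont_onB; [exact: cont_on_id|exact: cont_on_cst].
have cm : cont_on setT (fun a : 'rV[R]_n => Num.min (`|a - c| / rad) 1).
  apply: cont_on_min; last exact: cont_on_cst.
  by apply: cont_onM; [exact: cont_on_norm|exact: cont_on_cst].
apply: cont_onD; first exact: cont_on_cst.
apply: cont_onZ => //; apply: cont_onV; first by move=> a _; rewrite gt_eqF // squeeze_scale_gt0.
apply: cont_onD => //; apply: cont_onM; first exact: cont_on_cst.
by apply: cont_onB => //; exact: cont_on_cst.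
Qed.

Lemma squeeze_in l r a : 0 < l -> r < rad -> `|c - a| <= r ->
  `|c - squeeze l a| <= r * rad / (l * (rad - r)).
Proof.
move=> l0 rr ar; have rd : 0 < rad - r by rewrite subr_gt0.
have p1 := squeeze_scale_gt0 (a - c) l0.
rewrite /squeeze opprD addNKr normrN normrZ gtr0_norm ?invr_gt0 // (distrC a).
have h : l * (rad - r) / rad <= squeeze_scale l (a - c).
  rewrite /squeeze_scale distrC min_l; last by rewrite ler_pdivrMr // mul1r (le_trans ar) // ltW.
  rewrite ler_pdivrMr // mulrDl mulfVK ?gt_eqF // -mulrA mulrBl mul1r mulfVK ?gt_eqF //.
  by rewrite ler_wpDl // ler_pM2l // lerB.
have r0 : 0 <= r by exact: le_trans (normr_ge0 _) ar.
have h0 : 0 < l * (rad - r) / rad by rewrite divr_gt0 // mulr_gt0.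
rewrite mulrC; apply: (le_trans (y := r / (l * (rad - r) / rad))).
  apply: ler_pM => //; first by rewrite invr_ge0 ltW.
  by rewrite lef_pV2.
by rewrite invf_div mulrA.
Qed.

End Squeeze.

Lemma squeeze_ball {R : realType} {n : nat} (c : 'rV[R]_n) (r e : R) : 0 <= r -> 0 < e ->
  exists s s' : 'rV[R]_n -> 'rV[R]_n,
    [/\ cont_on setT s /\ cont_on setT s', cancel s s' /\ cancel s' s, s c = c,
        forall a, ~ `|c - a| <= r + 1 -> s a = a & forall a, `|c - a| <= r -> `|c - s a| < e].
Proof.
move=> r0 e0; have R0 : 0 < r + 1 by rewrite ltr_wpDl.
(* With support radius r + 1, [squeeze_in] sends the ball of radius r into radius r (r + 1) / l,
   which is less than e. *)
pose l := r * (r + 1) / e + 1; have l0 : 0 < l.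
  by rewrite ltr_wpDl // divr_ge0 ?(ltW e0) // mulr_ge0 // ltW.
have lV0 : 0 < l^-1 by rewrite invr_gt0.
exists (squeeze c (r + 1) l), (squeeze c (r + 1) l^-1); split.
- by split; exact: squeeze_cont.
- by split; [exact: squeezeK|rewrite -{2}[l]invrK; exact: squeezeK].
- exact: squeeze_center.
- by move=> a /negP; rewrite -ltNge => /ltW; exact: squeeze_out.
move=> a ar; have rr : r < r + 1 by rewrite ltrDl.
apply: le_lt_trans (squeeze_in R0 l0 rr ar) _.
rewrite (_ : r + 1 - r = 1) ?mulr1; last by rewrite addrC addKr.
by rewrite ltr_pdivrMr // /l [e * (_ + 1)]mulrDr mulr1 [e * _]mulrC divfK ?gt_eqF // ltrDl.
Qed.

(** * The sphere as a one-point compactification *)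

Section Stereo.
Context {R : realType} {n : nat}.

Lemma cont_on_row {V : normedModType R} {m} (A : set V) (f : V -> 'rV[R]_m) :
  (forall j, cont_on A (fun x => f x 0 j)) -> cont_on A f.
Proof.
move=> cf; apply: (@cont_on_ext _ _ _ _ (fun x => \sum_j f x 0 j *: delta_mx 0 j)).
  by move=> x _; rewrite [RHS]row_sum_delta.
elim: (index_enum _) => [|i s IH].
  by apply: cont_on_ext (cont_on_cst 0) => x _; rewrite big_nil.
apply: cont_on_ext (cont_onD (cont_onZ (cf i) (cont_on_cst (delta_mx 0 i))) IH) => x _.
by rewrite big_cons.
Qed.

(** Inverse stereographic projection from [pole]. *)
Definition stereo (u : 'rV[R]_n) : 'rV[R]_n.+1 :=
  \row_j oapp (fun i => 2 * u 0 i / (dotp u u + 1)) ((dotp u u - 1) / (dotp u u + 1)) (unlift ord0 j).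

Definition pole : 'rV[R]_n.+1 := delta_mx 0 ord0.

Lemma stereo0 u : stereo u 0 ord0 = (dotp u u - 1) / (dotp u u + 1).
Proof. by rewrite mxE unlift_none. Qed.

Lemma stereoS u i : stereo u 0 (lift ord0 i) = 2 * u 0 i / (dotp u u + 1).
Proof. by rewrite mxE liftK. Qed.

Lemma dotp_recl (x y : 'rV[R]_n.+1) :
  dotp x y = x 0 ord0 * y 0 ord0 + \sum_(i < n) x 0 (lift ord0 i) * y 0 (lift ord0 i).
Proof. by rewrite /dotp big_ord_recl. Qed.

Lemma sphereE (x : 'rV[R]_n.+1) : sphere R n x <-> dotp x x = 1.
Proof.
rewrite /sphere /= /enorm; split=> [h|->]; last by rewrite sqrtr1.
by rewrite -(sqr_sqrtr (dotp_ge0 x)) h expr1n.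
Qed.

Lemma den_gt0 (u : 'rV[R]_n) : 0 < dotp u u + 1.
Proof. by rewrite ltr_wpDl // dotp_ge0. Qed.

Lemma stereo_sphere u : sphere R n (stereo u).
Proof.
apply/sphereE; rewrite dotp_recl stereo0; have d0 := den_gt0 u.
rewrite (eq_bigr (fun i => (4 / (dotp u u + 1) ^+ 2) * (u 0 i * u 0 i))); last first.
  by move=> i _; rewrite stereoS; field; rewrite gt_eqF.
by rewrite -mulr_sumr -/(dotp u u); field; rewrite gt_eqF.
Qed.

Lemma stereo_inj : injective stereo.
Proof.
move=> u v E; have d0 := den_gt0 u; have d1 := den_gt0 v.
have E0 : dotp u u = dotp v v.
  move/rowP: (E) => /(_ ord0); rewrite !stereo0 => /eqP.
  rewrite (eqr_div _ _ (lt0r_neq0 d0) (lt0r_neq0 d1)) => /eqP; move: (dotp u u) (dotp v v) => a b h; lra.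
apply/rowP => i; move/rowP: E => /(_ (lift ord0 i)); rewrite !stereoS E0.
by move=> /(mulIf (invr_neq0 (lt0r_neq0 d1))) /mulfI; apply.
Qed.

Lemma stereo_neq u : stereo u <> pole.
Proof.
move=> /rowP /(_ ord0); rewrite stereo0 mxE !eqxx /= => /eqP.
rewrite -subr_eq0 (_ : _ - _ = - 2 / (dotp u u + 1)); last by field; rewrite gt_eqF ?den_gt0.
rewrite mulf_eq0 invr_eq0 (gt_eqF (den_gt0 u)) orbF oppr_eq0 pnatr_eq0 //.
Qed.

Lemma stereo_surj x : sphere R n x -> x <> pole -> exists u, stereo u = x.
Proof.
move=> /sphereE; rewrite dotp_recl; set t := x 0 ord0; set S := \sum_(i < n) _ => xS xp.
have S0 : 0 <= S by apply: sumr_ge0 => i _; rewrite -expr2 sqr_ge0.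
have tn : t != 1.
  apply/eqP => t1; apply: xp; apply/rowP => j; have [i ->|->] := unliftP ord0 j; last first.
    by rewrite mxE !eqxx.
  rewrite mxE eqxx /=; move/eqP: xS; rewrite t1 mulr1 -subr_eq0 addrC addKr => /eqP/psumr_eq0P S0'.
  have /eqP := S0' (fun i _ => sqr_ge0 (x 0 (lift ord0 i))) i isT.
  by rewrite mulf_eq0 orbb => /eqP.
have t1 : 0 < 1 - t.
  rewrite subr_gt0 lt_def eq_sym tn /=; nra.
exists (\row_i (x 0 (lift ord0 i) / (1 - t))).
have D : dotp (\row_i (x 0 (lift ord0 i) / (1 - t))) (\row_i (x 0 (lift ord0 i) / (1 - t)))
    = (1 + t) / (1 - t).
  rewrite /dotp (eq_bigr (fun i => (1 - t) ^- 2 * (x 0 (lift ord0 i) * x 0 (lift ord0 i)))).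
    rewrite -mulr_sumr -/S (_ : S = (1 - t) * (1 + t)); last by lra.
    by field; rewrite gt_eqF.
  by move=> i _; rewrite !mxE; field; rewrite gt_eqF.
have dn : (1 + t) / (1 - t) + 1 = 2 / (1 - t) by field; rewrite gt_eqF.
apply/rowP => j; have [i ->|->] := unliftP ord0 j.
  by rewrite stereoS D dn mxE; field; rewrite gt_eqF.
by rewrite stereo0 D dn -/t; field; rewrite gt_eqF.
Qed.

Lemma stereo_cont : cont_on setT stereo.
Proof.
have cd : cont_on setT (fun u : 'rV[R]_n => dotp u u).
  by apply: cont_on_dotp => j; apply: cont_on_coord; exact: cont_on_id.
have cV : cont_on setT (fun u : 'rV[R]_n => (dotp u u + 1)^-1).
  apply: cont_onV; first by move=> u _; rewrite gt_eqF // den_gt0.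
  by apply: cont_onD => //; exact: cont_on_cst.
apply: cont_on_row => j; have [i ->|->] := unliftP ord0 j.
  apply: (@cont_on_ext _ _ _ _ (fun u : 'rV[R]_n => 2 * u 0 i * (dotp u u + 1)^-1)).
    by move=> u _; rewrite stereoS.
  apply: cont_onM => //; apply: cont_onM; first exact: cont_on_cst.
  by apply: cont_on_coord; exact: cont_on_id.
apply: (@cont_on_ext _ _ _ _ (fun u : 'rV[R]_n => (dotp u u - 1) * (dotp u u + 1)^-1)).
  by move=> u _; rewrite stereo0.
by apply: cont_onM => //; apply: cont_onB => //; exact: cont_on_cst.
Qed.

Lemma stereo_pole (e : R) : 0 < e -> exists rho : R, forall u, rho <= `|u| -> `|pole - stereo u| < e.
Proof.
move=> e0; pose q := 4 / e ^+ 2; have q0 : 0 < q by rewrite divr_gt0 // exprn_gt0.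
exists (q + 1) => u hu; have d0 := den_gt0 u.
have un : `|u| ^+ 2 <= dotp u u.
  by rewrite -enorm_sqr ler_sqr ?nnegrE ?enorm_ge0 // le_norm_enorm.
have qu : q < dotp u u + 1.
  have : q + 1 <= `|u| ^+ 2 by rewrite (le_trans hu) // expr2 ler_peMl // (le_trans _ hu) // lerDr ltW.
  by move: un; lra.
apply: le_lt_trans (le_norm_enorm _) _; rewrite enorm_lt //.
have /sphereE sS := stereo_sphere u.
have pp : dotp pole pole = 1.
  rewrite dotp_recl mxE !eqxx mulr1 big1 ?addr0 // => i _.
  by rewrite mxE eqxx /= mul0r.
have ps : dotp pole (stereo u) = (dotp u u - 1) / (dotp u u + 1).
  rewrite dotp_recl stereo0 mxE !eqxx mul1r big1 ?addr0 // => i _.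
  by rewrite mxE eqxx /= mul0r.
rewrite !dotpBl !dotpBr (dotpC (stereo u) pole) sS pp ps.
rewrite (_ : _ - _ - _ = 4 / (dotp u u + 1)); last by field; rewrite gt_eqF.
  by move: qu; rewrite /q ltr_pdivrMr ?exprn_gt0 // ltr_pdivrMr // [X in _ < X]mulrC.
exact: ltW.
Qed.

End Stereo.

Lemma homeomorphic_compact {R : realType} {n d : nat} (A : set 'rV[R]_d) (B : set 'rV[R]_n)
    (f : 'rV[R]_d -> 'rV[R]_n) : compact A -> cont_on A f ->
    (forall x, A x -> B (f x)) -> (forall x y, A x -> A y -> f x = f y -> x = y) ->
    (forall y, B y -> exists2 x, A x & f x = y) -> homeomorphic A B.
Proof.
move=> cA cf AB fi fs.
have /choice[g hg] : forall y, exists x, B y -> A x /\ f x = y.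
  move=> y; have [/fs[x Ax xy]|nB] := pselect (B y); first by exists x.
  by exists 0.
exists f; split.
- split; first by move=> x /AB.
  + by move=> x y; rewrite !inE => Ax Ay; exact: fi.
  + by move=> y /fs[x Ax <-]; exists x.
- exact/cont_onP.
have gf x : A x -> g (f x) = x.
  by move=> Ax; have [Ag E] := hg _ (AB _ Ax); exact: fi.
exists g => //; apply/cont_onP; apply: cont_onS (cont_on_inv cA cf gf).
by move=> y /fs[x Ax <-]; exists x.
Qed.

(** * A compact union of two open cells is a sphere *)

Section Brown.
Context {R : realType} {n d : nat}.
Variables (M : set 'rV[R]_d) (f f' : 'rV[R]_n -> 'rV[R]_d) (g g' : 'rV[R]_d -> 'rV[R]_n).
Hypotheses (cM : compact M) (E : embed M setT f g) (E' : embed M setT f' g')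
  (cov : forall x, M x -> range f x \/ range f' x).

(** Otherwise G would be continuous on the compact set M and hence bounded, while its values fill
    the coordinate space. *)
Lemma cell_escape (F : 'rV[R]_n -> 'rV[R]_d) G : (0 < n)%N -> M !=set0 -> embed M setT F G ->
  exists2 z, M z & ~ range F z.
Proof.
move=> n0 M0 [_ hF _ cG _]; apply: contrapT => h.
have all x : M x -> range F x by move=> Mx; apply: contrapT => nx; apply: h; exists x.
have [x _ xmax] := compact_max cM M0 (cont_on_norm (cont_onS all cG)).
have := xmax (F (const_mx (`|G x| + 1))) (hF _ I).1; rewrite (hF _ I).2.
have := mx_norm_coord (const_mx (`|G x| + 1) : 'rV[R]_n) (Ordinal n0).
rewrite mxE ger0_norm ?addr_ge0 // => h1 h2; have := le_trans h1 h2; lra.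
Qed.

Lemma embed_far (F : 'rV[R]_n -> 'rV[R]_d) G (S : set 'rV[R]_d) a : embed M setT F G ->
  closed S -> ~ S (F a) -> exists2 e : R, 0 < e & forall b, `|a - b| < e -> ~ S (F b).
Proof.
move=> [_ _ cF _ _] cS nS; have [r r0 hr] := not_closed_dist cS nS.
have [e e0 he] := cF a I r r0; exists e => // b ab /hr.
by rewrite leNgt he.
Qed.

Lemma embed_range (F : 'rV[R]_n -> 'rV[R]_d) G : embed M setT F G -> forall a, M (F a) /\ G (F a) = a.
Proof. by move=> [_ h _ _ _] a; exact: h. Qed.

(* Shrinking the complement of [range f] towards z inside the second cell, conjugated by a
   squeeze of the first cell, so that the given ball of the first cell is not moved. *)
Lemma engulf z a0 (r : R) C : M z -> ~ range f z -> ~ range f' (f a0) -> 0 <= r ->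
  compact C -> C `<=` M -> ~ C z ->
  exists h k, [/\ homeoM M h k, h z = z, forall a, `|a0 - a| <= r -> h (f a) = f a &
    forall x, C x -> exists a, h (f a) = x].
Proof.
move=> Mz nz nx r0 cC CM nCz.
have [c0 _ c0z] : range f' z by case: (cov Mz).
pose K := [set x | M x /\ ~ range f x].
have cK : compact K.
  apply: (compact_sub cM); last by move=> x [].
  apply/closedP => x h; have Mx : M x.
    have /closedP : closed M by exact: compact_isclosed.
    by apply=> e /h[w [? _] xw]; exists w.
  split=> // -[a _ ax]; have [_ _ _ _ op] := E; have [e e0 he] := op a I.
  by have [w [Mw nw] xw] := h e e0; apply: nw; apply: he; rewrite ?ax.
have Kz : K z by [].
have KB x : K x -> range f' x by move=> [/cov[|]].
have cg : cont_on K (fun x => `|c0 - g' x|).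
  apply: cont_on_norm; apply: cont_onB; first exact: cont_on_cst.
  by have [_ _ _ cg _] := E'; apply: cont_onS cg.
have [x1 Kx1 rmax] := compact_max cK (ex_intro _ _ Kz) cg.
set r1 := `|c0 - g' x1| in rmax; have r10 : 0 <= r1 by exact: normr_ge0.
pose B' : set 'rV[R]_n := [set a | `|c0 - a| <= r1 + 1].
have cB' : compact B' by exact: closed_ball_compact.
have cfB' : compact (f' @` B') by apply: compact_image => //; have [_ _ cf _ _] := E'; exact: cont_onS cf.
(* T squeezes the given ball of the first cell into this e-ball, which lies off the support of S; so
   T^-1 S T fixes that ball pointwise. *)
have [e e0 he] : exists2 e : R, 0 < e & forall b, `|a0 - b| < e -> ~ (f' @` B') (f b).
  apply: embed_far E (compact_isclosed cfB') _.
  by move=> [b _ E1]; apply: nx; exists b.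
have [t [t' [[ct ct'] [tK t'K] _ tout tin]]] := squeeze_ball a0 r0 e0.
pose B : set 'rV[R]_n := [set a | `|a0 - a| <= r + 1].
have cB : compact B by exact: closed_ball_compact.
have HT := extend_homeo E cB (@subsetT _ _) ct ct' tK t'K tout.
set T := extend setT f g t in HT; set T' := extend setT f g t' in HT.
have Tz : T z = z by apply: extend_out.
have T'z : T' z = z by apply: extend_out.
have TM x : M x -> M (T x) /\ T' (T x) = x by case: HT => h _ _ _; exact: h.
have TM' x : M x -> M (T' x) /\ T (T' x) = x by case: HT => _ h _ _; exact: h.
have cTC : compact (T @` C).
  by apply: compact_image => //; case: HT => _ _ cT _; exact: cont_onS cT.
have nTz : ~ (T @` C) z.
  move=> [x Cx Tx]; apply: nCz; suff -> : z = x by [].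
  by rewrite -T'z -Tx (TM _ (CM _ Cx)).2.
(* S moves the complement K of the first cell into this neighbourhood of z, which misses T C; so the
   preimage of every point of C lies in the first cell. *)
have [e' e'0 he'] : exists2 e : R, 0 < e & forall b, `|c0 - b| < e -> ~ (T @` C) (f' b).
  by apply: embed_far E' (compact_isclosed cTC) _; rewrite c0z.
have [s [s' [[cs cs'] [sK s'K] sc sout sin]]] := squeeze_ball c0 r10 e'0.
have HS := extend_homeo E' cB' (@subsetT _ _) cs cs' sK s'K sout.
set S := extend setT f' g' s in HS; set S' := extend setT f' g' s' in HS.
have Sz : S z = z by rewrite -c0z [LHS](extend_in E') // sc.
have SM x : M x -> M (S x) /\ S' (S x) = x by case: HS => h _ _ _; exact: h.
have SM' x : M x -> M (S' x) /\ S (S' x) = x by case: HS => _ h _ _; exact: h.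
have fM := embed_range E.
exists (T' \o (S \o T)), ((T' \o S') \o T); split.
- exact: homeoM_comp (homeoM_comp HT HS) (homeoM_sym HT).
- by rewrite /= Tz Sz T'z.
- move=> a /tin ar /=; rewrite {1}/T (extend_in E) // [S _](extend_fix E' sout (he _ ar)) //.
  by rewrite /T' (extend_in E) // tK.
move=> x Cx; have Mx := CM _ Cx; have [MTx T'Tx] := TM _ Mx.
have [MS SS'] := SM' _ MTx.
have [[b _ bS]|nS] := pselect (range f (S' (T x))).
  exists (t' b); rewrite /= {1}/T (extend_in E) // t'K bS SS' //.
have KS : K (S' (T x)) by [].
have [b _ bS] := KB _ KS.
have br : `|c0 - b| <= r1 by have := rmax _ KS; rewrite -bS (embed_range E' b).2.
case: (he' _ (sin _ br)); exists x => //.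
by rewrite -SS' -bS /S (extend_in E').
Qed.

(** Homeomorphisms h_j fixing z are built by [engulf] so that h_j (f u) no longer changes once u
    lies in the ball of radius r_j, while the images of these balls exhaust M without z. The limit G
    identifies M without z with the coordinate space, and the sphere is the one-point
    compactification of the latter. *)
Lemma two_cells : (0 < n)%N -> M !=set0 -> homeomorphic M (sphere R n).
Proof.
move=> n0 M0; have [z Mz nz] := cell_escape n0 M0 E.
have [x0 Mx0 nx0] := cell_escape n0 M0 E'.
have [a0 _ a0E] : range f x0 by case: (cov Mx0).
have nx : ~ range f' (f a0) by rewrite a0E.
have fM := embed_range E.
(* A state holds the current homeomorphism, its inverse, and the radius of the ball around a0 on
   which it is final. *)
pose st : Type := ((('rV[R]_d -> 'rV[R]_d) * ('rV[R]_d -> 'rV[R]_d)) * R)%type.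
pose P (s : st) := [/\ homeoM M s.1.1 s.1.2, s.1.1 z = z & 0 <= s.2].
have /choice[step hstep] : forall js : nat * st, exists s' : st, P js.2 ->
    [/\ P s', js.2.2 + 1 <= s'.2, forall u, `|a0 - u| <= js.2.2 -> s'.1.1 (f u) = js.2.1.1 (f u) &
    forall x, M x -> js.1.+1%:R^-1 <= `|z - x| -> exists2 u, `|a0 - u| <= s'.2 & s'.1.1 (f u) = x].
  move=> [j [[h k] r]] /=; have [[H hz r0]|nP] := pselect (P (h, k, r)); last by exists (h, k, r).
  pose C := [set x | M x /\ j.+1%:R^-1 <= `|z - x|].
  have cC : compact C.
    apply: (compact_sub cM); last by move=> x [].
    apply: closed_ge; first exact: compact_isclosed.
    by apply: cont_on_norm; apply: cont_onB; [exact: cont_on_cst|exact: cont_on_id].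
  have [hM kM ch ck] := H; move: hM kM ch ck hz r0 => /= hM kM ch ck hz r0.
  have ckC : cont_on C k by apply: cont_onS ck => x [].
  have kz : k z = z by rewrite -{1}hz (hM _ Mz).2.
  have kCM : k @` C `<=` M by move=> _ [x [Mx _] <-]; exact: (kM _ Mx).1.
  have nkz : ~ (k @` C) z.
    move=> [x [Mx xj] kx]; move: xj; rewrite -(kM _ Mx).2 kx hz subrr normr0 leNgt.
    by rewrite invr_gt0 ltr0n.
  have [h1 [k1 [H1 h1z h1f h1C]]] := engulf Mz nz nx r0 (compact_image cC ckC) kCM nkz.
  have [h1M k1M ch1 ck1] := H1.
  have inC x : C x -> exists a, h (h1 (f a)) = x.
    move=> Cx; have [a aE] := h1C _ (imageP k Cx); exists a.
    by rewrite aE; case: Cx => Mx _; exact: (kM _ Mx).2.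
  (* The coordinates of the preimages of C are bounded by compactness. Taking the maximum with r + 1
     makes the radii tend to infinity. *)
  have [rho hrho] : exists rho : R, forall a, C (h (h1 (f a))) -> `|a0 - a| <= rho.
    have [C0|C0] := pselect (C !=set0); last by exists 0 => a Ca; case: C0; eexists; exact: Ca.
    have cc : cont_on C (fun x => `|a0 - g (k1 (k x))|).
      apply: cont_on_norm; apply: cont_onB; first exact: cont_on_cst.
      have [_ _ _ cg _] := E.
      apply: (@cont_on_comp _ _ _ _ _ _ (k1 \o k) g _ _ cg).
        move=> x Cx; have [a <-] := inC x Cx; exists a => //=.
        by rewrite (hM _ _).2 ?(h1M _ _).2 //; [exact: (fM a).1|exact: (h1M _ (fM a).1).1].
      apply: cont_on_comp ckC ck1; by move=> x [Mx _]; exact: (kM _ Mx).1.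
    have [x _ xmax] := compact_max cC C0 cc.
    exists `|a0 - g (k1 (k x))| => a Ca; apply: le_trans (xmax _ Ca); rewrite (hM _ _).2 ?(h1M _ _).2 ?(fM _).2 //.
    - by case: (fM a).
    - by case: (h1M _ (fM a).1).
  exists (h \o h1, k1 \o k, Num.max rho (r + 1)) => _; split.
  - split=> /=; [exact: homeoM_comp H1 H|by rewrite h1z|by rewrite le_max addr_ge0 ?orbT].
  - by rewrite /= le_max lexx orbT.
  - by move=> u ur /=; rewrite h1f.
  - move=> x Mx xj; have [a aE] := inC x (conj Mx xj); exists a => //=.
    by rewrite le_max hrho // aE.
pose hs j := nat_rect (fun=> st) (id, id, 0) (fun j s => step (j, s)) j.
have hP j : P (hs j).
  elim: j => [|j IH]; first by split=> //; exact: homeoM_id.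
  by have [] := hstep (j, hs j) IH.
have hr j : (hs j).2 + 1 <= (hs j.+1).2 by have [] := hstep (j, hs j) (hP j).
have hf j u : `|a0 - u| <= (hs j).2 -> (hs j.+1).1.1 (f u) = (hs j).1.1 (f u).
  by have [_ _ h _] := hstep (j, hs j) (hP j); exact: h.
have hC j x : M x -> j.+1%:R^-1 <= `|z - x| ->
    exists2 u, `|a0 - u| <= (hs j.+1).2 & (hs j.+1).1.1 (f u) = x.
  by have [_ _ _ h] := hstep (j, hs j) (hP j); exact: h.
have hj j : j%:R <= (hs j).2.
  by elim: j => [//|j IH]; rewrite -natr1; apply: le_trans (hr j); rewrite lerD2r.
have hmono j m : (hs j).2 <= (hs (j + m)%N).2.
  elim: m => [|m IH]; first by rewrite addn0.
  by rewrite addnS; apply: le_trans IH _; apply: le_trans (hr _); rewrite lerDl.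
have hstab j m u : `|a0 - u| <= (hs j).2 -> (hs (j + m)%N).1.1 (f u) = (hs j).1.1 (f u).
  move=> uj; elim: m => [|m IH]; first by rewrite addn0.
  by rewrite addnS hf // (le_trans uj).
pose jj (u : 'rV[R]_n) := Num.bound `|a0 - u|.
have jjP u : `|a0 - u| <= (hs (jj u)).2.
  by apply: le_trans (hj _); apply: ltW; apply: archi_boundP.
pose G u := (hs (jj u)).1.1 (f u).
have GE j u : `|a0 - u| <= (hs j).2 -> G u = (hs j).1.1 (f u).
  move=> uj; rewrite /G; have [l|/ltnW l] := leqP j (jj u).
    by rewrite -(subnKC l) hstab.
  by rewrite -[in RHS](subnKC l) hstab.
have hM j x : M x -> M ((hs j).1.1 x) /\ (hs j).1.2 ((hs j).1.1 x) = x.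
  by have [[h _ _ _] _ _] := hP j; exact: h.
have GM u : M (G u) by exact: (hM _ _ (fM u).1).1.
have Gz u : G u <> z.
  move=> Gu; apply: nz; have [_ hz _] := hP (jj u).
  suff -> : z = f u by exists u.
  by rewrite -(hM (jj u) _ (fM u).1).2 -/(G u) Gu -{2}hz (hM _ _ Mz).2.
have common u v : exists j, `|a0 - u| <= (hs j).2 /\ `|a0 - v| <= (hs j).2.
  exists (jj u + jj v)%N; split; first exact: le_trans (jjP u) (hmono _ _).
  by rewrite addnC; exact: le_trans (jjP v) (hmono _ _).
have Ginj u v : G u = G v -> u = v.
  have [j [uj vj]] := common u v; rewrite (GE _ _ uj) (GE _ _ vj) => /(congr1 (hs j).1.2).
  rewrite (hM _ _ (fM u).1).2 (hM _ _ (fM v).1).2 => /(congr1 g).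
  by rewrite (fM u).2 (fM v).2.
have Gsurj x : M x -> x <> z -> exists u, G u = x.
  move=> Mx xz; have d0 : 0 < `|z - x| by rewrite normr_gt0 subr_eq0; apply/eqP => e; apply: xz.
  have [j jz] : exists j, j.+1%:R^-1 <= `|z - x|.
    exists (Num.bound `|z - x|^-1); rewrite invf_ple ?posrE ?ltr0n //.
    apply: ltW; apply: lt_trans (archi_boundP _) _; first by rewrite invr_ge0.
    by rewrite ltr_nat.
  by have [u ur ux] := hC _ _ Mx jz; exists u; rewrite (GE _ _ ur).
have /choice[H hH] : forall x, exists u, M x -> x <> z -> G u = x.
  move=> x; have [Mx|nM] := pselect (M x); last by exists 0 => /nM.
  have [->|xz] := pselect (x = z); first by exists 0.
  by have [u ux] := Gsurj _ Mx xz; exists u.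
have HG u : H (G u) = u by apply: Ginj; apply: hH.
(* One unit of room around u lets a single stage h_j serve all nearby parameters, so G inherits
   openness from it. *)
have Gopen u (e : R) : 0 < e -> exists2 r : R, 0 < r & forall x, M x -> `|G u - x| < r ->
    x <> z /\ `|u - H x| < e.
  move=> e0; have [j [uj1 _]] : exists j, `|a0 - u| + 1 <= (hs j).2 /\ True.
    exists (jj u).+1; split=> //; apply: le_trans (hr _); by rewrite lerD2r.
  have uj : `|a0 - u| <= (hs j).2 by apply: le_trans uj1; rewrite lerDl.
  have [Hj _ _] := hP j.
  have [_ hF _ cF op] := embed_homeo E Hj.
  have [r1 r10 h1] := op u I.
  have e10 : 0 < Num.min e 1 by rewrite lt_min e0 ltr01.
  have [r2 r20 h2] := cF _ (imageP _ (I : setT u)) _ e10.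
  exists (Num.min r1 r2); first by rewrite lt_min r10.
  move=> x Mx; rewrite (GE _ _ uj) lt_min => /andP[/(h1 _ Mx) [v _ vx] xr].
  have := h2 x; rewrite -vx (hF u I).2 (hF v I).2 => h3.
  have {}h3 : `|u - v| < Num.min e 1 by apply: h3; [exact: imageP|rewrite vx].
  move: h3; rewrite lt_min => /andP[ue u1].
  have vj : `|a0 - v| <= (hs j).2.
    by apply: le_trans uj1; have := ler_distD u a0 v; lra.
  have Gv : G v = x by rewrite (GE _ _ vj) -vx.
  by split; [rewrite vx -Gv; exact: Gz|rewrite vx -Gv HG].
(* Images of bounded sets stay away from z; this gives continuity of [Phi] at z. *)
have Gprop (rho : R) : exists2 r : R, 0 < r & forall u, `|a0 - u| <= rho -> r <= `|z - G u|.
  pose D : set 'rV[R]_n := [set u | `|a0 - u| <= rho].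
  have cD : compact D by exact: closed_ball_compact.
  have [j rj] : exists j, rho <= (hs j).2.
    exists (Num.bound `|rho|); apply: le_trans (hj _); apply: le_trans (ler_norm _) _.
    by apply: ltW; exact: archi_boundP.
  have cG : cont_on D G.
    have [[_ _ ch _] _ _] := hP j; have [_ _ cf _ _] := E.
    apply: (@cont_on_ext _ _ _ _ ((hs j).1.1 \o f)).
      by move=> u Du /=; rewrite (GE j) // (le_trans Du).
    apply: cont_on_comp ch; first by move=> u _; exact: (fM u).1.
    exact: cont_onS cf.
  have [|r r0 h] := @not_closed_dist _ _ _ z (compact_isclosed (compact_image cD cG)).
    by move=> [u _]; exact: Gz.
  by exists r => // u ur; apply: h; exists u.
pose Phi x := if asbool (x = z) then pole else stereo (H x).
have Phiz : Phi z = pole by rewrite /Phi asboolT.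
have PhiG x : x <> z -> Phi x = stereo (H x) by move=> xz; rewrite /Phi asboolF.
apply: (homeomorphic_compact (f := Phi)) => //.
- move=> x Mx e e0; have [->|xz] := pselect (x = z).
    have [rho hrho] := stereo_pole (n := n) e0.
    have [r r0 hr'] := Gprop (rho + `|a0|).
    exists r => // y My zy; rewrite Phiz; have [->|yz] := pselect (y = z).
      by rewrite Phiz subrr normr0.
    rewrite PhiG //; apply: hrho; rewrite leNgt; apply/negP => l.
    have ar : `|a0 - H y| <= rho + `|a0|.
      by apply: le_trans (ler_normB _ _) _; rewrite addrC lerD2r ltW.
    by have := hr' _ ar; rewrite hH // leNgt zy.
  have [r1 r10 h1] := @stereo_cont _ _ (H x) I _ e0.
  have [r r0 h] := Gopen (H x) r1 r10.
  exists r => // y My; have := h y My; rewrite hH // => {}h /h[yz xy].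
  by rewrite !PhiG //; exact: h1.
- move=> x Mx; have [->|xz] := pselect (x = z); last by rewrite PhiG //; exact: stereo_sphere.
  rewrite Phiz; apply/sphereE; rewrite dotp_recl mxE !eqxx mulr1 big1 ?addr0 // => i _.
  by rewrite mxE eqxx /= mul0r.
- move=> x y Mx My; have [->|xz] := pselect (x = z).
    have [->//|yz] := pselect (y = z); rewrite Phiz PhiG // => /esym; by move/stereo_neq.
  rewrite PhiG //; have [->|yz] := pselect (y = z); first by rewrite Phiz => /stereo_neq.
  by rewrite PhiG // => /stereo_inj Hxy; rewrite -(hH _ Mx xz) Hxy hH.
move=> y Sy; have [->|yp] := pselect (y = pole); first by exists z.
have [u <-] := stereo_surj Sy yp; exists (G u); first exact: GM.
by rewrite PhiG ?HG //; exact: Gz.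
Qed.

End Brown.

(** * Closed curves *)

Section Arcs.
Context {R : realType} {d : nat}.
Variable M : set 'rV[R]_d.
Implicit Types (F H : R -> 'rV[R]_d) (G K : 'rV[R]_d -> R).

(** An open embedding of the line. The last clause contains both openness of the image and
    continuity of the inverse. *)
Definition arc F G : Prop :=
  [/\ forall t : R, M (F t) /\ G (F t) = t,
      forall (t e : R), 0 < e -> exists2 r : R, 0 < r & forall y : R, `|t - y| < r -> `|F t - F y| < e &
      forall (t e : R), 0 < e -> exists2 r : R, 0 < r &
        forall x, M x -> `|F t - x| < r -> exists2 y : R, `|t - y| < e & F y = x].

Lemma arc_inj F G : arc F G -> injective F.
Proof. by move=> [h _ _] t s E; rewrite -(h t).2 E (h s).2. Qed.

Lemma arc_back F G s : arc F G -> forall e : R, 0 < e -> exists2 r : R, 0 < r &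
  forall y, range F y -> `|F s - y| < r -> `|s - G y| < e.
Proof.
move=> [h _ op] e e0; have [r r0 hr] := op s e e0; exists r => // _ [u _ <-] /(hr _ (h u).1)[v vs vu].
by rewrite -vu (h v).2.
Qed.

Definition rev_arc F : R -> 'rV[R]_d := fun t => F (- t).
Definition rev_inv G : 'rV[R]_d -> R := fun x => - G x.

Lemma arc_rev F G : arc F G -> arc (rev_arc F) (rev_inv G).
Proof.
move=> [h c op]; split.
- by move=> t; rewrite /rev_arc /rev_inv (h _).2 opprK; split=> //; exact: (h _).1.
- move=> t e e0; have [r r0 hr] := c (- t) e e0; exists r => // y ty; apply: hr.
  by rewrite -opprD normrN opprK in ty * || rewrite -normrN opprD !opprK.
move=> t e e0; have [r r0 hr] := op (- t) e e0; exists r => // x Mx /(hr _ Mx)[y ty yx].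
exists (- y); last by rewrite /rev_arc opprK.
by rewrite -normrN opprD opprK.
Qed.

(* IVT for the transition map G' \o F. *)
Lemma transition F G F' G' (a b v : R) : arc F G -> arc F' G' -> a <= b ->
  (forall t : R, a <= t <= b -> range F' (F t)) ->
  (G' (F a) <= v <= G' (F b)) \/ (G' (F b) <= v <= G' (F a)) ->
  exists2 t : R, a <= t <= b & F t = F' v.
Proof.
move=> A A' ab rg hv; have [_ cF _] := A; have [hF' _ _] := A'.
have c : cont_on (`[a, b]%classic : set R) (G' \o F).
  move=> t; rewrite /= in_itv /= => tab e e0.
  have [s _ sE] := rg t tab; have [r r0 hr] := arc_back s A' e0.
  have [q q0 hq] := cF t r r0; exists q => // y; rewrite /= in_itv /= => yab /hq.
  by rewrite -sE (hF' s).2 => /(hr _ (rg _ yab)).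
have : Num.min ((G' \o F) a) ((G' \o F) b) <= v <= Num.max ((G' \o F) a) ((G' \o F) b).
  rewrite /= ge_min le_max; case: hv => /andP[-> ->]; by rewrite ?orbT.
move=> /(IVT ab ((cont_onP _ _).1 c))[t]; rewrite in_itv /= => tab tv; exists t => //.
by have [s _ sE] := rg t tab; rewrite -sE -tv -sE (hF' s).2.
Qed.

(** If the transition map had a minimum at b, it would take some larger value on both sides of b,
    against injectivity of F. *)
Lemma no_turn F G F' G' (a b c : R) : arc F G -> arc F' G' -> a < b -> b < c ->
  (forall t : R, a <= t <= c -> range F' (F t)) ->
  G' (F b) < G' (F a) -> G' (F b) < G' (F c) -> False.
Proof.
move=> A A' ab bc rg ha hc.
pose v := Num.min (G' (F a)) (G' (F c)).
have vb : G' (F b) < v by rewrite lt_min ha.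
have va : v <= G' (F a) by rewrite ge_min lexx.
have vc : v <= G' (F c) by rewrite ge_min lexx orbT.
have [t1 /andP[_ t1b] E1] : exists2 t : R, a <= t <= b & F t = F' v.
  apply: (transition A A'); [exact: ltW| |by right; rewrite (ltW vb)].
  by move=> t /andP[ta tb]; apply: rg; rewrite ta (le_trans tb) ?ltW.
have [t2 /andP[t2b _] E2] : exists2 t : R, b <= t <= c & F t = F' v.
  apply: (transition A A'); [exact: ltW| |by left; rewrite (ltW vb)].
  by move=> t /andP[ta tb]; apply: rg; rewrite tb (le_trans _ ta) ?ltW.
have t12 : t1 = t2 by apply: (arc_inj A); rewrite E1.
have tb : t1 = b by apply/le_anti; rewrite t1b t12.
have [hF' _ _] := A'; move: vb; rewrite -tb E1 (hF' v).2 ltxx //.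
Qed.

(** The two arcs run in the same direction at a common point: near it, each half of one is covered
    by the corresponding half of the other. *)
Definition aligned F F' (t0 s0 : R) : Prop :=
  exists2 e : R, 0 < e &
   [/\ forall t : R, t0 <= t < t0 + e -> exists2 s : R, s0 <= s & F' s = F t,
       forall t : R, t0 - e < t <= t0 -> exists2 s : R, s <= s0 & F' s = F t,
       forall s : R, s0 <= s < s0 + e -> exists2 t : R, t0 <= t & F t = F' s &
       forall s : R, s0 - e < s <= s0 -> exists2 t : R, t <= t0 & F t = F' s].

Lemma aligned_sym F F' t0 s0 : aligned F F' t0 s0 -> aligned F' F s0 t0.
Proof. by move=> [e e0 [h1 h2 h3 h4]]; exists e. Qed.

Lemma aligned_rev F F' t0 s0 : aligned F F' t0 s0 ->
  aligned (rev_arc F) (rev_arc F') (- t0) (- s0).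
Proof.
have aux1 (a e t : R) : - a <= t < - a + e -> a - e < - t <= a by move=> ?; lra.
have aux2 (a e t : R) : - a - e < t <= - a -> a <= - t < a + e by move=> ?; lra.
move=> [e e0 [h1 h2 h3 h4]]; exists e => //; split.
- by move=> t /aux1/h2[s s0' E]; exists (- s); rewrite ?lerN2 // /rev_arc opprK.
- by move=> t /aux2/h1[s s0' E]; exists (- s); rewrite ?lerN2 // /rev_arc opprK.
- by move=> t /aux1/h4[s s0' E]; exists (- s); rewrite ?lerN2 // /rev_arc opprK.
- by move=> t /aux2/h3[s s0' E]; exists (- s); rewrite ?lerN2 // /rev_arc opprK.
Qed.

Lemma align_up F G F' G' (t0 e : R) : arc F G -> arc F' G' -> 0 < e ->
  (forall t : R, t0 - e <= t <= t0 + e -> range F' (F t)) ->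
  G' (F t0) < G' (F (t0 + e)) -> aligned F F' t0 (G' (F t0)).
Proof.
have sc1 (a q : R) : 0 < q -> [/\ a - q <= a <= a + q, a - q < a & a < a + q] by move=> ?; split; lra.
move=> A A' e0 rg hi; have [hF' _ _] := A'; have [a1 a2 a3] := sc1 t0 e e0.
have FE t : t0 - e <= t <= t0 + e -> F' (G' (F t)) = F t.
  by move=> /rg[s _ <-]; rewrite (hF' s).2.
have inj t u : t0 - e <= t <= t0 + e -> t0 - e <= u <= t0 + e -> G' (F t) = G' (F u) -> t = u.
  by move=> ht hu E; apply: (arc_inj A); rewrite -FE // E FE.
have b1 : t0 - e <= t0 - e <= t0 + e by move: a1; lra.
have b2 : t0 - e <= t0 + e <= t0 + e by move: a1; lra.
have lo : G' (F (t0 - e)) < G' (F t0).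
  rewrite ltNge; apply/negP; rewrite le_eqVlt => /orP[/eqP E|l].
    by have := inj _ _ a1 b1 E; lra.
  exact: (no_turn A A' a2 a3 rg l hi).
set s0 := G' (F t0) in hi lo *; set sp := G' (F (t0 + e)) in hi; set sm := G' (F (t0 - e)) in lo.
have m0 : 0 < Num.min e (Num.min (sp - s0) (s0 - sm)) by rewrite !lt_min e0 !subr_gt0 hi lo.
have sc (x y q a b : R) : (x <= y < x + Num.min q (Num.min (a - x) (x - b)) -> x <= y <= a)
   /\ (x - Num.min q (Num.min (a - x) (x - b)) < y <= x -> b <= y <= x).
  have m2 : Num.min q (Num.min (a - x) (x - b)) <= a - x by rewrite !ge_min lexx orbT.
  have m3 : Num.min q (Num.min (a - x) (x - b)) <= x - b by rewrite !ge_min lexx !orbT.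
  by split=> h; lra.
have le_e : Num.min e (Num.min (sp - s0) (s0 - sm)) <= e by rewrite ge_min lexx.
exists (Num.min e (Num.min (sp - s0) (s0 - sm))) => //; split.
- move=> t /andP[tl tu]; have tt : t0 - e <= t <= t0 + e by lra.
  exists (G' (F t)); last exact: FE.
  rewrite leNgt; apply/negP => l.
  have tq : t <= t0 + e by move: tt => /andP[].
  have rg1 u : t <= u <= t0 + e -> range F' (F u).
    by move=> /andP[u1 u2]; apply: rg; rewrite u2 andbT; lra.
  have hv : G' (F t) <= s0 <= G' (F (t0 + e)) by rewrite (ltW l) (ltW hi).
  have [u /andP[ut ue] E] := transition A A' tq rg1 (or_introl hv).
  have Eu : u = t0 by apply: (arc_inj A); rewrite E FE.
  have tE : t = t0 by apply/le_anti; rewrite tl -Eu ut.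
  by move: l; rewrite tE ltxx.
- move=> t /andP[tl tu]; have tt : t0 - e <= t <= t0 + e by lra.
  exists (G' (F t)); last exact: FE.
  rewrite leNgt; apply/negP => l.
  have tq : t0 - e <= t by move: tt => /andP[].
  have rg1 u : t0 - e <= u <= t -> range F' (F u).
    by move=> /andP[u1 u2]; apply: rg; rewrite u1 /=; lra.
  have hv : G' (F (t0 - e)) <= s0 <= G' (F t) by rewrite (ltW l) (ltW lo).
  have [u /andP[ut ue] E] := transition A A' tq rg1 (or_introl hv).
  have Eu : u = t0 by apply: (arc_inj A); rewrite E FE.
  have tE : t = t0 by apply/le_anti; rewrite tu -Eu ue.
  by move: l; rewrite tE ltxx.
- move=> s /((sc _ _ _ _ _).1) h.
  have rg1 u : t0 <= u <= t0 + e -> range F' (F u).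
    by move=> /andP[u1 u2]; apply: rg; rewrite u2 andbT; lra.
  by have [u /andP[ut ue] E] := transition A A' (ltW a3) rg1 (or_introl h); exists u.
move=> s /((sc _ _ _ _ _).2) h.
have rg1 u : t0 - e <= u <= t0 -> range F' (F u).
  by move=> /andP[u1 u2]; apply: rg; rewrite u1 /=; lra.
by have [u /andP[ut ue] E] := transition A A' (ltW a2) rg1 (or_introl h); exists u.
Qed.

Lemma align F G F' G' (t0 s0 : R) : arc F G -> arc F' G' -> F t0 = F' s0 ->
  aligned F F' t0 s0 \/ aligned F (rev_arc F') t0 (- s0).
Proof.
move=> A A' E0; have [hF cF _] := A; have [hF' _ op'] := A'.
have [r r0 hr] := op' s0 1 ltr01.
have [q q0 hq] := cF t0 r r0.
have [e e0 eq] : exists2 e : R, 0 < e & e < q.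
  by exists (q / 2); rewrite ?divr_gt0 // ltr_pdivrMr // ltr_pMr // ltr1n.
have sc (t : R) : t0 - e <= t <= t0 + e -> `|t0 - t| < q.
  by move=> h; rewrite ltr_norml; move: h eq; lra.
have rg t : t0 - e <= t <= t0 + e -> range F' (F t).
  move=> /sc/hq; rewrite E0 => /(hr _ (hF t).1)[y _ <-]; by exists y.
have iF := arc_inj A; have te : t0 - e <= t0 + e <= t0 + e by apply/andP; split; lra.
have ne : t0 + e <> t0 by lra.
have s0E : G' (F t0) = s0 by rewrite E0 (hF' s0).2.
have [h|h] := ltP s0 (G' (F (t0 + e))).
  by left; rewrite -s0E; apply: align_up A A' e0 rg _; rewrite s0E.
right; have A'' := arc_rev A'.
have rg' t : t0 - e <= t <= t0 + e -> range (rev_arc F') (F t).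
  by move=> /rg[y _ <-]; exists (- y); rewrite // /rev_arc opprK.
have E1 : rev_inv G' (F t0) = - s0 by rewrite /rev_inv s0E.
rewrite -E1; apply: align_up A A'' e0 rg' _; rewrite E1 /rev_inv ltrN2.
rewrite lt_def h andbT; apply/eqP => E2.
have [y _ yE] := rg _ te.
have : F (t0 + e) = F t0 by rewrite E0 -yE; congr F'; rewrite E2 -yE (hF' y).2.
by move=> /iF.
Qed.

(** Suppose the forward half of F leaves that of F', and let [be] be the first parameter where it
    does. The s >= s0 with F' s on F [t0, be) form a relatively clopen set, since F be is not on the
    forward half of F'; so they are all of [s0, oo). *)
Lemma ray F G F' G' (t0 s0 : R) : arc F G -> arc F' G' -> F t0 = F' s0 -> aligned F F' t0 s0 ->
  (forall t : R, t0 <= t -> exists2 s : R, s0 <= s & F' s = F t) \/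
  (forall s : R, s0 <= s -> exists2 t : R, t0 <= t & F t = F' s).
Proof.
move=> A A' E0 [e e0 [h1 _ h3 _]]; have [hF cF op] := A; have [hF' cF' op'] := A'.
have [|nR] := pselect (forall t : R, t0 <= t -> exists2 s : R, s0 <= s & F' s = F t); [by left|right].
have [u0 [u0t nu0]] : exists u : R, t0 <= u /\ ~ (exists2 s : R, s0 <= s & F' s = F u).
  by apply: contrapT => h; apply: nR => t tt; apply: contrapT => h'; apply: h; exists t.
pose X : set R := [set u | t0 <= u /\ ~ (exists2 s : R, s0 <= s & F' s = F u)].
have hX : has_inf X by split; [exists u0|exists t0 => u []].
have inR u : t0 <= u -> (exists2 s : R, s0 <= s & F' s = F u) ->
    exists2 r : R, 0 < r & forall y, t0 <= y -> `|u - y| < r -> exists2 s : R, s0 <= s & F' s = F y.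
  move=> tu [s ss sE]; have [Es|ns] := eqVneq s s0.
    have ut : u = t0 by apply: (arc_inj A); rewrite E0 -sE Es.
    exists e => // y ty; rewrite ut ltr_norml => /andP[ye _]; apply: h1; rewrite ty /=; lra.
  have ls : 0 < s - s0 by rewrite subr_gt0 lt_def ns.
  have [r r0 hr] := op' s _ ls; have [q q0 hq] := cF u r r0.
  exists q => // y _ /hq; rewrite -sE => /(hr _ (hF y).1)[v vs vE]; exists v => //.
  by move: vs; rewrite ltr_norml; lra.
set be := inf X.
have bt : t0 <= be by apply: lb_le_inf; [exists u0|move=> u []].
have Xb : X be.
  split=> // /(inR _ bt)[r r0 hr].
  have [u Xu ub] := inf_adherent r0 hX.
  case: (Xu) => tu nu; apply: nu; apply: hr => //.
  have l : be <= u by apply: ge_inf => //; case: hX.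
  by rewrite ltr_norml; move: ub; rewrite -/be; lra.
have below t : t0 <= t -> t < be -> exists2 s : R, s0 <= s & F' s = F t.
  move=> tt tb; apply: contrapT => h.
  have : be <= t by apply: ge_inf; [case: hX|].
  by rewrite leNgt tb.
have tb : t0 < be.
  by rewrite lt_def bt andbT; apply/eqP => bE; case: Xb => _; apply; exists s0; rewrite // bE.
have cK : compact (F @` `[t0, be]).
  apply: compact_image; first exact: segment_compact.
  by move=> t _ r r0; have [q q0 hq] := cF t r r0; exists q => // y _; exact: hq.
have clK := compact_isclosed cK.
suff all : [set s : R | s0 <= s] `<=` [set s : R | exists t : R, [/\ t0 <= t, t < be & F t = F' s]].
  by move=> s /all[t [tt _ tE]]; exists t.
apply: connected_all.
- rewrite (_ : [set s : R | s0 <= s] = `[s0, +oo[%classic); last first.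
    by apply/seteqP; split=> s /=; rewrite in_itv /= andbT.
  exact/connected_intervalP/interval_is_interval.
- by exists s0; rewrite /= ?lexx //; exists t0.
- move=> s /= ss [t [tt tb' tE]]; have [Et|nt] := eqVneq t t0.
    have sE : s = s0 by apply: (arc_inj A'); rewrite -E0 -tE Et.
    have b0 : 0 < be - t0 by rewrite subr_gt0.
    have [r r0 hr] := op t0 _ b0; have [q q0 hq] := cF' s0 r r0.
    have m0 : 0 < Num.min q e by rewrite lt_min q0.
    exists (Num.min q e) => // y sy; rewrite sE lt_min => /andP[yq ye].
    have [v tv vE] : exists2 t : R, t0 <= t & F t = F' y.
      by apply: h3; rewrite sy /=; move: ye; rewrite ltr_norml; lra.
    have := hq _ yq; rewrite -E0 => /(hr _ (hF' y).1)[v' v'b v'E].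
    have vv : v = v' by apply: (arc_inj A); rewrite vE.
    exists v; split=> //; rewrite vv; move: v'b; rewrite ltr_norml; lra.
  have m0 : 0 < Num.min (t - t0) (be - t) by rewrite lt_min !subr_gt0 tb' lt_def nt tt.
  have [r r0 hr] := op t _ m0; have [q q0 hq] := cF' s r r0.
  exists q => // y _ /hq; rewrite -tE => /(hr _ (hF' y).1)[v]; rewrite lt_min !ltr_norml => vb vE.
  by exists v; split=> //; move: vb; lra.
move=> s /= ss ns; have nK : ~ (F @` `[t0, be]) (F' s).
  move=> [t]; rewrite /= in_itv /= => /andP[tt]; rewrite le_eqVlt => /orP[/eqP -> E|tb' E].
    by case: Xb => _; apply; exists s.
  by apply: ns; exists t.
have [r r0 hr] := not_closed_dist clK nK; have [q q0 hq] := cF' s r r0.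
exists q => // y sy /hq l [t [tt tb' tE]].
have : r <= `|F' s - F' y|.
  by apply: hr; exists t => //=; rewrite in_itv /= tt ltW.
by rewrite leNgt l.
Qed.

Lemma ray_stop F G F' G' (t0 t1 s1 : R) : arc F G -> arc F' G' -> F t1 = F' s1 -> t1 < t0 ->
  (forall s : R, s1 <= s -> range F (F' s)) -> (forall s : R, s1 <= s -> F' s <> F t0) ->
  forall s : R, s1 <= s -> exists2 t : R, t <= t0 & F t = F' s.
Proof.
move=> A A' E1 t10 rg av s ss; have [t _ tE] := rg s ss; exists t => //.
rewrite leNgt; apply/negP => l; have [hF _ _] := A.
have rg1 u : s1 <= u <= s -> range F (F' u) by move=> /andP[us _]; exact: rg.
have hv : G (F' s1) <= t0 <= G (F' s) by rewrite -E1 (hF _).2 -tE (hF t).2 !ltW.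
have [u /andP[us _] uE] := transition A' A ss rg1 (or_introl hv).
exact: av uE.
Qed.

Definition covered F F' := forall x, M x -> range F x \/ range F' x.

Hypothesis nM : connected M.

(** The new arc follows F up to t0 and F' afterwards. If it is not injective, the arcs meet again
    and close up: their union is F [t1, t0] together with F' [s0, s1], compact and open in M, hence
    all of M. *)
Lemma glue F G F' G' (t0 s0 : R) : arc F G -> arc F' G' -> F t0 = F' s0 -> aligned F F' t0 s0 ->
  (forall t : R, t0 <= t -> exists2 s : R, s0 <= s & F' s = F t) ->
  (forall s : R, s <= s0 -> exists2 t : R, t <= t0 & F t = F' s) ->
  (exists H K, arc H K /\ range F `|` range F' `<=` range H) \/ covered F F'.
Proof.
move=> A A' E0 al R1 L2; have [hF cF op] := A; have [hF' cF' op'] := A'.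
have [[t1 [s1 [t1l s1l E1]]]|ninj] :=
  pselect (exists (t1 s1 : R), [/\ t1 < t0, s0 < s1 & F t1 = F' s1]).
  right.
  (* Opposite directions at the second meeting point would force one arc, read in the parameter of
     the other, to turn back. *)
  have [al1|al1] := align A A' E1; last first.
    have A'' := arc_rev A'.
    have E1' : F t1 = rev_arc F' (- s1) by rewrite /rev_arc opprK.
    have [e e0 [h1 h2 h3 h4]] := al.
    have [hh|hh] := ray A A'' E1' al1.
      have [s ss sE] : exists2 s : R, s0 <= s & F' s = F (t0 + e / 2).
        by apply: h1; rewrite lerDl; apply/andP; split; lra.
      exfalso; apply: (@no_turn F G F' G' t1 t0 (t0 + e / 2) A A' t1l).
      - by rewrite ltrDl divr_gt0.
      - by move=> t /andP[/hh[v _ vE] _]; exists (- v).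
      - by rewrite E0 (hF' _).2 E1 (hF' _).2.
      rewrite E0 (hF' _).2 -sE (hF' _).2 lt_def ss andbT; apply/eqP => sE'.
      have : t0 = t0 + e / 2 by apply: (arc_inj A); rewrite -sE sE' E0.
      by lra.
    have [t tt tE] : exists2 t : R, t <= t0 & F t = F' (s0 - e / 2).
      by apply: h4; apply/andP; split; lra.
    exfalso; apply: (@no_turn (rev_arc F') (rev_inv G') (rev_arc F) (rev_inv G) (- s1) (- s0) (- (s0 - e / 2))).
    - exact: A''.
    - exact: arc_rev.
    - by rewrite ltrN2.
    - by rewrite ltrN2; lra.
    - by move=> s /andP[/hh[v _ vE] _]; exists (- v); rewrite // /rev_arc opprK vE.
    - by rewrite /rev_inv /rev_arc !opprK -E0 -E1 !(hF _).2 ltrN2.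
    rewrite /rev_inv /rev_arc !opprK -E0 -tE !(hF _).2 ltrN2 lt_def tt andbT; apply/eqP => tE'.
    have : s0 = s0 - e / 2 by apply: (arc_inj A'); rewrite -tE -tE' E0.
    by lra.
  have [hR|hR] := ray A A' E1 al1.
    have [s ss sE] := hR t0 (ltW t1l).
    have : s = s0 by apply: (arc_inj A'); rewrite sE.
    by lra.
  have tail s : s1 <= s -> exists2 t : R, t1 <= t <= t0 & F t = F' s.
    move=> ss; have [t tt tE] := hR s ss.
    have [t' tt' tE'] : exists2 t : R, t <= t0 & F t = F' s.
      apply: (ray_stop A A' E1 t1l) ss => [v /hR[w _ <-]|v sv vE]; first by exists w.
      have : v = s0 by apply: (arc_inj A'); rewrite vE.
      by lra.
    exists t => //; rewrite tt /=; suff -> : t = t' by [].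
    by apply: (arc_inj A); rewrite tE.
  have E1' : rev_arc F (- t1) = rev_arc F' (- s1) by rewrite /rev_arc !opprK.
  have [hL|hL] := ray (arc_rev A) (arc_rev A') E1' (aligned_rev al1); last first.
    have s01 : - s1 <= - s0 by rewrite lerN2 ltW.
    have [t tt] := hL _ s01; rewrite /rev_arc opprK -E0 => /(arc_inj A); lra.
  have head t : t <= t1 -> exists2 s : R, s0 <= s <= s1 & F' s = F t.
    move=> tt; have tt' : - t1 <= - t by rewrite lerN2.
    have [s ss] := hL _ tt'; rewrite /rev_arc opprK => sE.
    have l : - s1 < - s0 by rewrite ltrN2.
    have rg1 v : - t1 <= v -> range (rev_arc F') (rev_arc F v) by move=> /hL[w _ wE]; exists w.
    have av v : - t1 <= v -> rev_arc F v <> rev_arc F' (- s0).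
      by move=> tv; rewrite /rev_arc opprK -E0 => /(arc_inj A); lra.
    have [s' ss'] := ray_stop (arc_rev A') (arc_rev A) (esym E1') l rg1 av tt'.
    rewrite /rev_arc opprK => sE'; exists (- s) => //.
    have -> : - s = - s' by apply: (arc_inj A'); rewrite sE.
    apply/andP; split; first by rewrite lerNr.
    suff <- : - s = - s' by rewrite lerNl.
    by apply: (arc_inj A'); rewrite sE.
  pose C := (F @` `[t1, t0]) `|` (F' @` `[s0, s1]).
  have cC : compact C.
    apply: compactU; apply: compact_image; try exact: segment_compact.
      by move=> t _ r r0; have [q q0 hq] := cF t r r0; exists q => // y _; exact: hq.
    by move=> t _ r r0; have [q q0 hq] := cF' t r r0; exists q => // y _; exact: hq.
  have tailC s : s1 <= s -> C (F' s).
    by move=> /tail[t tt tE]; left; exists t; rewrite //= in_itv.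
  have FC t : C (F t).
    have [l|l] := leP t t1; first by have [s ss sE] := head t l; right; exists s; rewrite //= in_itv.
    have [l'|/ltW l'] := leP t t0; first by left; exists t; rewrite //= in_itv /= l' ltW.
    have [s ss sE] := R1 t l'; rewrite -sE; have [l''|/ltW] := leP s s1; last exact: tailC.
    by right; exists s; rewrite //= in_itv /= ss.
  have FC' s : C (F' s).
    have [/L2[t tt <-]//|/ltW ss] := leP s s0.
    have [l''|/ltW] := leP s s1; last exact: tailC.
    by right; exists s; rewrite //= in_itv /= ss.
  have CO x : C x <-> range F x \/ range F' x.
    split; first by case=> -[t _ <-]; [left|right]; exists t.
    by case=> -[t _ <-].
  apply: (connected_all (O := [set x | range F x \/ range F' x]) nM).
  - by exists (F t0); [exact: (hF t0).1|left; exists t0].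
  - move=> x Mx [] [t _ <-].
      have [r r0 hr] := op t 1 ltr01; exists r => // y My /(hr _ My)[v _ <-]; by left; exists v.
    have [r r0 hr] := op' t 1 ltr01; exists r => // y My /(hr _ My)[v _ <-]; by right; exists v.
  move=> x Mx nx; have [|r r0 hr] := not_closed_dist (x := x) (compact_isclosed cC).
    by move=> /CO.
  by exists r => // y My xy /CO /hr; rewrite leNgt xy.
left.
pose H (t : R) := if t <= t0 then F t else F' (s0 + (t - t0)).
pose L x := exists2 t : R, t <= t0 & F t = x.
pose K x : R := if asbool (L x) then G x else G' x - s0 + t0.
have Hl t : t <= t0 -> H t = F t by rewrite /H => ->.
have Hr t : t0 < t -> H t = F' (s0 + (t - t0)) by rewrite /H leNgt => ->.
have Hr' t : t0 <= t -> H t = F' (s0 + (t - t0)).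
  by rewrite le_eqVlt => /orP[/eqP <-|/Hr//]; rewrite Hl // subrr addr0.
have HM t : M (H t) by rewrite /H; case: ifP => _; [exact: (hF _).1|exact: (hF' _).1].
have HK t : K (H t) = t.
  have [l|l] := leP t t0.
    by rewrite Hl // /K asboolT ?(hF _).2 //; exists t.
  rewrite Hr // /K asboolF; first by rewrite (hF' _).2; ring.
  move=> [v]; rewrite le_eqVlt => /orP[/eqP ->|vl vE].
    by rewrite E0 => /(arc_inj A'); lra.
  by apply: ninj; exists v, (s0 + (t - t0)); split=> //; rewrite ltrDl subr_gt0.
exists H, K; split; last first.
  move=> x [] [t _ <-].
    have [l|/ltW l] := leP t t0; first by exists t => //; rewrite Hl.
    have [s ss <-] := R1 t l; exists (t0 + (s - s0)) => //.
    by rewrite Hr' ?lerDl ?subr_ge0 //; congr F'; ring.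
  have [l|/ltW l] := leP t s0.
    by have [v vl <-] := L2 t l; exists v => //; rewrite Hl.
  exists (t0 + (t - s0)) => //; rewrite Hr' ?lerDl ?subr_ge0 //; congr F'; ring.
split=> //.
- move=> t e e0; have [l|l|l] := ltgtP t t0.
  + have [r r0 hr] := cF t e e0; have l0 : 0 < t0 - t by rewrite subr_gt0.
    exists (Num.min r (t0 - t)); first by rewrite lt_min r0.
    move=> y; rewrite lt_min => /andP[/hr yr yl].
    by rewrite !Hl ?(ltW l) //; move: yl; rewrite ltr_norml; lra.
  + have [r r0 hr] := cF' (s0 + (t - t0)) e e0; have l0 : 0 < t - t0 by rewrite subr_gt0.
    exists (Num.min r (t - t0)); first by rewrite lt_min r0.
    move=> y; rewrite lt_min => /andP[yr yl].
    rewrite !Hr //; last by move: yl; rewrite ltr_norml; lra.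
    by apply: hr; rewrite (_ : _ - _ = t - y) //; ring.
  have [r r0 hr] := cF t0 e e0; have [q q0 hq] := cF' s0 e e0.
  exists (Num.min r q); first by rewrite lt_min r0.
  move=> y; rewrite l lt_min (Hl t0) // => /andP[yr yq].
  have [l'|l'] := leP y t0; first by rewrite Hl //; exact: hr.
  rewrite Hr // E0; apply: hq; rewrite (_ : _ - _ = t0 - y) //; ring.
move=> t e e0; have [l|l|l] := ltgtP t t0.
- have m0 : 0 < Num.min e (t0 - t) by rewrite lt_min e0 subr_gt0.
  have [r r0 hr] := op t _ m0; exists r => // x Mx; rewrite Hl ?ltW // => /(hr _ Mx)[y].
  rewrite lt_min => /andP[ye yl] <-; exists y => //; rewrite Hl //.
  by move: yl; rewrite ltr_norml; lra.
- have m0 : 0 < Num.min e (t - t0) by rewrite lt_min e0 subr_gt0.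
  have [r r0 hr] := op' (s0 + (t - t0)) _ m0; exists r => // x Mx; rewrite Hr // => /(hr _ Mx)[y].
  rewrite lt_min => /andP[ye yl] <-; exists (y - s0 + t0).
    by rewrite (_ : t - _ = s0 + (t - t0) - y) //; ring.
  by rewrite Hr; [congr F'; ring|move: yl; rewrite ltr_norml; lra].
have [ea ea0 [h1 h2 h3 h4]] := al.
have m0 : 0 < Num.min e ea by rewrite lt_min e0.
have [r r0 hr] := op t0 e e0; have [q q0 hq] := op' s0 _ m0.
exists (Num.min r q); first by rewrite lt_min r0.
move=> x Mx; rewrite l Hl // lt_min => /andP[/(hr _ Mx)[y ye yE]].
rewrite E0 => /(hq _ Mx)[s]; rewrite lt_min => /andP[se sa] sE.
have [ls|ls] := leP s0 s.
  exists (t0 + (s - s0)); last by rewrite Hr' ?lerDl ?subr_ge0 // -sE; congr F'; ring.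
  by rewrite (_ : _ - _ = s0 - s) //; ring.
have [v vl vE] : exists2 t : R, t <= t0 & F t = F' s.
  by apply: h4; rewrite (ltW ls) andbT; move: sa; rewrite ltr_norml; lra.
have yv : y = v by apply: (arc_inj A); rewrite yE vE.
by exists y => //; rewrite Hl // yv.
Qed.

Lemma merge F G F' G' (t0 s0 : R) : arc F G -> arc F' G' -> F t0 = F' s0 ->
  (exists H K, arc H K /\ range F `|` range F' `<=` range H) \/ covered F F'.
Proof.
wlog al : F' G' s0 / aligned F F' t0 s0.
  move=> hw A A' E0; have [al|al] := align A A' E0; first exact: (hw F' G' s0).
  have rr : range (rev_arc F') = range F'.
    by apply/seteqP; split=> _ [t _ <-]; [exists (- t)|exists (- t); rewrite // /rev_arc opprK].
  have := hw (rev_arc F') (rev_inv G') (- s0) al A (arc_rev A').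
  by rewrite /covered rr /rev_arc opprK; apply.
move=> A A' E0.
have E0' : rev_arc F (- t0) = rev_arc F' (- s0) by rewrite /rev_arc !opprK.
have unrev F1 F2 a b : (forall t : R, - a <= t -> exists2 s : R, - b <= s & rev_arc F2 s = rev_arc F1 t) ->
    forall t : R, t <= a -> exists2 s : R, s <= b & F2 s = F1 t.
  move=> h t ta; have [|s sb] := h (- t); first by rewrite lerN2.
  by rewrite /rev_arc opprK => sE; exists (- s) => //; rewrite lerNl.
have [R1|R2] := ray A A' E0 al; have [/unrev L1|/unrev L2] := ray (arc_rev A) (arc_rev A') E0' (aligned_rev al).
- left; exists F', G'; split=> // x [] // -[t _ <-].
  by have [/ltW/R1|/L1] := ltP t0 t => -[s _ <-]; exists s.
- exact: (glue A A' E0).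
- have [[H [K [AH hH]]]|cv] := glue A' A (esym E0) (aligned_sym al) R2 L1.
    by left; exists H, K; split=> //; rewrite setUC.
  by right=> x /cv[|]; [right|left].
left; exists F, G; split=> // x [] // -[t _ <-].
by have [/ltW/R2|/L2] := ltP s0 t => -[s _ <-]; exists s.
Qed.

Lemma arc_embed F G : arc F G -> embed M setT (fun u : 'rV[R]_1 => F (u 0 0)) (fun x => const_mx (G x)).
Proof.
move=> A; have [h c op] := A.
have uE (u : 'rV[R]_1) : const_mx (u 0 0) = u by apply/rowP => i; rewrite mxE ord1.
have dE (u v : 'rV[R]_1) : `|u - v| = `|u 0 0 - v 0 0|.
  apply/le_anti; rewrite [X in _ && X](_ : _ = true) ?andbT; last first.
    by have := mx_norm_coord (u - v) 0; rewrite !mxE.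
  by apply: le_trans (le_norm_enorm _) _; rewrite enorm_le // /dotp big_ord1 !mxE -expr2 real_normK ?num_real.
split.
- exact: openT.
- by move=> u _; rewrite (h _).2 uE; split=> //; exact: (h _).1.
- move=> u _ e e0; have [r r0 hr] := c (u 0 0) e e0; exists r => // v _.
  by rewrite dE; exact: hr.
- move=> _ [u _ <-] e e0; have [r r0 hr] := arc_back (u 0 0) A e0.
  exists r => // _ [v _ <-] l; rewrite dE !mxE (h _).2; apply: hr l; by exists (v 0 0).
move=> u _; have [r r0 hr] := op (u 0 0) 1 ltr01; exists r => // x Mx /(hr _ Mx)[y _ <-].
by exists (const_mx y); rewrite // mxE.
Qed.

Lemma embed_arc (f : 'rV[R]_1 -> 'rV[R]_d) g : embed M setT f g ->
  arc (fun t => f (const_mx t)) (fun x => g x 0 0).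
Proof.
move=> [_ h c cg op].
have nE (t : R) : `|const_mx t : 'rV[R]_1| <= `|t|.
  by apply: le_trans (le_norm_enorm _) _; rewrite enorm_le // /dotp big_ord1 !mxE -expr2 real_normK ?num_real.
have dE (t s : R) : (const_mx t - const_mx s : 'rV[R]_1) = const_mx (t - s).
  by apply/rowP => i; rewrite !mxE.
split.
- by move=> t; rewrite (h _ I).2 mxE; split=> //; exact: (h _ I).1.
- move=> t e e0; have [r r0 hr] := c (const_mx t) I e e0; exists r => // y ty; apply: hr => //.
  by rewrite dE; exact: le_lt_trans (nE _) ty.
move=> t e e0; have [r r0 hr] := cg _ (imageP f (I : setT (const_mx t))) e e0.
have [q q0 hq] := op (const_mx t) I.
exists (Num.min r q); first by rewrite lt_min r0.
move=> x Mx; rewrite lt_min => /andP[xr /(hq _ Mx)[u _ ux]]; exists (u 0 0); last first.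
  by rewrite -ux; congr f; apply/rowP => i; rewrite mxE ord1.
have := hr _ (ex_intro2 _ _ u I erefl); rewrite ux => /(_ xr); rewrite -{1}ux !(h _ I).2 => l.
by apply: le_lt_trans l; have := mx_norm_coord (const_mx t - u) 0; rewrite !mxE.
Qed.

End Arcs.

(** If M is not a sphere, two arcs with a common point merge into one, because arcs covering M would
    make it a union of two cells. Connectedness and compactness then yield a single arc covering M,
    which [cell_escape] excludes. *)
Lemma circle {R : realType} {d : nat} (M : set 'rV[R]_d) : compact M -> connected M -> M !=set0 ->
  (forall p, M p -> exists (f : 'rV[R]_1 -> 'rV[R]_d) g, embed M setT f g /\ range f p) ->
  homeomorphic M (sphere R 1).
Proof.
move=> cM nM M0 loc; apply: contrapT => ns.
have loc' p : M p -> exists F G, arc M F G /\ range F p.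
  move=> /loc[f [g [E [u _ <-]]]]; eexists; eexists; split; first exact: embed_arc E.
  by exists (u 0 0) => //; congr f; apply/rowP => i; rewrite mxE ord1.
have join F G F' G' p : arc M F G -> arc M F' G' -> range F p -> range F' p ->
    exists H K, arc M H K /\ range F `|` range F' `<=` range H.
  move=> A A' [t _ tp] [s _ sp]; have [//|cv] := merge nM A A' (etrans tp (esym sp)).
  case: ns; apply: (two_cells cM (arc_embed A) (arc_embed A')) => // x /cv[] [v _ <-].
    by left; exists (const_mx v); rewrite // mxE.
  by right; exists (const_mx v); rewrite // mxE.
have [p Mp] := M0.
have reach : M `<=` [set x | exists F G, [/\ arc M F G, range F p & range F x]].
  apply: connected_all => //.
  - by exists p => //; have [F [G [A Fp]]] := loc' _ Mp; exists F, G.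
  - move=> x Mx [F [G [A Fp [t _ <-]]]]; have [_ _ op] := A.
    have [r r0 hr] := op t 1 ltr01; exists r => // y My /(hr _ My)[v _ <-]; exists F, G; split=> //.
  move=> x Mx nx; have [F [G [A [t _ tx]]]] := loc' _ Mx; have [_ _ op] := A.
  have [r r0 hr] := op t 1 ltr01; exists r => // y My; rewrite -tx => /(hr _ My)[v _ vy] [F' [G' [A' F'p F'y]]].
  have Fy : range F y by exists v.
  have [H [K [AH hH]]] := join _ _ _ _ y A A' Fy F'y.
  by apply: nx; exists H, K; split=> //; apply: hH; [right|left; exists t].
have [F [G [A [_ Fall]]]] : exists F G, arc M F G /\ (range F p /\ M `<=` range F).
  apply: (compact_ind (P := fun K => exists F G, arc M F G /\ (range F p /\ K `<=` range F)) cM).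
  - by have [F [G [A Fp]]] := loc' _ Mp; exists F, G; do 2!split=> //; move=> x [].
  - move=> B C [F [G [A [Fp FB]]]] [F' [G' [A' [Fp' FC]]]].
    have [H [K [AH hH]]] := join _ _ _ _ p A A' Fp Fp'; exists H, K; split=> //.
    by split; [apply: hH; left|move=> x [/FB|/FC] ?; apply: hH; [left|right]].
  - by move=> B C BC [F [G [A [Fp FC]]]]; exists F, G; do 2!split=> //; move=> x /BC /FC.
  move=> x Mx; have [F [G [A Fp [t _ tx]]]] := reach _ Mx; have [_ _ op] := A.
  have [r r0 hr] := op t 1 ltr01; exists [set y | `|x - y| < r].
    by apply/nbhsP; exists r.
  exists F, G; do 2!split=> //; move=> y [My]; rewrite /= -tx => /(hr _ My)[v _ <-]; by exists v.
have [z Mz] := cell_escape cM (n := 1) isT M0 (arc_embed A).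
by apply; have [t _ <-] := Fall _ Mz; exists (const_mx t); rewrite // mxE.
Qed.

(** * Contact points *)

Section Contact.
Context {R : realType} {n d : nat}.
Variable M : set 'rV[R]_d.
Hypotheses (cM : compact M) (hC : charted (n := n) M) (nM : connected M).
Hypothesis n1 : (1 < n)%N.
Hypothesis ball3 : forall x, M x -> dotp x x <= 3^-1.
Hypothesis nsphere : ~ homeomorphic M (sphere R n).

(** For norms at most 1/sqrt 3 and mutual distances at least 1, both sides are pinned to 3 and x + y
    + z = 0. *)
Lemma three_points (x y z : 'rV[R]_d) : dist2 x y + dist2 y z + dist2 x z =
  3 * (dotp x x + dotp y y + dotp z z) - dotp (x + y + z) (x + y + z).
Proof.
rewrite /dist2 !(dotpBl, dotpBr, dotpDl, dotpDr).
rewrite (dotpC y x) (dotpC z x) (dotpC z y); ring.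
Qed.

Lemma dist2_lip : exists2 K : R, 0 < K & forall x q q', M x -> M q -> M q' ->
  dist2 x q' <= dist2 x q + K * `|q - q'|.
Proof.
have [C C0 hC'] := @enorm_lipschitz R d; exists (4 * C); first by rewrite mulr_gt0.
have e1 x : M x -> enorm x <= 1.
  by move=> /ball3 h; rewrite enorm_le // expr1n (le_trans h) // invf_le1 // ler1n.
move=> x q q' /e1 x1 /e1 q1 /e1 q1'.
have -> : dist2 x q' = dist2 x q + dotp (q - q') (x + x + (- q - q')).
  rewrite /dist2 !(dotpBl, dotpBr, dotpDl, dotpDr, dotpNr).
  by rewrite (dotpC q' x) (dotpC q x) (dotpC q' q); ring.
rewrite lerD2l; apply: le_trans (cauchy_le _ _) _.
have h1 : enorm (x + x + (- q - q')) <= 4.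
  apply: le_trans (enormD _ _) _; have h2 := enormD x x; have := enormD (- q) (- q').
  by rewrite !enormN; lra.
have := hC' (q - q'); have := enorm_ge0 (q - q'); have := enorm_ge0 (x + x + (- q - q')).
move: (enorm (q - q')) (enorm _) h1 `|q - q'| => a b b4 c b0 a0 ac.
by apply: (le_trans (y := a * 4)); [exact: ler_wpM2l|lra].
Qed.

Lemma not_two_slices p q : M p -> M q -> ~ (forall x, M x -> Om M p x \/ Om M q x).
Proof.
move=> Mp Mq /(two_balls cM hC Mp Mq)[f [g [f' [g' [E E' cov]]]]].
by apply: nsphere; apply: (two_cells cM E E' cov); [exact: ltnW|exists p].
Qed.

Definition contact p q := [/\ M q, dist2 q p = 1 &
  forall e : R, 0 < e -> exists2 z, Om M p z & `|q - z| < e].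

Lemma contact_exists p : M p -> exists q, contact p q.
Proof.
move=> Mp; apply: contrapT => no; apply: (not_two_slices Mp Mp).
suff all : M `<=` Om M p by move=> x /all; left.
apply: connected_all => //.
- by exists p => //; exact: Om_p.
- by move=> x Mx /(Om_open hC Mp)[e e0 he]; exists e.
move=> x Mx nO; apply: contrapT => h.
have near e : 0 < e -> exists2 z, Om M p z & `|x - z| < e.
  move=> e0; apply: contrapT => h'; apply: h; exists e => // z Mz xz Oz.
  by apply: h'; exists z.
have [l|l] := ltP (dist2 x p) 1; first by apply: nO; exact: (Om_closed hC Mp).
have [l'|l'] := leP (dist2 x p) 1.
  by apply: no; exists x; split=> //; apply/le_anti; rewrite l' l.
have d0 : 0 < dist2 x p - 1 by rewrite subr_gt0.
have [r r0 hr] := @cont_dist2p _ _ p setT x I _ d0.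
have [z Oz xz] := near r r0; have [_ z1] := Om_sub Oz.
by have := hr z I xz; rewrite ltr_norml => /andP[_]; lra.
Qed.

(** Let x0 maximize the smaller of the distances to p and q. If this maximum were below 1, the
    slices of p and of a point q' of the slice of p close to q would cover M by [two_components]. So
    x0 is at distance at least 1 from both, and [three_points] makes it the third vertex. *)
Lemma contact_third p q : M p -> contact p q ->
  [/\ M (- p - q), dotp p p = 3^-1 & dotp q q = 3^-1].
Proof.
move=> Mp [Mq qp near].
have [x0 Mx0 xmax] := compact_max cM (ex_intro _ _ Mp)
  (cont_on_min (@cont_dist2p _ _ p M) (@cont_dist2p _ _ q M)).
set m := Num.min _ _ in xmax.
have [m1|m1] := ltP m 1.
  have [K K0 hK] := dist2_lip; exfalso.
  pose e := (1 - m) / (2 * K); have e0 : 0 < e by rewrite divr_gt0 ?subr_gt0 ?mulr_gt0.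
  have Ke : K * e = (1 - m) / 2 by rewrite /e; field; rewrite gt_eqF.
  have [q' Oq' qq'] := near e e0; have [Mq' _] := Om_sub Oq'.
  have Kq : K * `|q - q'| < (1 - m) / 2 by rewrite -Ke ltr_pM2l.
  have h1 : (1 + m) / 2 < dist2 p q'.
    have := hK p q' q Mp Mq' Mq; rewrite (dist2C p q) qp distrC => h; lra.
  apply: (not_two_slices Mp Mq'); apply: (two_components cM hC nM n1 Mp Mq' (c := (1 + m) / 2)) => //.
  - lra.
  - move=> x Mx cx; have := hK x q q' Mx Mq Mq'; have := xmax _ Mx.
    by rewrite ge_min => /orP[]; lra.
  by exists q'; [split=> //; rewrite dist2C|exact: Om_p].
have [h1 h2] : 1 <= dist2 x0 p /\ 1 <= dist2 x0 q by move: m1; rewrite le_min => /andP[].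
have := three_points x0 p q; rewrite (dist2C p q) qp => E.
have := ball3 Mx0; have := ball3 Mp; have := ball3 Mq; have := dotp_ge0 (x0 + p + q) => g0 b1 b2 b3.
have S0 : dotp (x0 + p + q) (x0 + p + q) = 0 by lra.
split; [|lra|lra].
move/eqP: S0; rewrite dotp_eq0 -addrA addr_eq0 => /eqP x0E.
by rewrite -opprD -x0E.
Qed.

(** If y near q were at distance more than 1 from p, [three_points] would exclude points at distance
    at least 1 from both p and y, and the slices of p and y would cover M. *)
Lemma contact_max p q : M p -> contact p q ->
  exists2 e : R, 0 < e & forall y, M y -> `|q - y| < e -> dist2 y p <= 1.
Proof.
move=> Mp [Mq qp near].
have [e e0 he] := O_open hC (O_diag ltr01 Mq).
exists e => // y My qy; rewrite leNgt; apply/negP => yp.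
have [x0 Mx0 xmax] := compact_max cM (ex_intro _ _ Mp)
  (cont_on_min (@cont_dist2p _ _ p M) (@cont_dist2p _ _ y M)).
set m := Num.min _ _ in xmax.
have m1 : m < 1.
  rewrite ltNge; apply/negP; rewrite le_min => /andP[h1 h2].
  have := three_points x0 p y; rewrite (dist2C p y) => E.
  have := ball3 Mx0; have := ball3 Mp; have := ball3 My; have := dotp_ge0 (x0 + p + y); lra.
have [K K0 hK] := dist2_lip.
pose e1 := (1 - m) / (2 * K); have e10 : 0 < e1 by rewrite divr_gt0 ?subr_gt0 ?mulr_gt0.
have Ke : K * e1 = (1 - m) / 2 by rewrite /e1; field; rewrite gt_eqF.
have m0 : 0 < Num.min e e1 by rewrite lt_min e0.
have [q' Oq'] := near _ m0; rewrite lt_min => /andP[qq' qq1]; have [Mq' _] := Om_sub Oq'.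
have Kq : K * `|q - q'| < (1 - m) / 2 by rewrite -Ke ltr_pM2l.
apply: (not_two_slices Mp My); apply: (two_components cM hC nM n1 Mp My (c := (1 + m) / 2)) => //.
- lra.
- by rewrite dist2C; lra.
- by move=> x Mx cx; have := xmax _ Mx; rewrite ge_min => /orP[]; lra.
exists q'; last by apply: he => //; apply/norm_pair_lt.
split=> //; have := hK p q' q Mp Mq' Mq; rewrite (dist2C p q) (dist2C p q') qp distrC => h; lra.
Qed.

Lemma contact_normal p q : M p -> contact p q -> norm2 (n := n) M q p = 1.
Proof.
move=> Mp ct; have [Mq qp _] := ct; have [e e0 he] := contact_max Mp ct.
rewrite -qp; apply: contrapT => /eqP nc.
have [W [U [phi [g [J [[C _] Wq Uq fq _]]]]]] := chart_at hC Mq.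
have [b [r [r0 rU hb]]] := descent_dir hC C Mq Wq nc.
have [s s0 hs] := line_near b C Uq e0.
have b1 : 0 < `|b| + 1 by rewrite ltr_wpDl.
have m0 : 0 < Num.min (s / 2) (r / 2 / (`|b| + 1)) by rewrite lt_min !divr_gt0.
have [t t0 [ts tr]] : exists2 t : R, 0 < t & t < s /\ t * `|b| < r.
  exists (Num.min (s / 2) (r / 2 / (`|b| + 1))) => //; split.
    by rewrite gt_min ltr_pdivrMr // ltr_pMr // ltr1n.
  apply: (le_lt_trans (y := r / 2 / (`|b| + 1) * (`|b| + 1))).
    by apply: ler_pM => //; [exact: ltW|rewrite ge_min lexx orbT|rewrite lerDl].
  by rewrite divfK ?gt_eqF // ltr_pdivrMr // ltr_pMr // ltr1n.
have [|Ua Ma Wa ga] := hs t; first by rewrite gtr0_norm.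
rewrite fq => /(he _ Ma); rewrite leNgt => /negP; apply.
rewrite -qp -{1}fq -[X in dist2 (phi X) _](addrK (t *: b)).
apply: hb => //; last by rewrite subrr normr0.
- by rewrite opprD addNKr normrN normrZ gtr0_norm.
- by rewrite addrK subrr normr0.
Qed.

End Contact.

(** * Slices as graphs over tangent spaces *)

Section Bilinear.
Context {R : realType} {d : nat}.
Implicit Types (B : 'rV[R]_d -> 'rV[R]_d -> 'rV[R]_d) (u v w : 'rV[R]_d).

Definition bilin B : Prop :=
  (forall (a : R) u v w, B (a *: u + v) w = a *: B u w + B v w) /\ forall u v, B u v = B v u.

Section Theory.
Variable B : 'rV[R]_d -> 'rV[R]_d -> 'rV[R]_d.
Hypothesis hB : bilin B.

Lemma bilC u v : B u v = B v u. Proof. by case: hB. Qed.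

Lemma bilDl u v w : B (u + v) w = B u w + B v w.
Proof. by case: hB => h _; have := h 1 u v w; rewrite !scale1r. Qed.

Lemma bil0l w : B 0 w = 0.
Proof. by have := bilDl 0 0 w; rewrite addr0 -[LHS]addr0 => /addrI. Qed.

Lemma bilZl (a : R) u w : B (a *: u) w = a *: B u w.
Proof. by case: hB => h _; have := h a u 0 w; rewrite !addr0 bil0l addr0. Qed.

Lemma bilDr u v w : B w (u + v) = B w u + B w v.
Proof. by rewrite !(bilC w) bilDl. Qed.

Lemma bilZr (a : R) u w : B w (a *: u) = a *: B w u.
Proof. by rewrite !(bilC w) bilZl. Qed.

Lemma bilNl u w : B (- u) w = - B u w.
Proof. by rewrite -scaleN1r bilZl scaleN1r. Qed.

Lemma bilNr u w : B w (- u) = - B w u.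
Proof. by rewrite !(bilC w) bilNl. Qed.

Lemma bil_suml (I : Type) (r : seq I) (F : I -> 'rV[R]_d) w :
  B (\sum_(i <- r) F i) w = \sum_(i <- r) B (F i) w.
Proof.
elim: r => [|i r IH]; first by rewrite !big_nil bil0l.
by rewrite !big_cons bilDl IH.
Qed.

Lemma bil_mx : exists D : 'I_d -> 'M[R]_d, forall v w, B v w = \sum_i v 0 i *: (w *m D i).
Proof.
exists (fun i => \matrix_(k, j) B (delta_mx 0 i) (delta_mx 0 k) 0 j) => v w.
rewrite {1}(row_sum_delta v) bil_suml; apply: eq_bigr => i _; rewrite bilZl; congr (_ *: _).
rewrite bilC {1}(row_sum_delta w) bil_suml; apply/rowP => j; rewrite summxE !mxE.
by apply: eq_bigr => k _; rewrite bilZl !mxE bilC.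
Qed.

Lemma cont_on_mulmx {V : normedModType R} {m p} (A : set V) (f : V -> 'rV[R]_m) (D : 'M[R]_(m, p)) :
  cont_on A f -> cont_on A (fun x => f x *m D).
Proof.
move=> cf; apply: cont_on_row => j; apply: (@cont_on_ext _ _ _ _ (fun x => \sum_k f x 0 k * D k j)).
  by move=> x _; rewrite mxE.
by apply: cont_on_bigsum => k; apply: cont_onM; [exact: cont_on_coord|exact: cont_on_cst].
Qed.

Lemma cont_on_bil {V : normedModType R} (A : set V) (f : V -> 'rV[R]_d) :
  cont_on A f -> cont_on A (fun x => B (f x) (f x)).
Proof.
have [D DE] := bil_mx; move=> cf; apply: cont_on_row => j.
apply: (@cont_on_ext _ _ _ _ (fun x => \sum_k f x 0 k * (f x *m D k) 0 j)).
  by move=> x _; rewrite DE summxE; apply: eq_bigr => k _; rewrite [RHS]mxE.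
apply: cont_on_bigsum => k; apply: cont_onM; first exact: cont_on_coord.
by apply: cont_on_coord; exact: cont_on_mulmx.
Qed.

End Theory.
End Bilinear.

Section Rigid.
Context {R : realType} {n d : nat}.
Variable M : set 'rV[R]_d.
Hypotheses (cM : compact M) (hC : charted (n := n) M) (nM : connected M).
Hypothesis n1 : (1 < n)%N.
Hypothesis ball3 : forall x, M x -> dotp x x <= 3^-1.
Hypothesis nsphere : ~ homeomorphic M (sphere R n).
Local Notation norm2 := (norm2 (n := n) M).
Local Notation Pi := (Pi (n := n) M).

(** The other inequality is [O_norm2]. For this one, |nu|^2 - l s^4 is minimized over the closure of
    the slice. By [ascend] the minimum is at p, with value 0, or at a contact point, where the chord
    is normal and the value is 1 - l; then l tends to 1. *)
Lemma rigid p x : M p -> Om M p x -> norm2 x p = dist2 x p ^+ 2.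
Proof.
move=> Mp Ox; apply/le_anti/andP; split; first exact: (O_norm2 cM hC Ox).
pose K := [set x | M x /\ forall e : R, 0 < e -> exists2 z, Om M p z & `|x - z| < e].
have cK : compact K.
  apply: (compact_sub cM); last by move=> y [].
  apply/closedP => y h; split.
    have /closedP : closed M by exact: compact_isclosed.
    by apply=> e /h[w [? _] xw]; exists w.
  move=> e e0; have e20 : 0 < e / 2 by rewrite divr_gt0.
  have [w [_ hw] yw] := h _ e20; have [z Oz wz] := hw _ e20; exists z => //.
  by have := ler_distD w y z; lra.
have Kp : K p.
  split=> // e e0; exists p; first exact: Om_p.
  by rewrite subrr normr0.
have sub z : Om M p z -> K z.
  move=> Oz; split=> [|e e0]; first by have [] := Om_sub Oz.
  by exists z => //; rewrite subrr normr0.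
have bound (l : R) : 1 < l -> l * (dist2 x p ^+ 2 - 1) + 1 <= norm2 x p.
  move=> l1; pose f z := norm2 z p - l * dist2 z p ^+ 2.
  have cf : cont_on K f.
    apply: cont_onB.
      have c1 : cont_on K (fun z => (z, p) : 'rV[R]_d * 'rV[R]_d).
        by apply: cont_on_pair; [exact: cont_on_id|exact: cont_on_cst].
      by apply: (cont_on_comp _ c1 (cont_norm2 hC)) => z [].
    apply: cont_onM; first exact: cont_on_cst.
    apply: (@cont_on_ext _ _ _ _ (fun z => dist2 z p * dist2 z p)).
      by move=> z _; rewrite expr2.
    by apply: cont_onM; exact: cont_dist2p.
  have [z Kz zmin] := compact_min cK (ex_intro _ _ Kp) cf.
  have := zmin _ (sub _ Ox); rewrite /f; case: (Kz) => Mz near.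
  suff : 1 - l <= norm2 z p - l * dist2 z p ^+ 2 by lra.
  have [Oz|nOz] := pselect (Om M p z).
    have [->|zp] := pselect (z = p); first by rewrite norm2xx dist2xx expr0n /= mulr0; lra.
    have nc : norm2 z p != dist2 z p by apply/eqP; exact: (O_noncrit cM hC Oz).
    have [e e0 he] := Om_open hC Mp Oz.
    have [y [My zy]] := ascend hC Mz nc (O_norm2 cM hC Oz) l1 e0.
    by have := zmin _ (sub _ (he _ My zy)); rewrite /f leNgt => /negP.
  have ct : contact M p z.
    split=> //; apply/le_anti/andP; split; rewrite leNgt; apply/negP => l'; last first.
      by apply: nOz; exact: (Om_closed hC Mp).
    have d0 : 0 < dist2 z p - 1 by rewrite subr_gt0.
    have [r r0 hr] := @cont_dist2p _ _ p setT z I _ d0.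
    have [y Oy zy] := near r r0; have [_ y1] := Om_sub Oy.
    by have := hr y I zy; rewrite ltr_norml => /andP[_]; lra.
  rewrite (contact_normal cM hC nM n1 ball3 nsphere Mp ct).
  by case: ct => _ -> _; rewrite expr1n mulr1.
have [_ x1] := Om_sub Ox; have D1 : dist2 x p ^+ 2 <= 1.
  by rewrite expr_le1 // ?dist2_ge0 // ltW.
have D0 : 0 <= dist2 x p ^+ 2 by rewrite sqr_ge0.
move: (dist2 x p ^+ 2) (norm2 x p) bound D1 D0 => D N bound D1 D0.
rewrite leNgt; apply/negP => l.
have l1 : 1 < 1 + (D - N) / 2 by rewrite ltrDl divr_gt0 // subr_gt0.
have := bound _ l1; have : 0 <= (D - N) * D by rewrite mulr_ge0 // subr_ge0 ltW.
lra.
Qed.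

Definition pt x (B : 'rV[R]_d -> 'rV[R]_d -> 'rV[R]_d) w := x + (1 + dotp w w)^-1 *: (w + B w w).

(* The slice around x is parametrized by its tangent space, in the coordinate w = v / sqrt(1 - |v|^2)
   where |v| is the distance to x; B is half the second fundamental form. *)
Lemma slice_param x : M x -> exists B, [/\ bilin B, forall u v, B u v *m Pi x = 0 &
  forall y, Om M x y -> let w := (1 - dist2 y x)^-1 *: ((y - x) *m Pi x) in
    [/\ w *m Pi x = w, (1 + dotp w w)^-1 = 1 - dist2 y x, y = pt x B w &
        dotp (B w w) (B w w) = dotp w w ^+ 2]].
Proof.
have vec (s : R) (z z' : 'rV[R]_d) : 0 < 1 - s -> s *: z = - (2 * (s - s ^+ 2)) *: z' ->
    s *: ((1 - s) *: (2^-1 *: ((1 - s)^-1 ^+ 2 *: z))) = s *: - z'.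
  move=> s1 E; have -> : s *: ((1 - s) *: (2^-1 *: ((1 - s)^-1 ^+ 2 *: z))) =
      ((1 - s) * 2^-1 * (1 - s)^-1 ^+ 2) *: (s *: z).
    by rewrite !scalerA; congr (_ *: _); move: (2^-1 : R) (_^-1) => h q; ring.
  by rewrite E scalerA scalerN -scaleNr; congr (_ *: _); field; rewrite gt_eqF.
have half2 (X : 'rV[R]_d) : 2^-1 *: (X + X) = X.
  by apply/rowP => i; rewrite !mxE; field.
move=> Mx; have [W [U [phi [g [J [G Wx Ux fx PE]]]]]] := chart_at hC Mx.
have [C cJ] := G; have oP := Pi_oproj hC Mx.
set a := g x in Ux fx PE.
pose D i : 'M[R]_(n, d) := \matrix_(k, j) 'd (fun a' => J a' k j) a (delta_mx 0 i).
pose A (b c : 'rV[R]_n) : 'rV[R]_d := \sum_i b 0 i *: (c *m D i).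
have AE b : acc J b a = A b b.
  have [_ _ _ _ DJ] := C; have [_ _ _ dJ] := DJ _ Ux.
  apply/rowP => j; rewrite mxE (_ : (fun a' => _) = fun a' => \sum_k b 0 k * J a' k j); last first.
    by apply/funext => a'; rewrite mxE.
  have dk k : differentiable (fun a' => b 0 k * J a' k j) a.
    by apply: differentiableM; [exact: differentiable_cst|exact: dJ].
  rewrite (diff_bigsum _ _ dk) summxE.
  under eq_bigr => k _.
    rewrite diff_mul ?diff_const ?mulr0 ?addr0; last 2 first.
    - exact: differentiable_cst.
    - exact: dJ.
    rewrite {2}(row_sum_delta b) linear_sum mulr_sumr; over.
  rewrite exchange_big /=; apply: eq_bigr => i _; rewrite !mxE mulr_sumr; apply: eq_bigr => k _.
  by rewrite linearZ !mxE /=; rewrite mulrCA.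
have AD k b b' c : A (k *: b + b') c = k *: A b c + A b' c.
  rewrite /A scaler_sumr -big_split /=; apply: eq_bigr => i _.
  by rewrite !mxE scalerDl scalerA.
have AD' k b c c' : A b (k *: c + c') = k *: A b c + A b c'.
  rewrite /A scaler_sumr -big_split /=; apply: eq_bigr => i _.
  by rewrite mulmxDl -scalemxAl scalerDr !scalerA mulrC.
pose Q : 'M[R]_(d, n) := (J a)^T *m ((\det (J a *m (J a)^T))^-1 *: \adj (J a *m (J a)^T)).
have QE z : z *m Pi x = z *m Q *m J a by rewrite PE /proj mulmxA.
pose B u v : 'rV[R]_d := 2^-1 *: nu (Pi x) (2^-1 *: (A (u *m Q) (v *m Q) + A (v *m Q) (u *m Q))).
have nuL (k : R) z z' : nu (Pi x) (k *: z + z') = k *: nu (Pi x) z + nu (Pi x) z'.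
  by rewrite /nu mulmxDl -scalemxAl scalerBr opprD addrACA.
have lin k (X X' Y Y' : 'rV[R]_d) :
    2^-1 *: nu (Pi x) (2^-1 *: (k *: X + Y + (k *: X' + Y'))) =
    k *: (2^-1 *: nu (Pi x) (2^-1 *: (X + X'))) + 2^-1 *: nu (Pi x) (2^-1 *: (Y + Y')).
  rewrite (_ : 2^-1 *: (_ + _ + _) = k *: (2^-1 *: (X + X')) + 2^-1 *: (Y + Y')); last first.
    by apply/rowP => i; rewrite !mxE; ring.
  by rewrite nuL scalerDr !scalerA [2^-1 * k]mulrC.
have hB : bilin B.
  split=> [k u v w|u v]; last by rewrite /B addrC.
  rewrite /B !mulmxDl -!scalemxAl AD AD'; exact: lin.
have Bn u v : B u v *m Pi x = 0 by rewrite /B -scalemxAl nu_proj // scaler0.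
exists B; split=> // y Oy w.
have [My y1] := Om_sub Oy; have s0 : 0 < 1 - dist2 y x by rewrite subr_gt0.
have Oxy : Om M y x by exact: O_sym.
have wP : w *m Pi x = w by rewrite /w -scalemxAl -mulmxA oP.2.
have rg := rigid My Oxy; rewrite (dist2C x y) in rg.
have tE : (y - x) *m Pi x = - tang (n := n) M x y.
  by rewrite /tang -mulNmx opprB.
have tS := tang_sqr hC y Mx; rewrite (dist2C x y) rg in tS.
have ww : dotp w w = dist2 y x / (1 - dist2 y x).
  rewrite /w tE !(dotpZl, dotpZr, dotpNl, dotpNr) opprK tS; move: s0.
  by move: (dist2 y x) => s s0; field; rewrite gt_eqF.
have wi : (1 + dotp w w)^-1 = 1 - dist2 y x.
  rewrite ww -[RHS]invrK; congr (_^-1); move: s0; move: (dist2 y x) => s s0.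
  by field; rewrite gt_eqF.
(* [acc_rigid] is applied at the base point x with y in the role of p: the normal part of the chord
   determines the second fundamental form at x in the direction of y. *)
have BE : (1 - dist2 y x) *: B w w = - nu (Pi x) (x - y).
  have [yx|yx] := eqVneq y x.
    by rewrite /w yx subrr mul0mx scaler0 (bil0l hB) scaler0 /nu mul0mx subrr oppr0.
  have [e e0 he] := Om_open hC My Oxy.
  have nc : norm2 x y != dist2 x y.
    by apply/eqP; apply: (O_noncrit cM hC Oxy) => xy; rewrite xy eqxx in yx.
  pose b := (x - y) *m Q.
  have bT : b *m J a = tang (n := n) M x y by rewrite /b /tang QE.
  have := acc_rigid hC G Mx Wx e0 (fun z Mz xz => rigid My (he _ Mz xz)) nc bT.
  rewrite (dist2C x y) tS -/a AE => E.
  have d0 : dist2 y x != 0 by rewrite dist2_eq0.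
  have wQ : w *m Q *m J a = (- (1 - dist2 y x)^-1 *: b) *m J a.
    by rewrite -QE wP /w tE -scalemxAl bT scaleNr scalerN.
  have [_ _ _ _ DJ] := C; have [_ _ fJ _] := DJ _ Ux.
  have {}wQ : w *m Q = - (1 - dist2 y x)^-1 *: b by apply: (row_free_inj fJ).
  have AL0 c : A 0 c = 0.
    by rewrite /A big1 // => i _; rewrite mxE scale0r.
  have AR0 c : A c 0 = 0.
    by rewrite /A big1 // => i _; rewrite mul0mx scaler0.
  have AZ k : A (k *: b) (k *: b) = k ^+ 2 *: A b b.
    by rewrite -[k *: b]addr0 AD AD' !AL0 AR0 !addr0 scalerA expr2.
  have -> : B w w = 2^-1 *: nu (Pi x) (A (w *m Q) (w *m Q)).
    by rewrite /B half2.
  rewrite wQ AZ sqrrN.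
  have nuZ k z : nu (Pi x) (k *: z) = k *: nu (Pi x) z.
    by rewrite -[k *: z]addr0 nuL /nu mul0mx subrr addr0.
  rewrite nuZ; apply: (scalerI d0); exact: (vec _ _ _ s0 E).
split=> //.
- rewrite /pt wi scalerDr BE {1}/w scalerA mulfV ?gt_eqF // scale1r.
  rewrite /nu !mulmxBl; move: (y *m _) (x *m _) => Y X.
  by apply/rowP => i; rewrite !mxE; ring.
rewrite ww; move: (B w w) BE => v BE.
have := congr1 (fun z => dotp z z) BE.
rewrite !(dotpZl, dotpZr, dotpNl, dotpNr) opprK -/(norm2 x y) rg.
move: (dotp v v) (dist2 y x) s0 => N s s0 E.
have -> : N = s ^+ 2 / (1 - s) ^+ 2 by rewrite -E; field; rewrite gt_eqF.
by field; rewrite gt_eqF.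
Qed.

End Rigid.

Section LocalOnto.
Context {R : realType} {n : nat}.

Lemma mxdiff_cont {m} (h : 'rV[R]_n -> 'rV[R]_m) A : (forall a, A a -> mxdiff h a) -> cont_on A h.
Proof.
move=> dh; apply: cont_on_row => j a Aa e e0.
have /differentiable_continuous/cvgrPdist_lt/(_ e e0) := dh a Aa 0 j.
by move=> /nbhsP[r r0 hr]; exists r => // y _ /hr.
Qed.

(** Surjectivity by minimization. The value h a1 closest to u is attained in the interior, as h
    stays away from h a0 on the bounding sphere. Along the b with b Jm = h a1 - u the squared
    distance to u has derivative 2 |h a1 - u|^2, which must vanish. *)
Lemma local_onto (h : 'rV[R]_n -> 'rV[R]_n) a0 (rho : R) : 0 < rho ->
  (forall a, `|a0 - a| <= rho -> mxdiff h a /\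
     forall b, (forall j, 'd (fun x => h x 0 j) a b = 0) -> b = 0) ->
  (forall a, `|a0 - a| <= rho -> h a = h a0 -> a = a0) ->
  exists2 e : R, 0 < e & forall u, `|h a0 - u| < e -> exists2 a, `|a0 - a| < rho & h a = u.
Proof.
have ic (c : R) : is_derive (0 : R) 1 (fun=> c) 0.
  have := is_derive_affine c 0; rewrite (_ : (fun t : R => c + 0 * t) = fun=> c) //.
  by apply/funext => t; rewrite mul0r addr0.
move=> r0 dh ih; pose D : set 'rV[R]_n := [set a | `|a0 - a| <= rho].
have cD : compact D by exact: closed_ball_compact.
have ch : cont_on D h by apply: mxdiff_cont => a /dh[].
pose S := [set a | D a /\ rho <= `|a0 - a|].
have cS : compact S.
  apply: (compact_sub cD); last by move=> a [].
  apply: closed_ge; first exact: compact_isclosed.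
  by apply: cont_on_norm; apply: cont_onB; [exact: cont_on_cst|exact: cont_on_id].
have [m m0 hm] : exists2 m : R, 0 < m & forall a, S a -> m <= enorm (h a - h a0).
  have [S0|S0] := pselect (S !=set0); last by exists 1 => // a Sa; case: S0; exists a.
  have cdd : cont_on S (fun a => dotp (h a - h a0) (h a - h a0)).
    have c1 : cont_on S (fun a => h a - h a0).
      apply: cont_onB; last exact: cont_on_cst.
      by apply: cont_onS ch => a [].
    by apply: cont_on_dotp => j; apply: cont_on_coord.
  have [a1 [Da1 ra1] amin] := compact_min cS S0 cdd.
  exists (enorm (h a1 - h a0)) => [|a Sa].
    rewrite enorm_gt0 subr_eq0; apply/eqP => /(ih _ Da1) E.
    by move: ra1; rewrite E subrr normr0 leNgt r0.
  by rewrite enorm_le ?enorm_ge0 // enorm_sqr amin.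
have [C C0 hC] := @enorm_lipschitz R n.
exists (m / (2 * C)); first by rewrite divr_gt0 // mulr_gt0.
move=> u ul.
have u0 : enorm (h a0 - u) < m / 2.
  apply: le_lt_trans (hC _) _; move: ul; rewrite -(ltr_pM2l C0).
  by rewrite (_ : C * (m / (2 * C)) = m / 2) //; field; rewrite gt_eqF.
have cdu : cont_on D (fun a => dotp (h a - u) (h a - u)).
  have c1 : cont_on D (fun a => h a - u) by apply: cont_onB => //; exact: cont_on_cst.
  by apply: cont_on_dotp => j; apply: cont_on_coord.
have Da0 : D a0 by rewrite /D /= subrr normr0 ltW.
have [a1 Da1 amin] := compact_min cD (ex_intro _ _ Da0) cdu.
have a1r : `|a0 - a1| < rho.
  rewrite ltNge; apply/negP => l; have /hm h1 : S a1 by [].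
  have h2 : enorm (h a1 - u) <= enorm (h a0 - u) by rewrite enorm_le ?enorm_ge0 // enorm_sqr amin.
  by have := enormBD (h a1) u (h a0); rewrite (enormB u); lra.
exists a1 => //; have [d1 i1] := dh _ Da1.
pose Jm : 'M[R]_n := \matrix_(i, j) 'd (fun x => h x 0 j) a1 (delta_mx 0 i).
have JE b j : 'd (fun x => h x 0 j) a1 b = (b *m Jm) 0 j.
  rewrite {1}(row_sum_delta b) linear_sum mxE; apply: eq_bigr => i _.
  by rewrite linearZ mxE.
have uJ : Jm \in unitmx.
  rewrite -row_free_unit -kermx_eq0; apply/eqP/row_matrixP => i; rewrite row0.
  apply: i1 => j; rewrite JE; have : (row i (kermx Jm) <= kermx Jm)%MS by exact: row_sub.
  by move=> /sub_kermxP ->; rewrite mxE.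
pose b := (h a1 - u) *m invmx Jm.
have db : mxdiff (fun x => h x - u) a1 by exact: mxdiffB d1 (mxdiff_cst _ _).
have [df dfE] := diff_dotp_coord b db db.
have dr : \row_j 'd (fun x => (h x - u) 0 j) a1 b = h a1 - u.
  apply/rowP => j; rewrite mxE (_ : (fun _ => _) = fun x => h x 0 j - u 0 j); last first.
    by apply/funext => x; rewrite !mxE.
  rewrite diff_sub; [|exact: d1|exact: differentiable_cst].
  by rewrite diff_const subr0 JE /b mulmxKV.
have i2 := is_derive_chart b df; rewrite dfE dr in i2.
have e0 : 0 < rho - `|a0 - a1| by rewrite subr_gt0.
have b1 : 0 < `|b| + 1 by rewrite ltr_wpDl.
have q0 : 0 < (rho - `|a0 - a1|) / (`|b| + 1) by rewrite divr_gt0.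
have h0 : dotp (h a1 - u) (h a1 - u) =
    dotp (h (a1 + (0 : R) *: b) - u) (h (a1 + (0 : R) *: b) - u) by rewrite scale0r addr0.
have hle (t : R) : `|t| < (rho - `|a0 - a1|) / (`|b| + 1) ->
    dotp (h a1 - u) (h a1 - u) <= dotp (h (a1 + t *: b) - u) (h (a1 + t *: b) - u).
  rewrite ltr_pdivlMr // => tl; apply: amin; rewrite /D /=.
  have : `|t *: b| <= `|t| * (`|b| + 1) by rewrite normrZ ler_wpM2l // lerDl.
  have := ler_normB (a0 - a1) (t *: b); rewrite opprD addrA; lra.
have := touching_derive q0 (ic (dotp (h a1 - u) (h a1 - u))) i2 h0 hle.
have := dotp_ge0 (h a1 - u) => g0 E.
have /eqP : dotp (h a1 - u) (h a1 - u) = 0 by lra.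
by rewrite dotp_eq0 subr_eq0 => /eqP.
Qed.

End LocalOnto.

Section Flat.
Context {R : realType} {V : normedModType R}.
Variables (a b : V).

(** Stationary in one direction. This passes through sums, products and quadratic maps, so a
    stationary w makes w + B(w, w) stationary. *)
Definition flat (f : V -> R) := differentiable f a /\ 'd f a b = 0.

Lemma flatM f g : flat f -> flat g -> flat (fun x => f x * g x).
Proof.
move=> [df f0] [dg g0]; split; first exact: differentiableM.
by rewrite diff_mul // f0 g0 !mulr0 addr0.
Qed.

Lemma flatD f g : flat f -> flat g -> flat (fun x => f x + g x).
Proof.
move=> [df f0] [dg g0]; split; first exact: differentiableD.
by rewrite diff_add // f0 g0 addr0.
Qed.

Lemma flat_cst (c : R) : flat (fun=> c).
Proof. by split; [exact: differentiable_cst|rewrite diff_const]. Qed.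

Lemma flat_sum (I : Type) (r : seq I) (f : I -> V -> R) :
  (forall i, flat (f i)) -> flat (fun x => \sum_(i <- r) f i x).
Proof.
move=> hf; split; first by apply: differentiable_bigsum => i _; have [] := hf i.
rewrite diff_bigsum; last by move=> i; have [] := hf i.
by rewrite big1 // => i _; have [] := hf i.
Qed.

Lemma flat_ext f g : (forall x, f x = g x) -> flat f -> flat g.
Proof. by move=> /funext ->. Qed.

Lemma flat_mulmx {m p} (f : V -> 'rV[R]_m) (D : 'M[R]_(m, p)) :
  (forall j, flat (fun x => f x 0 j)) -> forall j, flat (fun x => (f x *m D) 0 j).
Proof.
move=> hf j; apply: (@flat_ext (fun x => \sum_k f x 0 k * D k j)); first by move=> x; rewrite mxE.
by apply: flat_sum => k; apply: flatM => //; exact: flat_cst.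
Qed.

Lemma flat_bil {d} (B : 'rV[R]_d -> 'rV[R]_d -> 'rV[R]_d) (f : V -> 'rV[R]_d) : bilin B ->
  (forall j, flat (fun x => f x 0 j)) -> forall j, flat (fun x => (B (f x) (f x)) 0 j).
Proof.
move=> hB hf j; have [D DE] := bil_mx hB.
apply: (@flat_ext (fun x => \sum_k f x 0 k * (f x *m D k) 0 j)).
  by move=> x; rewrite DE summxE; apply: eq_bigr => k _; rewrite [RHS]mxE.
by apply: flat_sum => k; apply: flatM => //; exact: flat_mulmx.
Qed.

End Flat.

Section Slice.
Context {R : realType} {n d : nat}.
Variable M : set 'rV[R]_d.
Hypotheses (cM : compact M) (hC : charted (n := n) M) (nM : connected M).
Hypothesis n1 : (1 < n)%N.
Hypothesis ball3 : forall x, M x -> dotp x x <= 3^-1.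
Hypothesis nsphere : ~ homeomorphic M (sphere R n).
Local Notation norm2 := (norm2 (n := n) M).
Local Notation Pi := (Pi (n := n) M).

Lemma pt_dist2 x (B : 'rV[R]_d -> 'rV[R]_d -> 'rV[R]_d) w : M x -> (forall u v, B u v *m Pi x = 0) ->
  w *m Pi x = w -> dotp (B w w) (B w w) = dotp w w ^+ 2 ->
  1 - dist2 (pt x B w) x = (1 + dotp w w)^-1 /\
  (pt x B w - x) *m Pi x = (1 + dotp w w)^-1 *: w.
Proof.
move=> Mx Bn wP BB; have oP := Pi_oproj hC Mx.
have wB : dotp w (B w w) = 0 by rewrite -wP (oproj_dotp _ _ oP) Bn dotp0r.
have w0 : 0 < 1 + dotp w w by rewrite ltr_pwDl // dotp_ge0.
rewrite /dist2 /pt [x + _]addrC addrK -scalemxAl mulmxDl wP Bn addr0; split=> //.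
rewrite dotpZl dotpZr !(dotpDl, dotpDr) wB (dotpC _ w) wB BB.
by move: (dotp w w) w0 => s s0; field; rewrite gt_eqF.
Qed.

(** The tangent parameters reached by the slice form a set H that contains 0, is closed by
    continuity because [pt] always has squared distance below 1 from x, and is open by
    [local_onto]. *)
Lemma slice_all x : M x -> exists B, [/\ bilin B, forall u v, B u v *m Pi x = 0,
  forall w, w *m Pi x = w -> dotp (B w w) (B w w) = dotp w w ^+ 2 /\ Om M x (pt x B w) &
  forall y, Om M x y -> exists2 w, w *m Pi x = w & y = pt x B w].
Proof.
have sc1 (A N T r z : R) : T <= z -> z < r - A -> N <= A + T -> N < r by move=> ? ? ?; lra.
have sc2 (k q : R) : 0 <= q -> k = - (2 * (k * q)) -> k = 0.
  move=> q0 kE; have /eqP : k * (1 + 2 * q) = 0 by lra.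
  by rewrite mulf_eq0 => /orP[/eqP//|/eqP]; lra.
move=> Mx; have [B [hB Bn hy]] := slice_param cM hC nM n1 ball3 nsphere Mx.
exists B; split=> //; last first.
  by move=> y /hy[w1 _ yE _]; exists ((1 - dist2 y x)^-1 *: ((y - x) *m Pi x)).
have [W0 [U0 [phi0 [g0 [J0' [[C0 _] Wx U0x f0x PE]]]]]] := chart_at hC Mx.
have oP := Pi_oproj hC Mx.
have fJ0 : row_free (J0' (g0 x)) by have [_ _ _ _ DJ] := C0; have [] := DJ _ U0x.
set J0 := J0' (g0 x) in PE fJ0.
pose Q : 'M[R]_(d, n) := J0^T *m ((\det (J0 *m J0^T))^-1 *: \adj (J0 *m J0^T)).
have QE (z : 'rV[R]_d) : z *m Pi x = z *m Q *m J0 by rewrite PE /proj mulmxA.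
have JP (c : 'rV[R]_n) : c *m J0 *m Pi x = c *m J0 by rewrite PE; exact: proj_id.
pose hh y : 'rV[R]_n := (1 - dist2 y x)^-1 *: ((y - x) *m Q).
have hhE y : hh y *m J0 = (1 - dist2 y x)^-1 *: ((y - x) *m Pi x).
  by rewrite /hh -scalemxAl -QE.
pose H := [set c : 'rV[R]_n | exists2 y, Om M x y & hh y = c].
have HE c : H c -> dotp (B (c *m J0) (c *m J0)) (B (c *m J0) (c *m J0)) = dotp (c *m J0) (c *m J0) ^+ 2
    /\ Om M x (pt x B (c *m J0)).
  by move=> [y Oy <-]; have [_ _ yE BE] := hy y Oy; rewrite hhE -yE.
have cJ : cont_on setT (fun c : 'rV[R]_n => c *m J0).
  by apply: cont_on_mulmx; exact: cont_on_id.
have cBJ : cont_on setT (fun c : 'rV[R]_n => B (c *m J0) (c *m J0)) by exact: cont_on_bil.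
have cN : cont_on setT (fun c : 'rV[R]_n => dotp (c *m J0) (c *m J0)).
  by apply: cont_on_dotp => j; exact: cont_on_coord.
have cBB : cont_on setT (fun c : 'rV[R]_n => dotp (B (c *m J0) (c *m J0)) (B (c *m J0) (c *m J0))).
  by apply: cont_on_dotp => j; exact: cont_on_coord.
have cF : cont_on setT (fun c : 'rV[R]_n => pt x B (c *m J0)).
  apply: cont_onD; first exact: cont_on_cst.
  apply: cont_onZ; last exact: cont_onD.
  apply: cont_onV; first by move=> c _; rewrite gt_eqF // ltr_pwDl // dotp_ge0.
  by apply: cont_onD => //; exact: cont_on_cst.
have Hcl c : (forall e : R, 0 < e -> exists2 c', H c' & `|c - c'| < e) -> H c.
  move=> near; set w := c *m J0.
  have BB : dotp (B w w) (B w w) = dotp w w ^+ 2.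
    apply: contrapT => /eqP; rewrite -subr_eq0 -normr_gt0 => N0.
    have cG : cont_on setT (fun c : 'rV[R]_n => dotp (B (c *m J0) (c *m J0)) (B (c *m J0) (c *m J0))
        - dotp (c *m J0) (c *m J0) * dotp (c *m J0) (c *m J0)).
      by apply: cont_onB => //; apply: cont_onM.
    have [r r0 hr] := cG c I _ N0; have [c' Hc' cc'] := near r r0.
    have := hr c' I cc'; have [-> _] := HE _ Hc'.
    by rewrite -!expr2 subrr subr0 ltxx.
  have My : M (pt x B w).
    have /closedP : closed M by exact: compact_isclosed.
    apply=> e e0; have [r r0 hr] := cF c I e e0; have [c' /HE[_ /Om_sub[M' _]] cc'] := near r r0.
    by exists (pt x B (c' *m J0)) => //; exact: hr.
  have [dE tE] := pt_dist2 Mx Bn (JP c) BB.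
  have w0 : 0 < (1 + dotp w w)^-1 by rewrite invr_gt0 ltr_pwDl // dotp_ge0.
  have y1 : dist2 (pt x B w) x < 1 by rewrite -subr_gt0 dE.
  exists (pt x B w).
    apply: (Om_closed hC Mx) => // e e0.
    have [r r0 hr] := cF c I e e0; have [c' /HE[_ O'] cc'] := near r r0.
    by exists (pt x B (c' *m J0)) => //; exact: hr.
  apply: (row_free_inj fJ0); rewrite hhE tE dE invrK scalerA mulfV ?scale1r //.
  by rewrite gt_eqF // ltr_pwDl // dotp_ge0.
have Hop c : H c -> exists2 e : R, 0 < e & forall c', `|c - c'| < e -> H c'.
  move=> [y0 Oy0 yc]; have [My0 _] := Om_sub Oy0.
  have [W [U [phi [g [J [[C _] Wy Uy fy _]]]]]] := chart_at hC My0.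
  have [e e0 he] := Om_open hC Mx Oy0.
  have [rho rho0 [hr _]] := chart_ball C My0 Wy e0.
  have [_ _ hU _ DJ] := C.
  have OU a : `|g y0 - a| < rho -> U a /\ Om M x (phi a).
    by move=> /hr[Ua l]; split=> //; apply: he => //; have [] := hU _ Ua.
  have r20 : 0 < rho / 2 by rewrite divr_gt0.
  have r2 : rho / 2 < rho by rewrite ltr_pdivrMr // ltr_pMr // ltr1n.
  pose h a := hh (phi a).
  have kd a : U a -> Om M x (phi a) -> differentiable (fun a => 1 - sqdist phi x a) a.
    by move=> Ua Oa; apply: differentiableB; [exact: differentiable_cst|have [] := sqdist_diff C x 0 Ua].
  have hd a : U a -> Om M x (phi a) -> mxdiff h a.
    move=> Ua Oa; apply: mxdiffZ.
      apply: differentiableV; first exact: kd.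
      by have [_ l] := Om_sub Oa; rewrite gt_eqF // subr_gt0.
    by apply: mxdiffM; [have [] := phiB_diff C x 0 Ua|exact: mxdiff_cst].
  have hE a : Om M x (phi a) -> phi a = pt x B (h a *m J0) /\
      (1 + dotp (h a *m J0) (h a *m J0))^-1 = 1 - dist2 (phi a) x.
    by move=> Oa; have [_ wi yE _] := hy _ Oa; rewrite /h hhE.
  have [|a ar ha|q q0 hq] := @local_onto R n h (g y0) (rho / 2) r20.
  - move=> a ar; have ar' := le_lt_trans ar r2; have [Ua Oa] := OU _ ar'.
    split; first exact: hd.
    (* If w is stationary along b, differentiating phi - x = (1 - s^2) (w + B(w, w)) gives b J = k
       (w + B(w, w)), where k = -2 <phi - x, b J> is the derivative of 1 - s^2. As phi - x is a
       positive multiple of w + B(w, w), this forces k = 0 and b = 0. *)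
    move=> b b0; have [_ _ fJ _] := DJ _ Ua; have [_ dE _ _] := DJ _ Ua.
    pose w a := h a *m J0.
    have fw j : flat a b (fun x => w x 0 j).
      by apply: flat_mulmx => k; split; [exact: hd|exact: b0].
    have fG j : flat a b (fun x => (w x + B (w x) (w x)) 0 j).
      apply: (@flat_ext _ _ _ _ (fun x => w x 0 j + B (w x) (w x) 0 j)).
        by move=> y; rewrite [RHS]mxE.
      by apply: flatD => //; exact: flat_bil.
    have [dS dSE] := sqdist_diff C x b Ua.
    set k := 'd (fun a => 1 - sqdist phi x a) a b.
    have kE : k = - (2 * dotp (phi a - x) (b *m J a)).
      by rewrite /k diff_sub ?diff_const ?sub0r ?dSE //; exact: differentiable_cst.
    have [p0 pE] := phiB_diff C x b Ua.
    have m0 : 0 < rho - `|g y0 - a| by rewrite subr_gt0.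
    have b1 : 0 < `|b| + 1 by rewrite ltr_wpDl.
    have stay (t : R) : `|t| < (rho - `|g y0 - a|) / (`|b| + 1) -> Om M x (phi (a + t *: b)).
      rewrite ltr_pdivlMr // => tl; have [|//] := OU (a + t *: b).
      have tb : `|t *: b| <= `|t| * (`|b| + 1) by rewrite normrZ ler_wpM2l // lerDl.
      by have := ler_normB (g y0 - a) (t *: b); rewrite opprD addrA; exact: sc1 tb tl.
    have bJ : b *m J a = k *: (w a + B (w a) (w a)).
      rewrite -pE; apply/rowP => j; rewrite mxE [RHS]mxE.
      have key a' : Om M x (phi a') ->
          (phi a' - x) 0 j = (1 - sqdist phi x a') * (w a' + B (w a') (w a')) 0 j.
        move=> O'; have [yE wi] := hE _ O'.
        by rewrite {1}yE /pt [x + _]addrC addrK wi [LHS]mxE.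
      have [fd f0] := fG j.
      have i1 := is_derive_chart b (p0 0 j).
      have i2 := is_derive_chart b (differentiableM (kd _ Ua Oa) fd).
      rewrite (diff_mul _ (kd _ Ua Oa) fd) f0 mulr0 add0r -/k in i2.
      rewrite (touching_derive (e := (rho - `|g y0 - a|) / (`|b| + 1)) _ i1 i2) ?divr_gt0 //.
      + exact: mulrC.
      + by rewrite scale0r addr0; exact: key.
      move=> t /stay Ot; rewrite le_eqVlt; apply/orP; left; apply/eqP; exact: key.
    have [yE wi] := hE _ Oa; have [_ l1] := Om_sub Oa.
    have s0 : 0 < 1 - dist2 (phi a) x by rewrite subr_gt0.
    have zE : phi a - x = (1 - dist2 (phi a) x) *: (w a + B (w a) (w a)).
      by rewrite {1}yE /pt [x + _]addrC addrK wi.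
    have k0 : k = 0.
      have := kE; rewrite bJ dotpZr.
      have := dist2_ge0 (phi a) x; rewrite /dist2 {2}zE dotpZr.
      rewrite -/(dist2 (phi a) x); move: (dotp _ _) (dist2 _ _) s0 => q s s0 h1 h2.
      have q0 : 0 <= q by rewrite -(pmulr_rge0 _ s0).
      exact: sc2 q0 h2.
    by apply: (row_free_inj fJ); rewrite bJ k0 scale0r mul0mx.
  - have [Ua Oa] := OU _ (le_lt_trans ar r2).
    have [|Uy0 O0] := OU (g y0); first by rewrite subrr normr0.
    have [_ _ ga] := hU _ Ua; have [_ _ g00] := hU _ Uy0.
    by rewrite -ga -g00 (hE _ Oa).1 (hE _ O0).1 ha.
  exists q => // c'; rewrite -yc -{1}fy => /hq[a ar <-].
  by exists (phi a) => //; have [] := OU a (lt_trans ar r2).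
have H0 : H 0.
  exists x; first exact: Om_p.
  by rewrite /hh subrr mul0mx scaler0.
have HT c : H c.
  pose K := [set (0 : 'rV[R]_n) + t *: (c - 0) | t in `[0 : R, 1]].
  have nK : connected K := @connected_segment _ _ 0 c.
  have K0 : K 0 by exists 0; rewrite ?scale0r ?addr0 //= in_itv /= lexx ler01.
  have Kc : K c by exists 1; rewrite ?scale1r ?subr0 ?add0r //= in_itv /= lexx ler01.
  apply: (connected_all nK _ _ _ Kc); first by exists 0.
    by move=> z _ /Hop[e e0 he]; exists e => // y _ /he.
  move=> z _ nz; apply: contrapT => h; apply: nz; apply: Hcl => e e0.
  by apply: contrapT => h'; apply: h; exists e => // y _ zy Hy; apply: h'; exists y.
by move=> w wP; have := HE _ (HT (w *m Q)); rewrite -QE wP.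
Qed.

End Slice.

Section Full.
Context {R : realType} {n d : nat}.
Variable M : set 'rV[R]_d.
Hypotheses (cM : compact M) (hC : charted (n := n) M) (nM : connected M).
Hypothesis n1 : (1 < n)%N.
Hypothesis ball3 : forall x, M x -> dotp x x <= 3^-1.
Hypothesis nsphere : ~ homeomorphic M (sphere R n).
Local Notation Pi := (Pi (n := n) M).

Definition slice_form x B := [/\ bilin B, forall u v, B u v *m Pi x = 0,
  forall w, w *m Pi x = w -> dotp (B w w) (B w w) = dotp w w ^+ 2 /\ Om M x (pt x B w) &
  forall y, Om M x y -> exists2 w, w *m Pi x = w & y = pt x B w].

Lemma slice_form_ex x : M x -> exists B, slice_form x B.
Proof. by move=> Mx; exact: (slice_all cM hC nM n1 ball3 nsphere Mx). Qed.

Lemma tan_normal x B u v w : M x -> slice_form x B -> w *m Pi x = w -> dotp w (B u v) = 0.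
Proof.
move=> Mx [_ Bn _ _] wP; by rewrite -wP (oproj_dotp _ _ (Pi_oproj hC Mx)) Bn dotp0r.
Qed.

Lemma cont_pt {V : normedModType R} (A : set V) x B (f : V -> 'rV[R]_d) : bilin B ->
  cont_on A f -> cont_on A (fun z => pt x B (f z)).
Proof.
move=> hB cf; apply: cont_onD; first exact: cont_on_cst.
apply: cont_onZ; last by apply: cont_onD => //; exact: cont_on_bil.
apply: cont_onV; first by move=> z _; rewrite gt_eqF // ltr_pwDl // dotp_ge0.
apply: cont_onD; first exact: cont_on_cst.
by apply: cont_on_dotp => j; exact: cont_on_coord.
Qed.

(** In the bounded coordinate v = w / sqrt (1 + |w|^2) the parametrization becomes x + sqrt (1 -
    |v|^2) v + B(v, v), continuous up to |v| = 1. So limits of slice points have this form, and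
    squared distance 1 selects |v| = 1. *)
Lemma contact_form x B q : M x -> slice_form x B -> contact M x q ->
  exists u, [/\ u *m Pi x = u, dotp u u = 1 & q = x + B u u].
Proof.
move=> Mx F [Mq qx near]; have [hB Bn BB param] := F; have oP := Pi_oproj hC Mx.
pose K : set 'rV[R]_d := [set v | `|0 - v| <= 1 /\ dotp v v <= 1].
have cK : compact K.
  pose K0 : set 'rV[R]_d := [set v | `|0 - v| <= 1].
  have cK0 : compact K0 by exact: closed_ball_compact.
  apply: (compact_sub cK0); last by move=> v [].
  apply: closed_le; first exact: compact_isclosed.
  by apply: cont_on_dotp => j; apply: cont_on_coord; exact: cont_on_id.
pose G v := x + (Num.sqrt (1 - dotp (v *m Pi x) (v *m Pi x)) *: (v *m Pi x) + B (v *m Pi x) (v *m Pi x)).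
have cP : cont_on K (fun v : 'rV[R]_d => v *m Pi x).
  by apply: cont_on_mulmx; exact: cont_on_id.
have cG : cont_on K G.
  apply: cont_onD; first exact: cont_on_cst.
  apply: cont_onD; last exact: cont_on_bil.
  apply: cont_onZ => //.
  apply: (@cont_on_comp _ _ _ _ K setT (fun v => 1 - dotp (v *m Pi x) (v *m Pi x)) Num.sqrt) => //.
    apply: cont_onB; first exact: cont_on_cst.
    by apply: cont_on_dotp => j; exact: cont_on_coord.
  by apply: continuous_cont_on; exact: sqrt_continuous.
have /closedP : closed (G @` K) by apply: compact_isclosed; exact: compact_image.
move=> /(_ q) []; last first.
  move=> v [_ v1] qE; exists (v *m Pi x); set u := v *m Pi x in qE *.
  have uP : u *m Pi x = u by rewrite /u -mulmxA oP.2.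
  have u1 : dotp u u <= 1.
    by apply: le_trans v1; rewrite (pythagoras v oP) lerDl dotp_ge0.
  have [B4 _] := BB _ uP.
  have : dist2 q x = dotp u u.
    rewrite /dist2 -qE /G -/u [x + _]addrC addrK !(dotpDl, dotpDr) !(dotpZl, dotpZr).
    rewrite (dotpC (B u u)) !(tan_normal _ _ Mx F uP) B4 !mulr0 addr0 add0r mulrA -expr2.
    by rewrite sqr_sqrtr ?subr_ge0 //; ring.
  rewrite qx => u1'; split=> //; rewrite -qE /G -/u -u1' subrr sqrtr0 scale0r add0r //.
move=> e e0; have [z Oz qz] := near e e0; exists z => //.
have [w wP ->] := param _ Oz.
have w0 : 0 < 1 + dotp w w by rewrite ltr_pwDl // dotp_ge0.
pose c := Num.sqrt (1 + dotp w w); have c0 : 0 < c by rewrite sqrtr_gt0.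
have cc : c ^+ 2 = 1 + dotp w w by rewrite sqr_sqrtr // ltW.
have vv : dotp (c^-1 *: w) (c^-1 *: w) = dotp w w / (1 + dotp w w).
  by rewrite dotpZl dotpZr -cc; field; rewrite gt_eqF.
have v1 : dotp (c^-1 *: w) (c^-1 *: w) <= 1 by rewrite vv ler_pdivrMr // mul1r lerDr.
exists (c^-1 *: w).
  split=> //; rewrite sub0r normrN; apply: le_trans (le_norm_enorm _) _.
  by rewrite enorm_le // expr1n.
rewrite /G -scalemxAl wP vv (bilZl hB) (bilZr hB) !scalerA.
have -> : 1 - dotp w w / (1 + dotp w w) = (c^-1) ^+ 2.
  by rewrite exprVn cc; field; rewrite gt_eqF.
rewrite sqrtr_sqr ger0_norm ?invr_ge0 ?ltW // -!expr2 -scalerDr exprVn cc.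
by [].
Qed.

(** t -> [pt x B (t *: u)] traces a round circle of diameter 1, on which x + B(u, u) is the point
    opposite to x. *)
Lemma antipode x B u : M x -> slice_form x B -> u *m Pi x = u -> dotp u u = 1 ->
  dist2 (x + B u u) x = 1 /\
  forall t : R, dist2 (pt x B (t *: u)) (x + B u u) = (1 + t ^+ 2)^-1.
Proof.
move=> Mx F uP u1; have [hB Bn BB param] := F; have [B4 _] := BB _ uP.
have uB := tan_normal u u Mx F uP.
split=> [|t]; first by rewrite /dist2 [x + _]addrC addrK B4 u1 expr1n.
have t0 : 0 < 1 + t ^+ 2 by rewrite ltr_pwDl // sqr_ge0.
have -> : dist2 (pt x B (t *: u)) (x + B u u) =
    dotp ((1 + t ^+ 2)^-1 *: (t *: u - B u u)) ((1 + t ^+ 2)^-1 *: (t *: u - B u u)).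
  rewrite /dist2; have -> // : pt x B (t *: u) - (x + B u u) = (1 + t ^+ 2)^-1 *: (t *: u - B u u).
  rewrite /pt dotpZl dotpZr u1 mulr1 -expr2 (bilZl hB) (bilZr hB).
  by apply/rowP => j; rewrite !mxE; field; rewrite gt_eqF.
rewrite dotpZl dotpZr !(dotpBl, dotpBr) !(dotpZl, dotpZr) u1 uB (dotpC _ u) uB B4 u1.
by field; rewrite gt_eqF.
Qed.

(** The points t > 0 of the circle through x and q have squared distance below 1 from q and tend to
    q, so they lie in the slice of q; t -> 0 puts x in its closure. *)
Lemma contact_sym x q : M x -> contact M x q -> contact M q x.
Proof.
move=> Mx ct; have [B F] := slice_form_ex Mx.
have [u [uP u1 qE]] := contact_form Mx F ct.
have [Mq qx _] := ct; have [hB Bn BB param] := F.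
have [_ hd] := antipode Mx F uP u1; rewrite -qE in hd.
pose f (t : R) := pt x B (t *: u).
have cf : cont_on setT f.
  by apply: cont_pt => //; apply: cont_onZ; [exact: cont_on_id|exact: cont_on_cst].
have Mf t : M (f t).
  by have [|_ /Om_sub[]] := BB (t *: u) => //; rewrite -scalemxAl uP.
have fO t : 0 < t -> Om M q (f t).
  move=> t0; have [e e0 he] := Om_open hC Mq (Om_p Mq).
  pose T := t + e^-1; have T0 : 0 < T by rewrite addr_gt0 ?invr_gt0.
  have OT : Om M q (f T).
    apply: he => //; rewrite distrC; apply: le_lt_trans (le_norm_enorm _) _.
    rewrite enorm_lt ?(ltW e0) // -/(dist2 (f T) q) hd invf_plt ?posrE ?exprn_gt0 //; last first.
      by rewrite ltr_pwDl // sqr_ge0.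
    rewrite -exprVn; apply: (le_lt_trans (y := T ^+ 2)); last by rewrite ltrDr.
    by rewrite ler_sqr ?nnegrE ?invr_ge0 ?(ltW e0) ?(ltW T0) // lerDr ltW.
  apply: (Om_linked Mq OT); apply: (linked_segment (f := f) (A := setT)) => // s /andP[s0 s1].
  split=> //; split=> //; rewrite hd invf_lt1 ?ltrDl ?exprn_gt0 //.
    have := mulr_ge0 s0 (ltW t0); have h : 0 <= (1 - s) * T by rewrite mulr_ge0 ?subr_ge0 ?(ltW T0).
    have : 0 < t * 1 by rewrite mulr1.
    rewrite /T in h *; have : 0 <= e^-1 by rewrite invr_ge0 ltW.
    move: (e^-1) h => i h i0 h1 h2; have h3 : 0 <= (1 - s) * i by rewrite mulr_ge0 ?subr_ge0.
    by rewrite (_ : t + i + _ = t + (1 - s) * i); [lra|rewrite /GRing.scale /=; ring].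
  by rewrite ltr_pwDl // sqr_ge0.
split=> //; first by rewrite dist2C.
move=> e e0; have [r r0 hr] := cf 0 I e e0; exists (f (r / 2)).
  by apply: fO; rewrite divr_gt0.
have <- : f 0 = x by rewrite /f /pt scale0r (bil0l hB) addr0 scaler0 addr0.
by apply: hr => //; rewrite sub0r normrN gtr0_norm ?divr_gt0 // ltr_pdivrMr // ltr_pMr // ltr1n.
Qed.

Lemma pt_dist_antipode q B u w : M q -> slice_form q B -> u *m Pi q = u -> dotp u u = 1 ->
  w *m Pi q = w ->
  dist2 (pt q B w) (q + B u u) = 1 - (2 * dotp (B w w) (B u u) - dotp w w) / (1 + dotp w w).
Proof.
move=> Mq F uP u1 wP; have [hB Bn BB param] := F; have [B4 _] := BB _ uP; have [W4 _] := BB _ wP.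
have w0 : 0 < 1 + dotp w w by rewrite ltr_pwDl // dotp_ge0.
have -> : dist2 (pt q B w) (q + B u u) = dotp ((1 + dotp w w)^-1 *: (w + B w w) - B u u)
     ((1 + dotp w w)^-1 *: (w + B w w) - B u u).
  rewrite /dist2; have -> // : pt q B w - (q + B u u) = (1 + dotp w w)^-1 *: (w + B w w) - B u u.
  by rewrite /pt opprD addrACA subrr add0r.
rewrite !(dotpBl, dotpBr) !(dotpZl, dotpZr) !(dotpDl, dotpDr) (dotpC (B w w) w) (dotpC (B u u) w).
rewrite (dotpC (B u u) (B w w)) !(tan_normal _ _ Mq F wP) W4 B4 u1.
by move: (dotp w w) w0 => s s0; field; rewrite gt_eqF.
Qed.

(** Second order condition at q, a local maximum of the distance to x by [contact_max]: up to a
    positive factor, the quadratic form is 1 - [dist2] in [pt_dist_antipode]. *)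
Lemma contact_psd x q B u v : M x -> contact M x q -> slice_form q B -> u *m Pi q = u -> dotp u u = 1 ->
  x = q + B u u -> v *m Pi q = v -> 0 <= 2 * dotp (B v v) (B u u) - dotp v v.
Proof.
move=> Mx ct F uP u1 xE vP; have [Mq _ _] := ct; have [hB Bn BB param] := F.
have [e e0 he] := contact_max cM hC nM n1 ball3 nsphere Mx ct.
pose f (t : R) := pt q B (t *: v).
have cf : cont_on setT f.
  by apply: cont_pt => //; apply: cont_onZ; [exact: cont_on_id|exact: cont_on_cst].
have tP (t : R) : t *: v *m Pi q = t *: v by rewrite -scalemxAl vP.
have Mf t : M (f t) by have [|_ /Om_sub[]] := BB (t *: v).
have f0 : f 0 = q by rewrite /f /pt scale0r (bil0l hB) addr0 scaler0 addr0.
have [r r0 hr] := cf 0 I e e0.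
have r20 : 0 < r / 2 by rewrite divr_gt0.
have /he : M (f (r / 2)) by [].
rewrite -f0 => h; have {h} : dist2 (f (r / 2)) x <= 1.
  by apply: h; apply: hr => //; rewrite sub0r normrN gtr0_norm // ltr_pdivrMr // ltr_pMr // ltr1n.
rewrite {1}xE /f (pt_dist_antipode Mq F uP u1 (tP _)).
have w0 : 0 < 1 + dotp ((r / 2) *: v) ((r / 2) *: v) by rewrite ltr_pwDl // dotp_ge0.
rewrite gerBl pmulr_lge0 ?invr_gt0 // (bilZl hB) (bilZr hB) !(dotpZl, dotpZr).
rewrite (_ : _ - _ = (r / 2) ^+ 2 * (2 * dotp (B v v) (B u u) - dotp v v)); last by ring.
by rewrite pmulr_rge0 // exprn_gt0.
Qed.

Definition clOm x q := M q /\ forall e : R, 0 < e -> exists2 z, Om M x z & `|q - z| < e.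

(** Along v + t u the form of [contact_psd] gains t^2, so for t > 0 the corresponding points are at
    distance less than 1 from x, and they tend to x as t grows. They lie in the slice of x, and t ->
    0 reaches [pt q B v]. *)
Lemma contact_slice x q v B : M x -> contact M x q -> slice_form q B -> v *m Pi q = v -> clOm x (pt q B v).
Proof.
have sc (e t T a1 a2 b1 b2 : R) : 0 < e * (t + 1) * T -> 0 <= (b1 + a1) * T -> 0 <= b2 * (T - 1) ->
    - a2 <= b2 -> 0 < (e * (t + 1) + (b1 + b2)) * T + a1 * T + a2 by move=> *; lra.
move=> Mx ct F vP; have [Mq qx _] := ct; have [hB Bn BB param] := F.
have [u0 [u0P u01 x0E]] := contact_form Mq F (contact_sym Mx ct).
(* Replacing u by -u keeps B(u, u) and makes the term linear in t nonnegative. *)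
have [u [uP u1 xE be0]] : exists u, [/\ u *m Pi q = u, dotp u u = 1, x = q + B u u &
    0 <= 2 * dotp (B v u) (B u u) - dotp v u].
  have [h|h] := lerP 0 (2 * dotp (B v u0) (B u0 u0) - dotp v u0); first by exists u0.
  exists (- u0); split.
  - by rewrite mulNmx u0P.
  - by rewrite dotpNl dotpNr opprK.
  - by rewrite (bilNl hB) (bilNr hB) opprK.
  - by rewrite (bilNl hB) !(bilNr hB) opprK dotpNl dotpNr; move: h; lra.
pose D w := 2 * dotp (B w w) (B u u) - dotp w w.
have D0 w : w *m Pi q = w -> 0 <= D w by exact: contact_psd ct F uP u1 xE.
pose W (t : R) := v + t *: u.
have WP t : W t *m Pi q = W t by rewrite /W mulmxDl -scalemxAl vP uP.
have B4 : dotp (B u u) (B u u) = 1 by have [-> _] := BB _ uP; rewrite u1 expr1n.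
have WW t : dotp (W t) (W t) = dotp v v + 2 * t * dotp v u + t ^+ 2.
  by rewrite /W !(dotpDl, dotpDr) !(dotpZl, dotpZr) u1 (dotpC u v); ring.
have DW t : D (W t) = D v + 2 * t * (2 * dotp (B v u) (B u u) - dotp v u) + t ^+ 2.
  rewrite /D WW /W (bilDl hB) !(bilDr hB) !(bilZl hB) !(bilZr hB) !(dotpDl, dotpDr) !(dotpZl, dotpZr).
  by rewrite (bilC hB u v) B4; ring.
pose f (t : R) := pt q B (W t).
have cf : cont_on setT f.
  apply: cont_pt => //; apply: cont_onD; first exact: cont_on_cst.
  by apply: cont_onZ; [exact: cont_on_id|exact: cont_on_cst].
have Mf t : M (f t) by have [|_ /Om_sub[]] := BB (W t).
have Wpos t : 0 < 1 + dotp (W t) (W t) by rewrite ltr_pwDl // dotp_ge0.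
have hd t : dist2 (f t) x = 1 - D (W t) / (1 + dotp (W t) (W t)).
  by rewrite {1}xE (pt_dist_antipode Mq F uP u1 (WP t)).
have f1 t : 0 < t -> dist2 (f t) x < 1.
  move=> t0; rewrite hd gtrBl divr_gt0 // DW.
  have := D0 _ vP; have := mulr_ge0 (ltW t0) be0; have := exprn_gt0 2 t0; lra.
have far (e t : R) : 0 < e -> 0 < t -> exists2 T, t <= T & dist2 (f T) x < e.
  move=> e0 t0; set b := 2 * dotp (B v u) (B u u) - dotp v u in DW.
  pose a1 := 2 * e * dotp v u - 2 * dotp v u + 2 * b.
  pose a2 := e * (1 + dotp v v) - 1 - dotp v v + D v.
  pose T := t + 1 + (`|a1| + `|a2|) / e.
  have q0 : 0 <= (`|a1| + `|a2|) / e by rewrite divr_ge0 ?addr_ge0 ?(ltW e0).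
  have Tt : t <= T by rewrite /T -addrA lerDl addr_ge0.
  have T1 : 1 <= T by rewrite /T -addrA addrCA lerDl addr_ge0 // ltW.
  exists T => //; rewrite hd; have h0 := Wpos T.
  rewrite -(ltr_pM2r h0) mulrBl divfK ?gt_eqF // mul1r WW DW -subr_gt0.
  rewrite (_ : _ - _ = e * T ^+ 2 + a1 * T + a2); last by rewrite /a1 /a2; ring.
  have eT : e * T = e * (t + 1) + (`|a1| + `|a2|) by rewrite /T; field; rewrite gt_eqF.
  have T0 : 0 <= T by exact: le_trans T1.
  rewrite expr2 mulrA eT; have n1' := ler_norm (- a1); have n2 := ler_norm (- a2); rewrite !normrN in n1' n2.
  have Tp : 0 < T := lt_le_trans ltr01 T1.
  have p1 : 0 < e * (t + 1) * T by rewrite mulr_gt0 // mulr_gt0 // addr_gt0.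
  have p2 : 0 <= (`|a1| + a1) * T by apply: mulr_ge0 => //; lra.
  have p3 : 0 <= `|a2| * (T - 1) by apply: mulr_ge0 => //; rewrite subr_ge0.
  exact: sc p1 p2 p3 n2.
have fO t : 0 < t -> Om M x (f t).
  move=> t0; have [e e0 he] := Om_open hC Mx (Om_p Mx).
  have [T tT TE] := far (e ^+ 2) t (exprn_gt0 2 e0) t0.
  have OT : Om M x (f T).
    apply: he => //; rewrite distrC; apply: le_lt_trans (le_norm_enorm _) _.
    by rewrite enorm_lt ?(ltW e0).
  apply: (Om_linked Mx OT); apply: (linked_segment (f := f) (A := setT)) => // s /andP[s0 s1].
  split=> //; split=> //; apply: f1.
  have h : 0 <= (1 - s) * (T - t) by rewrite mulr_ge0 ?subr_ge0.
  by rewrite (_ : T + _ = t + (1 - s) * (T - t)); [lra|rewrite /GRing.scale /=; ring].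
have f0 : f 0 = pt q B v by rewrite /f /W scale0r addr0.
split; first by rewrite -f0.
move=> e e0; have [r r0 hr] := cf 0 I e e0; exists (f (r / 2)).
  by apply: fO; rewrite divr_gt0.
rewrite -f0; apply: hr => //.
by rewrite sub0r normrN gtr0_norm ?divr_gt0 // ltr_pdivrMr // ltr_pMr // ltr1n.
Qed.

(** The closure of the slice is open: around a contact point z it contains the whole slice of z by
    [contact_slice]. *)
Lemma clOm_all x y : M x -> M y -> clOm x y.
Proof.
move=> Mx; suff : M `<=` clOm x by exact.
apply: connected_all => //.
- by exists x => //; split=> // e e0; exists x; [exact: Om_p|rewrite subrr normr0].
- move=> z Mz [_ near]; have [l|l] := ltP (dist2 z x) 1.
    have Oz : Om M x z by exact: (Om_closed hC Mx).
    have [e e0 he] := Om_open hC Mx Oz; exists e => // w Mw zw; split=> // r r0.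
    by exists w; [exact: he|rewrite subrr normr0].
  have ct : contact M x z.
    split=> //; apply/le_anti; rewrite l andbT leNgt; apply/negP => l'.
    have d0 : 0 < dist2 z x - 1 by rewrite subr_gt0.
    have [r r0 hr] := @cont_dist2p _ _ x setT z I _ d0.
    have [w Ow zw] := near r r0; have [_ w1] := Om_sub Ow.
    by have := hr w I zw; rewrite ltr_norml => /andP[_]; lra.
  have [e e0 he] := Om_open hC Mz (Om_p Mz); exists e => // w Mw /(he _ Mw) Ow.
  have [B F] := slice_form_ex Mz; have [_ _ _ param] := F.
  by have [v vP ->] := param _ Ow; exact: contact_slice ct F vP.
move=> z Mz nz; apply: contrapT => h; apply: nz; split=> // e e0.
have e20 : 0 < e / 2 by rewrite divr_gt0.
have [w [Mw near] zw] : exists2 w, clOm x w & `|z - w| < e / 2.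
  apply: contrapT => h'; apply: h; exists (e / 2) => // w _ zw cw; apply: h'; by exists w.
by have [v Ov wv] := near _ e20; exists v => //; have := ler_distD w z v; lra.
Qed.

Lemma contactE x y : M x -> M y -> Om M x y \/ contact M x y.
Proof.
move=> Mx My; have [_ near] := clOm_all Mx My.
have [l|l] := ltP (dist2 y x) 1; [left; exact: (Om_closed hC Mx)|right].
split=> //; apply/le_anti; rewrite l andbT leNgt; apply/negP => l'.
have d0 : 0 < dist2 y x - 1 by rewrite subr_gt0.
have [r r0 hr] := @cont_dist2p _ _ x setT y I _ d0.
have [w Ow zw] := near r r0; have [_ w1] := Om_sub Ow.
by have := hr w I zw; rewrite ltr_norml => /andP[_]; lra.
Qed.

Lemma antipode_in x B u : M x -> slice_form x B -> u *m Pi x = u -> dotp u u = 1 -> M (x + B u u).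
Proof.
move=> Mx F uP u1; have [hB Bn BB param] := F.
have /closedP : closed M by exact: compact_isclosed.
apply=> e e0; exists (pt x B (e^-1 *: u)).
  by have [|_ /Om_sub[]] := BB (e^-1 *: u) => //; rewrite -scalemxAl uP.
rewrite distrC; apply: le_lt_trans (le_norm_enorm _) _.
rewrite enorm_lt ?(ltW e0) //; have [_ hd] := antipode Mx F uP u1.
rewrite -/(dist2 _ (x + B u u)) hd invf_plt ?posrE ?exprn_gt0 //; last by rewrite ltr_pwDl // sqr_ge0.
by rewrite exprVn ltrDr.
Qed.

End Full.

(** * Triples of mutually distant points *)

Section Subspaces.
Context {R : realType} {d : nat}.

(** A matrix of maximal rank among those whose row space satisfies P: a missing vector could be
    added and would raise the rank. *)
Lemma subspace_mx (P : 'rV[R]_d -> Prop) : P 0 -> (forall (a : R) u v, P u -> P v -> P (a *: u + v)) ->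
  exists U : 'M[R]_d, forall v, (v <= U)%MS <-> P v.
Proof.
move=> P0 PL.
pose Q k := exists U : 'M[R]_d, \rank U = k /\ forall v : 'rV[R]_d, (v <= U)%MS -> P v.
have Q0 : exists k, `[< Q k >].
  exists 0%N; apply/asboolP; exists 0; split=> [|v]; first by rewrite mxrank0.
  by rewrite submx0 => /eqP ->.
have Qb k : `[< Q k >] -> (k <= d)%N by move=> /asboolP[U [<- _]]; exact: rank_leq_row.
have [k /asboolP[U [Uk UP]] kmax] := ex_maxnP Q0 Qb.
exists U => v; split; first exact: UP.
move=> Pv; apply: contrapT => /negP nv.
have : (\rank (U + v)%MS <= k)%N.
  apply: kmax; apply/asboolP; exists (U + v)%MS; split=> // w /sub_addsmxP[[a b] /= ->].
  rewrite addrC [b]mx11_scalar mul_scalar_mx; apply: PL => //; apply: UP; exact: submxMl.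
rewrite leqNgt -Uk => /negP; apply; rewrite ltn_neqAle mxrankS ?addsmxSl // andbT.
apply/negP => /eqP E; case/negP: nv; apply: submx_trans (addsmxSr U v) _.
by have := mxrank_leqif_sup (addsmxSl U v) => /leqifP; case: ifP => // _; rewrite E ltnn.
Qed.

Lemma dotp_mx (u v : 'rV[R]_d) : u *m v^T = (dotp u v)%:M.
Proof. by rewrite dotpE -mx11_scalar. Qed.

Lemma orthonormal_basis k (U : 'M[R]_d) : \rank U = k -> exists A : 'M[R]_(k, d),
  A *m A^T = 1%:M /\ forall v : 'rV[R]_d, (v <= U)%MS <-> exists c, v = c *m A.
Proof.
elim: k U => [|k IH] U Uk.
  exists 0; split=> [|v]; first by apply/matrixP => -[].
  move/eqP: Uk; rewrite mxrank_eq0 => /eqP ->; rewrite submx0; split=> [/eqP ->|[c ->]].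
    by exists 0; rewrite mulmx0.
  by rewrite mulmx0.
have U0 : U != 0 by rewrite -mxrank_eq0 Uk.
have [v v1 vU] : exists2 v : 'rV[R]_d, dotp v v = 1 & (v <= U)%MS.
  pose v0 := nz_row U; have v00 : v0 != 0 by rewrite nz_row_eq0.
  exists ((enorm v0)^-1 *: v0); last by apply: scalemx_sub; exact: nz_row_sub.
  by rewrite dotpZl dotpZr -enorm_sqr; field; rewrite enorm_eq0.
pose U' := (U :&: kermx v^T)%MS.
have r1 : \rank (U *m v^T) = 1%N.
  apply/eqP; rewrite eqn_leq rank_leq_col lt0n mxrank_eq0; apply/eqP => E.
  have [D vE] := submxP vU; have := dotp_mx v v.
  rewrite {1}vE -mulmxA E mulmx0 v1 => /matrixP/(_ 0 0); rewrite !mxE /= => /eqP.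
  by rewrite eq_sym oner_eq0.
have U'k : \rank U' = k.
  by have := mxrank_mul_ker U v^T; rewrite r1 Uk add1n => -[].
have [A' [AA HA]] := IH U' U'k.
have A'v : A' *m v^T = 0.
  apply/row_matrixP => i; rewrite row_mul row0.
  have /HA : exists c, row i A' = c *m A' by exists (delta_mx 0 i); rewrite rowE.
  by rewrite sub_capmx => /andP[_ /sub_kermxP].
have vA' : v *m A'^T = 0 by rewrite -[v]trmxK -trmx_mul A'v trmx0.
have E1 : col_mx v A' *m (col_mx v A')^T = 1%:M :> 'M[R]_(1 + k).
  by rewrite tr_col_mx mul_col_row AA A'v vA' dotp_mx v1 (scalar_mx_block 1 k).
exists (col_mx v A' : 'M[R]_(1 + k, d)); split=> [|w]; first exact: E1.
split=> [wU|[c ->]].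
  have /HA[c' cE] : (w - dotp w v *: v <= U')%MS.
    rewrite sub_capmx; apply/andP; split.
      by rewrite -scaleNr addmx_sub // scalemx_sub.
    apply/sub_kermxP; rewrite mulmxBl -scalemxAl !dotp_mx v1.
    by apply/matrixP => i j; rewrite !ord1 !mxE /= mulr1 subrr.
  exists (row_mx (dotp w v)%:M c' : 'rV[R]_(1 + k)).
  have E2 : w = row_mx (dotp w v)%:M c' *m col_mx v A' :> 'rV[R]_d.
    by rewrite mul_row_col -cE mul_scalar_mx addrC subrK.
  exact: E2.
have E3 (b : 'rV[R]_(1 + k)) : (b *m col_mx v A' <= U)%MS.
  rewrite -[b]hsubmxK mul_row_col addmx_sub //; first exact: submx_trans (submxMl _ _) vU.
  apply: submx_trans (capmxSl U (kermx v^T)) => //; apply/HA; by eexists.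
exact: E3.
Qed.

End Subspaces.

(** * Projective lines in M and the product of their directions *)

Section Shape.
Context {R : realType} {n d : nat}.
Local Notation vec := 'rV[R]_d.
Variables (M : set vec) (T : vec -> 'M[R]_d) (B : vec -> vec -> vec -> vec).
Hypothesis Bbil : forall x, M x -> bilin (B x).
Hypothesis Bn : forall x u v (w : vec), M x -> (w <= T x)%MS -> dotp w (B x u v) = 0.
Hypothesis B4 : forall x (w : vec), M x -> (w <= T x)%MS ->
  dotp (B x w w) (B x w w) = dotp w w ^+ 2 /\ M (pt x (B x) w).
Hypothesis Ba : forall x (u : vec), M x -> (u <= T x)%MS -> dotp u u = 1 -> M (x + B x u u).
Hypothesis Mpt : forall x y, M x -> M y -> (exists2 w : vec, (w <= T x)%MS & y = pt x (B x) w) \/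
  (exists u : vec, [/\ (u <= T x)%MS, dotp u u = 1 & y = x + B x u u]).
Hypothesis M3 : forall x, M x -> dotp x x = 3^-1.
Hypothesis third : forall x q, M x -> M q -> dist2 x q = 1 -> M (- x - q).
Hypothesis rankT : forall x, M x -> \rank (T x) = n.

Lemma TZ x (a : R) (u : vec) : (u <= T x)%MS -> (a *: u <= T x)%MS.
Proof. exact: scalemx_sub. Qed.

Lemma TD x (u v : vec) : (u <= T x)%MS -> (v <= T x)%MS -> ((u + v)%R <= T x)%MS.
Proof. exact: addmx_sub. Qed.

Lemma dist2E x y : M x -> M y -> dist2 x y = 2 / 3 - 2 * dotp x y.
Proof.
move=> /M3 x3 /M3 y3; by rewrite /dist2 !(dotpBl, dotpBr) x3 y3 (dotpC y x); field.
Qed.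

Lemma den_pos (w : vec) : 0 < 1 + dotp w w.
Proof. by rewrite ltr_pwDl // dotp_ge0. Qed.

(** Comparing |pt|^2 = |x|^2 at w and at -w separates the odd term from the even one. *)
Lemma dot_base x (w : vec) : M x -> (w <= T x)%MS -> dotp x w = 0 /\ dotp x (B x w w) = - dotp w w / 2.
Proof.
move=> Mx; have key (v : vec) : (v <= T x)%MS -> 2 * (dotp x v + dotp x (B x v v)) = - dotp v v.
  move=> Tv; have [v4 Mp] := B4 Mx Tv; have := M3 Mp; have x3 := M3 Mx.
  rewrite /pt !(dotpDl, dotpDr) !(dotpZl, dotpZr) !(dotpDl, dotpDr) (dotpC _ x) (dotpC (B x v v) v).
  rewrite (dotpC (B x v v) x) !(Bn _ _ Mx Tv) v4 x3.
  move: (dotp v v) (den_pos v) (dotp x v) (dotp x (B x v v)) => r r0 a b E.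
  have : (1 + r)^-1 * (2 * (a + b) + r) = 0.
    have {}E := congr1 (fun z => z - 3^-1) E; rewrite /= subrr in E.
    by rewrite -E; field; rewrite gt_eqF.
  by move=> /eqP; rewrite mulf_eq0 invr_eq0 (gt_eqF r0) /= => /eqP; lra.
move=> Tw; have k1 := key w Tw.
have Tw' : (- w <= T x)%MS by rewrite -scaleN1r TZ.
have := key _ Tw'; rewrite (bilNl (Bbil Mx)) (bilNr (Bbil Mx)) opprK dotpNr dotpNl dotpNr opprK.
by split; lra.
Qed.

Lemma dot_baseB x (u v : vec) : M x -> (u <= T x)%MS -> (v <= T x)%MS ->
  dotp x (B x u v) = - dotp u v / 2.
Proof.
move=> Mx Tu Tv; have [_ h1] := dot_base Mx Tu; have [_ h2] := dot_base Mx Tv.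
have [_] := dot_base Mx (TD Tu Tv).
rewrite (bilDl (Bbil Mx)) !(bilDr (Bbil Mx)) !(dotpDr, dotpDl) h1 h2 (bilC (Bbil Mx) v u) (dotpC v u); lra.
Qed.

Lemma dot_ge x y : M x -> M y -> - 6^-1 <= dotp x y.
Proof.
move=> Mx My; have x3 := M3 Mx; have [[w Tw ->]|[u [Tu u1 ->]]] := Mpt Mx My.
  have [w0 wB] := dot_base Mx Tw.
  rewrite /pt dotpDr dotpZr dotpDr w0 wB x3; have := den_pos w; have := dotp_ge0 w.
  move: (dotp w w) => r r0 r1.
  rewrite -subr_ge0 (_ : _ - _ = 2^-1 / (1 + r)); first by rewrite divr_ge0 // ltW.
  by field; rewrite gt_eqF.
have [_ uB] := dot_base Mx Tu; rewrite dotpDr uB x3 u1; lra.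
Qed.

Lemma dist2_1 x q : M x -> M q -> dotp x q = - 6^-1 -> dist2 x q = 1.
Proof. by move=> Mx Mq E; rewrite dist2E // E; field. Qed.

(* A geodesic circle through two points antipodal to x stays antipodal to x. *)
Lemma circle_flat x q (w : vec) : M x -> M q -> dotp x q = - 6^-1 -> (w <= T q)%MS ->
  dotp x w + dotp x (B q w w) = 0 -> dotp x w = 0 /\ dotp x (B q w w) = 0.
Proof.
move=> Mx Mq xq Tw ab.
have h (t : R) : 0 <= t * dotp x w + t ^+ 2 * dotp x (B q w w).
  have [_ Mp] := B4 Mq (TZ t Tw); have := dot_ge Mx Mp.
  rewrite /pt; move: (1 + _) (den_pos (t *: w)) => D D0.
  rewrite dotpDr xq dotpZr dotpDr (bilZl (Bbil Mq)) (bilZr (Bbil Mq)) !dotpZr lerDl.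
  by rewrite pmulr_rge0 ?invr_gt0 // mulrA -expr2.
move: (dotp x w) (dotp x _) ab h => a b ab h.
have h1 := h (2^-1); have h2 := h 2; split; lra.
Qed.

(** Directions of circles from x through q: for a unit v, x + B(v, v) = q. In the model it is the
    tangent space at x of the projective line through x and q. *)
Definition VV x q (v : vec) : Prop := (v <= T x)%MS /\ B x v v = dotp v v *: (q - x).

Section Pair.
Variables (x q : vec).
Hypotheses (Mx : M x) (Mq : M q) (xq : dotp x q = - 6^-1).
Let s := - x - q.

Lemma unit_diff : dotp (q - x) (q - x) = 1.
Proof. by rewrite !(dotpBl, dotpBr) (M3 Mx) (M3 Mq) (dotpC q x) xq; field. Qed.

(** A form that is positive semidefinite on T_x, as |B(v, v)| = |v|^2 and |q - x| = 1. [VV] is its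
    null cone, and for such a form null vectors are orthogonal to everything, which makes [VV]
    linear. *)
Let P v w := dotp v w - dotp (B x v w) (q - x).

Lemma P_ge0 v : (v <= T x)%MS -> 0 <= P v v.
Proof.
move=> Tv; rewrite subr_ge0; apply: le_trans (cauchy_le _ _) _.
have [v4 _] := B4 Mx Tv; by rewrite /enorm v4 unit_diff sqrtr1 mulr1 sqrtr_sqr ger0_norm // dotp_ge0.
Qed.

Lemma VVP v : VV x q v <-> (v <= T x)%MS /\ P v v = 0.
Proof.
split=> -[Tv h]; split=> //.
  by rewrite /P h dotpZl unit_diff mulr1 subrr.
have [v4 _] := B4 Mx Tv; apply: cauchy_eq; first by rewrite v4 dotpZl dotpZr unit_diff mulr1 -expr2.
rewrite dotpZl dotpZr unit_diff mulr1 dotpZr; move/eqP: h; rewrite /P subr_eq0 => /eqP <-.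
by [].
Qed.

Lemma P_polar v w : VV x q v -> (w <= T x)%MS -> P v w = 0.
Proof.
move=> /VVP[Tv v0] Tw.
have h (t : R) : 0 <= 2 * t * P v w + t ^+ 2 * P w w.
  have := P_ge0 (TD Tv (TZ t Tw)).
  suff -> : P (v + t *: w) (v + t *: w) = P v v + (2 * t * P v w + t ^+ 2 * P w w) by rewrite v0 add0r.
  rewrite /P (bilDl (Bbil Mx)) !(bilDr (Bbil Mx)) !(bilZl (Bbil Mx)) !(bilZr (Bbil Mx)).
  rewrite !(dotpDl, dotpDr) !(dotpZl, dotpZr) (bilC (Bbil Mx) w v) (dotpC w v); ring.
have p0 := P_ge0 Tw; move: (P v w) (P w w) p0 h => a b b0 h.
have b1 : 0 < b + 1 by rewrite ltr_wpDl.
have := h (- a / (b + 1)).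
rewrite (_ : _ + _ = - (a / (b + 1)) ^+ 2 * (b + 2)); last by field; rewrite gt_eqF.
have b2 : 0 < b + 2 by rewrite ltr_wpDl.
rewrite mulNr oppr_ge0 pmulr_lle0 //.
by rewrite real_exprn_even_le0 ?num_real //= mulf_eq0 invr_eq0 (gt_eqF b1) orbF => /eqP.
Qed.

Lemma VV0 : VV x q 0.
Proof. by split; [exact: sub0mx|rewrite (bil0l (Bbil Mx)) dotp0l scale0r]. Qed.

Lemma VVL (a : R) v w : VV x q v -> VV x q w -> VV x q (a *: v + w).
Proof.
move=> hv hw; have [Tv _] := hv; have [Tw w0] := (VVP w).1 hw; have [_ v0] := (VVP v).1 hv.
apply/VVP; split; first by apply: TD => //; exact: TZ.
have := P_polar hv Tw; move: v0 w0; rewrite /P; move: (q - x) => D.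
rewrite (bilDl (Bbil Mx)) !(bilDr (Bbil Mx)) !(bilZl (Bbil Mx)) !(bilZr (Bbil Mx)).
rewrite !(dotpDl, dotpDr) !(dotpZl, dotpZr) (bilC (Bbil Mx) w v) (dotpC w v).
by move=> /subr0_eq -> /subr0_eq -> /subr0_eq ->; ring.
Qed.

Lemma VVZ (a : R) v : VV x q v -> VV x q (a *: v).
Proof. by move=> hv; rewrite -[a *: v]addr0; apply: VVL hv VV0. Qed.

Lemma Ms : M s. Proof. by apply: third => //; exact: dist2_1. Qed.

Lemma dot_s : dotp x s = - 6^-1 /\ dotp q s = - 6^-1.
Proof.
rewrite /s !(dotpBr, dotpNr) (M3 Mx) (M3 Mq) (dotpC q x) xq; split; by field.
Qed.

End Pair.

Lemma third_uniq x q y : M x -> M q -> M y -> dotp x q = - 6^-1 -> dotp x y = - 6^-1 ->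
  dotp q y = - 6^-1 -> y = - x - q.
Proof.
move=> Mx Mq My h1 h2 h3; apply/eqP; rewrite -subr_eq0 opprB opprK addrA -dotp_eq0.
rewrite !(dotpDl, dotpDr) (M3 Mx) (M3 Mq) (M3 My) (dotpC y q) (dotpC y x) (dotpC q x) h1 h2 h3.
by apply/eqP; field.
Qed.

(* W_x, the part of T_q tangent to the line dual to x, consists of the directions joining q to the
   points antipodal to x. *)
Lemma dual_line x q y : M x -> M q -> M y -> dotp x q = - 6^-1 -> dotp x y = - 6^-1 ->
  let xi := 2 *: q + x in let e := 2 *: y + x in VV q (- x - q) (e - dotp e xi *: xi).
Proof.
move=> Mx Mq My xq xy xi e; set s := - x - q.
have Msx : M s := Ms Mx Mq xq; have [xs qs] := dot_s Mx Mq xq; rewrite -/s in xs qs.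
have qx : dotp q x = - 6^-1 by rewrite dotpC.
have xi1 : dotp xi xi = 1.
  by rewrite /xi !(dotpDl, dotpDr) !(dotpZl, dotpZr) (M3 Mx) (M3 Mq) (dotpC x q) qx; field.
have sq : s - q = - xi by apply/rowP => j; rewrite !mxE; ring.
have [[w Tw yE]|[u [Tu u1 yE]]] := Mpt Mq My; last first.
  have bu : dotp x (B q u u) = 0 by move: xy; rewrite yE dotpDr xq; lra.
  have ys : y = s.
    apply: third_uniq => //; rewrite yE dotpDr (M3 Mq) (dot_base Mq Tu).2 u1; lra.
  have -> : e - dotp e xi *: xi = 0; last exact: VV0.
  have -> : e = - xi by rewrite /e ys; apply/rowP => j; rewrite !mxE; ring.
  by rewrite dotpNl xi1 scaleN1r subrr.
have [a0 b0] : dotp x w = 0 /\ dotp x (B q w w) = 0.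
  apply: circle_flat => //; move: xy; rewrite yE /pt dotpDr xq dotpZr dotpDr => /eqP.
  rewrite -subr_eq0 addrAC subrr add0r mulf_eq0 invr_eq0 (gt_eqF (den_pos w)) /= => /eqP //.
have [w0|w0] := eqVneq w 0.
  have -> : e - dotp e xi *: xi = 0; last exact: VV0.
  have -> : e = xi by rewrite /e yE /pt w0 (bil0l (Bbil Mq)) addr0 scaler0 addr0.
  by rewrite xi1 scale1r subrr.
have r0 : 0 < dotp w w by rewrite dotp_gt0.
pose c := Num.sqrt (dotp w w); have c0 : 0 < c by rewrite sqrtr_gt0.
have cc : c ^+ 2 = dotp w w by rewrite sqr_sqrtr // ltW.
have Tu : (c^-1 *: w <= T q)%MS by exact: TZ.
have u1 : dotp (c^-1 *: w) (c^-1 *: w) = 1 by rewrite dotpZl dotpZr -cc; field; rewrite gt_eqF.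
have uB : B q (c^-1 *: w) (c^-1 *: w) = (dotp w w)^-1 *: B q w w.
  by rewrite (bilZl (Bbil Mq)) (bilZr (Bbil Mq)) scalerA -cc -exprVn expr2.
have ps : q + (dotp w w)^-1 *: B q w w = s.
  rewrite -uB; apply: third_uniq => //; first exact: Ba.
    by rewrite uB dotpDr dotpZr b0 mulr0 addr0.
  by rewrite dotpDr (M3 Mq) (dot_base Mq Tu).2 u1; lra.
have BE : B q w w = dotp w w *: (s - q).
  by rewrite -ps [q + _]addrC addrK scalerA mulfV ?gt_eqF // scale1r.
have wV : VV q s w by [].
have wxi : dotp w xi = 0.
  have := Bn w w Mq Tw; rewrite BE sq dotpZr dotpNr => /eqP.
  by rewrite mulf_eq0 (gt_eqF r0) oppr_eq0 /= => /eqP.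
have d0 := den_pos w.
have eE : e = (1 + dotp w w)^-1 *: ((1 - dotp w w) *: xi + 2 *: w).
  rewrite /e yE /pt BE sq; move: (dotp w w) d0 => r d0; rewrite /xi.
  by apply/rowP => j; rewrite !mxE; field; rewrite gt_eqF.
have -> : e - dotp e xi *: xi = (2 / (1 + dotp w w)) *: w.
  rewrite eE dotpZl dotpDl !dotpZl xi1 wxi; move: (dotp w w) d0 => r d0.
  by apply/rowP => j; rewrite !mxE; field; rewrite gt_eqF.
exact: VVZ.
Qed.

(** With s = -x - q, the point [pt x (B x) v] is antipodal to s, as q is. [dual_line] for s places
    the direction from q towards it, a multiple of v, in [VV q x]. *)
Lemma VV_sym x q v : M x -> M q -> dotp x q = - 6^-1 -> VV x q v -> VV q x v.
Proof.
move=> Mx Mq xq hv; have [Tv vB] := hv.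
have [xs qs] := dot_s Mx Mq xq; set s := - x - q in xs qs.
have Msx : M s := Ms Mx Mq xq.
have sx : dotp s x = - 6^-1 by rewrite dotpC.
have [_ My] := B4 Mx Tv.
have sqx : dotp s (q - x) = 0 by rewrite dotpBr (dotpC s q) qs sx subrr.
have sv : dotp s v = 0.
  have h (t : R) : 0 <= t * dotp s v.
    have [_ Mp] := B4 Mx (TZ t Tv); have := dot_ge Msx Mp.
    rewrite /pt; move: (1 + _) (den_pos (t *: v)) => D D0.
    rewrite dotpDr sx dotpZr dotpDr (bilZl (Bbil Mx)) (bilZr (Bbil Mx)) vB !dotpZr sqx !mulr0 addr0 lerDl.
    by rewrite pmulr_rge0 // invr_gt0.
  have := h 1; have := h (-1); lra.
have sy : dotp s (pt x (B x) v) = - 6^-1.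
  by rewrite /pt dotpDr sx dotpZr dotpDr vB dotpZr sqx sv mulr0 addr0 mulr0 addr0.
have sq : dotp s q = - 6^-1 by rewrite dotpC.
have := dual_line Msx Mq My sq sy.
have -> : - s - q = x by rewrite /s; apply/rowP => j; rewrite !mxE; ring.
set xi := 2 *: q + s; set e := _ + s => h.
have xiE : xi = q - x by rewrite /xi /s; apply/rowP => j; rewrite !mxE; ring.
have d0 := den_pos v.
have xi1 : dotp xi xi = 1 by rewrite xiE unit_diff.
have vxi : dotp v xi = 0.
  have [->|v0] := eqVneq v 0; first by rewrite dotp0l.
  have r0 : 0 < dotp v v by rewrite dotp_gt0.
  have := Bn v v Mx Tv; rewrite vB -xiE dotpZr => /eqP.
  by rewrite mulf_eq0 (gt_eqF r0) /= => /eqP.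
have eE : e = (1 + dotp v v)^-1 *: (- (1 - dotp v v) *: xi + 2 *: v).
  rewrite /e /pt vB xiE /s; move: (dotp v v) d0 => r d0.
  by apply/rowP => j; rewrite !mxE; field; rewrite gt_eqF.
have hE : e - dotp e xi *: xi = (2 / (1 + dotp v v)) *: v.
  rewrite eE dotpZl dotpDl !dotpZl xi1 vxi; move: (dotp v v) d0 => r d0.
  by apply/rowP => j; rewrite !mxE; field; rewrite gt_eqF.
have {}h : VV q x (e - dotp e xi *: xi) := h.
rewrite hE in h.
have qx : dotp q x = - 6^-1 by rewrite dotpC.
have := VVZ Mq Mx qx ((1 + dotp v v) / 2) h; rewrite scalerA.
by rewrite (_ : _ / 2 * _ = 1) ?scale1r //; field; rewrite gt_eqF.
Qed.

Lemma VV_orth x q v w : M x -> M q -> dotp x q = - 6^-1 -> VV x q v -> VV x (- x - q) w -> dotp v w = 0.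
Proof.
move=> Mx Mq xq hv hw; have [Tv _] := hv; have [Tw _] := hw.
have [xs _] := dot_s Mx Mq xq; have Msx := Ms Mx Mq xq.
have := P_polar Mx Mq xq hv Tw; have := P_polar Mx Msx xs hw Tv.
have := dot_baseB Mx Tv Tw.
rewrite (bilC (Bbil Mx) w v) (dotpC w v) (dotpC x) !(dotpBr, dotpNr); lra.
Qed.

(* Polarizing |B v v|^2 = |v|^4 at a direction u joining x to q. *)
Lemma polar4 x q u w : M x -> M q -> dotp x q = - 6^-1 -> VV x q u -> dotp u u = 1 ->
  (w <= T x)%MS -> dotp u w = 0 ->
  2 * dotp (B x u w) (B x u w) = dotp w w - dotp (B x w w) (q - x).
Proof.
move=> Mx Mq xq [Tu uB] u1 Tw uw; have [w4 _] := B4 Mx Tw; rewrite u1 scale1r in uB.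
have Tw' : (- w <= T x)%MS by rewrite -scaleN1r TZ.
have [p4 _] := B4 Mx (TD Tu Tw); have [m4 _] := B4 Mx (TD Tu Tw').
have wu : dotp w u = 0 by rewrite dotpC.
have := unit_diff Mx Mq xq; move: (q - x) uB => D uB b1.
move: p4 m4; rewrite !(bilDl (Bbil Mx)) !(bilDr (Bbil Mx)) !(bilNl (Bbil Mx)) !(bilNr (Bbil Mx)) !opprK.
rewrite (bilC (Bbil Mx) w u) uB !(dotpDl, dotpDr, dotpNl, dotpNr) u1 uw wu b1 w4.
move: (dotpC D (B x u w)) (dotpC D (B x w w)) (dotpC (B x w w) (B x u w)) => -> -> ->.
move: (dotp w w) (dotp _ _) (dotp _ _) (dotp _ _) (dotp _ _) => *; lra.
Qed.

(** The normalized directions u + w and u - w lead to two points antipodal to x, both subject to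
    [dual_line]. Only B(u, w) is odd in w, so the difference of the two resulting vectors of
    [VV q (- x - q)] is a multiple of it. *)
Lemma mixed_in x q u w : M x -> M q -> dotp x q = - 6^-1 -> VV x q u -> dotp u u = 1 ->
  (w <= T x)%MS -> dotp u w = 0 -> VV q (- x - q) (B x u w).
Proof.
move=> Mx Mq xq hu u1 Tw uw; have [Tu uB] := hu; rewrite u1 scale1r in uB.
have qx : dotp q x = - 6^-1 by rewrite dotpC.
have [_ qs] := dot_s Mx Mq xq; have Msx := Ms Mx Mq xq.
set xi := 2 *: q + x.
have xiE : xi = 2 *: (q - x) + 3 *: x by apply/rowP => j; rewrite !mxE; ring.
have bx : dotp (B x u w) xi = 0.
  have := P_polar Mx Mq xq hu Tw; have := dot_baseB Mx Tu Tw.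
  by rewrite uw xiE; move: (q - x) => D; rewrite (dotpC x) dotpDr !dotpZr; lra.
have d0 := den_pos w.
have key (w' : vec) : (w' <= T x)%MS -> dotp u w' = 0 -> dotp w' w' = dotp w w ->
    let e := 3 *: x + (2 / (1 + dotp w w)) *: (q - x + 2 *: B x u w' + B x w' w') in
    VV q (- x - q) (e - dotp e xi *: xi).
  move=> Tw' uw' r' e; have Tv : ((u + w')%R <= T x)%MS by exact: TD.
  have vv : dotp (u + w') (u + w') = 1 + dotp w w.
    by rewrite !(dotpDl, dotpDr) u1 (dotpC w') uw' r'; ring.
  pose c := Num.sqrt (1 + dotp w w); have c0 : 0 < c by rewrite sqrtr_gt0.
  have cc : c ^+ 2 = 1 + dotp w w by rewrite sqr_sqrtr // ltW.
  have Tz : (c^-1 *: (u + w') <= T x)%MS by exact: TZ.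
  have z1 : dotp (c^-1 *: (u + w')) (c^-1 *: (u + w')) = 1.
    by rewrite dotpZl dotpZr vv -cc; field; rewrite gt_eqF.
  have My := Ba Mx Tz z1.
  have xy : dotp x (x + B x (c^-1 *: (u + w')) (c^-1 *: (u + w'))) = - 6^-1.
    by rewrite dotpDr (M3 Mx) (dot_base Mx Tz).2 z1; lra.
  have := dual_line Mx Mq My xq xy; rewrite -/xi.
  suff -> : 2 *: (x + B x (c^-1 *: (u + w')) (c^-1 *: (u + w'))) + x = e by [].
  rewrite (bilZl (Bbil Mx)) (bilZr (Bbil Mx)) scalerA -expr2 exprVn cc.
  rewrite (bilDl (Bbil Mx)) !(bilDr (Bbil Mx)) (bilC (Bbil Mx) w' u) uB /e.
  move: (dotp w w) d0 (B x u w') (B x w' w') => r d0 b1 b2.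
  by apply/rowP => j; rewrite !mxE; field; rewrite gt_eqF.
have Tw' : (- w <= T x)%MS by rewrite -scaleN1r TZ.
have h1 := key w Tw uw erefl.
have h2 := key (- w) Tw'; rewrite dotpNr uw oppr0 dotpNl dotpNr opprK in h2.
have {}h2 := h2 erefl erefl; rewrite /= !(bilNr (Bbil Mx)) (bilNl (Bbil Mx)) opprK in h2.
have := VVL Mq Msx qs (-1) h2 h1; set z := (X in VV _ _ X).
have -> : z = (8 / (1 + dotp w w)) *: B x u w.
  rewrite /z !(dotpDl, dotpZl) !(dotpDl, dotpZl, dotpNl) bx.
  move: (dotp w w) d0 (dotp (B x w w) xi) (dotp (q - x) xi) (dotp x xi) (B x w w) (B x u w) => r d0 *.
  by apply/rowP => j; rewrite !mxE; field; rewrite gt_eqF.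
move=> h; have := VVZ Mq Msx qs ((1 + dotp w w) / 8) h; rewrite scalerA.
by rewrite (_ : _ / 8 * _ = 1) ?scale1r //; field; rewrite gt_eqF.
Qed.

Lemma antipode_unit x q : M x -> M q -> dotp x q = - 6^-1 ->
  exists2 u, VV x q u & dotp u u = 1.
Proof.
move=> Mx Mq xq; have [[w Tw E]|[u [Tu u1 E]]] := Mpt Mx Mq.
  have [w0 wB] := dot_base Mx Tw; move: xq; rewrite E /pt; have := den_pos w.
  rewrite dotpDr dotpZr dotpDr w0 wB (M3 Mx); move: (dotp w w) => r r0.
  move/eqP; rewrite -subr_eq0 (_ : _ - _ = 2^-1 / (1 + r)); last by field; rewrite gt_eqF.
  by rewrite mulf_eq0 !invr_eq0 (gt_eqF r0) pnatr_eq0.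
by exists u => //; split=> //; rewrite u1 scale1r E addrC addKr.
Qed.

Lemma VV_perp x q v : M x -> M q -> VV x q v -> dotp x v = 0 /\ dotp q v = 0.
Proof.
move=> Mx Mq [Tv vB]; have [x0 _] := dot_base Mx Tv; split=> //.
have [->|v0] := eqVneq v 0; first exact: dotp0r.
have r0 : 0 < dotp v v by rewrite dotp_gt0.
have := Bn v v Mx Tv; rewrite vB dotpZr dotpBr (dotpC v x) x0 subr0 => /eqP.
by rewrite mulf_eq0 (gt_eqF r0) dotpC /= => /eqP.
Qed.

(** Rank and nullity of w -> B(u, w - <w, u> u) on T_x, for a unit u in [VV x q]: the kernel lies in
    [VV x q] by [polar4] and the image in [VV q (- x - q)] by [mixed_in]. *)
Lemma rank_ge x q (U W : 'M[R]_d) : M x -> M q -> dotp x q = - 6^-1 ->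
  (forall v : vec, (v <= U)%MS <-> VV x q v) -> (forall v : vec, (v <= W)%MS <-> VV q (- x - q) v) ->
  (n <= \rank U + \rank W)%N.
Proof.
move=> Mx Mq xq hU hW; have [u hu u1] := antipode_unit Mx Mq xq; have [Tu _] := hu.
have [D DE] := bil_mx (Bbil Mx); pose F := \sum_i u 0 i *: D i.
have FE w : w *m F = B x u w.
  by rewrite DE /F mulmx_sumr; apply: eq_bigr => i _; rewrite -scalemxAr.
pose F' := (1%:M - u^T *m u) *m F.
have F'E w : w *m F' = B x u (w - dotp w u *: u).
  by rewrite /F' mulmxA mulmxBr mulmx1 mulmxA dotp_mx mul_scalar_mx FE.
have perp w : dotp u (w - dotp w u *: u) = 0.
  by rewrite dotpBr dotpZr u1 mulr1 dotpC subrr.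
have Tw' (w : vec) : (w <= T x)%MS -> ((w - dotp w u *: u)%R <= T x)%MS.
  by move=> Tw; rewrite -scaleNr; apply: TD => //; exact: TZ.
rewrite -(rankT Mx) -(mxrank_mul_ker (T x) F') addnC; apply: leq_add; apply: mxrankS.
  apply/rV_subP => v; rewrite sub_capmx => /andP[Tv /sub_kermxP]; rewrite F'E => E.
  apply/hU; rewrite -(subrK (dotp v u *: u) v) addrC; apply: (VVL Mx Mq xq) => //.
  apply/(VVP Mx Mq xq); split; first exact: Tw'.
  have := polar4 Mx Mq xq hu u1 (Tw' _ Tv) (perp v).
  by rewrite E dotp0l mulr0 => <-.
apply/row_subP => i; rewrite row_mul F'E; apply/hW.
by apply: mixed_in => //; apply: Tw'; exact: row_sub.
Qed.

Lemma rank_le x q (U W : 'M[R]_d) : M x -> M q -> dotp x q = - 6^-1 ->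
  (forall v : vec, (v <= U)%MS <-> VV x q v) -> (forall v : vec, (v <= W)%MS <-> VV x (- x - q) v) ->
  (\rank U + \rank W <= n)%N /\ (n = (\rank U + \rank W)%N -> (T x <= U + W)%MS).
Proof.
move=> Mx Mq xq hU hW.
have cap : (U :&: W)%MS = 0.
  apply/eqP; rewrite -submx0; apply/rV_subP => v; rewrite sub_capmx => /andP[/hU hu /hW hw].
  by have /eqP := VV_orth Mx Mq xq hu hw; rewrite dotp_eq0 => /eqP ->; exact: sub0mx.
have sub : (U + W <= T x)%MS.
  by rewrite addsmx_sub; apply/andP; split; apply/rV_subP => v; [case/hU|case/hW].
have E := mxrank_sum_cap U W; rewrite cap mxrank0 addn0 in E.
rewrite -E -(rankT Mx); split; first exact: mxrankS.
by move=> /eqP; rewrite eq_sym (mxrank_leqif_sup sub).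
Qed.

(** [polar4] at a w with B(w, w) = |w|^2 (s - x), where s = -x - q and <s - x, q - x> = 1/2. *)
Lemma mixed_norm x q u w : M x -> M q -> dotp x q = - 6^-1 -> VV x q u -> VV x (- x - q) w ->
  VV q (- x - q) (2 *: B x u w) /\ dotp (2 *: B x u w) (2 *: B x u w) = dotp u u * dotp w w.
Proof.
move=> Mx Mq xq hu hw; have uw := VV_orth Mx Mq xq hu hw.
have [xs qs] := dot_s Mx Mq xq; have Msx := Ms Mx Mq xq.
have [->|u0] := eqVneq u 0.
  by rewrite (bil0l (Bbil Mx)) scaler0 !dotp0l mul0r; split=> //; exact: VV0.
have r0 : 0 < dotp u u by rewrite dotp_gt0.
pose c := Num.sqrt (dotp u u); have c0 : 0 < c by rewrite sqrtr_gt0.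
have cc : c ^+ 2 = dotp u u by rewrite sqr_sqrtr // ltW.
have hv := VVZ Mx Mq xq c^-1 hu.
have v1 : dotp (c^-1 *: u) (c^-1 *: u) = 1 by rewrite dotpZl dotpZr -cc; field; rewrite gt_eqF.
have vw : dotp (c^-1 *: u) w = 0 by rewrite dotpZl uw mulr0.
have [Tw wB] := hw.
have uE : B x u w = c *: B x (c^-1 *: u) w.
  by rewrite (bilZl (Bbil Mx)) scalerA mulfV ?scale1r // gt_eqF.
split.
  rewrite uE scalerA; apply: VVZ => //; exact: mixed_in.
have := polar4 Mx Mq xq hv v1 Tw vw; rewrite wB [dotp (dotp w w *: _) _]dotpZl.
have -> : dotp (- x - q - x) (q - x) = 2^-1.
  rewrite !(dotpBl, dotpNl, dotpBr) (M3 Mx) (M3 Mq) (dotpC q x) xq; by field.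
rewrite {2}uE (uE) !(dotpZl, dotpZr) -cc; move: (dotp (B x (c^-1 *: u) w) _) (dotp w w) => N r h.
have -> : r = 4 * N by lra.
by ring.
Qed.

(* The points of M in homogeneous coordinates (c, a, b), relative to the triple x, q, s. *)
Definition vpoint k (x q s : vec) (A1 A2 A3 : 'M[R]_(k, d)) (m : 'rV[R]_k -> 'rV[R]_k -> 'rV[R]_k)
    (c : R) (a b : 'rV[R]_k) : vec :=
  c ^+ 2 *: x + dotp a a *: q + dotp b b *: s + c *: (a *m A1) + c *: (b *m A2) + m a b *m A3.

(** The vertices form an equilateral triangle of side 1 and their coefficients sum to 0, so they
    contribute half the sum of squares, the norm of a traceless diagonal matrix. *)
Lemma frame_norm (x q s u v w : vec) (h1 h2 h3 : R) :
  [/\ dotp x x = 3^-1, dotp q q = 3^-1 & dotp s s = 3^-1] ->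
  [/\ dotp x q = - 6^-1, dotp x s = - 6^-1 & dotp q s = - 6^-1] ->
  [/\ dotp x u = 0, dotp x v = 0 & dotp x w = 0] ->
  [/\ dotp q u = 0, dotp q v = 0 & dotp q w = 0] ->
  [/\ dotp s u = 0, dotp s v = 0 & dotp s w = 0] ->
  [/\ dotp u v = 0, dotp u w = 0 & dotp v w = 0] -> h1 + h2 + h3 = 0 ->
  let z := h1 *: x + h2 *: q + h3 *: s + u + v + w in
  dotp z z = (h1 ^+ 2 + h2 ^+ 2 + h3 ^+ 2) / 2 + dotp u u + dotp v v + dotp w w.
Proof.
move=> [e1 e2 e3] [e4 e5 e6] [p1 p2 p3] [p4 p5 p6] [p7 p8 p9] [c1 c2 c3] h0 z; rewrite /z.
have -> : h1 = - h2 - h3 by lra.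
rewrite !(dotpDl, dotpDr) !(dotpZl, dotpZr).
rewrite (dotpC q x) (dotpC s x) (dotpC s q) (dotpC u x) (dotpC v x) (dotpC w x).
rewrite (dotpC u q) (dotpC v q) (dotpC w q) (dotpC u s) (dotpC v s) (dotpC w s).
rewrite (dotpC v u) (dotpC w u) (dotpC w v).
by rewrite p1 p2 p3 p4 p5 p6 p7 p8 p9 c1 c2 c3 e1 e2 e3 e4 e5 e6; lra.
Qed.

(** [rank_ge] and [rank_le] around the triangle force the three subspaces to have the same dimension
    k, with n = 2 k. So T_x is the sum of two of them, and 2 B maps their product to the third; in
    orthonormal bases this is m. *)
Lemma shape : (0 < n)%N -> M !=set0 -> exists k (x q s : vec) (A1 A2 A3 : 'M[R]_(k, d))
    (m : 'rV[R]_k -> 'rV[R]_k -> 'rV[R]_k),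
  [/\ (0 < k)%N,
      (forall (a : R) (u v w : 'rV[R]_k), m (a *: u + v) w = a *: m u w + m v w) /\
      (forall (a : R) (u v w : 'rV[R]_k), m w (a *: u + v) = a *: m w u + m w v),
      forall a b : 'rV[R]_k, dotp (m a b) (m a b) = dotp a a * dotp b b,
      forall (h1 h2 h3 : R) a b c, h1 + h2 + h3 = 0 ->
        let z := h1 *: x + h2 *: q + h3 *: s + a *m A1 + b *m A2 + c *m A3 in
        dotp z z = (h1 ^+ 2 + h2 ^+ 2 + h3 ^+ 2) / 2 + dotp a a + dotp b b + dotp c c &
      forall y, M y <-> exists c a b, c ^+ 2 + dotp a a + dotp b b = 1 /\
        y = vpoint x q s A1 A2 A3 m c a b].
Proof.
move=> n0 [x Mx].
have [q Mq xq] : exists2 q, M q & dotp x q = - 6^-1.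
  have T0 : T x != 0 by rewrite -mxrank_eq0 rankT // -lt0n.
  pose v := nz_row (T x); have v0 : v != 0 by rewrite nz_row_eq0.
  pose u := (enorm v)^-1 *: v; have Tu : (u <= T x)%MS by apply: TZ; exact: nz_row_sub.
  have u1 : dotp u u = 1 by rewrite dotpZl dotpZr -enorm_sqr; field; rewrite enorm_eq0.
  exists (x + B x u u); first exact: Ba.
  by rewrite dotpDr (M3 Mx) (dot_base Mx Tu).2 u1; lra.
set s := - x - q; have Msx : M s := Ms Mx Mq xq; have [xs qs] := dot_s Mx Mq xq.
rewrite -/s in xs qs.
have qx : dotp q x = - 6^-1 by rewrite dotpC.
have sx : dotp s x = - 6^-1 by rewrite dotpC.
have sq : dotp s q = - 6^-1 by rewrite dotpC.
have e1 : - q - x = s by rewrite /s addrC.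
have e2 : - x - s = q by rewrite /s; apply/rowP => j; rewrite !mxE; ring.
have e3 : - s - x = q by rewrite -e2 addrC.
have e4 : - q - s = x by rewrite /s; apply/rowP => j; rewrite !mxE; ring.
have [U1 H1] := subspace_mx (VV0 q Mx) (fun a u v hu hv => VVL Mx Mq xq a hu hv).
have [U2 H2] := subspace_mx (VV0 s Mx) (fun a u v hu hv => VVL Mx Msx xs a hu hv).
have [U3 H3] := subspace_mx (VV0 s Mq) (fun a u v hu hv => VVL Mq Msx qs a hu hv).
have symm y z (U : 'M[R]_d) : M y -> M z -> dotp y z = - 6^-1 ->
    (forall v : vec, (v <= U)%MS <-> VV y z v) -> forall v : vec, (v <= U)%MS <-> VV z y v.
  move=> My Mz yz hU v; rewrite hU; split; apply: VV_sym => //; by rewrite dotpC.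
have H1' := symm _ _ _ Mx Mq xq H1; have H2' := symm _ _ _ Mx Msx xs H2.
have H3' := symm _ _ _ Mq Msx qs H3.
have i1 : (n <= \rank U1 + \rank U3)%N by apply: (rank_ge Mx Mq xq).
have i2 : (n <= \rank U2 + \rank U3)%N by apply: (rank_ge Mx Msx xs) => //; rewrite e2.
have i3 : (n <= \rank U1 + \rank U2)%N by apply: (rank_ge Mq Mx qx) => //; rewrite e1.
have [j1 full] : (\rank U1 + \rank U2 <= n)%N /\ (n = (\rank U1 + \rank U2)%N -> (T x <= U1 + U2)%MS).
  by apply: (rank_le Mx Mq xq).
have [j2 _] : (\rank U1 + \rank U3 <= n)%N /\ (n = (\rank U1 + \rank U3)%N -> (T q <= U1 + U3)%MS).
  by apply: (rank_le Mq Mx qx) => //; rewrite e1.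
have [j3 _] : (\rank U2 + \rank U3 <= n)%N /\ (n = (\rank U2 + \rank U3)%N -> (T s <= U2 + U3)%MS).
  by apply: (rank_le Msx Mx sx) => //; rewrite e3.
have TU : (T x <= U1 + U2)%MS by apply: full; apply/eqP; rewrite eqn_leq i3.
have r12 : \rank U2 = \rank U1.
  have E1 : (\rank U1 + \rank U3 = n)%N by apply/eqP; rewrite eqn_leq j2.
  have E2 : (\rank U2 + \rank U3 = n)%N by apply/eqP; rewrite eqn_leq j3.
  by apply/eqP; rewrite -(eqn_add2r (\rank U3)) E1 E2.
have r13 : \rank U3 = \rank U1.
  have E1 : (\rank U1 + \rank U2 = n)%N by apply/eqP; rewrite eqn_leq j1.
  have E2 : (\rank U2 + \rank U3 = n)%N by apply/eqP; rewrite eqn_leq j3.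
  by apply/eqP; rewrite -(eqn_add2l (\rank U2)) E2 addnC E1.
have k0 : (0 < \rank U1)%N.
  by rewrite lt0n; apply/eqP => r0; move: i3 n0; rewrite r12 r0 addn0 leqn0 => /eqP ->.
have [k r1] : exists k, \rank U1 = k by exists (\rank U1).
rewrite r1 in r12 r13 k0; rename r12 into r2; rename r13 into r3.
have [A1 [AA1 HA1]] := orthonormal_basis r1.
have [A2 [AA2 HA2]] := orthonormal_basis r2.
have [A3 [AA3 HA3]] := orthonormal_basis r3.
have V1 a : VV x q (a *m A1) by apply/H1/HA1; exists a.
have V2 a : VV x s (a *m A2) by apply/H2/HA2; exists a.
have V3 a : VV q s (a *m A3) by apply/H3/HA3; exists a.
pose m a b := (2 *: B x (a *m A1) (b *m A2)) *m A3^T.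
have mE a b : m a b *m A3 = 2 *: B x (a *m A1) (b *m A2).
  have [/H3/HA3[c cE] _] := mixed_norm Mx Mq xq (V1 a) (V2 b).
  by rewrite /m cE -[c *m A3 *m A3^T]mulmxA AA3 mulmx1.
have iso (A : 'M[R]_(k, d)) a b : A *m A^T = 1%:M -> dotp (a *m A) (b *m A) = dotp a b.
  by move=> AA; rewrite dotp_mulmx -mulmxA AA mulmx1.
exists k, x, q, s, A1, A2, A3, m; split=> //.
- split=> a u v w; rewrite /m mulmxDl -[(a *: u) *m _]scalemxAl.
    rewrite (bilDl (Bbil Mx)) (bilZl (Bbil Mx)) scalerDr mulmxDl scalerA [2 * a]mulrC.
    by rewrite -scalerA -[X in X + _]scalemxAl.
  rewrite (bilDr (Bbil Mx)) (bilZr (Bbil Mx)) scalerDr mulmxDl scalerA [2 * a]mulrC.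
  by rewrite -scalerA -[X in X + _]scalemxAl.
- move=> a b; rewrite -(iso A3) // mE.
  by have [_ ->] := mixed_norm Mx Mq xq (V1 a) (V2 b); rewrite !iso.
- move=> h1 h2 h3 a b c h0 z.
  have [p1 p2] := VV_perp Mx Mq (V1 a); have [p3 p4] := VV_perp Mx Msx (V2 b).
  have [p5 p6] := VV_perp Mq Msx (V3 c).
  have o1 : dotp (a *m A1) (b *m A2) = 0 by apply: (VV_orth Mx Mq xq).
  have V1' : VV q x (a *m A1) by apply: VV_sym.
  have V2' : VV s x (b *m A2) by apply: VV_sym.
  have V3' : VV s q (c *m A3) by apply: VV_sym.
  have o2 : dotp (a *m A1) (c *m A3) = 0.
    by apply: (VV_orth Mq Mx qx V1'); rewrite e1.
  have o3 : dotp (b *m A2) (c *m A3) = 0.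
    by apply: (VV_orth Msx Mx sx V2'); rewrite e3.
  have p7 : dotp s (a *m A1) = 0 by rewrite /s dotpBl dotpNl p1 p2 oppr0 addr0.
  have p8 : dotp q (b *m A2) = 0.
    by move: p4; rewrite /s dotpBl dotpNl p3 oppr0 sub0r => /eqP; rewrite oppr_eq0 => /eqP.
  have p9 : dotp x (c *m A3) = 0.
    by move: p6; rewrite /s dotpBl dotpNl p5 subr0 => /eqP; rewrite oppr_eq0 => /eqP.
  rewrite -(iso A1 a a AA1) -(iso A2 b b AA2) -(iso A3 c c AA3).
  by apply: frame_norm => //; split=> //; exact: M3.
(* Homogeneous coordinates treat both kinds of points at once: with w = a A1 + b A2, c <> 0 gives
   [pt] at w / c, and c = 0 the point opposite to x in direction w. *)
have ptE (c : R) (a b : 'rV[R]_k) : c ^+ 2 + dotp a a + dotp b b = 1 ->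
    x + c *: (a *m A1 + b *m A2) + B x (a *m A1 + b *m A2) (a *m A1 + b *m A2) =
    vpoint x q s A1 A2 A3 m c a b.
  move=> c1; rewrite /vpoint mE; have [_ b1] := V1 a; have [_ b2] := V2 b.
  rewrite (bilDl (Bbil Mx)) !(bilDr (Bbil Mx)) b1 b2 (bilC (Bbil Mx) (b *m A2)) !iso //.
  have -> : c ^+ 2 = 1 - dotp a a - dotp b b by lra.
  move: (a *m A1) (b *m A2) (B x _ _) => u v w.
  by apply/rowP => j; rewrite !mxE; ring.
have nrm a b : dotp (a *m A1 + b *m A2) (a *m A1 + b *m A2) = dotp a a + dotp b b.
  have o1 : dotp (a *m A1) (b *m A2) = 0 by apply: (VV_orth Mx Mq xq).
  by rewrite dotpDl !dotpDr (dotpC (b *m A2)) o1 !iso // addr0 add0r.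
have dec (w : vec) : (w <= T x)%MS -> exists a b, w = a *m A1 + b *m A2.
  move=> Tw; have /sub_addsmxP[[u1 u2] /= ->] := submx_trans Tw TU.
  have [_ /(_ _)] := HA1 (u1 *m U1); have [/(_ (submxMl _ _))[a ->] _] := HA1 (u1 *m U1).
  have [/(_ (submxMl _ _))[b ->] _] := HA2 (u2 *m U2).
  by exists a, b.
have TAB (a b : 'rV[R]_k) : ((a *m A1 + b *m A2)%R <= T x)%MS.
  by have [T1 _] := V1 a; have [T2 _] := V2 b; exact: TD.
move=> y; split=> [My|[c [a [b [c1 ->]]]]].
  have [[w Tw yE]|[u [Tu u1 yE]]] := Mpt Mx My.
    pose c := (Num.sqrt (1 + dotp w w))^-1.
    have d0 := den_pos w; have c0 : 0 < c by rewrite invr_gt0 sqrtr_gt0.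
    have cc : c ^+ 2 = (1 + dotp w w)^-1 by rewrite exprVn sqr_sqrtr // ltW.
    have [a [b wE]] := dec _ (TZ c Tw); exists c, a, b.
    have c1 : c ^+ 2 + dotp a a + dotp b b = 1.
      rewrite -addrA -nrm -wE dotpZl dotpZr mulrA -expr2 cc.
      by rewrite -[X in X + _]mulr1 -mulrDr mulVf // gt_eqF.
    split=> //; rewrite -ptE // -wE yE /pt (bilZl (Bbil Mx)) (bilZr (Bbil Mx)) !scalerA -!expr2 -cc.
    by rewrite scalerDr addrA.
  have [a [b uE]] := dec _ Tu; exists 0, a, b.
  have c1 : 0 ^+ 2 + dotp a a + dotp b b = 1 :> R by rewrite expr0n add0r -nrm -uE.
  by split=> //; rewrite -ptE // -uE scale0r addr0.
rewrite -ptE //; have [c0|c0] := eqVneq c 0.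
  rewrite c0 scale0r addr0; apply: Ba => //.
  by rewrite nrm; move: c1; rewrite c0 expr0n add0r.
have [_] := B4 Mx (TZ c^-1 (TAB a b)).
rewrite /pt dotpZl dotpZr nrm (bilZl (Bbil Mx)) (bilZr (Bbil Mx)).
have -> : (1 + c^-1 * (c^-1 * (dotp a a + dotp b b)))^-1 = c ^+ 2.
  rewrite (_ : dotp a a + dotp b b = 1 - c ^+ 2); last by lra.
  by rewrite -[RHS]invrK; congr (_^-1); field.
suff -> : c ^+ 2 *: (c^-1 *: (a *m A1 + b *m A2) + c^-1 *: (c^-1 *: B x (a *m A1 + b *m A2) (a *m A1 + b *m A2)))
    = c *: (a *m A1 + b *m A2) + B x (a *m A1 + b *m A2) (a *m A1 + b *m A2) by rewrite addrA.
rewrite scalerDr !scalerA; congr (_ + _); first by congr (_ *: _); field.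
by rewrite (_ : c ^+ 2 * _ = 1) ?scale1r //; field.
Qed.

End Shape.

(** * Hurwitz' theorem *)

Section Composition.
Context {R : realType} {k : nat}.
Local Notation vec := 'rV[R]_k.
Variables (p : vec -> vec -> vec) (e : vec).
Hypothesis pL : forall (a : R) (u v w : vec), p (a *: u + v) w = a *: p u w + p v w.
Hypothesis pR : forall (a : R) (u v w : vec), p w (a *: u + v) = a *: p w u + p w v.
Hypothesis pN : forall u v : vec, dotp (p u v) (p u v) = dotp u u * dotp v v.
Hypotheses (pe1 : forall v, p e v = v) (pe2 : forall v, p v e = v) (ee : dotp e e = 1).
Implicit Types u v w z : vec.

Lemma pDl u v w : p (u + v) w = p u w + p v w.
Proof. by have := pL 1 u v w; rewrite !scale1r. Qed.

Lemma pDr u v w : p w (u + v) = p w u + p w v.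
Proof. by have := pR 1 u v w; rewrite !scale1r. Qed.

Lemma p0l w : p 0 w = 0.
Proof. by have := pDl 0 0 w; rewrite addr0 -[LHS]addr0 => /addrI. Qed.

Lemma p0r w : p w 0 = 0.
Proof. by have := pDr 0 0 w; rewrite addr0 -[LHS]addr0 => /addrI. Qed.

Lemma pZl (a : R) u w : p (a *: u) w = a *: p u w.
Proof. by have := pL a u 0 w; rewrite p0l !addr0. Qed.

Lemma pZr (a : R) u w : p w (a *: u) = a *: p w u.
Proof. by have := pR a u 0 w; rewrite p0r !addr0. Qed.

Lemma pNl u w : p (- u) w = - p u w.
Proof. by rewrite -scaleN1r pZl scaleN1r. Qed.

Lemma pNr u w : p w (- u) = - p w u.
Proof. by rewrite -scaleN1r pZr scaleN1r. Qed.

(** Conjugation: it fixes e and changes sign on the orthogonal complement. *)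
Definition bar u := (2 * dotp u e) *: e - u.

Lemma barE u v : dotp u e = 0 -> bar u = - u.
Proof. by move=> h; rewrite /bar h mulr0 scale0r sub0r. Qed.

Lemma barK : involutive bar.
Proof.
move=> u; rewrite /bar dotpBl dotpZl ee; apply/rowP => j; rewrite !mxE; ring.
Qed.

Lemma bar_dotp u v : dotp (bar u) v = dotp u (bar v).
Proof.
rewrite /bar !(dotpBl, dotpBr) dotpZl dotpZr (dotpC e v); ring.
Qed.

Lemma barD u v : bar (u + v) = bar u + bar v.
Proof. by rewrite /bar dotpDl mulrDr scalerDl opprD addrACA. Qed.

Lemma polarL x y z : dotp (p x y) (p x z) = dotp x x * dotp y z.
Proof.
have := pN x (y + z); rewrite pDr !(dotpDl, dotpDr) !pN (dotpC (p x z)) (dotpC z y); lra.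
Qed.

Lemma polarR x y z : dotp (p y x) (p z x) = dotp x x * dotp y z.
Proof.
have := pN (y + z) x; rewrite pDl !(dotpDl, dotpDr) !pN (dotpC (p z x)) (dotpC z y); lra.
Qed.

Lemma polarLR x y z w : dotp (p x y) (p z w) + dotp (p x w) (p z y) = 2 * dotp x z * dotp y w.
Proof.
have := polarL (x + z) y w; rewrite !pDl !(dotpDl, dotpDr) !polarL (dotpC z x).
by rewrite (dotpC (p x w)); lra.
Qed.

Lemma adjL x y z : dotp (p x y) z = dotp y (p (bar x) z).
Proof.
have := polarLR x y e z; rewrite !pe1 /bar pDl pNl pZl pe1 dotpBr dotpZr (dotpC (p x z) y); lra.
Qed.

Lemma adjR x y z : dotp (p x y) z = dotp x (p z (bar y)).
Proof.
have := polarLR x y z e; rewrite !pe2 /bar pDr pNr pZr pe2 dotpBr dotpZr; lra.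
Qed.

Lemma barM x y : bar (p x y) = p (bar y) (bar x).
Proof.
apply: dotp_inj => z; rewrite bar_dotp (dotpC (p x y)) (adjR (bar y)) barK.
by transitivity (dotp (p (bar z) (bar y)) x); [rewrite adjR barK|rewrite adjL barK].
Qed.

Lemma altL x y : p (bar x) (p x y) = dotp x x *: y.
Proof. by apply: dotp_inj => z; rewrite adjL barK polarL dotpZl. Qed.

Lemma altR x y : p (p y x) (bar x) = dotp x x *: y.
Proof. by apply: dotp_inj => z; rewrite adjR barK polarR dotpZl. Qed.

Lemma altL2 x z y : p (bar x) (p z y) + p (bar z) (p x y) = (2 * dotp x z) *: y.
Proof.
have := altL (x + z) y.
rewrite barD (pDl x z) (pDl (bar x)) (pDr (p x y)) (pDr (p x y)) !altL !(dotpDl, dotpDr) (dotpC z x).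
move=> E; apply/rowP => j; move/rowP: E => /(_ j); rewrite !mxE; lra.
Qed.

Lemma bar_e : bar e = e.
Proof. by rewrite /bar ee mulr1 -[2]/(1 + 1) scalerDl !scale1r addrK. Qed.

Section Doubling.
Variables (S : vec -> Prop) (i : vec).
Hypothesis SL : forall (a : R) u v, S u -> S v -> S (a *: u + v).
Hypothesis S1 : S e.
Hypothesis SM : forall u v, S u -> S v -> S (p u v).
Hypotheses (i1 : dotp i i = 1) (iS : forall u, S u -> dotp u i = 0).

Lemma S_bar u : S u -> S (bar u).
Proof.
by move=> Su; rewrite /bar; apply: SL => //; rewrite -scaleN1r -[_ *: u]addr0; apply: SL => //;
  rewrite -(subrr e) addrC -scaleN1r; exact: SL.
Qed.

Lemma bar_i : bar i = - i.
Proof. by apply: barE => //; rewrite dotpC iS. Qed.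

Lemma bi_perp b u : S b -> S u -> dotp (p b i) u = 0.
Proof. by move=> Sb Su; rewrite adjL dotpC iS //; apply: SM => //; exact: S_bar. Qed.

Lemma bar_bi b : S b -> bar (p b i) = - p b i.
Proof. by move=> Sb; apply: barE => //; exact: bi_perp. Qed.

Lemma bi_comm b : S b -> p b i = p i (bar b).
Proof. by move=> Sb; rewrite -[LHS]opprK -bar_bi // barM bar_i pNl opprK. Qed.

Lemma dbl1 a d : S a -> S d -> p a (p d i) = p (p d a) i.
Proof.
move=> Sa Sd; rewrite bi_comm // [RHS]bi_comm; last exact: SM.
have := altL2 (bar a) i (bar d); rewrite barK bar_i pNl iS; last exact: S_bar.
by rewrite mulr0 scale0r => /eqP; rewrite subr_eq0 => /eqP ->; rewrite barM.
Qed.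

Lemma dbl2 b c : S b -> S c -> p (p b i) c = p (p b (bar c)) i.
Proof.
move=> Sb Sc; apply: (can_inj barK); rewrite barM !bar_bi //; last by apply: SM => //; exact: S_bar.
by rewrite pNr dbl1 //; exact: S_bar.
Qed.

Lemma dbl3 b d : S b -> S d -> p (p b i) (p d i) = - p (bar d) b.
Proof.
move=> Sb Sd; have := altL2 (bar (p b i)) d i; rewrite barK bar_bi // pNl pNr.
rewrite dotpNl bi_perp // oppr0 mulr0 scale0r => /eqP; rewrite subr_eq0 => /eqP ->.
have := altR i b; rewrite bar_i pNr i1 scale1r => /eqP; rewrite eqr_oppLR => /eqP ->.
by rewrite pNr.
Qed.

(** The product rule of [cayley_dickson], assembled from the mixed products [dbl1], [dbl2] and
    [dbl3], which come from the polarized alternative law [altL2]. *)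
Lemma dbl_mul a b c d : S a -> S b -> S c -> S d ->
  p (a + p b i) (c + p d i) = (p a c - p (bar d) b) + p (p d a + p b (bar c)) i.
Proof.
move=> Sa Sb Sc Sd; rewrite (pDl a) !(pDr c) dbl1 // dbl2 // dbl3 // (pDl (p d a)).
by rewrite [p (p b _) i + _]addrC addrACA.
Qed.

Lemma dbl_perp a b : S a -> S b -> dotp a (p b i) = 0.
Proof. by move=> Sa Sb; rewrite dotpC bi_perp. Qed.

(* If the doubling of S is again a composition algebra, then S is associative. *)
Lemma dbl_assoc a c d : S a -> S c -> S d -> p d (p a c) = p (p d a) c.
Proof.
move=> Sa Sc Sd; apply/eqP; rewrite -subr_eq0 -dotp_eq0; set b := _ - _.
have Sb : S b by rewrite /b addrC -scaleN1r; apply: SL; apply: SM => //; exact: SM.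
have := polarLR a c (p b i) (p d i).
rewrite (dbl1 Sa Sd) (dbl2 Sb Sc) (dbl3 Sb Sd) (dbl_perp Sa Sb) mulr0 mul0r dotpNr polarR i1 mul1r.
have : dotp b b = dotp (p d (p a c)) b - dotp (p (p d a) c) b by rewrite -dotpBl.
rewrite (adjR (p d a) c) (adjL d (p a c)) => -> h; apply/eqP; lra.
Qed.

End Doubling.

(** Identifies F with a subalgebra, matching conjugation with [bar] and the real part with the
    component along e; this is the invariant of the doubling process. *)
Definition emb (F : conj_algebra R) (j : F -> vec) : Prop :=
  [/\ (forall (a : R) x y, j (a *: x + y) = a *: j x + j y) /\ injective j,
      j (cone F) = e, forall x y, j (cmul x y) = p (j x) (j y),
      forall x, j (cconj x) = bar (j x) & forall x, cre x = dotp (j x) e].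

Section Emb.
Variables (F : conj_algebra R) (j : F -> vec).
Hypothesis E : emb j.

Lemma embD x y : j (x + y) = j x + j y.
Proof. by have [[h _] _ _ _ _] := E; have := h 1 x y; rewrite !scale1r. Qed.

Lemma emb0 : j 0 = 0.
Proof. by have := embD 0 0; rewrite addr0 -[LHS]addr0 => /addrI. Qed.

Lemma embZ (a : R) x : j (a *: x) = a *: j x.
Proof. by have [[h _] _ _ _ _] := E; have := h a x 0; rewrite emb0 !addr0. Qed.

Lemma embN x : j (- x) = - j x.
Proof. by rewrite -scaleN1r embZ scaleN1r. Qed.

Lemma embB x y : j (x - y) = j x - j y.
Proof. by rewrite embD embN. Qed.

Lemma range_L (a : R) u v : range j u -> range j v -> range j (a *: u + v).
Proof. by have [[h _] _ _ _ _] := E; move=> [x _ <-] [y _ <-]; exists (a *: x + y). Qed.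

Lemma range_e : range j e.
Proof. by have [_ <- _ _ _] := E; exists (cone F). Qed.

Lemma range_M u v : range j u -> range j v -> range j (p u v).
Proof. by have [_ _ h _ _] := E; move=> [x _ <-] [y _ <-]; exists (cmul x y). Qed.

Lemma emb_abs2 x : abs2 x = dotp (j x) (j x).
Proof.
have [_ _ hM hB hr] := E; rewrite /abs2 hr hM hB adjL barK pe2 //.
Qed.

Lemma perp_range : ~ (forall v, range j v) -> exists2 i, dotp i i = 1 & forall u, range j u -> dotp u i = 0.
Proof.
move=> nall.
have r0 : range j 0 by exists 0 => //; exact: emb0.
have [U HU] := subspace_mx r0 range_L.
have Uk : (\rank U < k)%N.
  rewrite ltn_neqAle rank_leq_row andbT; apply/eqP => Ek; apply: nall => v; apply/HU.
  by apply: submx_full; rewrite /row_full Ek.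
have K0 : kermx U^T != 0.
  by rewrite -mxrank_eq0 mxrank_ker mxrank_tr -lt0n subn_gt0.
pose w := nz_row (kermx U^T); have w0 : w != 0 by rewrite nz_row_eq0.
have wU : w *m U^T = 0 by apply/sub_kermxP; exact: nz_row_sub.
exists ((enorm w)^-1 *: w); first by rewrite dotpZl dotpZr -enorm_sqr; field; rewrite enorm_eq0.
move=> u /HU/submxP[D ->]; rewrite dotpZr dotpC.
by rewrite -[U in _ *m U]trmxK -dotp_mulmx wU dotp0l mulr0.
Qed.

Lemma emb_double i : dotp i i = 1 -> (forall u, range j u -> dotp u i = 0) ->
  emb (F := cayley_dickson F) (fun x => j x.1 + p (j x.2) i).
Proof.
move=> i1 iS; have [[hL hI] h1 hM hB hr] := E.
have Rj x : range j (j x) by exists x.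
split.
- split=> [a [x1 x2] [y1 y2] /=|[x1 x2] [y1 y2] /= h].
    by rewrite !hL pL scalerDr addrACA.
  have d0 : j (x1 - y1) + p (j (x2 - y2)) i = 0.
    by rewrite !embB pDl pNl addrACA -opprD h subrr.
  have := congr1 (fun z => dotp z z) d0; rewrite dotp0l !(dotpDl, dotpDr) pN i1 mulr1.
  rewrite (dotpC (p _ i)) (dbl_perp range_L range_e range_M iS (Rj _) (Rj _)) addr0 add0r => h0.
  have g1 := dotp_ge0 (j (x1 - y1)); have g2 := dotp_ge0 (j (x2 - y2)).
  have z x : dotp (j x) (j x) = 0 -> x = 0.
    by move=> /eqP; rewrite dotp_eq0 => /eqP jx; apply: hI; rewrite jx emb0.
  have /z/subr0_eq -> : dotp (j (x1 - y1)) (j (x1 - y1)) = 0 by lra.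
  by have /z/subr0_eq -> : dotp (j (x2 - y2)) (j (x2 - y2)) = 0 by lra.
- by rewrite /= h1 emb0 p0l addr0.
- move=> [x1 x2] [y1 y2] /=; rewrite (dbl_mul range_L range_e range_M i1 iS) //.
  by rewrite embB embD !hM !hB.
- move=> [x1 x2] /=; rewrite barD (bar_bi range_L range_e range_M iS) // hB embN pNl //.
move=> [x1 x2] /=; rewrite dotpDl (bi_perp range_L range_e range_M iS) ?addr0 //; exact: range_e.
Qed.

End Emb.

Lemma emb_real : emb (F := real_algebra R) (fun t : R => t *: e).
Proof.
split=> /=.
- split=> [a x y|x y h].
    by rewrite scalerDl -scalerA.
  by have := congr1 (fun z => dotp z e) h; rewrite !dotpZl ee !mulr1.
- exact: scale1r.
- by move=> x y; rewrite pZl pZr pe1 scalerA.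
- by move=> x; rewrite /bar dotpZl ee mulr1 -scalerBl; congr (_ *: _); ring.
- by move=> x; rewrite dotpZl ee mulr1.
Qed.

(** [complex_algebra] is not literally a [cayley_dickson] of the reals, but the formulas agree on
    pairs, so everything is transferred from [emb_double]. *)
Lemma emb_complex i : dotp i i = 1 -> dotp e i = 0 ->
  emb (F := complex_algebra R) (fun z : Rcomplex R => complex.Re z *: e + complex.Im z *: i).
Proof.
move=> i1 ei.
have iS u : range (fun t : R => t *: e) u -> dotp u i = 0 by move=> [t _ <-]; rewrite dotpZl ei mulr0.
have [[hL hI] h1 hM hB hr] := emb_double emb_real i1 iS.
have jE (z : Rcomplex R) : complex.Re z *: e + complex.Im z *: i =
    (fun x : R * R => x.1 *: e + p (x.2 *: e) i) (complex.Re z, complex.Im z).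
  by rewrite /= pZl pe1.
split.
- split=> [a x y|x y]; last first.
    by rewrite !jE => /hI [r1 r2]; case: x y r1 r2 => [a b] [c d] /= -> ->.
  rewrite !jE -hL; congr (_ *: _ + p (_ *: _) _); by case: x y => [x1 x2] [y1 y2].
- by rewrite /= scale1r scale0r addr0.
- move=> [x1 x2] [y1 y2]; have := hM (x1, x2) (y1, y2); rewrite /= !pZl !pe1 => <-.
  by congr (_ *: _ + _ *: _); ring.
- by move=> [x1 x2]; have := hB (x1, x2); rewrite /= !pZl !pe1.
by move=> [x1 x2]; have := hr (x1, x2); rewrite /= !pZl !pe1.
Qed.

(** From the multiples of e, the subalgebra is doubled by a unit vector orthogonal to it until it is
    everything. A subalgebra that can be doubled is associative, which stops the process at the
    octonions. *)
Lemma hurwitz : exists F, [\/ F = real_algebra R, F = complex_algebra R,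
    F = quaternion_algebra R | F = octonion_algebra R] /\
  exists j : F -> vec, emb j /\ forall v, range j v.
Proof.
have E0 := emb_real; set j0 := (fun t : R => t *: e) in E0.
have [s0|n0] := pselect (forall v, range j0 v).
  by exists (real_algebra R); split; [constructor 1|exists j0].
have [i0 i01 p0] := perp_range E0 n0.
have e0 : dotp e i0 = 0 by apply: p0; exact: range_e E0.
have E1 := emb_complex i01 e0; set j1 := (fun z : Rcomplex R => _) in E1.
have [s1|n1] := pselect (forall v, range j1 v).
  by exists (complex_algebra R); split; [constructor 2|exists j1].
have [i1 i11 p1] := perp_range E1 n1.
have E2 := emb_double E1 i11 p1; set j2 := (fun x : cayley_dickson (complex_algebra R) => _) in E2.
have [s2|n2] := pselect (forall v, range j2 v).
  by exists (quaternion_algebra R); split; [constructor 3|exists j2].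
have [i2 i21 p2] := perp_range E2 n2.
have E3 := emb_double E2 i21 p2.
set j3 := (fun x : cayley_dickson (cayley_dickson (complex_algebra R)) => _) in E3.
have [s3|n3] := pselect (forall v, range j3 v).
  by exists (octonion_algebra R); split; [constructor 4|exists j3].
have [i3 i31 p3] := perp_range E3 n3; exfalso.
have r1 : range j1 i0 by exists ((0 : R) +i* (1 : R))%C; rewrite // /j1 /= scale0r add0r scale1r.
have up1 u : range j1 u -> range j2 u.
  by move=> [x _ <-]; exists (x, 0); rewrite // /j2 /= (emb0 E1) p0l addr0.
have up2 u : range j2 u -> range j3 u.
  by move=> [x _ <-]; exists (x, 0); rewrite // /j3 /= (emb0 E2) p0l addr0.
have r2 : range j2 i1.
  by exists (0, cone (complex_algebra R)); rewrite // /j2 /= (emb0 E1) add0r; have [_ -> _ _ _] := E1; rewrite pe1.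
have r3 : range j3 i2.
  exists (0, cone (quaternion_algebra R)); rewrite // /j3 /= (emb0 E2) add0r.
  by have [_ -> _ _ _] := E2; rewrite pe1.
have r20 := up1 _ r1.
(* A fourth doubling would give i0 (i1 i2) = (i0 i1) i2, whereas the doubling rule at i2 gives (i1
   i0) i2. So i0 and i1 would commute, although they anticommute by [bi_comm]. *)
have as3 := dbl_assoc (range_L E3) (range_e E3) (range_M E3) i31 p3 (up2 _ r2) r3 (up2 _ r20).
have comm : p i1 i0 = p i0 i1.
  move: as3; rewrite (dbl1 (range_L E2) (range_e E2) (range_M E2) p2 r20 r2) => h.
  have := congr1 (fun z => p z (bar i2)) h; rewrite !altR i21 !scale1r //.
have := bi_comm (range_L E1) (range_e E1) (range_M E1) p1 r1.
have -> : bar i0 = - i0 by apply: barE => //; rewrite dotpC.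
rewrite pNr -comm => /eqP; rewrite eq_sym -subr_eq0 -opprD oppr_eq0 => /eqP h.
have := pN i1 i0; rewrite i11 i01 mulr1.
have -> : p i1 i0 = 0.
  by apply/rowP => l; move/rowP: h => /(_ l); rewrite !mxE; lra.
by rewrite dotp0l => /eqP; rewrite eq_sym oner_eq0.
Qed.

End Composition.

(** * The Veronese embedding *)

Lemma sum3 (V : zmodType) (f : 'I_3 -> V) : \sum_i f i = f 0 + f 1 + f 2%:R.
Proof.
rewrite !big_ord_recl big_ord0 addr0 addrA; congr (_ + f _ + f _); exact: val_inj.
Qed.

Lemma ord3_ind (P : 'I_3 -> Prop) : P 0 -> P 1 -> P 2%:R -> forall i, P i.
Proof.
move=> h0 h1 h2 [[|[|[|//]]] h].
- by rewrite (_ : Ordinal h = 0) //; exact: val_inj.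
- by rewrite (_ : Ordinal h = 1) //; exact: val_inj.
- by rewrite (_ : Ordinal h = 2%:R) //; exact: val_inj.
Qed.

Lemma linear_mx {R : realType} (k l : nat) (f : 'rV[R]_k -> 'rV[R]_l) :
  (forall (a : R) u v, f (a *: u + v) = a *: f u + f v) -> exists L, forall u, f u = u *m L.
Proof.
move=> H; pose f' : {linear 'rV[R]_k -> 'rV[R]_l} := HB.pack f (GRing.isLinear.Build _ _ _ _ f H).
by exists (lin1_mx f') => u; rewrite mul_rV_lin1.
Qed.

Lemma isometry_mx {R : realType} (k : nat) (L : 'M[R]_k) :
  (forall u : 'rV[R]_k, dotp (u *m L) (u *m L) = dotp u u) -> L *m L^T = 1%:M /\ L^T *m L = 1%:M.
Proof.
move=> H; have LL : L *m L^T = 1%:M.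
  have pol u v : dotp (u *m L) (v *m L) = dotp u v.
    have := H (u + v); rewrite mulmxDl !(dotpDl, dotpDr) !H (dotpC (v *m L)) (dotpC v u); lra.
  apply/row_matrixP => i; rewrite !rowE mulmx1; apply: dotp_inj => w.
  by rewrite mulmxA dotp_mulmx trmxK pol.
by split=> //; exact: mulmx1C.
Qed.

Section Frame.
Context {R : realType} {d k : nat}.
Variables (x q s : 'rV[R]_d) (A1 A2 A3 : 'M[R]_(k, d)).
Hypothesis nrm : forall (h1 h2 h3 : R) (a b c : 'rV[R]_k), h1 + h2 + h3 = 0 ->
  let z := h1 *: x + h2 *: q + h3 *: s + a *m A1 + b *m A2 + c *m A3 in
  dotp z z = (h1 ^+ 2 + h2 ^+ 2 + h3 ^+ 2) / 2 + dotp a a + dotp b b + dotp c c.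

Section Unital.
Variables (p : 'rV[R]_k -> 'rV[R]_k -> 'rV[R]_k) (e : 'rV[R]_k).
Hypothesis pL : forall (a : R) u v w, p (a *: u + v) w = a *: p u w + p v w.
Hypothesis pR : forall (a : R) u v w, p w (a *: u + v) = a *: p w u + p w v.
Hypothesis pN : forall u v, dotp (p u v) (p u v) = dotp u u * dotp v v.
Hypotheses (pe1 : forall v, p e v = v) (pe2 : forall v, p v e = v) (ee : dotp e e = 1).
Variables (F : conj_algebra R) (j : F -> 'rV[R]_k).
Hypotheses (E : emb p e j) (jS : forall v, range j v).

(** The diagonal of a trace-one Hermitian matrix gives barycentric coordinates in the triangle x, q,
    s, and three off-diagonal entries give the components along the three subspaces. *)
Let f (A : 'M[F]_3) : 'rV[R]_d :=
  dotp (j (A 0 0)) e *: x + dotp (j (A 1 1)) e *: q + dotp (j (A 2%:R 2%:R)) e *: s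
  + j (A 1 0) *m A1 + j (A 0 2%:R) *m A2 + j (A 1 2%:R) *m A3.

Lemma bar_fixed v : v = bar e v -> v = dotp v e *: e.
Proof.
rewrite /bar => h; apply/rowP => l; move/rowP: h => /(_ l); rewrite !mxE; lra.
Qed.

Lemma bar_norm v : dotp (bar e v) (bar e v) = dotp v v.
Proof. by rewrite bar_dotp (barK ee). Qed.

Lemma herm_vec (A : 'M[F]_3) : hermitian3 A -> forall i l, j (A i l) = bar e (j (A l i)).
Proof. by move=> H i l; have [_ _ _ hB _] := E; rewrite -hB -H. Qed.

Lemma affine_frame : isometric_affine f.
Proof.
have [[hL hI] h1 hM hB hr] := E.
split=> [A B t _ _|A B [hA tA] [hB' tB]].
  rewrite /f !mxE !(embD E) !(embZ E) !dotpDl !dotpZl !mulmxDl -!scalemxAl.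
  move: (j (A 1 0) *m A1) (j (A 0 2%:R) *m A2) (j (A 1 2%:R) *m A3) => u1 u2 u3.
  move: (j (B 1 0) *m A1) (j (B 0 2%:R) *m A2) (j (B 1 2%:R) *m A3) => v1 v2 v3.
  by apply/rowP => l; rewrite !mxE; ring.
rewrite /enorm /hnorm; congr (Num.sqrt _).
pose D i l := j (A i l) - j (B i l).
have DE i l : j ((A - B) i l) = D i l by rewrite !mxE (embB E).
have Dh i l : D i l = bar e (D l i).
  rewrite /D (herm_vec hA i l) (herm_vec hB' i l) /bar dotpBl.
  by apply/rowP => y; rewrite !mxE; ring.
have Dd i : dotp (D i i) (D i i) = dotp (D i i) e ^+ 2.
  by rewrite {1 2}(bar_fixed (Dh i i)) dotpZl dotpZr ee; ring.
have Dn i l : dotp (D i l) (D i l) = dotp (D l i) (D l i) by rewrite Dh bar_norm.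
have tr0 : dotp (D 0 0) e + dotp (D 1 1) e + dotp (D 2%:R 2%:R) e = 0.
  have tE (C : 'M[F]_3) : ctrace C = cone F -> j (C 0 0) + j (C 1 1) + j (C 2%:R 2%:R) = e.
    by rewrite -!(embD E) -h1 => <-; rewrite /ctrace sum3.
  have := congr1 (fun w => dotp w e) (tE A tA); have := congr1 (fun w => dotp w e) (tE B tB).
  by rewrite /D /= !dotpBl !dotpDl; lra.
have -> : f A - f B = dotp (D 0 0) e *: x + dotp (D 1 1) e *: q + dotp (D 2%:R 2%:R) e *: s
    + D 1 0 *m A1 + D 0 2%:R *m A2 + D 1 2%:R *m A3.
  rewrite /f /D !dotpBl !mulmxBl.
  move: (j (A 1 0) *m A1) (j (A 0 2%:R) *m A2) (j (A 1 2%:R) *m A3) => u1 u2 u3.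
  move: (j (B 1 0) *m A1) (j (B 0 2%:R) *m A2) (j (B 1 2%:R) *m A3) => v1 v2 v3.
  by apply/rowP => l; rewrite !mxE; ring.
rewrite nrm // !sum3 !(emb_abs2 pL pR pN pe1 pe2 ee E) !DE !Dd.
by rewrite (Dn 0 1) (Dn 2%:R 0) (Dn 2%:R 1); field.
Qed.

(* The point [c : u : v], i.e. the projection psi psi^* with psi = (c, u, bar v). *)
Let point (c : R) (u v : 'rV[R]_k) (i l : 'I_3) : 'rV[R]_k :=
  match val i, val l with
  | 0%N, 0%N => c ^+ 2 *: e | 0%N, 1%N => c *: bar e u | 0%N, _ => c *: v
  | 1%N, 0%N => c *: u | 1%N, 1%N => dotp u u *: e | 1%N, _ => p u v
  | _, 0%N => c *: bar e v | _, 1%N => p (bar e v) (bar e u) | _, _ => dotp v v *: e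
  end.

Lemma proj_point c u v : c ^+ 2 + dotp u u + dotp v v = 1 ->
  exists2 P, projective_plane F P & f P = vpoint x q s A1 A2 A3 p c u v.
Proof.
have [[hL hI] h1 hM hB hr] := E.
move=> c1; have [g gE] : exists g, forall v, j (g v) = v.
  by exists (fun w => s2val (cid2 (jS w))) => w; exact: s2valP' (cid2 (jS w)).
pose P : 'M[F]_3 := \matrix_(i, l) g (point c u v i l).
have jP i l : j (P i l) = point c u v i l by rewrite mxE gE.
have bZ (a : R) w : bar e (a *: w) = a *: bar e w.
  by rewrite /bar dotpZl; apply/rowP => l; rewrite !mxE; ring.
have bK := barK ee; have be := bar_e ee; have bM := barM pL pR pN pe1 pe2 ee.
have aL := altL pL pR pN pe1 ee; have aR := altR pL pR pN pe2 ee.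
(* Every entry of P P involves only u, v and their conjugates, and reduces by the alternative laws
   and multiplicativity of the norm, so nonassociativity does no harm. *)
have aL' w y : p w (p (bar e w) y) = dotp w w *: y by rewrite -{1}(bK w) aL bar_norm.
have aR' w y : p (p y (bar e w)) w = dotp w w *: y by rewrite -{2}(bK w) aR bar_norm.
have a1 w : p (bar e w) w = dotp w w *: e by have := aL w e; rewrite pe2.
have a2 w : p w (bar e w) = dotp w w *: e by have := aR w e; rewrite pe1.
have pp : p (p u v) (p (bar e v) (bar e u)) = (dotp u u * dotp v v) *: e by rewrite -bM a2 pN.
have pp' : p (p (bar e v) (bar e u)) (p u v) = (dotp u u * dotp v v) *: e by rewrite -bM a1 pN.
have uu : dotp u u = 1 - c ^+ 2 - dotp v v by lra.
exists P.
  split.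
  - move=> i l; apply: hI; rewrite hB !jP.
    elim/ord3_ind: i; elim/ord3_ind: l; rewrite /point /= ?bZ ?bM ?bK ?be //.
  - apply/matrixP => i l; apply: hI; rewrite mxE sum3 !(embD E) !hM !jP.
    elim/ord3_ind: i; elim/ord3_ind: l; rewrite /point /= ?(pZl pL) ?(pZr pR) ?pe1 ?pe2 ?a1 ?a2 ?aL ?aR ?aL' ?aR' ?pp ?pp' ?a1 ?a2 ?scalerA;
      by apply/rowP => t; rewrite !mxE ?uu; ring.
  apply: hI; rewrite /ctrace sum3 !(embD E) !jP h1 /point /= -!scalerDl.
  by rewrite c1 scale1r.
rewrite /f !jP /point /= /vpoint !dotpZl ee !mulr1 -!scalemxAl //.
Qed.

(** The diagonal of P P = P gives |a|^2 = r0 r1, |b|^2 = r0 r2, |c|^2 = r1 r2, and one off-diagonal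
    entry gives a b = r0 c. Dividing by the root of a nonzero diagonal entry yields homogeneous
    coordinates. *)
Lemma point_proj P : projective_plane F P -> exists c u v,
  c ^+ 2 + dotp u u + dotp v v = 1 /\ f P = vpoint x q s A1 A2 A3 p c u v.
Proof.
have [[hL hI] h1 hM hB hr] := E.
move=> [hP PP tP]; have hX := herm_vec hP.
have PX i l : p (j (P i 0)) (j (P 0 l)) + p (j (P i 1)) (j (P 1 l)) + p (j (P i 2%:R)) (j (P 2%:R l)) = j (P i l).
  by rewrite -!hM -!(embD E) -(sum3 (fun y => cmul (P i y) (P y l))) -[in RHS]PP mxE.
have tX : j (P 0 0) + j (P 1 1) + j (P 2%:R 2%:R) = e by rewrite -!(embD E) -h1 -tP /ctrace sum3.
have dX i := bar_fixed (hX i i).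
have bK := barK ee.
have aL := altL pL pR pN pe1 ee; have aR := altR pL pR pN pe2 ee.
have a1 w : p (bar e w) w = dotp w w *: e by have := aL w e; rewrite pe2.
have a2 w : p w (bar e w) = dotp w w *: e by have := aR w e; rewrite pe1.
have einj (y z : R) : y *: e = z *: e -> y = z.
  by move=> h; have := congr1 (fun w => dotp w e) h; rewrite !dotpZl ee !mulr1.
have := PX 1 2%:R; have := PX 2%:R 2%:R; have := PX 1 1; have := PX 0 0; rewrite /f; move: tX.
rewrite (hX 0 1) (hX 2%:R 0) (hX 2%:R 1) (dX 0) (dX 1) (dX 2%:R) !dotpZl ee !mulr1.
move: (dotp (j (P 0 0)) e) (dotp (j (P 1 1)) e) (dotp (j (P 2%:R 2%:R)) e) => r0 r1 r2.
move: (j (P 1 0)) (j (P 0 2%:R)) (j (P 1 2%:R)) => a b c.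
rewrite !(pZl pL) !(pZr pR) !pe1 !pe2 !a1 !a2 !scalerA -!scalerDl -[X in _ = X -> _]scale1r.
move=> /einj t1 /einj e0 /einj e1 /einj e2 e12.
have ab : p a b = r0 *: c.
  by have -> : r0 = 1 - r1 - r2 by [lra|]; apply/rowP => l; move/rowP: e12 => /(_ l); rewrite !mxE; lra.
have ga := dotp_ge0 a; have gb := dotp_ge0 b; have gc := dotp_ge0 c.
have na : dotp a a = r0 * r1 by have -> : r0 = 1 - r1 - r2 by [lra|]; nra.
have nb : dotp b b = r0 * r2 by have -> : r0 = 1 - r1 - r2 by [lra|]; nra.
have nc : dotp c c = r1 * r2 by rewrite (_ : dotp c c = r1 * (1 - r1) - dotp a a); [rewrite na (_ : r0 = 1 - r1 - r2); [ring|lra]|lra].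
have p0 : 0 <= r0 by nra.
have p1 : 0 <= r1 by nra.
have p2 : 0 <= r2 by nra.
have z0 w : dotp w w = 0 -> w = 0 by move/eqP; rewrite dotp_eq0 => /eqP.
have [r00|r0N] := eqVneq r0 0; last first.
  have s0 : Num.sqrt r0 != 0 by rewrite gt_eqF // sqrtr_gt0 lt_def r0N.
  have ss : Num.sqrt r0 ^+ 2 = r0 by rewrite sqr_sqrtr.
  move: (Num.sqrt r0) s0 ss => k0 s0 ss.
  exists k0, (k0^-1 *: a), (k0^-1 *: b).
  have nu : dotp (k0^-1 *: a) (k0^-1 *: a) = r1.
    by rewrite dotpZl dotpZr na -ss; field.
  have nv : dotp (k0^-1 *: b) (k0^-1 *: b) = r2.
    by rewrite dotpZl dotpZr nb -ss; field.
  split; first by rewrite nu nv ss.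
  rewrite /vpoint nu nv ss (pZl pL) (pZr pR) ab -!scalemxAl !scalerA divff // !scale1r.
  by rewrite (_ : k0^-1 / k0 * r0 = 1) ?scale1r // -ss; field.
(* If r0 vanishes so do a and b. The first homogeneous coordinate is 0, and the remaining freedom is
   used to make one of the others a multiple of e. *)
have a0 : a = 0 by apply: z0; rewrite na r00 mul0r.
have b0 : b = 0 by apply: z0; rewrite nb r00 mul0r.
rewrite /vpoint a0 b0 r00 !mul0mx.
have [r10|r1N] := eqVneq r1 0.
  exists 0, 0, e; have c0 : c = 0 by apply: z0; rewrite nc r10 mul0r.
  have r21 : r2 = 1 by lra.
  by rewrite dotp0l ee (p0l pL) c0 r10 r21 expr0n !scale0r !mul0mx; split=> //; rewrite !add0r.
have s0 : Num.sqrt r1 != 0 by rewrite gt_eqF // sqrtr_gt0 lt_def r1N.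
have ss : Num.sqrt r1 ^+ 2 = r1 by rewrite sqr_sqrtr.
move: (Num.sqrt r1) s0 ss => k0 s0 ss.
exists 0, (k0 *: e), (k0^-1 *: c).
have nu : dotp (k0 *: e) (k0 *: e) = r1 by rewrite dotpZl dotpZr ee mulr1 -ss.
have nv : dotp (k0^-1 *: c) (k0^-1 *: c) = r2.
  by rewrite dotpZl dotpZr nc -ss; field.
rewrite nu nv expr0n; split; first by rewrite add0r; lra.
by rewrite !scale0r (pZl pL) (pZr pR) pe1 scalerA divff // scale1r !addr0.
Qed.

Lemma veronese_frame (V : set 'rV[R]_d) :
  (forall y, V y <-> exists c a b, c ^+ 2 + dotp a a + dotp b b = 1 /\ y = vpoint x q s A1 A2 A3 p c a b) ->
  veronese_image F V.
Proof.
move=> HV; exists f; first exact: affine_frame.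
apply/seteqP; split=> [y /HV[c [a [b [h ->]]]]|_ [P hP <-]].
  by have [P hP PE] := proj_point h; exists P.
by apply/HV; have [c [u [v [h PE]]]] := point_proj hP; exists c, u, v.
Qed.

End Unital.

End Frame.

(* Multiplying by fixed unit vectors turns a composition of quadratic forms into a unital one. *)
Lemma frame_veronese {R : realType} (d k : nat) (x q s : 'rV[R]_d) (A1 A2 A3 : 'M[R]_(k, d))
    (m : 'rV[R]_k -> 'rV[R]_k -> 'rV[R]_k) (V : set 'rV[R]_d) :
  (forall (h1 h2 h3 : R) (a b c : 'rV[R]_k), h1 + h2 + h3 = 0 ->
    let z := h1 *: x + h2 *: q + h3 *: s + a *m A1 + b *m A2 + c *m A3 in
    dotp z z = (h1 ^+ 2 + h2 ^+ 2 + h3 ^+ 2) / 2 + dotp a a + dotp b b + dotp c c) ->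
  (0 < k)%N ->
  (forall (a : R) u v w, m (a *: u + v) w = a *: m u w + m v w) ->
  (forall (a : R) u v w, m w (a *: u + v) = a *: m w u + m w v) ->
  (forall u v, dotp (m u v) (m u v) = dotp u u * dotp v v) ->
  (forall y, V y <-> exists c a b, c ^+ 2 + dotp a a + dotp b b = 1 /\ y = vpoint x q s A1 A2 A3 m c a b) ->
  [\/ veronese_image (real_algebra R) V, veronese_image (complex_algebra R) V,
      veronese_image (quaternion_algebra R) V | veronese_image (octonion_algebra R) V].
Proof.
move=> nrm k0 mL mR mN HV.
have [a0 a01] : exists a0 : 'rV[R]_k, dotp a0 a0 = 1.
  have : (const_mx 1 : 'rV[R]_k) != 0.
    apply/eqP => /rowP /(_ (Ordinal k0)); rewrite !mxE => /eqP; rewrite oner_eq0 //.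
  move: (const_mx 1) => v v0; exists ((enorm v)^-1 *: v).
  by rewrite dotpZl dotpZr -enorm_sqr; field; rewrite enorm_eq0.
(* Right and left multiplication by a unit vector a0 are isometries L and N. Composing m with their
   inverses in the two arguments keeps the norm identity and makes m(a0, a0) a two-sided unit. *)
have [L HL] := @linear_mx R k k (fun a => m a a0) (fun a u v => mL a u v a0).
have [N HN] := @linear_mx R k k (m a0) (fun a u v => mR a u v a0).
have [LL LL'] : L *m L^T = 1%:M /\ L^T *m L = 1%:M.
  by apply: isometry_mx => u; rewrite -HL mN a01 mulr1.
have [NN NN'] : N *m N^T = 1%:M /\ N^T *m N = 1%:M.
  by apply: isometry_mx => u; rewrite -HN mN a01 mul1r.
have isoL u : dotp (u *m L^T) (u *m L^T) = dotp u u.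
  by rewrite dotp_mulmx trmxK -mulmxA LL' mulmx1.
have isoN u : dotp (u *m N^T) (u *m N^T) = dotp u u.
  by rewrite dotp_mulmx trmxK -mulmxA NN' mulmx1.
pose p (u v : 'rV[R]_k) := m (u *m L^T) (v *m N^T); pose e := m a0 a0.
have pL (a : R) u v w : p (a *: u + v) w = a *: p u w + p v w.
  by rewrite /p mulmxDl -scalemxAl mL.
have pR (a : R) u v w : p w (a *: u + v) = a *: p w u + p w v.
  by rewrite /p mulmxDl -scalemxAl mR.
have pN u v : dotp (p u v) (p u v) = dotp u u * dotp v v by rewrite /p mN isoL isoN.
have ee : dotp e e = 1 by rewrite /e mN a01 mulr1.
have pe1 v : p e v = v.
  by rewrite /p /e (HL a0) -[a0 *m L *m _]mulmxA LL mulmx1 HN -mulmxA NN' mulmx1.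
have pe2 v : p v e = v.
  by rewrite /p /e (HN a0) -[a0 *m N *m _]mulmxA NN mulmx1 HL -mulmxA LL' mulmx1.
have nrm' (h1 h2 h3 : R) (a b c : 'rV[R]_k) : h1 + h2 + h3 = 0 ->
    let z := h1 *: x + h2 *: q + h3 *: s + a *m (L^T *m A1) + b *m (N^T *m A2) + c *m A3 in
    dotp z z = (h1 ^+ 2 + h2 ^+ 2 + h3 ^+ 2) / 2 + dotp a a + dotp b b + dotp c c.
  by move=> h; rewrite /= !mulmxA nrm // isoL isoN.
have HV' y : V y <-> exists c a b, c ^+ 2 + dotp a a + dotp b b = 1 /\
    y = vpoint x q s (L^T *m A1) (N^T *m A2) A3 p c a b.
  rewrite HV; split=> -[c [a [b [h ->]]]].
    exists c, (a *m L), (b *m N); rewrite /vpoint /p.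
    have e1 : a *m L *m L^T = a by rewrite -mulmxA LL mulmx1.
    have e2 : b *m N *m N^T = b by rewrite -mulmxA NN mulmx1.
    by rewrite -(isoL (a *m L)) -(isoN (b *m N)) !mulmxA e1 e2.
  by exists c, (a *m L^T), (b *m N^T); rewrite /vpoint /p !mulmxA isoL isoN.
have [F [cF [j [Ej jS]]]] := hurwitz pL pR pN pe1 pe2 ee.
have VF : veronese_image F V := veronese_frame nrm' pL pR pN pe1 pe2 ee Ej jS HV'.
by case: cF VF => ->; [constructor 1|constructor 2|constructor 3|constructor 4].
Qed.

Section Unit.
Context {R : realType} {n d : nat}.
Variable M : set 'rV[R]_d.
Hypotheses (cM : compact M) (hC : charted (n := n) M) (nM : connected M) (M0 : M !=set0).
Hypothesis ball3 : forall x, M x -> dotp x x <= 3^-1.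
Hypothesis nsphere : ~ homeomorphic M (sphere R n).
Local Notation Pi := (Pi (n := n) M).

Lemma Pi_sub x (w : 'rV[R]_d) : M x -> (w <= Pi x)%MS <-> w *m Pi x = w.
Proof.
move=> Mx; split=> [/submxP[D ->]|<-]; last exact: submxMl.
by rewrite -mulmxA (Pi_oproj hC Mx).2.
Qed.

Lemma rank_Pi x : M x -> \rank (Pi x) = n.
Proof.
move=> Mx; have [W [U [phi [g [J [[[_ _ _ _ D] _] Wx Ux _ ->]]]]]] := chart_at hC Mx.
have [_ _ fJ _] := D _ Ux; rewrite -[RHS](eqP fJ); apply: eqmx_rank; apply/andP; split.
  by apply/row_subP => i; rewrite rowE; have [c ->] := proj_range (J (g x)) (delta_mx 0 i); exact: submxMl.
by rewrite -{1}(proj_rowfree fJ) submxMl.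
Qed.

Lemma veronese_unit : (1 < n)%N ->
  [\/ veronese_image (real_algebra R) M, veronese_image (complex_algebra R) M,
      veronese_image (quaternion_algebra R) M | veronese_image (octonion_algebra R) M].
Proof.
move=> n1.
have [B HB] : exists B, forall x, M x -> slice_form (n := n) M x (B x).
  exists (fun x => xget (fun _ _ => 0) [set b | slice_form (n := n) M x b]) => x Mx.
  case: xgetP => // no; have [b hb] := slice_form_ex cM hC nM n1 ball3 nsphere Mx.
  by case: (no b).
have F1 x : M x -> bilin (B x) by move=> /HB[].
have F2 x u v (w : 'rV[R]_d) : M x -> (w <= Pi x)%MS -> dotp w (B x u v) = 0.
  by move=> Mx /(Pi_sub _ Mx) h; exact: (tan_normal hC u v Mx (HB x Mx) h).
have F3 x (w : 'rV[R]_d) : M x -> (w <= Pi x)%MS ->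
    dotp (B x w w) (B x w w) = dotp w w ^+ 2 /\ M (pt x (B x) w).
  move=> Mx /(Pi_sub _ Mx) h; have [_ _ /(_ w h)[-> /Om_sub[]]] := HB x Mx; by split.
have F4 x (u : 'rV[R]_d) : M x -> (u <= Pi x)%MS -> dotp u u = 1 -> M (x + B x u u).
  by move=> Mx /(Pi_sub _ Mx) h; exact: (antipode_in cM hC Mx (HB x Mx) h).
have F5 x y : M x -> M y -> (exists2 w : 'rV[R]_d, (w <= Pi x)%MS & y = pt x (B x) w) \/
    (exists u : 'rV[R]_d, [/\ (u <= Pi x)%MS, dotp u u = 1 & y = x + B x u u]).
  move=> Mx My; have [Oy|C] := contactE cM hC nM n1 ball3 nsphere Mx My; [left|right].
    by have [_ _ _ /(_ y Oy)[w /(Pi_sub _ Mx) h ->]] := HB x Mx; exists w.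
  have [u [/(Pi_sub _ Mx) h u1 ->]] := contact_form hC Mx (HB x Mx) C.
  by exists u.
have F6 x : M x -> dotp x x = 3^-1.
  move=> Mx; have [q C] := contact_exists cM hC nM n1 nsphere Mx.
  by have [] := contact_third cM hC nM n1 ball3 nsphere Mx C.
have F7 x q : M x -> M q -> dist2 x q = 1 -> M (- x - q).
  move=> Mx Mq xq; have [/Om_sub[_]|C] := contactE cM hC nM n1 ball3 nsphere Mx Mq.
    by rewrite dist2C xq ltxx.
  by have [] := contact_third cM hC nM n1 ball3 nsphere Mx C.
have [k [x [q [s [A1 [A2 [A3 [m [k0 [mL mR] mN nrm HM]]]]]]]]] :=
  shape F1 F2 F3 F4 F5 F6 F7 rank_Pi (ltnW n1) M0.
exact: (frame_veronese nrm k0 mL mR mN HM).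
Qed.

Lemma dim_gt1 : (0 < n)%N -> (1 < n)%N.
Proof.
move=> n0; have [//|n1] := ltnP 1 n; exfalso; apply: nsphere.
have {n0 n1} E : n = 1%N by apply/eqP; rewrite eqn_leq n1.
subst n; apply: circle => // p Mp.
have [W [U [phi [g [J [[C _] Wp Up fp _]]]]]] := chart_at hC Mp.
have [rho rho0 [ball _]] := chart_ball C Mp Wp (ltr01 : 0 < 1 :> R).
have [f' [g' [E' hr]]] := embed_ball (chart_embed C) rho0 (fun a h => (ball a h).1).
by exists f', g'; split=> //; rewrite -fp; apply: hr; rewrite subrr normr0.
Qed.

End Unit.

Section Normalize.
Context {R : realType} {n d : nat}.
Variables (M : set 'rV[R]_d) (c : 'rV[R]_d) (k : R).
Hypothesis k0 : 0 < k.
Let h (x : 'rV[R]_d) := k *: (x - c).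

Lemma rescale_cancel y : c + k^-1 *: h y = y.
Proof. by rewrite /h scalerA mulVf ?gt_eqF // scale1r addrC subrK. Qed.

Lemma rescale_image : rescaled M c k = h @` M.
Proof.
apply/seteqP; split=> [x Mx|_ [y My <-]]; last by rewrite /rescaled /= rescale_cancel.
exists (c + k^-1 *: x) => //.
by rewrite /h addrAC subrr add0r scalerA mulfV ?gt_eqF // scale1r.
Qed.

Lemma rescale_cont (A : set 'rV[R]_d) : cont_on A h.
Proof.
apply: cont_onZ; first exact: cont_on_cst.
by apply: cont_onB; [exact: cont_on_id|exact: cont_on_cst].
Qed.

Lemma rescale_homeomorphic (T : set 'rV[R]_n.+1) : homeomorphic (rescaled M c k) T -> homeomorphic M T.
Proof.
move=> [f [[fN finj fsurj] /cont_onP cf [g /cont_onP cg gf]]].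
have hM y : M y -> rescaled M c k (h y) by move=> My; rewrite rescale_image; exists y.
exists (f \o h); split.
- split.
  + by move=> y My; apply: fN; exact: hM.
  + move=> y z; rewrite !inE => My Mz /= e.
    have : h y = h z by apply: finj; rewrite ?inE //; exact: hM.
    by move=> /(congr1 (fun w => c + k^-1 *: w)); rewrite !rescale_cancel.
  + move=> t /fsurj[x]; rewrite rescale_image => -[y My <-] <-; by exists y.
- apply/cont_onP; apply: (cont_on_comp (B := rescaled M c k) (f := h)) => //.
  exact: rescale_cont.
exists (fun t => c + k^-1 *: g t).
  apply/cont_onP; apply: cont_onD; first exact: cont_on_cst.
  by apply: cont_onZ; first exact: cont_on_cst.
by move=> y My /=; rewrite gf ?rescale_cancel //; exact: hM.
Qed.

Lemma rescale_congruent (F : conj_algebra R) : veronese_image F (rescaled M c k) -> congruent_to_veronese F M.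
Proof.
move=> V; exists h, (rescaled M c k); split=> //; last by rewrite rescale_image.
exists c, k, (fun x => x - c); split=> //.
  by move=> x y; congr enorm; rewrite opprB addrA subrK.
by apply/funext => x; rewrite /homothety /= addrAC subrr add0r.
Qed.

End Normalize.

Theorem mainTheorem2 (R : realType) (n d : nat) (r : R) (M : set 'rV[R]_d)
    (hn : (1 <= n)%N) (hd : (1 <= d)%N) (hr : 0 < r)
    (hM : closed_submanifold n M)
    (hM0 : M !=set0) (hMconn : connected M)
    (hball : exists c : 'rV[R]_d, forall x, M x -> enorm (x - c) <= r)
    (hcurv : forall k, normal_curvatures n M k ->
               k <= 2 / Num.sqrt 3 * (1 / r))
    (hsphere : ~ homeomorphic M (sphere R n)) :
  [\/ congruent_to_veronese (real_algebra R) M,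
      congruent_to_veronese (complex_algebra R) M,
      congruent_to_veronese (quaternion_algebra R) M |
      congruent_to_veronese (octonion_algebra R) M].
Proof.
have [eM cM] := hM; have [c hc] := hball.
have s3 : 0 < Num.sqrt 3 :> R by rewrite sqrtr_gt0.
have s33 : Num.sqrt 3 ^+ 2 = 3 :> R by rewrite sqr_sqrtr.
move: (Num.sqrt 3) s3 s33 hcurv => t t0 tt hcurv.
(* Scaling by 1 / (sqrt 3 r) gives the ball radius 1 / sqrt 3 and turns the curvature bound into
   2. *)
pose k := (t * r)^-1; have k0 : 0 < k by rewrite invr_gt0 mulr_gt0.
have l2 : 2 / t * (1 / r) / k = 2 by rewrite /k; field; rewrite !gt_eqF.
have hN := rescale_image M c k0.
have cN : compact (rescaled M c k).
  by rewrite hN; apply: compact_image => //; exact: rescale_cont.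
have nN : connected (rescaled M c k).
  rewrite hN; apply: connected_continuous_connected => //; apply/cont_onP; exact: rescale_cont.
have N0 : rescaled M c k !=set0 by rewrite hN; have [x Mx] := hM0; eexists; exists x.
have hC : charted (n := n) (rescaled M c k).
  move=> x /eM[W [U [phi [P Wx]]]]; have [g C] := param_chart P.
  exists (rescaled W c k), U, (fun a => k *: (phi a - c)), (fun y => g (c + k^-1 *: y)), (fun a => k *: jac phi a).
  split=> //; split; first exact: chart_rescale.
  rewrite -l2; apply: curved_rescale => //; last exact: param_curved P hcurv.
  by have [_ _ _ _ D] := C; move=> a /D[].
have ball3 x : rescaled M c k x -> dotp x x <= 3^-1.
  rewrite hN => -[y My <-]; rewrite dotpZl dotpZr.
  have := hc y My; rewrite enorm_le ?(ltW hr) // => le.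
  have -> : 3^-1 = k * (k * r ^+ 2) by rewrite /k -tt; field; rewrite !gt_eqF.
  by rewrite !ler_pM2l.
have nsph : ~ homeomorphic (rescaled M c k) (sphere R n).
  by move=> /(rescale_homeomorphic k0)/hsphere.
have n1 := dim_gt1 cN hC nN N0 nsph hn.
have [] := veronese_unit cN hC nN N0 ball3 nsph n1 => V.
- by constructor 1; exact: (rescale_congruent k0 V).
- by constructor 2; exact: (rescale_congruent k0 V).
- by constructor 3; exact: (rescale_congruent k0 V).
- by constructor 4; exact: (rescale_congruent k0 V).
Qed.
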